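(* For every $g\ge 2$, every $0\le n\le 7$ and every $\sigma\in\mathbb{S}_n$ there are polynomials $P^{odd}_{g,\sigma}$ and $P^{even}_{g,\sigma}$ in one variable such that $N_k(g,\sigma)=P^{odd}_{g,\sigma}(q)$ for every finite field $k$ with an odd number $q$ of elements, and $N_k(g,\sigma)=P^{even}_{g,\sigma}(q)$ for every finite field $k$ with an even number $q$ of elements. If $n\le 5$ then $P^{odd}_{g,\sigma}=P^{even}_{g,\sigma}$ for all $g\geq 2$ and all $\sigma\in\mathbb{S}_n$. For $n=6$ one has $P^{odd}_{2,\sigma}=P^{even}_{2,\sigma}$ for all $\sigma\in\mathbb{S}_6$, but there is a $\sigma\in\mathbb{S}_6$ with $P^{odd}_{3,\sigma}\neq P^{even}_{3,\sigma}$.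
   Context: Let $k$ be a finite field with $q$ elements and $\bar k$ an algebraic closure. $\mathcal{H}_{g,n}$ is the moduli space of smooth hyperelliptic curves of genus $g$ with $n$ ordered distinct marked points, $H_{g,n}$ is the coarse moduli space of $\mathcal{H}_{g,n}\otimes\bar k$, $F$ is the geometric Frobenius morphism, and the symmetric group $\mathbb{S}_n$ acts on $H_{g,n}$ by permuting the marked points. For $\sigma\in\mathbb{S}_n$ let $N_k(g,\sigma)$ be the number of points of $H_{g,n}$ fixed by $F\sigma$. Equivalently, $N_k(g,\sigma)=\sum_{C}|C(\sigma)|/|\mathrm{Aut}_k(C)|$, where $C$ runs over representatives of the $k$-isomorphism classes of hyperelliptic curves of genus $g$ defined over $k$, and $C(\sigma)$ is the set of $n$-tuples of distinct points $(p_1,\dots,p_n)$ of $C(\bar k)$ such that $(F\sigma)(p_i)=p_i$ for all $i$. *)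

(* Defs.v *)
(* A smooth projective geometrically connected curve over a perfect field k is
   represented by its function field: an extension K of k, finite over k(x) for
   some transcendental x, in which k is algebraically closed.  Morphisms,
   points, divisors and the genus are expressed on K, as in Stichtenoth's
   "Algebraic Function Fields and Codes". *)
From mathcomp Require Import all_boot all_order all_algebra all_fingroup.
From mathcomp Require Import mxpoly.
From mathcomp Require Import classical_sets cardinality.

Set Implicit Arguments.
Unset Strict Implicit.
Unset Printing Implicit Defensive.

Import Order.TTheory GRing.Theory Num.Theory.

Local Open Scope classical_set_scope.
Local Open Scope ring_scope.

Record extension (k : fieldType) := Extension {
  ext_sort :> fieldType;
  emb : {rmorphism k -> ext_sort} }.

Arguments emb {k} e.

Section FunctionField.
Variables (k : fieldType) (K : extension k).

(* The quotient V / W has dimension d over the subfield S of K; here W is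
   contained in V and both are S-subspaces of K.  The vectors e i are lifts of
   a basis of V / W. *)
Definition has_dim (S V W : set K) (d : nat) : Prop :=
  exists e : 'I_d -> K,
    (forall i, V (e i)) /\
    (forall z, V z -> exists! c : {ffun 'I_d -> K},
       (forall i, S (c i)) /\ W (z - \sum_(i < d) c i * e i)).

Definition constants : set K := range (emb K).

Definition is_transcendental (x : K) : Prop := ~ algebraicOver (emb K) x.

(* The subfield k(x), for x transcendental. *)
Definition simple_ext (x : K) : set K :=
  [set z | exists p q : {poly k},
     q != 0 /\ z = (map_poly (emb K) p).[x] / (map_poly (emb K) q).[x]].

Definition constants_closed : Prop :=
  forall z : K, algebraicOver (emb K) z -> constants z.

(* Normalized discrete valuations of K / k, i.e., the closed points of the
   curve.  The value at 0 should be +oo; it is set to 0 so that distinct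
   closed points are distinct functions. *)
Definition is_valuation (v : K -> int) : Prop :=
  [/\ v 0 = 0,
      forall a : k, v (emb K a) = 0,
      forall x y, x != 0 -> y != 0 -> v (x * y) = v x + v y,
      forall x y, x != 0 -> y != 0 -> x + y != 0 ->
        Num.min (v x) (v y) <= v (x + y)
    & exists x, v x = 1].

Definition val_ge (v : K -> int) (m : int) : set K :=
  [set z | z = 0 \/ m <= v z].

(* The degree over k of the residue field of v. *)
Definition val_degree (v : K -> int) (d : nat) : Prop :=
  has_dim constants (val_ge v 0) (val_ge v 1) d.

(* L(A) for the divisor A = \sum_i m i * P i with distinct P i. *)
Definition RR_space r (P : 'I_r -> K -> int) (m : 'I_r -> int) : set K :=
  [set z | (forall i, val_ge (P i) (- m i) z) /\
           (forall v, is_valuation v -> (forall i, v <> P i) -> val_ge v 0 z)].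

(* s = deg A - l(A) + 1 for some divisor A. *)
Definition RR_defect (s : int) : Prop :=
  exists (r : nat) (P : 'I_r -> K -> int) (m : 'I_r -> int) (d : 'I_r -> nat)
         (l : nat),
    [/\ injective P,
        forall i, is_valuation (P i),
        forall i, val_degree (P i) (d i),
        has_dim constants (RR_space P m) [set 0] l
      & s = \sum_(i < r) m i * (d i)%:Z - l%:Z + 1].

(* g = max_A (deg A - l(A) + 1) over all divisors A. *)
Definition has_genus (g : nat) : Prop :=
  RR_defect g%:Z /\ (forall s, RR_defect s -> s <= g%:Z).

(* x is a map of degree 2 to the projective line.  Over a perfect field such a
   map is automatically separable in genus >= 2; over a finite field every
   conic is a projective line. *)
Definition is_hyperelliptic (g : nat) : Prop :=
  [/\ exists x : K, is_transcendental x /\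
        has_dim (simple_ext x) [set: K] [set 0] 2,
      constants_closed
    & has_genus g].

End FunctionField.

(* Isomorphisms over k between the curves of K1 and K2, contravariantly. *)
Definition isos (k : fieldType) (K1 K2 : extension k) : set (K1 -> K2) :=
  [set phi | exists f : {rmorphism K1 -> K2},
     [/\ phi = f :> (K1 -> K2), bijective f
       & forall a, f (emb K1 a) = emb K2 a]].

Arguments isos {k} K1 K2.

Definition isomorphic (k : fieldType) (K1 K2 : extension k) : Prop :=
  isos K1 K2 !=set0.

Section Points.
Variables (k : finFieldType) (kbar : closedFieldType).
Variable iota : {rmorphism k -> kbar}.

(* A kbar-point of the curve of K is a valuation ring O of K / k together with
   a k-embedding of its residue field into kbar: p x = Some a if x is in O
   with residue a (the value of x at p), and p x = None if x has a pole at p.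
   The last clause excludes the generic point. *)
Definition is_point (K : extension k) (p : K -> option kbar) : Prop :=
  [/\ forall a : k, p (emb K a) = Some (iota a),
      forall x y a b, p x = Some a -> p y = Some b -> p (x + y) = Some (a + b),
      forall x y a b, p x = Some a -> p y = Some b -> p (x * y) = Some (a * b),
      forall x, p x = None -> p x^-1 = Some 0
    & exists x, p x = None].

(* The geometric Frobenius raises the coordinates of a point to the power q. *)
Definition Frob (K : extension k) (p : K -> option kbar) : K -> option kbar :=
  fun x => omap (fun a => a ^+ #|k|) (p x).

(* C(sigma), where (sigma p)_i = p_(sigma i); replacing sigma by its inverse
   amounts to the other convention for the action. *)
Definition fixed_tuples (K : extension k) (n : nat) (sigma : 'S_n) :
    set ('I_n -> K -> option kbar) :=
  [set p | [/\ forall i, is_point (p i), injective p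
             & forall i, Frob (p (sigma i)) = p i]].

Arguments fixed_tuples K {n} sigma.

(* N = \sum_C |C(sigma)| / |Aut_k(C)| over a (finite) system of representatives
   C of the k-isomorphism classes of hyperelliptic curves of genus g over k. *)
Definition is_count (g n : nat) (sigma : 'S_n) (N : rat) : Prop :=
  exists (r : nat) (C : 'I_r -> extension k) (c a : 'I_r -> nat),
    [/\ forall i, is_hyperelliptic (C i) g,
        forall i j, isomorphic (C i) (C j) -> i = j,
        forall K : extension k, is_hyperelliptic K g ->
          exists i, isomorphic K (C i),
        forall i, (fixed_tuples (C i) sigma #= `I_(c i))%card /\
                  (isos (C i) (C i) #= `I_(a i))%card
      & N = \sum_(i < r) (c i)%:R / (a i)%:R].

End Points.

(* Main.v *)
Require Import Defs.
From HB Require Import structures.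
From mathcomp Require Import all_boot all_order all_algebra all_fingroup.
From mathcomp Require Import mxpoly generic_quotient fraction all_field ring zify ssrZ.
From mathcomp Require Import boolp classical_sets functions cardinality.

Set Implicit Arguments.
Unset Strict Implicit.
Unset Printing Implicit Defensive.

Import Order.TTheory GRing.Theory Num.Theory.

Local Open Scope classical_set_scope.
Local Open Scope ring_scope.

(** With G = g + 1, the hyperelliptic curves of genus g are the curves y^2 + h y = f with deg h <= G and
deg f <= 2 G that are smooth, also at infinity, in every characteristic.  Two such pairs (h, f) are isomorphic
iff they are related by one of the (q^3 - q) (q - 1) q^(G + 1) coordinate changes, so N is the sum of the
|C(sigma)| over all smooth pairs divided by this number.  |C(sigma)| is a polynomial in the traces tau_d(a),
one less than the number of F_(q^d)-points above the point a of degree d of P^1.  Every pair of nonzero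
discriminant arises from a unique smooth pair and a conductor, so sums over smooth pairs follow by a sieve
from sums over all pairs, which interpolation makes explicit.  It fails only for n >= 6 on conics (G = 1),
where the number of points of a conic is used instead.  The resulting polynomials are computed, and the
divisibility by kappa = (X^3 - X) (X - 1) is checked on finitely many cases and propagated along the sieve. *)

(** Values of f at points of total degree at most 2 G + 1 are equidistributed, so a sum over f
    splits into local moments of tau_d. The first moment is 0. The second is q^d - 1 for odd q; for
    even q it is q^d or 0 according to whether h is nonzero at the point. Apart from the number of
    pairs of discriminant 0, which cancels in the end, the parity of q thus enters only through the
    zeros of h, a form of degree G, and interpolation settles these up to total degree G + 1. For G
    >= 1 the first case beyond this bound is three squares on a conic, of weight 6 (a point of
    degree d with exponent e weighs d e): hence the equality for n <= 5. The quadratic twist kills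
    odd weights, so n = 7 stays within weight 6. First powers of total degree 2 G + 2, where the
    values of f obey one linear relation, are treated by counting tuples of roots. That a smooth
    conic has q^r + 1 points over F_(q^r) is itself drawn from the moments: the squares of the
    traces add up to 0. Levels G = 0 and G = 1 are met although g >= 2, since the sieve passes from
    G to G - d for a conductor of degree d. *)

Lemma size_polyD_leq (R : nzRingType) (p r : {poly R}) n :
 (size p <= n)%N && (size r <= n)%N -> (size (p + r)%R <= n)%N.
Proof. by rewrite -geq_max; apply: leq_trans (size_polyD p r). Qed.

(** * Evaluation of polynomials and minimal polynomials *)

Section Pev.
Variables (k F : fieldType) (j : {rmorphism k -> F}) (x : F).
Implicit Types p q : {poly k}.

Definition pev p : F := (map_poly j p).[x].

Lemma pevD p q : pev (p + q) = pev p + pev q.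
Proof. by rewrite /pev rmorphD hornerD. Qed.
Lemma pevN p : pev (- p) = - pev p.
Proof. by rewrite /pev rmorphN hornerN. Qed.
Lemma pevB p q : pev (p - q) = pev p - pev q.
Proof. by rewrite pevD pevN. Qed.
Lemma pevM p q : pev (p * q) = pev p * pev q.
Proof. by rewrite /pev rmorphM hornerM. Qed.
Lemma pevC c : pev c%:P = j c.
Proof. by rewrite /pev map_polyC hornerC. Qed.
Lemma pevX : pev 'X = x.
Proof. by rewrite /pev map_polyX hornerX. Qed.
Lemma pev0 : pev 0 = 0.
Proof. by rewrite /pev rmorph0 horner0. Qed.
Lemma pev1 : pev 1 = 1.
Proof. by rewrite /pev rmorph1 hornerC. Qed.
Lemma pevXn p n : pev (p ^+ n) = pev p ^+ n.
Proof. by elim: n => [|n IH]; rewrite ?pev1 // !exprS pevM IH. Qed.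
Lemma pevMn p n : pev (p *+ n) = pev p *+ n.
Proof. by elim: n => [|n IH]; rewrite ?mulr0n ?pev0 // !mulrS pevD IH. Qed.
Lemma pevZ c p : pev (c *: p) = j c * pev p.
Proof. by rewrite -mul_polyC pevM pevC. Qed.

Definition pevE := (pevD, pevN, pevM, pevC, pevX, pev0, pev1, pevXn, pevMn, pevZ).
End Pev.

Section Minpoly.
Variables (k L : fieldType) (j : {rmorphism k -> L}) (al : L).

Definition is_minpoly (p : {poly k}) : Prop :=
 [/\ p \is monic, (1 < size p)%N & forall q, pev j al q = 0 <-> p %| q].

Lemma minpoly_ex : algebraicOver j al -> exists p, is_minpoly p.
case=> p0 p0n p0r; rewrite /root in p0r.
have ex : exists n, `[< exists p, [/\ p != 0, pev j al p = 0 & size p = n] >].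
 by exists (size p0); apply/asboolP; exists p0; split=> //; apply/eqP.
have [n /asboolP [p [pn pr ps]] mn] := ex_minnP ex.
have dv q : pev j al q = 0 -> p %| q.
 move=> qr; apply/modp_eq0P; apply/eqP; apply: contraT => rn.
 have : pev j al (q %% p) = 0.
  by move: qr; rewrite {1}(divp_eq q p) !pevE pr mulr0 add0r.
 move=> rr; have : (n <= size (q %% p)%R)%N by apply: mn; apply/asboolP; exists (q %% p).
 by rewrite leqNgt -ps ltn_modp pn.
have lc0 : lead_coef p != 0 by rewrite lead_coef_eq0.
exists ((lead_coef p)^-1 *: p); split.
- by rewrite monicE lead_coefZ mulVf.
- rewrite size_scale ?invr_eq0 // ltnNge; apply/negP => /size1_polyC e.
 move: pr; rewrite e pevC => /eqP; rewrite fmorph_eq0 => /eqP h.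
 by move: pn; rewrite e h eqxx.
move=> q; rewrite dvdpZl ?invr_eq0 //; split; first exact: dv.
by case/dvdpP => r ->; rewrite !pevE pr mulr0.
Qed.

Variables (p : {poly k}) (pP : is_minpoly p).

Lemma minpoly_root : pev j al p = 0.
Proof. by case: pP => _ _ /(_ p)->. Qed.

Lemma minpoly_neq0 : p != 0.
Proof. by case: pP => /monic_neq0. Qed.

Lemma minpoly_inv q : pev j al q != 0 -> exists r, pev j al r * pev j al q = 1.
move=> q0; have cop : coprimep p q.
 rewrite /coprimep; case: (ltngtP (size (gcdp p q)) 1) => // [|s1].
  by rewrite ltnS leqn0 size_poly_eq0 gcdp_eq0 (negPf minpoly_neq0).
 have /dvdpP[r e] := dvdp_gcdl p q.
 have [e0|e0] := eqVneq (pev j al (gcdp p q)) 0.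
  have /dvdpP[s e2] := dvdp_gcdr p q.
  by move: q0; rewrite e2 pevM e0 mulr0 eqxx.
 have : pev j al r = 0.
  by apply/eqP; have := minpoly_root; rewrite e pevM => /eqP; rewrite mulf_eq0 (negPf e0) orbF.
 case: pP => _ _ dv /dv /dvdp_leq le; have r0 : r != 0.
  by apply: contraNneq minpoly_neq0 => r0; rewrite e r0 mul0r.
 have g0 : gcdp p q != 0 by rewrite gcdp_eq0 (negPf minpoly_neq0).
 have := le r0; rewrite {1}e size_mul //.
 by have := r0; rewrite -size_poly_gt0; lia.
have /Bezout_eq1_coprimepP [[a b] /= e] := cop.
exists b; have := congr1 (pev j al) e.
by rewrite !pevE minpoly_root mulr0 add0r.
Qed.

End Minpoly.

(** The relation is monic in y, so that k[x] + k[x] y is a ring. [model_free] contains both the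
    transcendence of x and the irreducibility of the equation; denominators are cleared in order to
    avoid the field k(x). *)
Record model (k : fieldType) (K : extension k) (x y : K) (h f : {poly k}) : Prop := Model {
 model_eq : y ^+ 2 + pev (emb K) x h * y = pev (emb K) x f;
 model_free : forall a b, pev (emb K) x a + pev (emb K) x b * y = 0 -> a = 0 /\ b = 0;
 model_gen : forall z, exists a b c,
  c != 0 /\ z * pev (emb K) x c = pev (emb K) x a + pev (emb K) x b * y }.

(** The localization of R at the kernel of phi is a discrete valuation ring with uniformizer t.
    Everything is phrased with numerators and denominators in R, so the localization itself is never
    formed. *)
Record uniformized (K L : fieldType) (R : set K) (phi : K -> L) (t : K) : Prop := Uniformized {
 unif_R1 : R 1;
 unif_RB : forall u w, R u -> R w -> R (u - w);
 unif_RM : forall u w, R u -> R w -> R (u * w);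
 unif_phi1 : phi 1 = 1;
 unif_phiB : forall u w, R u -> R w -> phi (u - w) = phi u - phi w;
 unif_phiM : forall u w, R u -> R w -> phi (u * w) = phi u * phi w;
 unif_gen : forall z, exists u w, [/\ R u, R w, w != 0 & z * w = u];
 unif_Rt : R t;
 unif_phit : phi t = 0;
 unif_t0 : t != 0;
 unif_dec : forall u, R u -> u != 0 -> exists (n : nat) w u',
  [/\ R w, R u', phi w != 0, phi u' != 0 & w * u = t ^+ n * u'] }.

(** * Valuation and place of a discrete valuation ring *)

Section DVR.
Variables (K L : fieldType) (R : set K) (phi : K -> L) (t : K) (D : uniformized R phi t).

Let R1 := unif_R1 D.
Let RB := unif_RB D.
Let RM := unif_RM D.
Let phi1 := unif_phi1 D.
Let phiB := unif_phiB D.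
Let phiM := unif_phiM D.
Let Rgen := unif_gen D.
Let Rt := unif_Rt D.
Let phit := unif_phit D.
Let t0 := unif_t0 D.
Let unif := unif_dec D.

Let R0 : R 0. Proof. by rewrite -(subrr 1); apply: RB. Qed.
Let phi0 : phi 0 = 0. Proof. by rewrite -(subrr 1) phiB // subrr. Qed.
Let phin0 u : phi u != 0 -> u != 0.
Proof. by apply: contra_neq => ->. Qed.
Let RX n : R (t ^+ n). Proof. by elim: n => // n IH; rewrite exprS; apply: RM. Qed.
Let RD u w : R u -> R w -> R (u + w).
Proof. by move=> Ru Rw; rewrite -(opprK w) -(add0r (- w)); do 2?apply: RB. Qed.
Let phiD u w : R u -> R w -> phi (u + w) = phi u + phi w.
move=> Ru Rw; have RNw : R (0 - w) by apply: RB.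
have -> : u + w = u - (0 - w) by rewrite sub0r opprK.
by rewrite (phiB Ru RNw) (phiB R0 Rw) phi0 sub0r opprK.
Qed.

Definition dvr_ord (z : K) (n : int) : Prop := exists u w,
 [/\ R u, R w, phi u != 0, phi w != 0 & z * w = t ^ n * u].

Lemma dvr_ord_ex z : z != 0 -> exists n, dvr_ord z n.
move=> z0; have [u [w [Ru Rw w0 zw]]] := Rgen z.
have u0 : u != 0 by rewrite -zw mulf_neq0.
have [n [a [u' [Ra Ru' pa pu' e1]]]] := unif Ru u0.
have [m [b [w' [Rb Rw' pb pw' e2]]]] := unif Rw w0.
exists (n%:Z - m%:Z), (b * u'), (a * w'); split; rewrite ?phiM ?mulf_neq0 //; try exact: RM.
apply: (mulfI (phin0 pb)); apply: (mulfI w0).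
rewrite expfzDr // -!exprnN -exprnP.
have tm : t ^+ m != 0 by rewrite expf_neq0.
apply: (mulfI tm).
transitivity (a * (z * w) * b * (t ^+ m * w')); first by ring.
rewrite zw -e2 e1.
transitivity ((t ^+ m / t ^+ m) * (t ^+ n * u' * b * (b * w))); last by ring.
by rewrite divff // mul1r.
Qed.

Lemma dvr_ord_inj z n m : dvr_ord z n -> dvr_ord z m -> n = m.
wlog lenm : n m / n <= m.
 move=> H h1 h2; case: (leP n m) => [/H|/ltW/H h]; first exact.
 by apply/esym/h.
move=> [u [w [Ru Rw pu pw e1]]] [u' [w' [Ru' Rw' pu' pw' e2]]].
have : t ^ n * (u * w') = t ^ n * (t ^ (m - n) * (u' * w)).
 by rewrite !mulrA -expfzDr // [n + _]addrC subrK -e1 -e2; ring.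
have tn : t ^ n != 0 by rewrite expfz_neq0.
move/(mulfI tn).
have : 0 <= m - n by rewrite subr_ge0.
case mn : (m - n) => [[|d]|//] _; first by move=> _; apply/esym/eqP; rewrite -subr_eq0 mn.
rewrite -exprnP exprS -mulrA => /(congr1 phi).
rewrite phiM // [in RHS]phiM //; last by apply: RM; [apply: RX|apply: RM].
by rewrite phit mul0r => /eqP; rewrite mulf_eq0 (negPf pu) (negPf pw').
Qed.

Definition dvr_val (z : K) : int := if z == 0 then 0 else xget 0 (dvr_ord z).

Lemma dvr_valP z : z != 0 -> dvr_ord z (dvr_val z).
move=> z0; rewrite /dvr_val (negPf z0).
have [n hn] := dvr_ord_ex z0.
by case: xgetP => [m -> //|/(_ n)].
Qed.

Lemma dvr_valE z n : dvr_ord z n -> dvr_val z = n.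
move=> h; have z0 : z != 0.
 case: h => u [w [Ru Rw pu pw e]]; apply: contraTneq pu => z0; move/eqP: e.
 by rewrite z0 mul0r eq_sym mulf_eq0 (negPf (expfz_neq0 n t0)) => /= /eqP->; rewrite phi0 eqxx.
by apply: dvr_ord_inj (dvr_valP z0) h.
Qed.

Lemma dvr_valM x y : x != 0 -> y != 0 -> dvr_val (x * y) = dvr_val x + dvr_val y.
move=> x0 y0; apply: dvr_valE.
have [u [w [Ru Rw pu pw e1]]] := dvr_valP x0.
have [u' [w' [Ru' Rw' pu' pw' e2]]] := dvr_valP y0.
exists (u * u'), (w * w'); split; rewrite ?phiM ?mulf_neq0 //; try exact: RM.
by rewrite expfzDr // mulrACA e1 e2 mulrACA.
Qed.

Lemma dvr_val_phi u : R u -> phi u != 0 -> dvr_val u = 0.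
Proof. by move=> Ru pu; apply: dvr_valE; exists u, 1; rewrite phi1 oner_eq0 mulr1 expr0z mul1r. Qed.

Lemma dvr_val_t : dvr_val t = 1.
Proof. by apply: dvr_valE; exists 1, 1; rewrite phi1 oner_eq0 expr1z. Qed.

Lemma dvr_val_R u : R u -> 0 <= dvr_val u.
move=> Ru; have [->|u0] := eqVneq u 0; first by rewrite /dvr_val eqxx.
have [n [w [u' [Rw Ru' pw pu' e]]]] := unif Ru u0.
by rewrite (@dvr_valE u n%:Z) //; exists u', w; rewrite mulrC.
Qed.

Lemma dvr_val_pos u : R u -> phi u = 0 -> u != 0 -> 0 < dvr_val u.
move=> Ru pu u0; have [n [w [u' [Rw Ru' pw pu' e]]]] := unif Ru u0.
rewrite (@dvr_valE u n%:Z); last by exists u', w; rewrite mulrC.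
case: n e => // e; move: (congr1 phi e); rewrite expr0 mul1r phiM // pu mulr0 => /eqP.
by rewrite eq_sym (negPf pu').
Qed.

Lemma dvr_val_ge0 z : z != 0 -> 0 <= dvr_val z -> exists u w, [/\ R u, R w, phi w != 0 & z * w = u].
move=> z0; have [u [w [Ru Rw pu pw e]]] := dvr_valP z0.
case: (dvr_val z) e => // n e _; exists (t ^+ n * u), w; split=> //; exact: RM.
Qed.

Lemma dvr_val_sum x y : x != 0 -> y != 0 -> x + y != 0 ->
 Num.min (dvr_val x) (dvr_val y) <= dvr_val (x + y).
wlog le : x y / dvr_val x <= dvr_val y.
 move=> H x0 y0 xy0; case: (leP (dvr_val x) (dvr_val y)) => h.
  by have := H _ _ h x0 y0 xy0; rewrite min_l.
 by have := H _ _ (ltW h) y0 x0; rewrite addrC min_l ?(ltW h) // => ->.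
move=> x0 y0 xy0; rewrite min_l //.
have yx : y / x != 0 by rewrite mulf_neq0 ?invr_eq0.
have e : x + y = x * (1 + y / x) by rewrite mulrDr mulr1 mulrCA divff // mulr1.
have s0 : 1 + y / x != 0 by apply: contra_neq xy0; rewrite e => ->; rewrite mulr0.
rewrite e dvr_valM // lerDl.
have vyx : 0 <= dvr_val (y / x).
 have : dvr_val y = dvr_val (y / x) + dvr_val x by rewrite -dvr_valM // divfK.
 by move=> h; rewrite h in le; rewrite -(lerD2r (dvr_val x)) add0r.
have [u [w [Ru Rw pw e1]]] := dvr_val_ge0 yx vyx.
have w0 := phin0 pw.
have ew : w + u = (1 + y / x) * w by rewrite mulrDl mul1r e1.
have -> : 1 + y / x = (w + u) * w^-1 by rewrite ew mulfK.
have wu0 : w + u != 0 by rewrite ew mulf_neq0.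
have vw : dvr_val w = 0 by rewrite dvr_val_phi.
rewrite dvr_valM ?invr_eq0 //.
have : dvr_val (w * w^-1) = 0 by rewrite divff // dvr_val_phi // phi1 oner_eq0.
rewrite dvr_valM ?invr_eq0 // vw add0r => ->; rewrite addr0.
by apply: dvr_val_R; apply: RD.
Qed.

Definition dvr_place (z : K) : option L :=
 if z == 0 then Some 0 else if dvr_val z < 0 then None else
 xget None [set o | exists u w, [/\ R u, R w, phi w != 0, z * w = u & o = Some (phi u / phi w)]].

Lemma dvr_placeE z u w : R u -> R w -> phi w != 0 -> z * w = u ->
 dvr_place z = Some (phi u / phi w).
move=> Ru Rw pw e; rewrite /dvr_place.
have [z0|z0] := eqVneq z 0; first by rewrite -e z0 mul0r phi0 mul0r.
have -> : dvr_val z < 0 = false.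
 apply/negbTE; rewrite -leNgt.
 have : dvr_val u = dvr_val z + dvr_val w by rewrite -dvr_valM ?e // phin0.
 by rewrite (@dvr_val_phi w) // addr0 => <-; apply: dvr_val_R.
apply: xget_unique; first by exists u, w.
move=> o [u' [w' [Ru' Rw' pw' e' ->]]]; congr Some.
have : phi (u * w') = phi (u' * w) by rewrite -e -e'; congr phi; ring.
rewrite !phiM // => h; apply/eqP; rewrite eqr_div //; apply/eqP; by rewrite -h.
Qed.

Lemma dvr_place_R u : R u -> dvr_place u = Some (phi u).
by move=> Ru; rewrite (@dvr_placeE u u 1) ?phi1 ?divr1 ?oner_eq0 ?mulr1.
Qed.

Lemma dvr_place_None z : dvr_place z = None -> z != 0 /\ dvr_val z < 0.
move=> h; have [z0|z0] := eqVneq z 0; first by move: h; rewrite /dvr_place z0 eqxx.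
split=> //; rewrite ltNge; apply/negP => v0.
have [u [w [Ru Rw pw e]]] := dvr_val_ge0 z0 v0.
by move: h; rewrite (dvr_placeE Ru Rw pw e).
Qed.

Lemma dvr_place_Some z a : dvr_place z = Some a -> exists u w,
 [/\ R u, R w, phi w != 0, z * w = u & a = phi u / phi w].
have [->|z0] := eqVneq z 0.
 by rewrite /dvr_place eqxx => -[<-]; exists 0, 1; rewrite phi1 oner_eq0 phi0 !mul0r.
rewrite {1}/dvr_place (negPf z0); case: ifP => // /negbT; rewrite -leNgt => v0.
have [u [w [Ru Rw pw e]]] := dvr_val_ge0 z0 v0.
move=> h; exists u, w; split=> //.
by move: (dvr_placeE Ru Rw pw e); rewrite /dvr_place (negPf z0) ltNge v0 /= h => -[].
Qed.

Lemma dvr_placeD x y a b : dvr_place x = Some a -> dvr_place y = Some b ->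
 dvr_place (x + y) = Some (a + b).
move=> /dvr_place_Some [u [w [Ru Rw pw e ->]]] /dvr_place_Some [u' [w' [Ru' Rw' pw' e' ->]]].
rewrite (@dvr_placeE _ (u * w' + u' * w) (w * w')) ?phiM ?mulf_neq0 //; first last.
- by rewrite -e -e'; ring.
- exact: RM.
- by apply: RD; apply: RM.
by rewrite phiD ?phiM ?addf_div //; apply: RM.
Qed.

Lemma dvr_placeM x y a b : dvr_place x = Some a -> dvr_place y = Some b ->
 dvr_place (x * y) = Some (a * b).
move=> /dvr_place_Some [u [w [Ru Rw pw e ->]]] /dvr_place_Some [u' [w' [Ru' Rw' pw' e' ->]]].
rewrite (@dvr_placeE _ (u * u') (w * w')) ?phiM ?mulf_neq0 //; first last.
- by rewrite -e -e'; ring.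
- exact: RM.
- exact: RM.
by rewrite mulf_div.
Qed.

Lemma dvr_placeV z : dvr_place z = None -> dvr_place z^-1 = Some 0.
move=> /dvr_place_None [z0]; have [u [w [Ru Rw pu pw e]]] := dvr_valP z0.
case: (dvr_val z) e => // n e _.
rewrite (@dvr_placeE _ (t ^+ n.+1 * w) u) //; last first.
- apply: (mulfI z0); rewrite mulVKf // mulrCA e NegzE -exprnN mulVKf //.
 by rewrite expf_neq0.
- by apply: RM.
by rewrite exprS -mulrA phiM ?phit ?mul0r //; apply: RM.
Qed.

Lemma dvr_place_tV : dvr_place t^-1 = None.
have tV0 : t^-1 != 0 by rewrite invr_eq0.
rewrite /dvr_place (negPf tV0); case: ltP => // h.
have : dvr_val (t * t^-1) = 0 by rewrite divff // dvr_val_phi // phi1 oner_eq0.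
rewrite dvr_valM // dvr_val_t => e; move: h.
by have -> : dvr_val t^-1 = -1 by lia.
Qed.

End DVR.

(** * Local ring of the affine curve at a point (al, be) *)

Section LocalRing.
Variables (k : fieldType) (K : extension k) (L : fieldType) (j : {rmorphism k -> L}) (x y : K) (h f : {poly k}) (M : model x y h f) (al be : L) (pt : be ^+ 2 + pev j al h * be = pev j al f).
Notation ev := (pev (emb K) x).
Notation va := (pev j al).

Definition affine : set K := [set z | exists a b, z = ev a + ev b * y].

Definition aff_eval (z : K) : L :=
 xget 0 [set r | exists a b, z = ev a + ev b * y /\ r = va a + va b * be].

Lemma affine_uniq a b a' b' : ev a + ev b * y = ev a' + ev b' * y -> a = a' /\ b = b'.
move=> e; have : ev (a - a') + ev (b - b') * y = 0.
 by rewrite !pevE; apply/eqP; rewrite mulrBl addrACA -opprD subr_eq0 e.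
by case/(model_free M) => /eqP; rewrite subr_eq0 => /eqP-> /eqP; rewrite subr_eq0 => /eqP->.
Qed.

Lemma aff_evalE a b : aff_eval (ev a + ev b * y) = va a + va b * be.
apply: xget_unique; first by exists a, b.
by move=> r [a' [b' [/affine_uniq[<- <-] ->]]].
Qed.

Lemma aff_mul a b a' b' : (ev a + ev b * y) * (ev a' + ev b' * y) =
 ev (a * a' + b * b' * f) + ev (a * b' + b * a' - b * b' * h) * y.
rewrite !pevE -(model_eq M); ring.
Qed.

Lemma affine1 : affine 1.
Proof. by exists 1, 0; rewrite !pevE mul0r addr0. Qed.
Lemma affineB u w : affine u -> affine w -> affine (u - w).
Proof. by move=> [a [b ->]] [a' [b' ->]]; exists (a - a'), (b - b'); rewrite !pevE; ring. Qed.
Lemma affineM u w : affine u -> affine w -> affine (u * w).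
Proof. by move=> [a [b ->]] [a' [b' ->]]; rewrite aff_mul; do 2!eexists. Qed.
Lemma affine_ev a : affine (ev a).
Proof. by exists a, 0; rewrite pev0 mul0r addr0. Qed.
Lemma affine_y : affine y.
Proof. by exists 0, 1; rewrite pev0 pev1 mul1r add0r. Qed.
Lemma aff_eval_ev a : aff_eval (ev a) = va a.
Proof. by rewrite -[ev a]addr0 -(mul0r y) -(pev0 (emb K) x) aff_evalE pev0 mul0r addr0. Qed.
Lemma aff_eval1 : aff_eval 1 = 1.
Proof. by rewrite -(pev1 (emb K) x) aff_eval_ev pev1. Qed.
Lemma aff_eval_y : aff_eval y = be.
have {1}-> : y = ev 0 + ev 1 * y by rewrite !pevE mul1r add0r.
by rewrite aff_evalE !pevE mul1r add0r.
Qed.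
Lemma aff_evalB u w : affine u -> affine w -> aff_eval (u - w) = aff_eval u - aff_eval w.
move=> [a [b ->]] [a' [b' ->]].
have -> : ev a + ev b * y - (ev a' + ev b' * y) = ev (a - a') + ev (b - b') * y.
 by rewrite !pevE; ring.
by rewrite !aff_evalE !pevE; ring.
Qed.
Lemma aff_evalM u w : affine u -> affine w -> aff_eval (u * w) = aff_eval u * aff_eval w.
move=> [a [b ->]] [a' [b' ->]].
by rewrite aff_mul !aff_evalE !pevE -pt; ring.
Qed.

Lemma affine0 : affine 0.
Proof. by exists 0, 0; rewrite !pevE mul0r addr0. Qed.
Lemma affineD u w : affine u -> affine w -> affine (u + w).
Proof. by move=> [a [b ->]] [a' [b' ->]]; exists (a + a'), (b + b'); rewrite !pevE; ring. Qed.
Lemma aff_evalD u w : affine u -> affine w -> aff_eval (u + w) = aff_eval u + aff_eval w.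
move=> [a [b ->]] [a' [b' ->]].
have -> : ev a + ev b * y + (ev a' + ev b' * y) = ev (a + a') + ev (b + b') * y.
 by rewrite !pevE; ring.
by rewrite !aff_evalE !pevE; ring.
Qed.
Lemma aff_eval0 : aff_eval 0 = 0.
Proof. by rewrite -(pev0 (emb K) x) aff_eval_ev pev0. Qed.
Lemma affineX u n : affine u -> affine (u ^+ n).
Proof. by move=> Ru; elim: n => [|n IH]; [exact: affine1|rewrite exprS; apply: affineM]. Qed.

Lemma affine_gen z : exists u w, [/\ affine u, affine w, w != 0 & z * w = u].
have [a [b [c [c0 e]]]] := model_gen M z.
exists (ev a + ev b * y), (ev c); split=> //; first by do 2!eexists.
 exact: affine_ev.
apply: contraNneq c0 => e0; have := @model_free _ _ _ _ _ _ M c 0.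
by rewrite e0 !pevE mul0r addr0 => /(_ erefl)[->].
Qed.

Lemma ev_eq0 a : (ev a == 0) = (a == 0).
apply/eqP/eqP => [e|->]; last exact: pev0.
by have := @model_free _ _ _ _ _ _ M a 0; rewrite e !pevE mul0r addr0 => /(_ erefl)[->].
Qed.

(** This is the norm to k[x]: the conjugate of a + b y is a - b h - b y. *)
Lemma affine_norm u : affine u -> u != 0 -> exists n w, [/\ n != 0, affine w & u * w = ev n].
move=> [a [b ue]] u0.
have e : u * (ev (a - b * h) + ev (- b) * y) = ev (a ^+ 2 - a * b * h - b ^+ 2 * f).
 by rewrite ue !pevE -(model_eq M); ring.
exists (a ^+ 2 - a * b * h - b ^+ 2 * f), (ev (a - b * h) + ev (- b) * y); split=> //.
 rewrite -ev_eq0 -e mulf_neq0 //.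
 apply/eqP => /(model_free M)[e1 /eqP]; rewrite oppr_eq0 => /eqP b0.
 move: e1; rewrite b0 mul0r subr0 => a0.
 by move: u0; rewrite ue a0 b0 !pevE mul0r addr0 eqxx.
by do 2!eexists.
Qed.

Variables (pi : {poly k}) (piP : is_minpoly j al pi) (nonsing : forall b, pi %| h + b *+ 2 -> pi ^+ 2 %| f - h * b - b ^+ 2 -> False).

Let va_pi (q : {poly k}) : va q = 0 <-> pi %| q. Proof. by case: piP. Qed.
Let pi0 : pi != 0 := minpoly_neq0 piP.
Let piv0 : va pi = 0 := minpoly_root piP.

(** A double root be outside k(al) is left out on purpose: there the residue field grows and pi
    remains a uniformizer. *)
Definition ramified : Prop := va h + be *+ 2 = 0 /\ exists b, va b = be.

(** 1 and be are independent over k(al), so both coefficients vanish at al. *)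
Lemma aff_eval0_inert u : ~ (exists b, va b = be) -> affine u -> aff_eval u = 0 ->
 exists a b, u = ev pi * (ev a + ev b * y).
move=> nb [a [b ->]]; rewrite aff_evalE => e.
have vb0 : va b = 0.
 apply/eqP; apply: contraT => vb; exfalso; apply: nb.
 have [r re] := minpoly_inv piP vb.
 exists (- r * a); rewrite !pevE.
 have -> : va a = - (va b * be) by apply/eqP; rewrite -addr_eq0 e.
 by rewrite mulNr mulrN opprK mulrA re mul1r.
have va0 : va a = 0 by move: e; rewrite vb0 mul0r addr0.
move/va_pi: vb0 => /dvdpP[b' ->]; move/va_pi: va0 => /dvdpP[a' ->].
by exists a', b'; rewrite !pevE; ring.
Qed.

Lemma aff_eval0_rat u b0 : va b0 = be -> affine u -> aff_eval u = 0 ->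
 exists a b, u = ev pi * ev a + ev b * (y - ev b0).
move=> vb [a [b ->]]; rewrite aff_evalE -vb => e.
have /va_pi/dvdpP[a' e'] : va (a + b * b0) = 0 by rewrite !pevE.
exists a', b.
have -> : a = a' * pi - b * b0 by rewrite -e' addrK.
by rewrite !pevE; ring.
Qed.

Lemma rat_shift b0 : va b0 = be -> exists c, f - h * b0 - b0 ^+ 2 = pi * c /\
 (y - ev b0) * (y - ev b0 + ev (h + b0 *+ 2)) = ev pi * ev c.
move=> vb; have /va_pi/dvdpP[c e] : va (f - h * b0 - b0 ^+ 2) = 0.
 by rewrite !pevE -pt vb; ring.
exists c; split; first by rewrite e mulrC.
by rewrite -pevM mulrC [pi * c]mulrC -e !pevE -(model_eq M); ring.
Qed.

(** If be is not in k(al), or if the conjugate root differs from be, pi is a uniformizer. In the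
    ramified case y - b0 is one: by nonsingularity (y - b0) (y + h + b0) = pi c with c a unit at the
    point. *)
Lemma local_step : exists t s, [/\ affine t, affine s, aff_eval t = 0, t != 0 & t ^+ 2 = ev pi * s] /\
 (forall u, affine u -> aff_eval u = 0 -> exists w u',
  [/\ affine w, affine u', aff_eval w != 0 & w * u = t * u']) /\
 (ramified -> exists s', [/\ affine s', aff_eval s' != 0 & t ^+ 2 = ev pi * s']) /\
 (~ ramified -> t = ev pi).
have [[b0 vb]|nb] := pselect (exists b, va b = be); last first.
 exists (ev pi), (ev pi); split; [|split].
   by split; rewrite ?expr2 ?ev_eq0 ?aff_eval_ev //; exact: affine_ev.
  move=> u Ru /(aff_eval0_inert nb Ru) [a [b ->]]; exists 1, (ev a + ev b * y).
  by rewrite aff_eval1 oner_eq0 mul1r; split=> //; [exact: affine1|do 2!eexists].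
 by split=> // -[_ /nb].
have [c [ce yc]] := rat_shift vb.
set y1 := y - ev b0 in yc; set h1 := h + b0 *+ 2 in yc.
have Ry1 : affine y1 by apply: affineB; [exact: affine_y|exact: affine_ev].
have py1 : aff_eval y1 = 0.
 by rewrite aff_evalB ?aff_eval_y ?aff_eval_ev ?vb ?subrr //; [exact: affine_y|exact: affine_ev].
have [h10|h10] := eqVneq (va h1) 0; last first.
 exists (ev pi), (ev pi); split; [|split].
   by split; rewrite ?expr2 ?ev_eq0 ?aff_eval_ev //; exact: affine_ev.
  move=> u Ru /(aff_eval0_rat vb Ru) [a [b ->]].
  (* The conjugate factor y1 + h1 is a unit here, and multiplying by it turns y1 into pi c. *)
  exists (y1 + ev h1), (ev a * (y1 + ev h1) + ev b * ev c); split.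
  - by apply: affineD => //; apply: affine_ev.
  - apply: affineD; apply: affineM; rewrite -/y1; do ?exact: affine_ev.
   by apply: affineD => //; apply: affine_ev.
  - by rewrite aff_evalD ?py1 ?add0r ?aff_eval_ev //; apply: affine_ev.
  rewrite mulrDr [in RHS]mulrDr; congr (_ + _); first by ring.
  by rewrite -/y1 [LHS]mulrC -mulrA yc; ring.
 split=> // -[hb _]; exfalso; move/eqP: h10; apply.
 by rewrite !pevE vb.
have [h2 h1e] : exists h2, h1 = pi * h2.
 by move/va_pi: h10 => /dvdpP[r ->]; exists r; rewrite mulrC.
have vc : va c != 0.
 apply/eqP => /va_pi/dvdpP[r re]; apply: (nonsing (b := b0)).
  by apply/va_pi.
 by rewrite ce re mulrCA -expr2 dvdp_mull.
have sq : y1 ^+ 2 = ev pi * (ev c - ev h2 * y1).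
 have -> : y1 ^+ 2 = y1 * (y1 + ev h1) - ev h1 * y1 by ring.
 by rewrite yc h1e !pevE; ring.
have Rs : affine (ev c - ev h2 * y1).
 by apply: affineB; [exact: affine_ev|apply: affineM => //; exact: affine_ev].
exists y1, (ev c - ev h2 * y1); split; [split=> //|split].
- apply/eqP => /eqP; rewrite subr_eq0 => /eqP e.
 have := @affine_uniq 0 1 b0 0; rewrite !pevE mul1r mul0r add0r addr0 => /(_ e)[_ /eqP].
 by rewrite oner_eq0.
- move=> u Ru /(aff_eval0_rat vb Ru) [a [b ->]].
 (* Here c is the unit, and pi c = y1 (y1 + h1) extracts a factor y1 from pi as well. *)
 exists (ev c), (ev a * (y1 + ev h1) + ev b * ev c); split; rewrite ?aff_eval_ev //.
 + exact: affine_ev.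
 + apply: affineD; apply: affineM; do ?exact: affine_ev.
  by apply: affineD => //; apply: affine_ev.
 by rewrite -/y1 mulrDr mulrA [ev c * ev pi]mulrC -yc; ring.
split.
 move=> _; exists (ev c - ev h2 * y1); split=> //.
 rewrite aff_evalB ?aff_evalM ?py1 ?mulr0 ?subr0 ?aff_eval_ev //; try exact: affine_ev.
 by apply: affineM => //; exact: affine_ev.
move=> nr; exfalso; apply: nr; split; last by exists b0.
by move: h10; rewrite /h1 !pevE vb.
Qed.

Lemma polyX_part (n : {poly k}) : n != 0 -> exists m n', n = pi ^+ m * n' /\ va n' != 0.
elim/ltn_ind: {n}_.+1 {-2}n (leqnn (size n).+1) => // s IH n sn n0.
have [e|ne] := eqVneq (va n) 0; last by exists 0%N, n; rewrite expr0 mul1r.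
move/va_pi: e => /dvdpP[r re]; have r0 : r != 0 by apply: contraNneq n0 => r0; rewrite re r0 mul0r.
have : (size r < size n)%N.
 case: piP => _ s1 _; have sr : (0 < size r)%N by rewrite size_poly_gt0.
 by rewrite re size_mul //; move: (size r) (size pi) sr s1 => ? ?; lia.
move=> lt; have [m [n' [e' v']]] := IH (size n) sn r lt r0.
by exists m.+1, n'; split=> //; rewrite re e' exprSr -!mulrA [n' * _]mulrC.
Qed.

(** If t^(2 m + 2) divided u locally, pi^(m + 1) would divide its norm, whose exact power of pi is
    pi^m. So extracting factors t from u must stop. *)
Lemma local_bound t s : affine t -> affine s -> aff_eval t = 0 -> t ^+ 2 = ev pi * s ->
 forall u, affine u -> u != 0 -> exists N, forall n w u', (N <= n)%N ->
  affine w -> affine u' -> aff_eval w != 0 -> w * u = t ^+ n * u' -> False.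
move=> Rt Rs pt0 ts u Ru u0; have [n [w0 [n0 Rw0 e]]] := affine_norm Ru u0.
have [m [n' [ne vn']]] := polyX_part n0; exists (2 * m.+1)%N => r w u' le Rw Ru' pw we.
have : w * ev n = t ^+ r * u' * w0 by rewrite -we -e mulrA.
rewrite ne pevM pevXn -(subnKC le) exprD exprM ts exprMn exprSr.
have pim : ev pi ^+ m != 0 by rewrite expf_neq0 // ev_eq0.
set r' := (r - _)%N => e2.
have {}e2 : w * ev n' = ev pi * (s ^+ m.+1 * t ^+ r' * u' * w0).
 by apply: (mulfI pim); rewrite mulrCA e2; ring.
have R1 : affine (s ^+ m.+1 * t ^+ r' * u' * w0).
 by apply: affineM => //; apply: affineM => //; apply: affineM; exact: affineX.
have := congr1 aff_eval e2; rewrite (aff_evalM Rw (affine_ev _)) (aff_evalM (affine_ev _) R1) !aff_eval_ev piv0 mul0r.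
by move/eqP; rewrite mulf_eq0 (negPf pw) (negPf vn').
Qed.

Lemma local_unif : exists t, uniformized affine aff_eval t /\
 (ramified -> exists s', [/\ affine s', aff_eval s' != 0 & t ^+ 2 = ev pi * s']) /\
 (~ ramified -> t = ev pi).
have [t [s [[Rt Rs t0 tn ts] [step rest]]]] := local_step.
exists t; split=> //; split=> //; try exact: affine_gen.
- exact: affine1.
- exact: affineB.
- exact: affineM.
- exact: aff_eval1.
- exact: aff_evalB.
- exact: aff_evalM.
move=> u Ru u0.
have [N HN] := local_bound Rt Rs t0 ts Ru u0.
suff : forall n, (exists m w u', [/\ affine w, affine u', aff_eval w != 0, aff_eval u' != 0 & w * u = t ^+ m * u'])
  \/ exists w u', [/\ affine w, affine u', aff_eval w != 0 & w * u = t ^+ n * u'].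
 by case/(_ N) => // -[w [u' [Rw Ru' pw /(HN N _ _ (leqnn N) Rw Ru' pw)]]].
elim=> [|n [IH|[w [u' [Rw Ru' pw e]]]]]; [right|by left|].
 by exists 1, u; rewrite aff_eval1 oner_eq0 expr0; split=> //; exact: affine1.
have [e0|ne] := eqVneq (aff_eval u') 0; last by left; exists n, w, u'.
have [w' [u'' [Rw' Ru'' pw' e']]] := step _ Ru' e0.
right; exists (w' * w), u''; split=> //; first exact: affineM.
 by rewrite aff_evalM // mulf_neq0.
by rewrite -mulrA e mulrCA e' exprSr mulrA.
Qed.

End LocalRing.

(** * Elementary properties of valuations *)

Section Valuation.
Variables (k : fieldType) (K : extension k) (v : K -> int) (vP : is_valuation v).

Lemma vM x y : x != 0 -> y != 0 -> v (x * y) = v x + v y.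
Proof. by case: vP => _ _ + _ _; apply. Qed.

Lemma v0 : v 0 = 0. Proof. by case: vP. Qed.

Lemma vC a : v (emb K a) = 0. Proof. by case: vP. Qed.

Lemma v1 : v 1 = 0. Proof. by rewrite -(rmorph1 (emb K)) vC. Qed.

Lemma vV x : v x^-1 = - v x.
have [->|x0] := eqVneq x 0; first by rewrite invr0 v0 oppr0.
by apply/eqP; rewrite -addr_eq0 -vM ?invr_eq0 // mulVf ?v1.
Qed.

Lemma vX x (n : nat) : v (x ^+ n) = v x *+ n.
have [->|x0] := eqVneq x 0; first by case: n => [|n]; rewrite ?expr0 ?mulr0n ?v1 // expr0n v0 mul0rn.
by elim: n => [|n IH]; rewrite ?v1 // exprS mulrS vM ?expf_neq0 // IH.
Qed.

Lemma vXz x (n : int) : v (x ^ n) = v x * n.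
case: n => n; first by rewrite -exprnP vX -mulr_natr natz.
by rewrite NegzE -exprnN vV vX -mulr_natr natz mulrN.
Qed.

Lemma vN x : v (- x) = v x.
have [->|x0] := eqVneq x 0; first by rewrite oppr0.
by rewrite -mulN1r vM ?oppr_eq0 ?oner_eq0 // -(rmorph1 (emb K)) -rmorphN vC add0r.
Qed.

Lemma vD x y : x != 0 -> y != 0 -> x + y != 0 -> Num.min (v x) (v y) <= v (x + y).
Proof. by case: vP => _ _ _ + _; apply. Qed.

Lemma val_ge0 m : val_ge v m 0. Proof. by left. Qed.

Lemma val_geD m x y : val_ge v m x -> val_ge v m y -> val_ge v m (x + y).
have [->|x0] := eqVneq x 0; first by rewrite add0r.
have [->|y0] := eqVneq y 0; first by rewrite addr0.
have [->|s0] := eqVneq (x + y) 0; first by left.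
move=> [/eqP|hx]; first by rewrite (negPf x0).
move=> [/eqP|hy]; first by rewrite (negPf y0).
by right; apply: le_trans (vD x0 y0 s0); rewrite le_min hx.
Qed.

Lemma val_geN m x : val_ge v m x -> val_ge v m (- x).
Proof. by case=> [->|h]; [left; rewrite oppr0|right; rewrite vN]. Qed.

Lemma val_geB m x y : val_ge v m x -> val_ge v m y -> val_ge v m (x - y).
Proof. by move=> hx hy; apply: val_geD => //; apply: val_geN. Qed.

Lemma val_geM m n x y : val_ge v m x -> val_ge v n y -> val_ge v (m + n) (x * y).
have [->|x0] := eqVneq x 0; first by rewrite mul0r; left.
have [->|y0] := eqVneq y 0; first by rewrite mulr0; left.
case=> [/eqP|hx]; first by rewrite (negPf x0).
case=> [/eqP|hy]; first by rewrite (negPf y0).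
by right; rewrite vM // lerD.
Qed.

Lemma val_geC a : val_ge v 0 (emb K a).
Proof. by right; rewrite vC. Qed.

Lemma val_ge_sum m (I : Type) (r : seq I) (P : pred I) (F : I -> K) :
 (forall i, P i -> val_ge v m (F i)) -> val_ge v m (\sum_(i <- r | P i) F i).
Proof. by move=> H; apply: big_ind => //; [exact: val_ge0|exact: val_geD]. Qed.

Lemma val_ge_le m n x : m <= n -> val_ge v n x -> val_ge v m x.
Proof. by move=> mn [->|h]; [left|right; apply: le_trans h]. Qed.

Lemma val_geX n x : val_ge v 0 x -> val_ge v 0 (x ^+ n).
move=> hx; elim: n => [|n IH]; first by right; rewrite v1.
by rewrite exprS -(addr0 0); apply: val_geM.
Qed.

Lemma val_ge_pev x (p : {poly k}) : val_ge v 0 x -> val_ge v 0 (pev (emb K) x p).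
move=> hx; elim/poly_ind: p => [|p c IH]; first by rewrite pev0; left.
rewrite !pevE; apply: val_geD; last exact: val_geC.
by rewrite -(addr0 0); apply: val_geM.
Qed.

Lemma v_add_lt x y : x != 0 -> (y = 0 \/ v x < v y) -> v (x + y) = v x /\ x + y != 0.
move=> x0 hy; have [->|y0] := eqVneq y 0; first by rewrite addr0.
case: hy => [/eqP|xy]; first by rewrite (negPf y0).
have s0 : x + y != 0.
 by rewrite addr_eq0; apply: contraTneq xy => ->; rewrite vN ltxx.
split=> //; apply/eqP; rewrite eq_le; apply/andP; split; last first.
 by apply: le_trans (vD x0 y0 s0); rewrite le_min lexx ltW.
rewrite leNgt; apply/negP => lt.
have yN : - y != 0 by rewrite oppr_eq0.
have := vD s0 yN; rewrite addrK => /(_ x0); rewrite vN.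
by rewrite leNgt lt_min lt xy.
Qed.

End Valuation.

(** * Valuation and place of a nonsingular point *)

Section LocalVal.
Variables (k : fieldType) (K : extension k) (L : fieldType) (j : {rmorphism k -> L}) (x y : K) (h f : {poly k}) (M : model x y h f).
Notation ev := (pev (emb K) x).
Notation va al := (pev j al).
Notation R := (affine x y).

(* The valuation of the local ring at the point (al, be). *)
Definition val_at (al be : L) (v : K -> int) : Prop :=
 is_valuation v /\ forall u, R u -> u != 0 ->
  0 <= v u /\ (0 < v u <-> aff_eval j x y al be u = 0).

(** In terms of y - b the equation has linear coefficient h + 2 b and constant term f - h b - b^2,
    so the two divisibilities say that (y - b) / pi is integral over k[x]. Their failure for every b
    is normality along pi, in any characteristic. *)
Definition nonsingular (pi : {poly k}) : Prop :=
 forall b, pi %| h + b *+ 2 -> pi ^+ 2 %| f - h * b - b ^+ 2 -> False.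

Definition place_axioms (p : K -> option L) : Prop :=
 [/\ forall a : k, p (emb K a) = Some (j a),
   forall x y a b, p x = Some a -> p y = Some b -> p (x + y) = Some (a + b),
   forall x y a b, p x = Some a -> p y = Some b -> p (x * y) = Some (a * b),
   forall x, p x = None -> p x^-1 = Some 0
  & exists x, p x = None].

Variables (al be : L) (pt : be ^+ 2 + va al h * be = va al f) (pi : {poly k}) (piP : is_minpoly j al pi) (nons : nonsingular pi).
Notation phi := (aff_eval j x y al be).

(** For uniqueness, any such v' equals v'(t) times v, and both take the value 1. *)
Lemma val_at_ex : exists v, [/\ val_at al be v,
  ramified j h al be -> v (ev pi) = 2,
  ~ ramified j h al be -> v (ev pi) = 1,
  (forall z, val_ge v 0 z -> exists u w, [/\ R u, R w, phi w != 0 & z * w = u]) &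
  forall v', val_at al be v' -> v' = v].
have [t [D [hr hnr]]] := local_unif M pt piP nons.
pose v := dvr_val R phi t.
have vP : is_valuation v.
 split.
 - by rewrite /v /dvr_val eqxx.
 - move=> a; have [->|a0] := eqVneq a 0; first by rewrite rmorph0 /v /dvr_val eqxx.
  have -> : emb K a = ev a%:P by rewrite pevC.
  apply: (dvr_val_phi D); first exact: affine_ev.
  by rewrite (aff_eval_ev j M) pevC fmorph_eq0.
 - exact: (dvr_valM D).
 - exact: (dvr_val_sum D).
 - by exists t; exact: (dvr_val_t D).
have vR u : R u -> u != 0 -> 0 <= v u /\ (0 < v u <-> phi u = 0).
 move=> Ru u0; split.
  exact: (dvr_val_R D).
 split; last by move=> pu; apply: (dvr_val_pos D).
 move=> vu; apply/eqP; apply: contraTT vu => pu.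
 by rewrite /v (dvr_val_phi D) ?ltxx.
have vt : v t = 1 by exact: (dvr_val_t D).
exists v; split=> //.
- move=> /hr [s [Rs ps ts]].
 have s0 : s != 0 by apply: contraNneq ps => ->; rewrite (aff_eval0 j M).
 have : v (t ^+ 2) = v (ev pi) + v s.
  by rewrite ts vM // (ev_eq0 M) (minpoly_neq0 piP).
 rewrite vX // vt; have [] := vR _ Rs s0.
 by rewrite le_eqVlt => /orP[/eqP<- _|lt [/(_ lt)/eqP]]; rewrite ?addr0 ?(negPf ps).
- by move=> /hnr <-.
- move=> z [->|vz].
  by exists 0, 1; rewrite (unif_phi1 D) oner_eq0 mul0r; split=> //; [exact: affine0|exact: affine1].
 have [->|z0] := eqVneq z 0.
  by exists 0, 1; rewrite (unif_phi1 D) oner_eq0 mul0r; split=> //; [exact: affine0|exact: affine1].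
 exact: (dvr_val_ge0 D).
move=> v' [v'P v'R]; have tpos : 0 < v' t by have [_ ->] := v'R _ (unif_Rt D) (unif_t0 D); exact: unif_phit D.
have e z : v' z = v' t * v z.
 have [->|z0] := eqVneq z 0; first by rewrite !v0 // mulr0.
 have [u [w [Ru Rw pu pw e]]] := dvr_valP D z0.
 have [u0 w0] : u != 0 /\ w != 0.
  by split; [apply: contraNneq pu|apply: contraNneq pw] => ->; rewrite (aff_eval0 j M).
 have vu0 s : R s -> s != 0 -> phi s != 0 -> v' s = 0.
  move=> Rs s0 ps; have [] := v'R _ Rs s0.
  by rewrite le_eqVlt => /orP[/eqP<- //|lt [/(_ lt)/eqP]]; rewrite (negPf ps).
 have := congr1 v' e; rewrite !(vM v'P) ?expfz_neq0 ?(unif_t0 D) // (vXz v'P) (vu0 w) // (vu0 u) //.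
 by rewrite !addr0.
have [z vz] : exists z, v' z = 1 by case: v'P.
have v't : v' t = 1.
 have vz' : v' t * v z = 1 by rewrite -e.
 by apply/eqP; rewrite eq_le -{1}vz' ler_peMr ?(ltW tpos) //; lia.
by apply/funext => z'; rewrite e v't mul1r.
Qed.

Lemma place_at_ex : exists p, [/\ place_axioms p, p x = Some al & p y = Some be].
have [t [D _]] := local_unif M pt piP nons.
have PR u : R u -> dvr_place R phi t u = Some (phi u).
 exact: (dvr_place_R D).
exists (dvr_place R phi t); split.
- split.
 + move=> a; have -> : emb K a = ev a%:P by rewrite pevC.
  by rewrite (PR _ (affine_ev _ _ _)) (aff_eval_ev j M) pevC.
 + exact: (dvr_placeD D).
 + exact: (dvr_placeM D).
 + exact: (dvr_placeV D).
 + by exists t^-1; exact: (dvr_place_tV D).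
- have Rx : R x by have := affine_ev x y 'X; rewrite pevX.
 by have := aff_eval_ev j M al be 'X; rewrite !pevX PR // => ->.
- by rewrite PR ?(aff_eval_y j M) //; exact: affine_y.
Qed.

Lemma place_pev p u a q : place_axioms p -> p u = Some a ->
 p (pev (emb K) u q) = Some (pev j a q).
case=> pC pD pMl _ _ pu; elim/poly_ind: q => [|q c IH].
 by rewrite !pev0 -(rmorph0 (emb K)) pC rmorph0.
by rewrite !pevE; apply: pD => //; apply: pMl.
Qed.

(** The values at x and y determine a place on the local ring. As this is a valuation ring, the
    inverse of an element outside it has value 0, so the element itself has no finite value. *)
Lemma place_at_uniq p p' : place_axioms p -> place_axioms p' ->
 p x = Some al -> p y = Some be -> p' x = Some al -> p' y = Some be -> p = p'.
move=> pp pp' px py px' py'.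
have [t [D _]] := local_unif M pt piP nons.
suff key p0 : place_axioms p0 -> p0 x = Some al -> p0 y = Some be -> p0 = dvr_place R phi t.
 by rewrite (key p) // (key p').
clear -M pt piP nons D.
move=> pp px py; have [pC pD pMl pV _] := pp.
have pR u : R u -> p0 u = Some (phi u).
 move=> [a [b ->]]; rewrite (aff_evalE j M); apply: pD; last apply: pMl => //.
  exact: place_pev.
 exact: place_pev.
have p01 : p0 1 = Some 1 by rewrite -(rmorph1 (emb K)) pC rmorph1.
have inv w : R w -> phi w != 0 -> p0 w^-1 = Some (phi w)^-1.
 move=> Rw pw; have w0 : w != 0 by apply: contraNneq pw => ->; rewrite (aff_eval0 j M).
 case e : (p0 w^-1) => [c|].
  have := pMl _ _ _ _ (pR _ Rw) e; rewrite divff // p01 => -[h1].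
  by congr Some; apply: (mulfI pw); rewrite divff.
 by move: (pV _ e); rewrite invrK pR // => -[/eqP]; rewrite (negPf pw).
have main z u w : R u -> R w -> phi w != 0 -> z * w = u -> p0 z = Some (phi u / phi w).
 move=> Ru Rw pw e; have w0 : w != 0 by apply: contraNneq pw => ->; rewrite (aff_eval0 j M).
 by rewrite -(mulfK w0 z) e; apply: pMl (pR _ Ru) (inv _ Rw pw).
apply/funext => z; case e : (dvr_place R phi t z) => [a|].
 have [u [w [Ru Rw pw ez ->]]] := dvr_place_Some D e.
 exact: main ez.
have eV := dvr_placeV D e.
have [z0 _] := dvr_place_None D e.
have [u [w [Ru Rw pw ez ea]]] := dvr_place_Some D eV.
have zV : p0 z^-1 = Some 0 by rewrite (main _ _ _ Ru Rw pw ez) -ea.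
case e0 : (p0 z) => [c|] //; exfalso.
have := pMl _ _ _ _ e0 zV; rewrite divff // p01 mulr0 => -[/eqP].
by rewrite oner_eq0.
Qed.

End LocalVal.

(** * Valuations above a prime of k[x] *)

Section Residues.
Variables (k : fieldType) (K : extension k) (L : fieldType) (j : {rmorphism k -> L}) (x y : K) (h f : {poly k}) (M : model x y h f).
Notation ev := (pev (emb K) x).
Notation va al := (pev j al).
Notation R := (affine x y).

Lemma valC_coprime v (n pi : {poly k}) al : is_valuation v -> val_ge v 0 x -> is_minpoly j al pi ->
 0 < v (ev pi) -> va al n != 0 -> v (ev n) = 0.
move=> vP vx piP vpi vn; have [r re] := minpoly_inv piP vn.
have : va al (1 - r * n) = 0 by rewrite pevB pev1 pevM re subrr.
case: piP => mon _ dv /dv/dvdpP[s se].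
have e1 : ev r * ev n = 1 - ev s * ev pi.
 by rewrite -!pevM -se pevB pev1; ring.
have n0 : ev n != 0.
 rewrite (ev_eq0 M); apply: contraNneq vn => ->; by rewrite pev0.
have pin0 : ev pi != 0 by rewrite (ev_eq0 M) monic_neq0.
have v1e : v (1 - ev s * ev pi) = 0.
 have [] := @v_add_lt _ _ v vP 1 (- (ev s * ev pi)) (oner_neq0 _) => [|-> _]; last by rewrite v1.
 have [->|s0] := eqVneq (ev s) 0; first by left; rewrite mul0r oppr0.
 right; rewrite (vN vP) (v1 vP) (vM vP s0 pin0).
 by have [/eqP|] := val_ge_pev vP s vx; [rewrite (negPf s0)|lia].
have r0 : ev r != 0.
 apply/eqP => r0; move: e1; rewrite r0 mul0r => e1.
 have sp : ev s * ev pi = 1 by apply/eqP; rewrite eq_sym -subr_eq0 -e1.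
 have s0 : ev s != 0 by apply: contraTneq (oner_neq0 K) => e0; rewrite -sp e0 mul0r eqxx.
 have := congr1 v sp; rewrite (vM vP s0 pin0).
 by rewrite (v1 vP); have [e|] := val_ge_pev vP s vx; [move: sp; rewrite e mul0r => /esym/eqP; rewrite oner_eq0|lia].
move: v1e; rewrite -e1 (vM vP) //.
have [/eqP|] := val_ge_pev vP r vx; first by rewrite (negPf r0).
by have [/eqP|] := val_ge_pev vP n vx; [rewrite (negPf n0)|lia].
Qed.

Lemma val_y v : is_valuation v -> val_ge v 0 x -> val_ge v 0 y.
move=> vP vx; have [->|y0] := eqVneq y 0; first by left.
right; rewrite leNgt; apply/negP => vy.
have : y ^+ 2 = ev f - ev h * y by rewrite -(model_eq M) addrK.
move/(congr1 v); rewrite (vX vP) => e.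
have : val_ge v (v y) (ev f - ev h * y).
 apply: (val_geB vP); first by apply: val_ge_le (val_ge_pev vP f vx); apply: ltW.
 by rewrite -(add0r (v y)); apply: (val_geM vP); [exact: val_ge_pev|right].
case=> [e0|]; last by rewrite -e; lia.
by move: e; rewrite e0 (v0 vP); lia.
Qed.

Lemma val_affine v u : is_valuation v -> val_ge v 0 x -> R u -> val_ge v 0 u.
move=> vP vx [a [b ->]]; apply: (val_geD vP); first exact: val_ge_pev.
by rewrite -(addr0 0); apply: (val_geM vP); [exact: val_ge_pev|exact: val_y].
Qed.

Lemma val_atx al be v : val_at j x y al be v -> val_ge v 0 x.
case=> vP vR; have [->|x0] := eqVneq x 0; first by left.
right; have [] // := vR x _ x0; by have := affine_ev x y 'X; rewrite pevX.
Qed.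

Variables (al : L) (pi : {poly k}) (piP : is_minpoly j al pi).

Definition on_curve (be : L) : Prop := be ^+ 2 + va al h * be = va al f.

Lemma on_curve_conj be : on_curve be -> on_curve (- va al h - be).
Proof. by rewrite /on_curve => <-; ring. Qed.

Lemma on_curve2 be be' : on_curve be -> on_curve be' -> be' = be \/ be' = - va al h - be.
rewrite /on_curve => e e'.
have /eqP : (be' - be) * (be' + va al h + be) = 0.
 have -> : (be' - be) * (be' + va al h + be) =
   (be' ^+ 2 + va al h * be') - (be ^+ 2 + va al h * be) by ring.
 by rewrite e e' subrr.
rewrite mulf_eq0 subr_eq0 => /orP[/eqP->|/eqP h0]; [by left|right].
by apply/eqP; rewrite -subr_eq0 -h0; apply/eqP; ring.
Qed.

Lemma inert_conj be : ~ (exists b, va al b = be) -> ~ (exists b, va al b = - va al h - be).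
Proof. by move=> nb [b e]; apply: nb; exists (- h - b); rewrite !pevE e; ring. Qed.

Lemma inert_eval0 be u : on_curve be -> ~ (exists b, va al b = be) -> R u ->
 (aff_eval j x y al be u = 0 <-> exists a b, u = ev pi * (ev a + ev b * y)).
move=> pt nb Ru; split; first exact: (aff_eval0_inert M piP).
move=> [a [b ->]]; rewrite (aff_evalM M pt) ?(aff_eval_ev j M) ?(minpoly_root piP) ?mul0r //.
 exact: affine_ev.
by do 2!eexists.
Qed.

(** For be outside k(al) the inverse comes from the norm. It does not vanish, because the conjugate
    point defines the same maximal ideal of k[x, y]. *)
Lemma residue_inv be w : on_curve be -> R w -> aff_eval j x y al be w != 0 ->
 exists w', R w' /\ aff_eval j x y al be w * aff_eval j x y al be w' = 1.
move=> pt Rw; have [[b0 vb]|nb] := pselect (exists b, va al b = be).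
 case: Rw => a [b ->]; rewrite (aff_evalE j M) => w0.
 have : va al (a + b * b0) != 0 by rewrite !pevE vb.
 move=> /(minpoly_inv piP)[r re]; exists (ev r); split; first exact: affine_ev.
 by rewrite (aff_eval_ev j M) -vb -pevM -pevD mulrC.
case: (Rw) => a [b ew]; rewrite ew (aff_evalE j M) => w0.
pose n := a ^+ 2 - a * b * h - b ^+ 2 * f.
have ne : (va al a + va al b * be) * (va al a + va al b * (- va al h - be)) = va al n.
 by rewrite /n !pevE -pt; ring.
have [n0|/(minpoly_inv piP)[r re]] := eqVneq (va al n) 0.
 exfalso; move: ne; rewrite n0 => /eqP; rewrite mulf_eq0 (negPf w0) /= => /eqP e.
 have ptc := on_curve_conj pt.
 have [|a' [b' e2]] := (inert_eval0 ptc (inert_conj nb) Rw).1.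
  by rewrite ew (aff_evalE j M).
 have : aff_eval j x y al be w = 0 by apply/(inert_eval0 pt nb Rw); exists a', b'.
 by rewrite ew (aff_evalE j M) => /eqP; rewrite (negPf w0).
exists (ev (r * (a - b * h)) + ev (- r * b) * y); split; first by do 2!eexists.
rewrite (aff_evalE j M) -re -ne !pevE; ring.
Qed.

(** In the inert case only one maximal ideal lies above pi. Otherwise [rat_shift] shows that y - b0
    or its conjugate y + h + b0 has positive value, and this selects be0 or the conjugate point. *)
Lemma val_classify_over v : is_valuation v -> val_ge v 0 x -> 0 < v (ev pi) ->
 (exists be, on_curve be) -> exists be, on_curve be /\ val_at j x y al be v.
move=> vP vx vpi [be0 pt0].
have vge u : R u -> u != 0 -> 0 <= v u.
 by move=> Ru u0; have [/eqP|//] := val_affine vP vx Ru; rewrite (negPf u0).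
have [[b0 vb0]|nb] := pselect (exists b, va al b = be0); last first.
 exists be0; split=> //; split=> // u Ru u0; split; first exact: vge.
 split.
  move=> vu; apply: contrapT => /eqP pu.
  have [w [Rw e]] := residue_inv pt0 Ru pu.
  have : aff_eval j x y al be0 (1 - u * w) = 0.
   rewrite (aff_evalB j M) ?(aff_eval1 j M) ?(aff_evalM M pt0) ?e ?subrr //.
    exact: affine1.
   exact: affineM M _ _ Ru Rw.
  have RB : R (1 - u * w) by apply: affineB; [exact: affine1|exact: (affineM M Ru Rw)].
  move=> /(inert_eval0 pt0 nb RB) [a [b e2]].
  have g1 : val_ge v 1 (1 - u * w).
   rewrite e2 -(addr0 1); apply: (val_geM vP); first by right; lia.
   by apply: val_affine => //; do 2!eexists.
  have g2 : val_ge v 1 (u * w).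
   rewrite -(addr0 1); apply: (val_geM vP); first by right; lia.
   exact: val_affine.
  have := val_geD vP g1 g2; rewrite subrK => -[/eqP|]; first by rewrite oner_eq0.
  by rewrite (v1 vP).
 move=> /(inert_eval0 pt0 nb Ru) [a [b e]].
 have : val_ge v 1 u.
  rewrite e -(addr0 1); apply: (val_geM vP); first by right; lia.
  by apply: val_affine => //; do 2!eexists.
 by case=> [/eqP|]; rewrite ?(negPf u0) //; lia.
have [be [b1 [pt vb vy]]] : exists be b, [/\ on_curve be, va al b = be & val_ge v 1 (y - ev b)].
 have [c [_ yc]] := rat_shift M pt0 piP vb0.
 have y10 : y - ev b0 != 0.
  apply/eqP => /eqP; rewrite subr_eq0 => /eqP e.
  have := @affine_uniq _ _ x y h f M 0 1 b0 0.
  by rewrite !pevE mul1r mul0r add0r addr0 => /(_ e)[_ /eqP]; rewrite oner_eq0.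
 have Ry b : R (y - ev b) by apply: affineB; [exact: affine_y|exact: affine_ev].
 have [|lt] := ltP 0 (v (y - ev b0)).
  by exists be0, b0; split=> //; right; lia.
 have vy0 : v (y - ev b0) = 0 by have := vge _ (Ry b0) y10; lia.
 exists (- va al h - be0), (- h - b0); split; first exact: on_curve_conj.
  by rewrite !pevE vb0; ring.
 have -> : y - ev (- h - b0) = y - ev b0 + ev (h + b0 *+ 2) by rewrite !pevE; ring.
 have [->|s0] := eqVneq (y - ev b0 + ev (h + b0 *+ 2)) 0; first by left.
 have : val_ge v 1 (ev pi * ev c).
  rewrite -(addr0 1); apply: (val_geM vP); first by right; lia.
  exact: val_ge_pev.
 rewrite -yc => -[/eqP|]; first by rewrite mulf_eq0 (negPf y10) (negPf s0).
 by rewrite (vM vP) // vy0 add0r; right.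
exists be; split=> //; split=> // u Ru u0; split; first exact: vge.
split; last first.
 move=> /(aff_eval0_rat M piP vb Ru) [a [b e]].
 have : val_ge v 1 u.
  rewrite e; apply: (val_geD vP).
   rewrite -(addr0 1); apply: (val_geM vP); first by right; lia.
   exact: val_ge_pev.
  by rewrite -(add0r 1); apply: (val_geM vP) => //; exact: val_ge_pev.
 by case=> [/eqP|]; rewrite ?(negPf u0) //; lia.
case: Ru u0 => a [b ->] u0; rewrite (aff_evalE j M) => vu.
apply: contrapT => /eqP pu.
have pu' : va al (a + b * b1) != 0 by rewrite !pevE vb.
have e0 := valC_coprime vP vx piP vpi pu'.
have n0 : ev (a + b * b1) != 0.
 by rewrite (ev_eq0 M); apply: contraNneq pu' => ->; rewrite pev0.
have eu : ev a + ev b * y = ev (a + b * b1) + ev b * (y - ev b1) by rewrite !pevE; ring.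
have : val_ge v 1 (ev b * (y - ev b1)).
 by rewrite -(add0r 1); apply: (val_geM vP) => //; exact: val_ge_pev.
case=> [e1|lt1]; first by move: vu; rewrite eu e1 addr0 e0.
have [|e2 _] := v_add_lt vP n0 (y := ev b * (y - ev b1)).
 by right; rewrite e0; lia.
by move: vu; rewrite eu e2 e0.
Qed.

End Residues.

(** Lower bounds for dimensions are carried by independent families: they pass to larger spaces V
    and presuppose no finiteness, unlike [has_dim]. *)
Definition free_mod (k : fieldType) (K : extension k) (V W : set K) (s : nat) : Prop :=
 exists e : 'I_s -> K, (forall i, V (e i)) /\
  forall c : 'I_s -> k, W (\sum_i emb K (c i) * e i) -> forall i, c i = 0.

(** * Residue degrees, ramification and the bound 2 deg pi *)

Section DegreeBound.
Variables (k : fieldType) (K : extension k) (L : fieldType) (j : {rmorphism k -> L}) (x y : K) (h f : {poly k}) (M : model x y h f).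
Notation ev := (pev (emb K) x).
Notation va al := (pev j al).
Notation R := (affine x y).
Notation oncurve := (on_curve j h f).

Lemma has_dim_free (V W : set K) d (e : 'I_d -> K) (c : 'I_d -> k) :
 W 0 -> V 0 ->
 (forall z, V z -> exists! g : {ffun 'I_d -> K},
    (forall i, constants (g i)) /\ W (z - \sum_(i < d) g i * e i)) ->
 W (\sum_i emb K (c i) * e i) -> (forall z, W z -> W (- z)) -> forall i, c i = 0.
move=> W0 V0 H Wc WN i; have [c0 [_ uc]] := H 0 V0.
have h1 : c0 = [ffun i => emb K (c i)].
 apply: uc; split=> [i'|]; first by rewrite ffunE; exists (c i').
 by rewrite sub0r; apply: WN; under eq_bigr do rewrite ffunE.
have h2 : c0 = [ffun i => 0].
 apply: uc; split=> [i'|]; first by rewrite ffunE; exists 0; rewrite ?rmorph0.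
 by rewrite big1 ?subr0 // => i' _; rewrite ffunE mul0r.
have := congr1 (fun g : {ffun 'I_d -> K} => g i) (etrans (esym h1) h2).
by rewrite !ffunE => /eqP; rewrite fmorph_eq0 => /eqP.
Qed.

Lemma has_dim_free_mod (V W : set K) d : W 0 -> V 0 -> (forall z, W z -> W (- z)) ->
 has_dim (@constants k K) V W d -> free_mod V W d.
move=> W0 V0 WN [e [Ve H]]; exists e; split=> // c Wc.
exact: has_dim_free W0 V0 H Wc WN.
Qed.

Lemma free_span_le d n (th : 'I_d -> L) (b : 'I_n -> L) :
 (forall c : 'I_d -> k, \sum_i j (c i) * th i = 0 -> forall i, c i = 0) ->
 (forall i, exists A : 'I_n -> k, th i = \sum_l j (A l) * b l) -> (d <= n)%N.
move=> fr /choice[A sp].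
pose B := (\matrix_(i < d, l < n) A i l).
suff /eqP <- : row_free B by apply: rank_leq_col.
apply: inj_row_free => c cB; apply/rowP => i; rewrite mxE.
apply: (fr (fun i => c 0 i)); under eq_bigr do rewrite sp mulr_sumr.
rewrite exchange_big big1 //= => l _.
have : \sum_i c 0 i * A i l = 0.
 have := congr1 (fun m : 'rV_n => m 0 l) cB; rewrite !mxE => E.
 by rewrite -[RHS]E; apply: eq_bigr => i' _; rewrite mxE.
move/(congr1 j); rewrite rmorph0 rmorph_sum /= => e0.
transitivity ((\sum_i0 j (c 0 i0 * A i0 l)) * b l); last by rewrite e0 mul0r.
by rewrite mulr_suml; apply: eq_bigr => i' _; rewrite rmorphM mulrA.
Qed.

Variables (al : L) (pi : {poly k}) (piP : is_minpoly j al pi) (nons : nonsingular h f pi).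

Lemma val_at_residue be v z : oncurve al be -> val_at j x y al be v -> val_ge v 0 z ->
 exists u w, [/\ R u, R w, aff_eval j x y al be w != 0 & z * w = u].
move=> pt vP vz; have [v' [_ _ _ H uq]] := val_at_ex M pt piP nons.
by apply: H; rewrite -(uq _ vP).
Qed.

Lemma val_at_uniq be v v' : oncurve al be -> val_at j x y al be v -> val_at j x y al be v' -> v = v'.
by move=> pt h1 h2; have [v0 [_ _ _ _ uq]] := val_at_ex M pt piP nons; rewrite (uq _ h1) (uq _ h2).
Qed.

Lemma val_at_pi be v : oncurve al be -> val_at j x y al be v ->
 (ramified j h al be -> v (ev pi) = 2) /\ (~ ramified j h al be -> v (ev pi) = 1).
by move=> pt h1; have [v0 [_ r nr _ uq]] := val_at_ex M pt piP nons; rewrite (uq _ h1).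
Qed.

(** Every residue class at v is represented in k[x, y], so evaluation at (al, be) embeds the residue
    field of v into k(al, be). *)
Lemma val_at_free be v d : oncurve al be -> val_at j x y al be v -> free_mod (val_ge v 0) (val_ge v 1) d ->
 exists th : 'I_d -> L, (forall i, exists a b, th i = va al a + va al b * be) /\
  (forall c : 'I_d -> k, \sum_i j (c i) * th i = 0 -> forall i, c i = 0).
move=> pt vP [e [eO efree]]; have [vv vR] := vP.
have H i : exists u, R u /\ val_ge v 1 (e i - u).
 have [u [w [Ru Rw pw ez]]] := val_at_residue pt vP (eO i).
 have [w' [Rw' e1]] := residue_inv M piP pt Rw pw.
 exists (u * w'); split; first exact: (affineM M).
 have R1 : R (1 - w * w') by apply: affineB; [exact: affine1|exact: (affineM M)].
 have -> : e i - u * w' = e i * (1 - w * w') by rewrite -ez; ring.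
 rewrite -(add0r 1); apply: (val_geM vv) => //.
 have [->|n0] := eqVneq (1 - w * w') 0; first by left.
 have [_ [_ pos]] := vR _ R1 n0; right.
 suff : 0 < v (1 - w * w') by lia.
 apply: pos; rewrite (aff_evalB j M) ?(aff_eval1 j M) ?(aff_evalM M pt) ?e1 ?subrr //.
  exact: affine1.
 exact: (affineM M).
have [u Hu] := choice H.
exists (fun i => aff_eval j x y al be (u i)); split.
 by move=> i; have [[a [b ->]] _] := Hu i; exists a, b; rewrite (aff_evalE j M).
move=> c c0; apply: efree.
have -> : \sum_i emb K (c i) * e i =
  \sum_i emb K (c i) * (e i - u i) + \sum_i emb K (c i) * u i.
 by rewrite -big_split /=; apply: eq_bigr => i _; ring.
apply: (val_geD vv).
 apply: (val_ge_sum vv) => i _; rewrite -(add0r 1).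
 by apply: (val_geM vv); [exact: val_geC|case: (Hu i)].
have cC i : R (emb K (c i)) by rewrite -(pevC (emb K) x); exact: affine_ev.
have RS (r : seq 'I_d) : R (\sum_(i <- r) emb K (c i) * u i) /\
  aff_eval j x y al be (\sum_(i <- r) emb K (c i) * u i) =
  \sum_(i <- r) j (c i) * aff_eval j x y al be (u i).
 elim: r => [|i r [IH1 IH2]]; first by rewrite !big_nil (aff_eval0 j M); split=> //; exact: affine0.
 have RM : R (emb K (c i) * u i) by apply: (affineM M) => //; case: (Hu i).
 rewrite !big_cons; split; first exact: affineD.
 rewrite (aff_evalD j M) // (aff_evalM M pt) //; last by case: (Hu i).
 by rewrite IH2 -{1}(pevC (emb K) x) (aff_eval_ev j M) pevC.
have [RSm es] := RS (index_enum 'I_d).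
have [->|s0] := eqVneq (\sum_i emb K (c i) * u i) 0; first by left.
have [_ [_ pos]] := vR _ RSm s0; right.
suff : 0 < v (\sum_i emb K (c i) * u i) by lia.
by apply: pos; rewrite es.
Qed.

Let n := (size pi).-1.

Lemma va_mod a : va al a = \sum_(l < n) j ((a %% pi)`_l) * al ^+ l.
have {1}-> : va al a = va al (a %% pi).
 by rewrite {1}(divp_eq a pi) !pevE (minpoly_root piP) mulr0 add0r.
rewrite /pev (horner_coef_wide (n := n)) => [|]; last first.
 rewrite size_map_poly /n -ltnS prednK; last by case: piP => _ s1 _; apply: ltnW.
 by rewrite ltn_modp (minpoly_neq0 piP).
by apply: eq_bigr => l _; rewrite coef_map.
Qed.

Lemma val_at_degree be v d : oncurve al be -> val_at j x y al be v ->
 free_mod (val_ge v 0) (val_ge v 1) d -> (d <= 2 * n)%N /\ ((exists b, va al b = be) -> (d <= n)%N).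
move=> pt vP vd; have [th [sp fr]] := val_at_free pt vP vd; split.
 pose b (l : 'I_(n + n)) := match fintype.split l with inl l => al ^+ l | inr l => al ^+ l * be end.
 rewrite mul2n -addnn; apply: (free_span_le (b := b) fr) => i.
 have [a1 [a2 ->]] := sp i.
 exists (fun l => match fintype.split l with inl l => (a1 %% pi)`_l | inr l => (a2 %% pi)`_l end).
 rewrite big_split_ord /=; congr (_ + _); rewrite va_mod ?mulr_suml; apply: eq_bigr => l _.
  by rewrite /b (unsplitK (inl _ l)).
 by rewrite /b (unsplitK (inr _ l)) mulrA.
move=> [b0 vb]; apply: (free_span_le (b := fun l => al ^+ (l : 'I_n)) fr) => i.
have [a1 [a2 ->]] := sp i; exists (fun l => ((a1 + a2 * b0) %% pi)`_l).
by rewrite -va_mod !pevE vb.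
Qed.

Lemma val_degree_free (v : K -> int) d : is_valuation v -> val_degree v d ->
 free_mod (val_ge v 0) (val_ge v 1) d.
Proof. by move=> vP; apply: has_dim_free_mod; [left|left|move=> z; exact: val_geN]. Qed.

Lemma sum_two_values r (T : Type) (v : 'I_r -> T) (F : 'I_r -> int) (va vb : T) (c : int) :
 injective v -> 0 <= c -> (forall i, F i <= c) -> (forall i, 0 < F i -> v i = va \/ v i = vb) ->
 \sum_i F i <= c *+ 2.
move=> vi c0 Fc H; rewrite mulr2n.
have one t : \sum_i (if `[< v i = t >] then c else 0) <= c.
 have [[i0 e0]|no] := pselect (exists i, v i = t); last first.
  by rewrite big1 // => i _; case: asboolP => // e; case: no; exists i.
 rewrite (bigD1 i0) //= big1 ?addr0; first by case: ifP.
 by move=> i ni; case: asboolP => // e; case/eqP: ni; apply: vi; rewrite e e0.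
apply: le_trans (lerD (one va) (one vb)); rewrite -big_split /=; apply: ler_sum => i _.
have [F0|/H[]e] := leP (F i) 0.
- by apply: le_trans F0 _; do 2!case: ifP => _; rewrite ?addr0 ?add0r ?addr_ge0.
- by rewrite (asboolT e); apply: le_trans (Fc i) _; rewrite lerDl; case: ifP.
- by rewrite (asboolT e); apply: le_trans (Fc i) _; rewrite lerDr; case: ifP.
Qed.

Lemma sum_one_value r (T : Type) (v : 'I_r -> T) (F : 'I_r -> int) (va : T) (c : int) :
 injective v -> 0 <= c -> (forall i, F i <= c) -> (forall i, 0 < F i -> v i = va) ->
 \sum_i F i <= c.
move=> vi c0 Fc H.
have [[i0 e0]|no] := pselect (exists i, v i = va); last first.
 apply: le_trans c0; apply: sumr_le0 => i _.
 by rewrite leNgt; apply/negP => /H e; apply: no; exists i.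
rewrite (bigD1 i0) //= -[leRHS]addr0; apply: lerD => //.
apply: le_trans (ler_sum _ (G := fun=> 0) _) _; last by rewrite big1.
move=> i ni; rewrite leNgt; apply/negP => /H e; case/eqP: ni; apply: vi.
by rewrite e e0.
Qed.

(** There are three cases: one inert point of degree at most 2 n, two rational points of degree at
    most n, or one ramified point of degree at most n at which pi has value 2. Only the inequality
    is obtained; at infinity equality will follow from a dimension count. *)
Lemma sum_over_irr r (v : 'I_r -> K -> int) (d : 'I_r -> nat) :
 injective v -> (forall i, is_valuation (v i)) -> (forall i, val_ge (v i) 0 x) ->
 (forall i, val_degree (v i) (d i)) -> (exists be, oncurve al be) ->
 \sum_i v i (ev pi) * (d i)%:Z <= n%:Z *+ 2.
move=> vi vP vx vd [be0 pt0].
have pin0 : ev pi != 0 by rewrite (ev_eq0 M) (minpoly_neq0 piP).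
have ge0 i : 0 <= v i (ev pi).
 by have [/eqP|//] := val_ge_pev (vP i) pi (vx i); rewrite (negPf pin0).
have cls i : 0 < v i (ev pi) * (d i)%:Z -> exists be, oncurve al be /\ val_at j x y al be (v i).
 move=> F0; apply: (val_classify_over M piP) => //; last by exists be0.
 by have := ge0 i; rewrite le_eqVlt => /orP[/eqP e|//]; move: F0; rewrite -e mul0r ltxx.
have bnd (c : int) : 0 <= c ->
  (forall i, 0 < v i (ev pi) * (d i)%:Z -> v i (ev pi) * (d i)%:Z <= c) ->
  forall i, v i (ev pi) * (d i)%:Z <= c.
 by move=> c0 H i; case: (leP (v i (ev pi) * (d i)%:Z) 0) => [F0|/H//]; apply: le_trans F0 c0.
have [[b0 vb0]|nb] := pselect (exists b, va al b = be0); last first.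
 have [v0 [v0P _ _ _ _]] := val_at_ex M pt0 piP nons.
 have nbe be : oncurve al be -> ~ (exists b, va al b = be).
  by move=> /(on_curve2 pt0)[->|->] //; apply: inert_conj.
 have same be w : oncurve al be -> val_at j x y al be w -> w = v0.
  move=> pt wP; apply: (val_at_uniq pt0) => //; have [ww wR] := wP; split=> // u Ru u0.
  have [w1 w2] := wR u Ru u0; split=> //; rewrite w2.
  by rewrite (inert_eval0 M piP pt (nbe _ pt) Ru) (inert_eval0 M piP pt0 nb Ru).
 apply: (sum_one_value (va := v0) vi) => //.
 - apply: bnd => // i /cls[be [pt wP]].
  have [_ ->] := val_at_pi pt wP; last by case=> _; apply: nbe.
  by have [dd _] := val_at_degree pt wP (val_degree_free (vP i) (vd i)); rewrite mul1r; lia.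
 - by move=> i /cls[be [pt wP]]; apply: same wP.
have ptc := on_curve_conj pt0.
have [v0 [v0P _ _ _ _]] := val_at_ex M pt0 piP nons.
have [v1 [v1P _ _ _ _]] := val_at_ex M ptc piP nons.
have rat be : oncurve al be -> exists b, va al b = be.
 move=> /(on_curve2 pt0)[->|->]; first by exists b0.
 by exists (- h - b0); rewrite !pevE vb0; ring.
have two i : 0 < v i (ev pi) * (d i)%:Z -> v i = v0 \/ v i = v1.
 move=> /cls[be [pt wP]]; have [e|e] := on_curve2 pt0 pt.
  by left; apply: (val_at_uniq pt0) => //; rewrite -e.
 by right; apply: (val_at_uniq ptc) => //; rewrite -e.
have [r0|nr0] := pselect (va al h + be0 *+ 2 = 0); last first.
 apply: (sum_two_values (va := v0) (vb := v1) vi) => //; apply: bnd => // i /cls[be [pt wP]].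
 have [_ ->] := val_at_pi pt wP.
  by have [_ dd] := val_at_degree pt wP (val_degree_free (vP i) (vd i)); have := dd (rat _ pt); rewrite mul1r; lia.
 case=> r1 _; apply: nr0; have [e|e] := on_curve2 pt0 pt; first by rewrite -e.
 by move: r1; rewrite e => /eqP; rewrite -oppr_eq0 => /eqP r1; rewrite -r1; ring.
have v01 : v1 = v0.
 apply: (val_at_uniq pt0) => //.
 have <- : - va al h - be0 = be0.
  by apply/eqP; rewrite -subr_eq0 -oppr_eq0; apply/eqP; rewrite -r0; ring.
 by [].
apply: (sum_one_value (va := v0) vi) => //.
- apply: bnd => // i /cls[be [pt wP]].
 have rm : ramified j h al be.
  split; last exact: rat.
  have [->//|->] := on_curve2 pt0 pt.
  by apply/eqP; rewrite -oppr_eq0; apply/eqP; rewrite -r0; ring.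
 have [/(_ rm)-> _] := val_at_pi pt wP.
 by have [_ dd] := val_at_degree pt wP (val_degree_free (vP i) (vd i)); have := dd (rat _ pt); lia.
- by move=> i /two[//|->].
Qed.

End DegreeBound.

(** * Local integrality *)

Section IntegralAt.
Variables (k : fieldType) (K : extension k) (L : fieldType) (j : {rmorphism k -> L}) (x y : K) (h f : {poly k}) (M : model x y h f).
Notation ev := (pev (emb K) x).
Notation va al := (pev j al).
Notation R := (affine x y).
Notation oncurve := (on_curve j h f).

Lemma val_at_v0 al pi be v a : is_minpoly j al pi -> val_at j x y al be v ->
 va al a != 0 -> v (ev a) = 0.
move=> piP [vP vR] a0.
have e0 : ev a != 0 by rewrite (ev_eq0 M); apply: contraNneq a0 => ->; rewrite pev0.
have [] := vR _ (affine_ev x y a) e0.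
rewrite (aff_eval_ev j M) le_eqVlt => /orP[/eqP<- //|lt [/(_ lt)/eqP]].
by rewrite (negPf a0).
Qed.

(** If pi divides the denominator, integrality at all points above pi forces pi to divide both
    coefficients of the numerator, and pi cancels. The ramified case is where nonsingularity is
    decisive. *)
Lemma integral_at al pi z : is_minpoly j al pi -> nonsingular h f pi ->
 (exists be, oncurve al be) ->
 (forall be v, oncurve al be -> val_at j x y al be v -> val_ge v 0 z) ->
 exists a b c, va al c != 0 /\ z * ev c = ev a + ev b * y.
move=> piP nons [be0 pt0] H.
have [a [b [c [c0 e]]]] := model_gen M z.
move: c0 e; elim/ltn_ind: {c}(size c) {-2}c (erefl (size c)) a b => s IH c cs a b c0 e.
have [vc0|nc] := eqVneq (va al c) 0; last by exists a, b, c.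
have dv q : va al q = 0 <-> pi %| q by case: piP.
have /dvdpP[c' ce] := (dv c).1 vc0.
have pin0 := minpoly_neq0 piP.
have c'0 : c' != 0 by apply: contraNneq c0 => c0; rewrite ce c0 mul0r.
have key : pi %| a /\ pi %| b.
 have [u0|u0] := eqVneq (ev a + ev b * y) 0.
  by have [-> ->] := model_free M u0; rewrite !dvdp0.
 have evc0 : ev c != 0 by rewrite (ev_eq0 M).
 have z0 : z != 0 by apply: contraNneq u0; rewrite -e => ->; rewrite mul0r.
 have vu be v : oncurve al be -> val_at j x y al be v -> v (ev pi) <= v (ev a + ev b * y).
  move=> pt vat; have [vP vR] := vat; rewrite -e vM // ce pevM vM ?(ev_eq0 M) //.
  have [/eqP|] := H _ _ pt vat; first by rewrite (negPf z0).
  have ec' : ev c' != 0 by rewrite (ev_eq0 M).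
  by have [] := vR _ (affine_ev x y c') ec'; lia.
 have Ru : R (ev a + ev b * y) by do 2!eexists.
 have phi0 be : oncurve al be -> va al a + va al b * be = 0.
  move=> pt; have [v [vat r1 r2 _ _]] := val_at_ex M pt piP nons.
  have [vP vR] := vat; have [_ [pos _]] := vR _ Ru u0.
  rewrite -(aff_evalE j M al be); apply: pos.
  apply: lt_le_trans (vu _ _ pt vat).
  by have [/r1->|/r2->] := pselect (ramified j h al be).
 have [[b0 vb]|nb] := pselect (exists b, va al b = be0); last first.
  have [a' [b' e2]] := (inert_eval0 M piP pt0 nb Ru).1 (etrans (aff_evalE j M _ _ _ _) (phi0 _ pt0)).
  have [-> ->] : a = pi * a' /\ b = pi * b'.
   apply: (affine_uniq M); rewrite e2 !pevE; ring.
  by rewrite !dvdp_mulr.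
 have bz : va al b = 0 -> pi %| a /\ pi %| b.
  move=> bz; split; apply/dv => //.
  by have := phi0 _ pt0; rewrite bz mul0r addr0.
 have ptc := on_curve_conj pt0.
 have [r0|nr] := eqVneq (va al h + be0 *+ 2) 0; last first.
  apply: bz; have : va al b * (va al h + be0 *+ 2) = 0.
   transitivity ((va al a + va al b * be0) - (va al a + va al b * (- va al h - be0))).
    by ring.
   by rewrite (phi0 _ pt0) (phi0 _ ptc) subrr.
  by move/eqP; rewrite mulf_eq0 (negPf nr) orbF => /eqP.
 have rm : ramified j h al be0 by split=> //; exists b0.
 have [v [vat /(_ rm) vpi _ _ _]] := val_at_ex M pt0 piP nons.
 have [vP vR] := vat; apply: bz; apply/eqP; apply: contraT => vb0; exfalso.
 have [c1 [ce1 yc]] := rat_shift M pt0 piP vb.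
 have vc1 : va al c1 != 0.
  apply/eqP => /dv/dvdpP[q qe]; apply: (nons b0).
   by apply/dv; rewrite !pevE vb.
  by rewrite ce1 qe mulrCA -expr2 dvdp_mull.
 have y0 : y - ev b0 != 0.
  apply/eqP => /eqP; rewrite subr_eq0 => /eqP e1.
  have := @affine_uniq _ _ x y h f M 0 1 b0 0.
  by rewrite !pevE mul1r mul0r add0r addr0 => /(_ e1)[_ /eqP]; rewrite oner_eq0.
 have evpi0 : ev pi != 0 by rewrite (ev_eq0 M).
 have vx := val_atx vat.
 have ge2 q : pi %| q -> val_ge v 2 (ev q).
  move=> /dvdpP[q' ->]; rewrite pevM -(add0r 2); apply: (val_geM vP).
   exact: val_ge_pev.
  by right; rewrite vpi.
 (* Otherwise both factors of pi c1 would have value at least 2, whereas pi c1 has value 2. *)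
 have vy : v (y - ev b0) < 2.
  rewrite ltNge; apply/negP => vy2.
  have g1 : val_ge v 2 (y - ev b0 + ev (h + b0 *+ 2)).
   apply: (val_geD vP); first by right.
   by apply: ge2; apply/dv; rewrite !pevE vb.
  have : val_ge v (2 + 2) ((y - ev b0) * (y - ev b0 + ev (h + b0 *+ 2))).
   by apply: (val_geM vP) => //; right.
  have ec1 : ev c1 != 0 by rewrite (ev_eq0 M); apply: contraNneq vc1 => ->; rewrite pev0.
  rewrite yc => -[/eqP|]; first by rewrite mulf_eq0 (negPf evpi0) (negPf ec1).
  by rewrite vM // vpi (val_at_v0 piP vat vc1).
 have : val_ge v 2 (ev b * (y - ev b0)).
  have -> : ev b * (y - ev b0) = (ev a + ev b * y) - ev (a + b * b0) by rewrite !pevE; ring.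
  apply: (val_geB vP); first by right; have := vu _ _ pt0 vat; rewrite vpi.
  by apply: ge2; apply/dv; rewrite !pevE vb phi0.
 have eb0 : ev b != 0 by rewrite (ev_eq0 M); apply: contraNneq vb0 => ->; rewrite pev0.
 case=> [/eqP|]; first by rewrite mulf_eq0 (negPf eb0) (negPf y0).
 by rewrite vM // (val_at_v0 piP vat vb0) add0r leNgt vy.
case: key => /dvdpP[a' ae] /dvdpP[b' be].
apply: (IH (size c') _ c' erefl a' b' c'0).
 rewrite -cs ce size_mul //; case: piP => _ s1 _.
 have : (0 < size c')%N by rewrite size_poly_gt0.
 by move: (size c') (size pi) s1 => ? ?; lia.
have epi0 : ev pi != 0 by rewrite (ev_eq0 M).
apply: (mulIf epi0); rewrite -mulrA -pevM -ce e ae be !pevE; ring.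
Qed.

End IntegralAt.

(** * The chart at infinity *)

Section RevPoly.
Variables (k F : fieldType) (j : {rmorphism k -> F}).
Implicit Types p : {poly k}.

Definition rev_poly (N : nat) (p : {poly k}) : {poly k} := \poly_(i < N.+1) p`_(N - i).

Lemma size_rev_poly N p : (size (rev_poly N p) <= N.+1)%N.
Proof. exact: size_poly. Qed.

Lemma coef_rev_poly N p i : (i <= N)%N -> (rev_poly N p)`_i = p`_(N - i).
Proof. by move=> iN; rewrite coef_poly ltnS iN. Qed.

Lemma rev_polyK N p : (size p <= N.+1)%N -> rev_poly N (rev_poly N p) = p.
move=> sp; apply/polyP => i; have [iN|Ni] := leqP i N.
 by rewrite coef_rev_poly // coef_rev_poly ?leq_subr // subKn.
by rewrite [RHS]nth_default ?(leq_trans sp) // nth_default // (leq_trans (size_rev_poly _ _)).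
Qed.

Lemma pev_rev N p x : (size p <= N.+1)%N -> x != 0 ->
 pev j x^-1 (rev_poly N p) * x ^+ N = pev j x p.
move=> sp x0; rewrite /pev (horner_coef_wide (n := N.+1)); last first.
 by rewrite size_map_poly size_rev_poly.
rewrite (horner_coef_wide (n := N.+1)) ?size_map_poly // (reindex_inj rev_ord_inj) /= mulr_suml.
apply: eq_bigr => i _; rewrite !coef_map subSS coef_rev_poly ?leq_subr // subKn ?leq_ord //.
rewrite -mulrA; congr (_ * _); rewrite -[in x ^+ N](subnK (leq_ord i)) exprD mulrA.
by rewrite exprVn mulVf ?mul1r // expf_neq0.
Qed.

Lemma pev_rev_inv N p x : (size p <= N.+1)%N -> x != 0 ->
 pev j x (rev_poly N p) = pev j x^-1 p * x ^+ N.
by move=> sp x0; rewrite -(pev_rev (size_rev_poly N p) x0) rev_polyK.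
Qed.

End RevPoly.

Lemma minpolyX (k L : fieldType) (j : {rmorphism k -> L}) : is_minpoly j 0 'X.
split; [exact: monicX|by rewrite size_polyX|move=> q].
rewrite /pev -{1}(rmorph0 j) horner_map /=; split.
 by move=> /eqP; rewrite fmorph_eq0 => e; rewrite -[X in X %| _]subr0 -polyC0 dvdp_XsubCl.
by rewrite -[X in X %| _]subr0 -polyC0 dvdp_XsubCl => /eqP ->; rewrite rmorph0.
Qed.

Section Chart.
Variables (k : fieldType) (K : extension k) (x y : K) (h f : {poly k}) (G : nat) (M : model x y h f) (sh : (size h <= G.+1)%N) (sf : (size f <= (2 * G).+1)%N).
Notation ev := (pev (emb K) x).
Notation evV := (pev (emb K) x^-1).

Lemma model_x0 : x != 0.
Proof. by rewrite -(pevX (emb K) x) (ev_eq0 M) polyX_eq0. Qed.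

Lemma model_inv : model x^-1 (y / x ^+ G) (rev_poly G h) (rev_poly (2 * G) f).
have x0 := model_x0; have xn n : x ^+ n != 0 by rewrite expf_neq0.
split.
- apply: (mulIf (xn (2 * G)%N)); rewrite (pev_rev _ sf x0) -(model_eq M) -(pev_rev _ sh x0).
 rewrite mul2n -addnn exprD; move: (xn G); move: (x ^+ G) (evV _) => s H s0.
 by field.
- move=> a b e; pose N := maxn (size a) (size b).
 have sa : (size a <= N.+1)%N by rewrite leqW // leq_maxl.
 have sb : (size b <= N.+1)%N by rewrite leqW // leq_maxr.
 have [] := @model_free _ _ _ _ _ _ M (rev_poly N a * 'X^G) (rev_poly N b).
  rewrite pevM pevXn pevX !(pev_rev_inv _ _ x0) // -(mul0r (x ^+ N * x ^+ G)) -e.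
  move: (xn G); move: (x ^+ G) (x ^+ N) (evV a) (evV b) => s t H H' s0.
  by field.
 move=> /eqP; rewrite mulf_eq0 expf_eq0 polyX_eq0 andbF orbF => /eqP a0 b0.
 have r0 : rev_poly N 0 = 0 :> {poly k} by apply/polyP => i; rewrite coef_poly !coef0 if_same.
 by rewrite -(rev_polyK sa) -(rev_polyK sb) a0 b0 r0.
move=> z; have [a [b [c [c0 e]]]] := model_gen M z.
pose N := maxn (size a) (maxn (size b) (size c)).
have sa : (size a <= N.+1)%N by rewrite leqW // leq_maxl.
have sb : (size b <= N.+1)%N by rewrite leqW // /N maxnCA leq_maxl.
have sc : (size c <= N.+1)%N by rewrite leqW // /N !leq_max leqnn !orbT.
exists (rev_poly N a * 'X^G), (rev_poly N b), (rev_poly N c * 'X^G); split.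
 rewrite mulf_neq0 ?expf_neq0 ?polyX_eq0 //; apply: contraNneq c0 => c0.
 rewrite -(rev_polyK sc) c0; apply/eqP/polyP => i; rewrite coef_poly !coef0.
 by case: ifP.
apply: (mulIf (xn N)); rewrite !pevM !pevXn !pevX.
rewrite -(pev_rev _ sa x0) -(pev_rev _ sb x0) -(pev_rev _ sc x0) in e.
transitivity (z * (evV (rev_poly N c) * x ^+ N) * x^-1 ^+ G); first by ring.
by rewrite e -exprVn; ring.
Qed.

End Chart.

(** Normality of the affine model and, in the chart (1/x, y/x^G), of the fibre at infinity. The
    finite condition ranges over all nonconstant p, not only irreducible ones, which makes a failure
    directly usable for [reduce_pair]. *)
Record smooth (k : fieldType) (G : nat) (h f : {poly k}) : Prop := Smooth {
 smooth_h : (size h <= G.+1)%N;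
 smooth_f : (size f <= (2 * G).+1)%N;
 smooth_fin : forall p : {poly k}, (1 < size p)%N -> nonsingular h f p;
 smooth_inf : nonsingular (rev_poly G h) (rev_poly (2 * G) f) 'X }.

Lemma quad_root (L : closedFieldType) (b c : L) : exists r, r ^+ 2 + b * r = c.
have [r] := @solve_monicpoly L 2 (fun i => if i == 0%N then c else - b) isT.
rewrite !big_ord_recl big_ord0 /= expr0 mulr1 expr1 addr0 => e.
by exists r; rewrite e mulNr subrK.
Qed.

(* Sections of n times the pole divisor of x. *)
Definition Lspace (k : fieldType) (K : extension k) (x : K) (n : nat) : set K :=
 [set z | forall v, is_valuation v ->
   (val_ge v 0 x -> val_ge v 0 z) /\ (v x < 0 -> val_ge v (v x * n%:Z) z)].

(** * Sections with poles along the polar divisor of x *)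

Section Global.
Variables (k : fieldType) (K : extension k) (L : closedFieldType) (j : {rmorphism k -> L}) (jalg : forall z : L, algebraicOver j z) (x y : K) (h f : {poly k}) (G : nat) (M : model x y h f) (S : smooth G h f).
Notation ev := (pev (emb K) x).
Notation R := (affine x y).

Lemma poly_root_minpoly (p : {poly k}) : (1 < size p)%N ->
 exists al pi, is_minpoly j al pi /\ pi %| p.
move=> sp; have [al ral] : exists al, root (map_poly j p) al.
 by apply: closed_rootP; rewrite size_map_poly; case: (size p) sp => [|[]].
have [pi piP] := minpoly_ex (jalg al).
by exists al, pi; split=> //; case: piP => _ _ <-; apply/eqP.
Qed.

(** k[x, y] is integrally closed. A denominator c of z of least degree has no root al: [integral_at]
    would give a denominator not vanishing at al, and the gcd of the two would be smaller than c. *)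
Lemma integral_affine z :
 (forall v, is_valuation v -> val_ge v 0 x -> val_ge v 0 z) -> R z.
move=> H; have [a0 [b0 [c0 [c0n e0]]]] := model_gen M z.
have ex : exists n, `[< exists c, [/\ c != 0, R (z * ev c) & size c = n] >].
 by exists (size c0); apply/asboolP; exists c0; split=> //; exists a0, b0.
have [n /asboolP[c [cn Rc cs]] mn] := ex_minnP ex.
have [s1|s1] := leqP (size c) 1.
 have ce := size1_polyC s1; have c00 : c`_0 != 0 by apply: contraNneq cn => e; rewrite ce e.
 have ec : ev c = emb K c`_0 by rewrite {1}ce pevC.
 have -> : z = z * ev c * ev (c`_0)^-1%:P.
  by rewrite ec pevC -mulrA -rmorphM divff // rmorph1 mulr1.
 by apply: (affineM M) => //; exact: affine_ev.
have [al [pi [piP pic]]] := poly_root_minpoly s1.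
have [_ s1' dv] := piP.
have [a [b [c' [vc' e']]]] : exists a b c', pev j al c' != 0 /\ z * ev c' = ev a + ev b * y.
 apply: (integral_at M piP) => //.
 - exact: smooth_fin S _ s1'.
 - exact: quad_root.
 - by move=> be v pt vat; apply: H; [case: vat|exact: val_atx vat].
have [[u w] /=] := Bezoutp c c'; rewrite /eqp => /andP[d1 d2].
have Rg : R (z * ev (u * c + w * c')).
 rewrite !pevE mulrDr !mulrA ![z * _]mulrC -!mulrA; apply: affineD.
  by apply: (affineM M) => //; exact: affine_ev.
 by apply: (affineM M); [exact: affine_ev|rewrite e'; do 2!eexists].
set g := u * c + w * c' in d1 d2 Rg.
have gc : g %| c by apply: dvdp_trans d1 (dvdp_gcdl _ _).
have gc' : g %| c' by apply: dvdp_trans d1 (dvdp_gcdr _ _).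
have gn : g != 0 by apply: contraNneq cn => g0; move: gc; rewrite g0 dvd0p.
have vg : pev j al g != 0.
 by apply: contraNneq vc' => vg; have /dvdpP[q ->] := gc'; rewrite pevM vg mulr0.
have le : (n <= size g)%N by apply: mn; apply/asboolP; exists g.
have sg : size g = size c.
 by apply/eqP; rewrite eqn_leq (dvdp_leq cn gc) cs.
move: vg; have : c %| g by move/eqP: sg; rewrite (dvdp_size_eqp gc) => /andP[].
move=> /dvdpP[q ->]; rewrite pevM (dv c).2 ?mulr0 ?eqxx //.
Qed.

Let x0 : x != 0 := model_x0 M.
Let MV : model x^-1 (y / x ^+ G) (rev_poly G h) (rev_poly (2 * G) f) :=
 model_inv M (smooth_h S) (smooth_f S).

Lemma val_pos_cases v : is_valuation v -> val_ge v 0 x \/ (v x < 0 /\ val_ge v 0 x^-1).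
move=> vP; have [h0|h0] := leP 0 (v x); first by left; right.
by right; split=> //; right; rewrite vV //; lia.
Qed.

Lemma val_y_inf v : is_valuation v -> v x < 0 -> val_ge v (v x * G%:Z) y.
move=> vP vx; have vxV : val_ge v 0 x^-1 by right; rewrite vV //; lia.
have := val_y MV vP vxV.
have -> : y = y / x ^+ G * x ^+ G by rewrite divfK // expf_neq0.
have -> : v x * G%:Z = 0 + v x *+ G by rewrite add0r -mulr_natr natz.
by rewrite mulfK ?expf_neq0 // => H; apply: (val_geM vP H); right; rewrite vX.
Qed.

Lemma val_pev_inf v (a : {poly k}) n : is_valuation v -> v x < 0 -> (size a <= n.+1)%N ->
 val_ge v (v x * n%:Z) (ev a).
move=> vP vx sa; rewrite /pev (horner_coef_wide (n := n.+1)) ?size_map_poly //.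
apply: (val_ge_sum vP) => i _; rewrite coef_map -(add0r (_ * _)).
apply: (val_geM vP); first exact: val_geC.
right; rewrite vX // -mulr_natr natz; have := leq_ord i.
by move: (v x) vx (nat_of_ord i) => t; nia.
Qed.

Lemma affine_Lspace (a b : {poly k}) n : (size a <= n.+1)%N -> (size b <= n.+1 - G)%N ->
 Lspace x n (ev a + ev b * y).
move=> sa sb v vP; split=> vx.
 by apply: (val_affine M) => //; do 2!eexists.
apply: (val_geD vP); first exact: val_pev_inf.
have [->|b0] := eqVneq b 0; first by left; rewrite pev0 mul0r.
have sb0 : (0 < size b)%N by rewrite size_poly_gt0.
have Gn : (G <= n)%N by move: (size b) sb sb0 => ? ?; lia.
have -> : v x * n%:Z = v x * (n - G)%N%:Z + v x * G%:Z by rewrite -mulrDr -PoszD subnK.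
apply: (val_geM vP); last exact: val_y_inf.
by apply: val_pev_inf => //; rewrite -subSn.
Qed.

(** z lies in k[x, y] by [integral_affine], and the degree bounds express that z / x^n is integral
    above the origin of the chart at infinity. *)
Lemma Lspace_affine n z : Lspace x n z ->
 exists a b, [/\ z = ev a + ev b * y, (size a <= n.+1)%N & (size b <= n.+1 - G)%N].
move=> Lz; have [a [b ez]] : R z by apply: integral_affine => v vP; case: (Lz v vP).
exists a, b.
have [a' [b' [c' [vc' e']]]] : exists a b c, pev j 0 c != 0 /\
  z / x ^+ n * pev (emb K) x^-1 c = pev (emb K) x^-1 a + pev (emb K) x^-1 b * (y / x ^+ G).
 apply: (integral_at MV (minpolyX j)) => //.
 - exact: smooth_inf S.
 - exact: quad_root.
 move=> be v pt vat; have [vP vR] := vat.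
 have xV0 : x^-1 != 0 by rewrite invr_eq0.
 have vx : v x < 0.
  have RV := affine_ev x^-1 (y / x ^+ G) 'X; rewrite pevX in RV.
  have [_ [_ pos]] := vR _ RV xV0.
  have : 0 < v x^-1.
   apply: pos; have := aff_eval_ev j MV 0 be 'X.
   by rewrite !pevX.
  by rewrite vV //; lia.
 have [_ /(_ vx) H] := Lz v vP.
 have -> : 0 = v x * n%:Z + - (v x * n%:Z) by rewrite subrr.
 apply: (val_geM vP H); right; rewrite vV // vX // -mulr_natr natz.
 exact: lexx.
pose N := maxn (size a') (maxn (size b') (size c')).
have sa : (size a' <= N.+1)%N by rewrite leqW // leq_maxl.
have sb : (size b' <= N.+1)%N by rewrite leqW // /N maxnCA leq_maxl.
have sc : (size c' <= N.+1)%N by rewrite leqW // /N !leq_max leqnn !orbT.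
have xn m : x ^+ m != 0 by rewrite expf_neq0.
(* The denominator c' is nonzero at the origin of the chart, so its reverse has degree exactly N and
   degrees can be compared. *)
have cN : (rev_poly N c')`_N != 0.
 rewrite coef_rev_poly // subnn; apply: contraNneq vc' => c0.
 by rewrite /pev -(rmorph0 j) horner_map horner_coef0 c0 rmorph0.
have sC : size (rev_poly N c') = N.+1.
 by apply/eqP; rewrite eqn_leq size_rev_poly ltnNge; apply: contraNN cN => le; rewrite nth_default.
have e2 : ev (a * rev_poly N c' * 'X^G) + ev (b * rev_poly N c' * 'X^G) * y =
     ev (rev_poly N a' * 'X^(n + G)) + ev (rev_poly N b' * 'X^n) * y.
 rewrite !pevM !pevXn !pevX !(pev_rev_inv _ _ x0) //.
 transitivity (z / x ^+ n * pev (emb K) x^-1 c' * (x ^+ n * x ^+ N * x ^+ G)).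
  rewrite ez; have := xn n; move: (x ^+ n) => t t0; by field.
 rewrite e' exprD; have := xn G; move: (x ^+ G) => s s0; by field.
have C0 : rev_poly N c' != 0 by rewrite -size_poly_gt0 sC.
have XG m : 'X^m != 0 :> {poly k} by rewrite expf_neq0 ?polyX_eq0.
have [ea eb] := affine_uniq M e2; split=> //.
 have [->|a0] := eqVneq a 0; first by rewrite size_poly0.
 have {}ea : a * rev_poly N c' = rev_poly N a' * 'X^n.
  by apply: (mulIf (XG G)); rewrite ea exprD mulrA.
 have := congr1 (fun p : {poly k} => size p) ea; rewrite size_mul // sC addnS /=.
 have [->|A0] := eqVneq (rev_poly N a') 0.
  by rewrite mul0r size_poly0 => /eqP; rewrite addn_eq0 size_poly_eq0 (negPf a0).
 rewrite size_mul // size_polyXn addnS /=; have := size_rev_poly N a'.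
 move: (size a) (size (rev_poly N a')) => ? ?; lia.
have [->|b0] := eqVneq b 0; first by rewrite size_poly0.
have sb0 : (0 < size b)%N by rewrite size_poly_gt0.
have := congr1 (fun p : {poly k} => size p) eb.
rewrite size_mul ?(mulf_neq0 b0) // size_mul // sC size_polyXn.
have [->|B0] := eqVneq (rev_poly N b') 0.
 rewrite mul0r size_poly0; move: (size b) sb0 => ?; lia.
rewrite size_mul // size_polyXn; have := size_rev_poly N b'.
move: (size b) sb0 (size (rev_poly N b')) => ? ? ?; lia.
Qed.

Lemma sum_over_poly r (v : 'I_r -> K -> int) (d : 'I_r -> nat) (p : {poly k}) : p != 0 ->
 injective v -> (forall i, is_valuation (v i)) -> (forall i, val_ge (v i) 0 x) ->
 (forall i, val_degree (v i) (d i)) ->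
 \sum_i v i (ev p) * (d i)%:Z <= (size p).-1%:Z *+ 2.
move=> + vi vP vx vd; elim/ltn_ind: {p}(size p) {-2}p (erefl (size p)) => s IH p sp p0.
have [s1|s1] := leqP (size p) 1.
 rewrite big1 ?mulrn_wge0 // => i _.
 by rewrite (size1_polyC s1) pevC vC // mul0r.
have [al [pi [piP /dvdpP[q pe]]]] := poly_root_minpoly s1.
have q0 : q != 0 by apply: contraNneq p0 => q0; rewrite pe q0 mul0r.
have pin0 := minpoly_neq0 piP.
have [_ s1' _] := piP.
have sq0 : (0 < size q)%N by rewrite size_poly_gt0.
have sz : ((size p).-1 = (size q).-1 + (size pi).-1)%N.
 rewrite pe size_mul //; move: (size q) (size pi) sq0 s1' => ? ?; lia.
rewrite sz PoszD mulrnDl.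
have lt : (size q < s)%N.
 by rewrite -sp pe size_mul //; move: (size q) (size pi) sq0 s1' => ? ?; lia.
apply: le_trans (lerD (IH _ lt q erefl q0) (sum_over_irr M piP (smooth_fin S s1') vi vP vx vd _)).
 rewrite -big_split /=; apply: ler_sum => i _.
 by rewrite pe pevM vM ?(ev_eq0 M) // mulrDl.
exact: quad_root.
Qed.

Lemma sum_over_inf r (v : 'I_r -> K -> int) (d : 'I_r -> nat) :
 injective v -> (forall i, is_valuation (v i)) -> (forall i, v i x < 0) ->
 (forall i, val_degree (v i) (d i)) ->
 \sum_i v i x * (d i)%:Z >= - 2.
move=> vi vP vx vd.
have vxV i : val_ge (v i) 0 x^-1 by right; rewrite vV //; have := vx i; lia.
have := sum_over_irr MV (minpolyX j) (smooth_inf S) vi vP vxV vd (quad_root _ _).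
rewrite pevX size_polyX /= => H.
rewrite -(opprK (\sum_i _)) lerN2 -sumrN; apply: le_trans H; apply: ler_sum => i _.
by rewrite vV // mulNr.
Qed.

End Global.

Definition kspace (k : fieldType) (K : extension k) (V : set K) : Prop :=
 [/\ V 0, forall u w, V u -> V w -> V (u + w) & forall c w, V w -> V (emb K c * w)].

(** * Linear algebra over the constants *)

Section Independence.
Variables (k : fieldType) (K : extension k).
Implicit Types V W : set K.

Lemma constants_choice d (c : 'I_d -> K) : (forall l, constants (c l)) ->
 exists A : 'I_d -> k, forall l, emb K (A l) = c l.
move=> cC; have ex l : exists a, emb K a = c l by case: (cC l) => a _ ea; exists a.
by have [A HA] := choice ex; exists A.
Qed.

Lemma kspace_sum V (I : Type) (r : seq I) (P : pred I) (F : I -> K) : kspace V ->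
 (forall i, P i -> V (F i)) -> V (\sum_(i <- r | P i) F i).
Proof. by case=> V0 VD _ H; apply: big_ind. Qed.

Lemma kspaceN V w : kspace V -> V w -> V (- w).
Proof. by case=> _ _ VZ Vw; rewrite -mulN1r -(rmorph1 (emb K)) -rmorphN; apply: VZ. Qed.

Lemma kspaceI V W : kspace V -> kspace W -> kspace (V `&` W).
case=> V0 VD VZ [W0 WD WZ]; split=> // [u w [? ?] [? ?]|c w [? ?]]; split; auto.
Qed.

Lemma kspace_val v m : is_valuation v -> kspace (K := K) (val_ge v m).
move=> vP; split; [by left|by move=> *; apply: val_geD|move=> c w h].
by rewrite -(add0r m); apply: (val_geM vP) => //; exact: val_geC.
Qed.

Lemma free_mod_sub V V' W s s' : (s' <= s)%N -> (forall z, V z -> V' z) ->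
 free_mod V W s -> free_mod V' W s'.
move=> le sub [e [Ve fr]]; exists (fun i => e (widen_ord le i)); split=> [i|c Wc i].
 exact: sub.
pose c' (i : 'I_s) := oapp c 0 (insub (val i) : option 'I_s').
have c'w i' : c' (widen_ord le i') = c i' by rewrite /c' /= valK.
rewrite -c'w; apply: fr; congr W: Wc.
rewrite [RHS](bigID (fun i : 'I_s => (i < s')%N)) /= [X in _ + X]big1 ?addr0 => [|i' ni]; last first.
 by rewrite /c' insubF ?rmorph0 ?mul0r // (negPf ni).
rewrite (big_ord_narrow le) /=; apply: eq_bigr => i' _; by rewrite -c'w.
Qed.

Lemma free_mod_map V V' (g : K) s : g != 0 -> (forall z, V z -> V' (g * z)) ->
 free_mod V [set 0] s -> free_mod V' [set 0] s.
move=> g0 H [e [Ve fr]]; exists (fun i => g * e i); split=> [i|c Wc]; first exact: H.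
apply: fr; apply: (mulfI g0); rewrite mulr0 mulr_sumr -[RHS]Wc.
by apply: eq_bigr => i _; rewrite mulrCA.
Qed.

(** The left kernel of A has rank at least s - d, and its basis yields combinations of the e i that
    lie in V'. *)
Lemma free_mod_ker V s d (e : 'I_s -> K) (A : 'M[k]_(s, d)) (V' : set K) : kspace V ->
 (forall i, V (e i)) -> (forall c : 'I_s -> k, \sum_i emb K (c i) * e i = 0 -> forall i, c i = 0) ->
 (forall c : 'rV[k]_s, c *m A = 0 -> V' (\sum_i emb K (c 0 i) * e i)) ->
 free_mod (V `&` V') [set 0] (s - d).
move=> kV Ve fr H; pose B := row_base (kermx A).
have rk : (s - d <= \rank (kermx A))%N by rewrite mxrank_ker leq_sub2l // rank_leq_col.
apply: (free_mod_sub rk (fun z Vz => Vz)).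
exists (fun i => \sum_l emb K (B i l) * e l); split=> [i|c].
 split; first by apply: (kspace_sum _ kV) => l _; case: kV => _ _; apply.
 have -> : \sum_l emb K (B i l) * e l = \sum_l emb K (row i B 0 l) * e l.
  by apply: eq_bigr => l _; congr (emb K _ * _); rewrite [RHS]mxE.
 apply: H; apply/sub_kermxP.
 by rewrite (submx_trans (row_sub i B)) ?eq_row_base.
pose cc : 'rV_(\rank (kermx A)) := \row_i c i.
move=> Wc i; suff : cc = 0 by move/rowP/(_ i); rewrite !mxE.
have : cc *m B = 0.
 apply/rowP => l; rewrite !mxE; apply: (fr (fun l => \sum_i0 cc 0 i0 * B i0 l)).
 rewrite -[RHS]Wc; under eq_bigr => l' _ do rewrite rmorph_sum mulr_suml /=.
 rewrite exchange_big; apply: eq_bigr => i' _; rewrite mulr_sumr.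
 by apply: eq_bigr => l' _; rewrite rmorphM mxE mulrA.
by move=> e0; apply: (row_free_inj (row_base_free (kermx A))); rewrite mul0mx.
Qed.

Lemma has_dim_free_le V d s : kspace V -> has_dim (@constants k K) V [set 0] d ->
 free_mod V [set 0] s -> (s <= d)%N.
move=> kV [b [Vb H]] [e [Ve fr]].
have ex i : exists A : 'I_d -> k, e i = \sum_l emb K (A l) * b l.
 have [c [[cC /eqP]]] := H _ (Ve i); rewrite subr_eq0 => /eqP ei _.
 have [A HA] := constants_choice cC.
 by exists A; rewrite ei; apply: eq_bigr => l _; rewrite HA.
have [A HA] := choice ex.
have [] := @free_mod_ker V s d e (\matrix_(i, l) A i l) [set 0] kV Ve fr.
 move=> c cA; rewrite /=; under eq_bigr do rewrite HA mulr_sumr.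
 rewrite exchange_big big1 //= => l _.
 have := congr1 (fun m : 'rV_d => emb K (m 0 l)) cA; rewrite !mxE rmorph0 rmorph_sum /= => E.
 transitivity ((\sum_i emb K (c 0 i * (\matrix_(i, l) A i l) i l)) * b l); last by rewrite E mul0r.
 by rewrite mulr_suml; apply: eq_bigr => i _; rewrite rmorphM mxE mulrA.
move=> g [Vg frg]; rewrite leqNgt; apply/negP => lt.
have i0 : 'I_(s - d) by exists 0%N; rewrite subn_gt0.
have := frg (fun=> 1); rewrite big1 => [/(_ erefl i0)/eqP|i _]; first by rewrite oner_eq0.
by have [_ /= ->] := Vg i; rewrite mulr0.
Qed.

Lemma has_dim_ex V W N : kspace V -> kspace W -> (forall s, free_mod V W s -> (s <= N)%N) ->
 exists d, has_dim (@constants k K) V W d.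
move=> kV kW bnd; have [V0 VD VZ] := kV; have [W0 WD WZ] := kW.
have ex : exists s, `[< free_mod V W s >].
 exists 0%N; apply/asboolP; exists (fun i : 'I_0 => 0); split=> [[]//|c _ []//].
have ub s : `[< free_mod V W s >] -> (s <= N)%N by move/asboolP/bnd.
have [s /asboolP[e [Ve fr]] mx] := ex_maxnP ex ub.
exists s, e; split=> // z Vz.
have [c Wc] : exists c : 'I_s -> k, W (z - \sum_i emb K (c i) * e i).
 apply: contrapT => nc.
 have : (s.+1 <= s)%N; last by rewrite ltnn.
 apply: mx; apply/asboolP.
 exists (fun i : 'I_s.+1 => oapp e z (unlift ord0 i)); split=> [i|c].
  by case: unliftP => [l _|_] /=.
 rewrite big_ord_recl unlift_none /= => Wc.
 have Wc' : W (emb K (c ord0) * z + \sum_i emb K (c (lift ord0 i)) * e i).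
  by congr W: Wc; congr (_ + _); apply: eq_bigr => i _; rewrite liftK.
 have c0 : c ord0 = 0.
  apply/eqP; apply: contrapT => /negP c0; apply: nc.
  exists (fun i => - (c ord0)^-1 * c (lift ord0 i)).
  have := WZ (c ord0)^-1 _ Wc'; rewrite mulrDr mulrA -rmorphM mulVf // rmorph1 mul1r => h.
  congr W: h; rewrite mulr_sumr -sumrN; congr (_ + _); apply: eq_bigr => i _.
  by rewrite mulrA -rmorphM mulNr rmorphN mulNr opprK.
 move=> i; case: (unliftP ord0 i) => [l ->|->] //.
 by apply: (fr (fun l => c (lift ord0 l))); move: Wc'; rewrite c0 rmorph0 mul0r add0r.
exists [ffun i => emb K (c i)]; split.
 split=> [i|]; first by rewrite ffunE; exists (c i).
 by congr W: Wc; congr (_ - _); apply: eq_bigr => i _; rewrite ffunE.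
move=> c' [c'C Wc']; apply/ffunP => i; rewrite ffunE.
have [A HA] := constants_choice c'C.
suff -> : c i = A i by [].
apply/eqP; rewrite -subr_eq0; apply/eqP; apply: (fr (fun i => c i - A i)).
have := WD _ _ Wc' (kspaceN kW Wc); congr W.
transitivity (\sum_i emb K (c i) * e i - \sum_i c' i * e i); first by ring.
by rewrite -sumrB; apply: eq_bigr => l _; rewrite rmorphB HA mulrBl.
Qed.

(* Raising the order of vanishing at v by one costs at most deg v dimensions. *)
Lemma free_mod_step V v m d s : kspace V -> is_valuation v -> val_degree v d ->
 free_mod (V `&` val_ge v m) [set 0] s ->
 free_mod (V `&` val_ge v (m + 1)) [set 0] (s - d).
move=> kV vP [b [Ob H]] [e [Ve fr]].
have [t vt] : exists t, v t = 1 by case: vP.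
have t0 : t != 0 by apply/eqP => t0; move: vt; rewrite t0 v0.
have sc z n m' : val_ge v m' z -> val_ge v (m' + n) (z * t ^ n).
 by move=> h; apply: (val_geM vP h); right; rewrite vXz // vt mul1r.
have ex i : exists A : 'I_d -> k, val_ge v 1 (e i * t ^ (- m) - \sum_l emb K (A l) * b l).
 have [_ vi] := Ve i; have := sc _ (- m) _ vi; rewrite subrr => hi.
 have [c [[cC Wc] _]] := H _ hi.
 have [A HA] := constants_choice cC.
 by exists A; congr (val_ge v 1): Wc; congr (_ - _); apply: eq_bigr => l _; rewrite HA.
have [A HA] := choice ex.
have kV' : kspace (V `&` val_ge v m) by apply: kspaceI => //; exact: kspace_val.
have := @free_mod_ker _ s d e (\matrix_(i, l) A i l) (val_ge v (m + 1)) kV' Ve fr.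
case=> [c cA|g [Vg frg]]; last first.
 by exists g; split=> // i; have [[]] := Vg i.
have -> : \sum_i emb K (c 0 i) * e i = (\sum_i emb K (c 0 i) * e i) * t ^ (- m) * t ^ m.
 by rewrite -mulrA -expfzDr // addNr expr0z mulr1.
rewrite addrC; apply: sc; rewrite mulr_suml.
have -> : \sum_i emb K (c 0 i) * e i * t ^ (- m) =
  \sum_i emb K (c 0 i) * (e i * t ^ (- m) - \sum_l emb K (A i l) * b l).
 have Z : \sum_i emb K (c 0 i) * (\sum_l emb K (A i l) * b l) = 0.
  under eq_bigr do rewrite mulr_sumr.
  rewrite exchange_big big1 //= => l _.
  have := congr1 (fun m : 'rV_d => emb K (m 0 l)) cA; rewrite !mxE rmorph0 rmorph_sum /= => E.
  transitivity ((\sum_i emb K (c 0 i * (\matrix_(i, l) A i l) i l)) * b l); last by rewrite E mul0r.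
  by rewrite mulr_suml; apply: eq_bigr => i _; rewrite rmorphM mxE mulrA.
 transitivity (\sum_i emb K (c 0 i) * e i * t ^ (- m) -
   \sum_i emb K (c 0 i) * (\sum_l emb K (A i l) * b l)); first by rewrite Z subr0.
 by rewrite -sumrB; apply: eq_bigr => i _; rewrite mulrBr mulrA.
apply: (val_ge_sum vP) => i _; rewrite -(add0r 1).
by apply: (val_geM vP); [exact: val_geC|exact: HA].
Qed.

Lemma free_mod_steps V v m (n : nat) d s : kspace V -> is_valuation v -> val_degree v d ->
 free_mod (V `&` val_ge v m) [set 0] s ->
 free_mod (V `&` val_ge v (m + n%:Z)) [set 0] (s - n * d).
move=> kV vP vd H; elim: n => [|n IH]; first by rewrite addr0 subn0.
rewrite mulSn addnC subnDA -addn1 PoszD addrA.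
exact: free_mod_step.
Qed.

Lemma free_mod_multi V (vs : seq (K -> int)) (m : (K -> int) -> int) (n D : (K -> int) -> nat) s :
 kspace V -> (forall v, v \in vs -> [/\ is_valuation v, val_degree v (D v) &
   forall z, V z -> val_ge v (m v) z]) ->
 free_mod V [set 0] s ->
 free_mod (V `&` [set z | forall v, v \in vs -> val_ge v (m v + (n v)%:Z) z]) [set 0]
  (s - \sum_(v <- vs) n v * D v).
move=> kV; elim: vs => [|v vs IH] Hvs H.
 by rewrite big_nil subn0; apply: free_mod_sub H => // z Vz; split.
have [vP vD vm] := Hvs v (mem_head _ _).
rewrite big_cons addnC subnDA.
set V' := V `&` [set z | forall v, v \in vs -> val_ge v (m v + (n v)%:Z) z] in IH.
have kV' : kspace V'.
 have [V0 VD VZ] := kV; split.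
 - by split=> // w _; left.
 - move=> u w [Vu Hu] [Vw Hw]; split; first exact: VD.
  move=> v' v's; have [v'P _ _] : [/\ is_valuation v', val_degree v' (D v') & _] := Hvs v' (mem_behead (s := v :: vs) v's).
  by apply: val_geD => //; [exact: Hu|exact: Hw].
 move=> c w [Vw Hw]; split; first exact: VZ.
 move=> v' v's; have [v'P _ _] : [/\ is_valuation v', val_degree v' (D v') & _] := Hvs v' (mem_behead (s := v :: vs) v's).
 by rewrite -(add0r (m v' + _)); apply: (val_geM v'P); [exact: val_geC|exact: Hw].
have H1 : free_mod V' [set 0] (s - \sum_(v <- vs) n v * D v).
 by apply: IH => // v' v's; apply: Hvs; rewrite inE v's orbT.
have := @free_mod_steps V' v (m v) (n v) (D v) _ kV' vP vD.
move=> /(_ (s - \sum_(v <- vs) n v * D v)%N) [|g [Vg frg]].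
 by apply: free_mod_sub H1 => // z V'z; split=> //; apply: vm; case: V'z.
exists g; split=> // i; have [[V1 V2] V3] := Vg i; split=> // v'.
by rewrite inE => /orP[/eqP->|/V2].
Qed.

End Independence.

Lemma bounded_enum (T : Type) (P : T -> Prop) N :
 (forall r (v : 'I_r -> T), injective v -> (forall i, P (v i)) -> (r <= N)%N) ->
 exists r (v : 'I_r -> T), [/\ injective v, forall i, P (v i) & forall t, P t -> exists i, v i = t].
move=> bnd; have ex : exists r, `[< exists v : 'I_r -> T, injective v /\ forall i, P (v i) >].
 by exists 0%N; apply/asboolP; exists (fun i : 'I_0 => let: Ordinal _ p := i in False_rect T (notF p)); split=> -[].
have ub r : `[< exists v : 'I_r -> T, injective v /\ forall i, P (v i) >] -> (r <= N)%N.
 by move=> /asboolP[v [vi vP]]; apply: bnd vi vP.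
have [r /asboolP[v [vi vP]] mx] := ex_maxnP ex ub.
exists r, v; split=> // t Pt; apply: contrapT => nt.
have : (r.+1 <= r)%N; last by rewrite ltnn.
apply: mx; apply/asboolP; exists (fun i => oapp v t (unlift ord0 i)); split.
 move=> i i'; case: unliftP => [l ->|->]; case: unliftP => [l' ->|->] //=.
 - by move/vi->.
 - by move=> e; case: nt; exists l.
 - by move=> e; case: nt; exists l'.
by move=> i; case: unliftP => [l _|_] /=.
Qed.

(** At a pole of t the leading term has strictly the smallest value. *)
Lemma val_ev_inf (k : fieldType) (K : extension k) (v : K -> int) (p : {poly k}) t : is_valuation v -> v t < 0 -> p != 0 ->
 v (pev (emb K) t p) = v t * (size p).-1%:Z /\ pev (emb K) t p != 0.
move=> vP vt p0; have t0 : t != 0 by apply/eqP => t0; move: vt; rewrite t0 v0.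
have sp : (0 < size p)%N by rewrite size_poly_gt0.
have [n sn] : exists n, size p = n.+1 by exists (size p).-1; rewrite prednK.
have lc : p`_n != 0 by have := lead_coef_eq0 p; rewrite lead_coefE sn /= => ->.
have e : pev (emb K) t p = emb K p`_n * t ^+ n + \sum_(i < n) emb K p`_i * t ^+ i.
 rewrite /pev (horner_coef_wide (n := n.+1)) ?size_map_poly ?sn // big_ord_recr addrC /= coef_map.
 by congr (_ + _); apply: eq_bigr => i _; rewrite coef_map.
have vl : v (emb K p`_n * t ^+ n) = v t * n%:Z.
 by rewrite vM ?fmorph_eq0 ?expf_neq0 // vC // vX // add0r -mulr_natr natz.
rewrite sn e -vl; apply: v_add_lt => //; first by rewrite mulf_neq0 ?fmorph_eq0 ?expf_neq0.
have : val_ge v (v t * n%:Z + 1) (\sum_(i < n) emb K p`_i * t ^+ i).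
 apply: (val_ge_sum vP) => i _; rewrite -(add0r (_ + 1)); apply: (val_geM vP); first exact: val_geC.
 right; rewrite vX // -mulr_natr natz; have := ltn_ord i.
 by move: (v t) vt (nat_of_ord i) => a; nia.
by case=> [->|]; [left|right; rewrite vl; lia].
Qed.

(** * Degrees of places and dimensions of the section spaces *)

Section Genus.
Variables (k : fieldType) (K : extension k) (L : closedFieldType) (j : {rmorphism k -> L}) (jalg : forall z : L, algebraicOver j z) (x y : K) (h f : {poly k}) (G : nat) (M : model x y h f) (S : smooth G h f).
Notation ev := (pev (emb K) x).

Let x0 : x != 0 := model_x0 M.
Let MV : model x^-1 (y / x ^+ G) (rev_poly G h) (rev_poly (2 * G) f) :=
 model_inv M (smooth_h S) (smooth_f S).

Lemma val_pos_poly (v : K -> int) : is_valuation v -> val_ge v 0 x -> exists n, n != 0 /\ 0 < v (ev n).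
move=> vP vx.
have [u [Ru u0 vu]] : exists u, [/\ affine x y u, u != 0 & 0 < v u].
 have [z vz] : exists z, v z = 1 by case: vP.
 have [u [w [Ru Rw w0 zw]]] := affine_gen M z.
 have z0 : z != 0 by apply/eqP => z0; move: vz; rewrite z0 v0.
 exists u; rewrite -zw mulf_neq0 //; split=> //; first by rewrite zw.
 rewrite vM // vz; have [/eqP|] := val_affine M vP vx Rw; first by rewrite (negPf w0).
 lia.
have [n [w [n0 Rw e]]] := affine_norm M Ru u0.
exists n; split=> //.
have en0 : ev n != 0 by rewrite (ev_eq0 M).
have w0 : w != 0 by apply: contraNneq en0 => w0; rewrite -e w0 mulr0.
rewrite -e vM //; have [/eqP|] := val_affine M vP vx Rw; first by rewrite (negPf w0).
 lia.
Qed.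

Lemma residue_bound (v : K -> int) : is_valuation v -> exists N, forall s,
 free_mod (val_ge v 0) (val_ge v 1) s -> (s <= N)%N.
move=> vP; have [vx|[vx vxV]] := val_pos_cases M vP; last first.
 have pos : 0 < v (pev (emb K) x^-1 'X) by rewrite pevX vV //; lia.
 have [be [pt vat]] := val_classify_over MV (minpolyX j) vP vxV pos (quad_root _ _).
 exists (2 * (size ('X : {poly k})).-1)%N => s fs.
 by have [] := val_at_degree MV (minpolyX j) (smooth_inf S) pt vat fs.
have [n [n0 vn]] := val_pos_poly vP vx.
have [al [pi [piP vpi]]] : exists al pi, is_minpoly j al pi /\ 0 < v (ev pi).
 elim/ltn_ind: {n}(size n) {-2}n (erefl (size n)) n0 vn => s IH n sn n0 vn.
 have s1 : (1 < size n)%N.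
  rewrite ltnNge; apply/negP => s1; move: vn.
  by rewrite (size1_polyC s1) pevC vC // ltxx.
 have [al [pi [piP /dvdpP[q qe]]]] := poly_root_minpoly jalg s1.
 have q0 : q != 0 by apply: contraNneq n0 => q0; rewrite qe q0 mul0r.
 have pin0 := minpoly_neq0 piP.
 have [vpi|vpi] := ltP 0 (v (ev pi)); first by exists al, pi.
 apply: (IH (size q) _ q erefl q0).
  rewrite -sn qe size_mul //; case: piP => _ s1' _.
  have : (0 < size q)%N by rewrite size_poly_gt0.
  by move: (size q) (size pi) s1' => ? ?; lia.
 by move: vn; rewrite qe pevM vM ?(ev_eq0 M) //; lia.
have [be [pt vat]] := val_classify_over M piP vP vx vpi (quad_root _ _).
exists (2 * (size pi).-1)%N => s fs.
by have [] := val_at_degree M piP (smooth_fin S (let: And3 _ s _ := piP in s)) pt vat fs.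
Qed.

Lemma val_degree_ex (v : K -> int) : is_valuation v -> exists d, val_degree v d.
move=> vP; have [N HN] := residue_bound vP.
by apply: (has_dim_ex (N := N)) => //; exact: kspace_val.
Qed.

Lemma val_degree_gt0 (v : K -> int) d : is_valuation v -> val_degree v d -> (0 < d)%N.
move=> vP [e [_ H]]; case: d e H => // e H.
have [|c [[_ Hc] _]] := H 1; first by right; rewrite v1.
by move: Hc; rewrite big_ord0 subr0 => -[/eqP|]; rewrite ?oner_eq0 // v1.
Qed.

Lemma val_degree_uniq (v : K -> int) d d' : is_valuation v -> val_degree v d -> val_degree v d' -> d = d'.
suff le d1 d2 : is_valuation v -> val_degree v d1 -> val_degree v d2 -> (d1 <= d2)%N.
 by move=> vP h1 h2; apply/eqP; rewrite eqn_leq !le.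
move=> vP /(val_degree_free vP) [e [Oe fr]] [b [Ob H]].
have ex i : exists A : 'I_d2 -> k, val_ge v 1 (e i - \sum_l emb K (A l) * b l).
 have [c [[cC Wc] _]] := H _ (Oe i); have [A HA] := constants_choice cC.
 by exists A; congr (val_ge v 1): Wc; congr (_ - _); apply: eq_bigr => l _; rewrite HA.
have [A HA] := choice ex.
pose B := (\matrix_(i < d1, l < d2) A i l).
suff /eqP <- : row_free B by apply: rank_leq_col.
apply: inj_row_free => c cB; apply/rowP => i; rewrite mxE.
apply: (fr (fun i => c 0 i)).
have -> : \sum_i emb K (c 0 i) * e i =
  \sum_i emb K (c 0 i) * (e i - \sum_l emb K (A i l) * b l).
 have Z : \sum_i emb K (c 0 i) * (\sum_l emb K (A i l) * b l) = 0.
  under eq_bigr do rewrite mulr_sumr.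
  rewrite exchange_big big1 //= => l _.
  have := congr1 (fun m : 'rV_d2 => emb K (m 0 l)) cB; rewrite !mxE rmorph0 rmorph_sum /= => E.
  transitivity ((\sum_i emb K (c 0 i * B i l)) * b l); last by rewrite E mul0r.
  by rewrite mulr_suml; apply: eq_bigr => i' _; rewrite rmorphM mxE mulrA.
 transitivity (\sum_i emb K (c 0 i) * e i -
   \sum_i emb K (c 0 i) * (\sum_l emb K (A i l) * b l)); first by rewrite Z subr0.
 by rewrite -sumrB; apply: eq_bigr => i' _; rewrite mulrBr.
apply: (val_ge_sum vP) => i' _; rewrite -(add0r 1).
by apply: (val_geM vP); [exact: val_geC|exact: HA].
Qed.

Definition vdeg (v : K -> int) : nat := xget 0%N [set d | val_degree v d].

Lemma vdegP v : is_valuation v -> val_degree v (vdeg v).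
Proof. by move=> /val_degree_ex [d hd]; apply: (xgetPex 0%N); exists d. Qed.

Lemma vdegE v d : is_valuation v -> val_degree v d -> vdeg v = d.
Proof. by move=> vP hd; apply: (val_degree_uniq vP) hd; apply: vdegP. Qed.

Lemma sum_seq_poly (vs : seq (K -> int)) (p : {poly k}) : p != 0 -> uniq vs ->
 (forall v, v \in vs -> is_valuation v /\ val_ge v 0 x) ->
 \sum_(v <- vs) v (ev p) * (vdeg v)%:Z <= (size p).-1%:Z *+ 2.
move=> p0 us H; rewrite (big_tnth _ _ vs).
have Hi (i : 'I_(size vs)) : tnth (in_tuple vs) i \in vs by apply: mem_tnth.
apply: (sum_over_poly jalg M S p0 (d := fun i => vdeg (tnth (in_tuple vs) i))).
- by apply/tuple_uniqP.
- by move=> i; case: (H _ (Hi i)).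
- by move=> i; case: (H _ (Hi i)).
- by move=> i; apply: vdegP; case: (H _ (Hi i)).
Qed.

Lemma sum_seq_inf (vs : seq (K -> int)) : uniq vs ->
 (forall v, v \in vs -> is_valuation v /\ v x < 0) ->
 - 2 <= \sum_(v <- vs) v x * (vdeg v)%:Z.
move=> us H; rewrite (big_tnth _ _ vs).
have Hi (i : 'I_(size vs)) : tnth (in_tuple vs) i \in vs by apply: mem_tnth.
apply: (@sum_over_inf _ _ _ j _ _ _ _ _ M S _ _ (fun i => vdeg (tnth (in_tuple vs) i))).
- by apply/tuple_uniqP.
- by move=> i; case: (H _ (Hi i)).
- by move=> i; case: (H _ (Hi i)).
- by move=> i; apply: vdegP; case: (H _ (Hi i)).
Qed.

Lemma enum_seq (P : (K -> int) -> Prop) N :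
 (forall vs : seq (K -> int), uniq vs -> (forall v, v \in vs -> P v) -> (size vs <= N)%N) ->
 exists vs, [/\ uniq vs, forall v, v \in vs -> P v & forall v, P v -> v \in vs].
move=> H; have [|r [v [vi vP vsur]]] := @bounded_enum _ P N.
 move=> r v vi vP; rewrite -(size_enum_ord r) -(size_map v); apply: H.
  by rewrite map_inj_uniq ?enum_uniq.
 by move=> _ /mapP[i _ ->].
exists (map v (enum 'I_r)); split.
- by rewrite map_inj_uniq ?enum_uniq.
- by move=> _ /mapP[i _ ->].
- by move=> w /vsur[i <-]; apply: map_f; rewrite mem_enum.
Qed.

Lemma enum_inf : exists vs, [/\ uniq vs, forall v, v \in vs -> is_valuation v /\ v x < 0
 & forall v, is_valuation v -> v x < 0 -> v \in vs].
have [|vs [us H1 H2]] := @enum_seq (fun v => is_valuation v /\ v x < 0) 2.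
 move=> vs us H; have := sum_seq_inf us H.
 have : \sum_(v <- vs) v x * (vdeg v)%:Z <= \sum_(v <- vs) (- 1).
  rewrite big_seq [leRHS]big_seq; apply: ler_sum => v /H[vP vx].
  by have := val_degree_gt0 vP (vdegP vP); move: (v x) vx (vdeg v) => a; nia.
 rewrite big_const_seq count_predT iter_addr_0 mulNrn; lia.
by exists vs; split=> // v vP vx; apply: H2.
Qed.

Lemma enum_over (p : {poly k}) : p != 0 -> exists vs, [/\ uniq vs,
 forall v, v \in vs -> is_valuation v /\ val_ge v 0 x
 & forall v, is_valuation v -> val_ge v 0 x -> 0 < v (ev p) -> v \in vs].
move=> p0; have [|vs [us H1 H2]] := @enum_seq (fun v => [/\ is_valuation v, val_ge v 0 x & 0 < v (ev p)])
  (2 * (size p).-1).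
 move=> vs us H; have Hs v : v \in vs -> is_valuation v /\ val_ge v 0 x by case/H.
 have := sum_seq_poly p0 us Hs.
 have : \sum_(v <- vs) 1 <= \sum_(v <- vs) v (ev p) * (vdeg v)%:Z.
  rewrite big_seq [leRHS]big_seq; apply: ler_sum => v /H[vP vx vp].
  by have := val_degree_gt0 vP (vdegP vP); move: (v (ev p)) vp (vdeg v) => a; nia.
 rewrite big_const_seq count_predT iter_addr_0; lia.
exists vs; split=> // [v /H1[]|v vP vx vp] //; exact: H2.
Qed.

Lemma kspace_Lspace n : kspace (Lspace x n).
split=> [v vP|u w Lu Lw v vP|c w Lw v vP]; split=> vx.
- by left.
- by left.
- by apply: (val_geD vP); [apply: (Lu v vP).1|apply: (Lw v vP).1].
- by apply: (val_geD vP); [apply: (Lu v vP).2|apply: (Lw v vP).2].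
- by rewrite -(addr0 0); apply: (val_geM vP); [exact: val_geC|apply: (Lw v vP).1].
- by rewrite -(add0r (_ * _)); apply: (val_geM vP); [exact: val_geC|apply: (Lw v vP).2].
Qed.

Lemma has_dim_Lspace n : has_dim (@constants k K) (Lspace x n) [set 0] (n.+1 + (n.+1 - G)).
pose b (i : 'I_(n.+1 + (n.+1 - G))) : K :=
 match fintype.split i with inl l => x ^+ l | inr l => x ^+ l * y end.
have bE (A : 'I_(n.+1 + (n.+1 - G)) -> k) : \sum_i emb K (A i) * b i =
  ev (\poly_(i < n.+1) oapp (fun l => A (lshift _ l)) 0 (insub i)) +
  ev (\poly_(i < n.+1 - G) oapp (fun l => A (rshift _ l)) 0 (insub i)) * y.
 rewrite big_split_ord /= /pev; congr (_ + _).
  rewrite (horner_coef_wide (n := n.+1)) ?size_map_poly ?size_poly //.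
  apply: eq_bigr => i _; rewrite coef_map coef_poly ltn_ord valK /=.
  by rewrite /b (unsplitK (inl _ i)).
 rewrite (horner_coef_wide (n := n.+1 - G)) ?size_map_poly ?size_poly // mulr_suml.
 apply: eq_bigr => i _; rewrite coef_map coef_poly ltn_ord valK /=.
 by rewrite /b (unsplitK (inr _ i)) mulrA.
exists b; split=> [i|z Lz].
 have := bE (fun i' => (i' == i)%:R); rewrite (bigD1 i) //= eqxx rmorph1 mul1r.
 rewrite big1 ?addr0 => [->|i' ni]; last by rewrite (negPf ni) rmorph0 mul0r.
 by apply: (affine_Lspace M S); rewrite size_poly.
have [a1 [a2 [ez s1 s2]]] := Lspace_affine jalg M S Lz.
pose A (i : 'I_(n.+1 + (n.+1 - G))) := match fintype.split i with inl l => a1`_l | inr l => a2`_l end.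
have bA : \sum_i emb K (A i) * b i = z.
 rewrite bE ez; congr (ev _ + ev _ * y); apply/polyP => i; rewrite coef_poly.
  case: ifP => [lt|/negbT ni]; first by rewrite insubT /= /A (unsplitK (inl _ (Ordinal lt))).
  by rewrite nth_default // (leq_trans s1) // leqNgt.
 case: ifP => [lt|/negbT ni]; first by rewrite insubT /= /A (unsplitK (inr _ (Ordinal lt))).
 by rewrite nth_default // (leq_trans s2) // leqNgt.
exists [ffun i => emb K (A i)]; split.
 split=> [i|]; first by rewrite ffunE; exists (A i).
 rewrite /= -bA -[RHS](subrr (\sum_i emb K (A i) * b i)); congr (_ - _).
 by apply: eq_bigr => i _; rewrite ffunE.
move=> c [cC /eqP]; rewrite subr_eq0 => /eqP e; have [C HC] := constants_choice cC.
apply/ffunP => i; rewrite ffunE -HC; congr (emb K _).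
have : \sum_i emb K (A i - C i) * b i = 0.
 rewrite -[RHS](subrr z) -{1}bA e -sumrB; apply: eq_bigr => l _.
 by rewrite rmorphB mulrBl HC.
rewrite bE => /(model_free M) [e1 e2]; apply/eqP; rewrite -subr_eq0; apply/eqP.
case: (split_ordP i) => l il.
 by have /polyP/(_ l) := e1; rewrite coef_poly ltn_ord valK coef0 /= -il.
by have /polyP/(_ l) := e2; rewrite coef_poly ltn_ord valK coef0 /= -il.
Qed.

(** Were the polar degree of x at most 1, removing the poles from the space of level N = G + 1, of
    dimension G + 4, would cost at most G + 1 and leave at least 3 dimensions at level 0, where the
    dimension is 1. *)
Lemma sum_inf_eq (vs : seq (K -> int)) : (0 < G)%N -> uniq vs ->
 (forall v, v \in vs -> is_valuation v /\ v x < 0) ->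
 (forall v, is_valuation v -> v x < 0 -> v \in vs) ->
 \sum_(v <- vs) v x * (vdeg v)%:Z = - 2.
move=> G0 us H1 H2; apply/eqP; rewrite eq_le sum_seq_inf // andbT.
rewrite leNgt; apply/negP => lt.
pose N := G.+1.
have fr : free_mod (Lspace x N) [set 0] (N.+1 + (N.+1 - G)).
 apply: has_dim_free_mod (has_dim_Lspace N) => //; first by case: (kspace_Lspace N).
 by move=> z ->; rewrite /= oppr0.
have := @free_mod_multi _ _ (Lspace x N) vs (fun v => v x * N%:Z) (fun v => (`|v x| * N)%N) vdeg _
 (kspace_Lspace N).
case/(_ (N.+1 + (N.+1 - G))%N) => [v vs_v| |g [Vg frg]] //.
 have [vP vx] := H1 _ vs_v; split=> //; first exact: vdegP.
 by move=> z Lz; case: (Lz v vP) => _; apply.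
have f0 : free_mod (Lspace x 0) [set 0] (N.+1 + (N.+1 - G) - \sum_(v <- vs) `|v x| * N * vdeg v).
 exists g; split=> // i v vP; have [L1 L2] := Vg i; split=> vx.
  by case: (L1 v vP) => + _; apply.
 have := L2 v (H2 v vP vx); congr (val_ge v _ _); move: (v x) vx => a; rewrite mulr0; lia.
have := has_dim_free_le (kspace_Lspace 0) (has_dim_Lspace 0) f0.
have e : \sum_(v <- vs) v x * (vdeg v)%:Z = - (\sum_(v <- vs) `|v x| * vdeg v)%N%:Z.
 rewrite -natz natr_sum -sumrN big_seq [RHS]big_seq; apply: eq_bigr => v /H1[_ vx].
 by rewrite natz; move: (v x) vx => a; lia.
have e2 : (\sum_(v <- vs) `|v x| * N * vdeg v = (\sum_(v <- vs) `|v x| * vdeg v) * N)%N.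
 by rewrite big_distrl; apply: eq_bigr => v _; rewrite mulnAC.
move: lt; rewrite e e2; move: (\sum_(v <- vs) _)%N => s lt.
have s1 : (s <= 1)%N by lia.
have le : (s * N <= N)%N by rewrite -{2}(mul1n N) leq_mul.
by rewrite /N in le *; lia.
Qed.

End Genus.

Lemma big_subseq_eq (T : eqType) (s1 s : seq T) (F : T -> int) : uniq s1 -> uniq s ->
 {subset s1 <= s} -> (forall v, v \notin s1 -> F v = 0) -> \sum_(v <- s) F v = \sum_(v <- s1) F v.
move=> u1 us sub F0; rewrite (bigID (mem s1)) /= [X in _ + X]big1 ?addr0; last by move=> v /F0.
rewrite -big_filter; apply: perm_big; apply: uniq_perm; rewrite ?filter_uniq // => v.
by rewrite mem_filter; apply: andb_idr => /sub.
Qed.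

(** * Genus of a smooth model *)

Section Riemann.
Variables (k : fieldType) (K : extension k) (L : closedFieldType) (j : {rmorphism k -> L}) (jalg : forall z : L, algebraicOver j z) (x y : K) (h f : {poly k}) (G : nat) (M : model x y h f) (S : smooth G h f).
Notation ev := (pev (emb K) x).

Lemma free_Lspace n : free_mod (Lspace x n) [set 0] (n.+1 + (n.+1 - G)).
apply: has_dim_free_mod (has_dim_Lspace jalg M S n) => //; first by case: (kspace_Lspace x n).
by move=> z ->; rewrite /= oppr0.
Qed.

Lemma kspace_RR r (P : 'I_r -> K -> int) (m : 'I_r -> int) : (forall i, is_valuation (P i)) ->
 kspace (K := K) (RR_space P m).
move=> PP; split; first by split=> *; left.
 move=> u w [u1 u2] [w1 w2]; split=> [i|v vP nv]; first exact: val_geD.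
 by apply: val_geD => //; [exact: u2|exact: w2].
move=> c w [w1 w2]; split=> [i|v vP nv].
 by rewrite -(add0r (- _)); apply: (val_geM (PP i)) => //; exact: val_geC.
by rewrite -(add0r 0); apply: (val_geM vP); [exact: val_geC|exact: w2].
Qed.

Let RR_arith (a l N : nat) (b e m : int) : (N - a <= l)%N -> a%:Z = b - e -> b <= 2 * m ->
 N%:Z = 2 * m + 2 - G%:Z -> e - l%:Z + 1 <= G%:Z - 1.
Proof. lia. Qed.

(** Take p in k[x] whose value at each P i with v(x) >= 0 is at least m i. Then L(A) contains p^-1
    times the sections of level n that satisfy finitely many vanishing conditions, each of which
    costs at most the degree of its place. The total cost is controlled by the bounds on the zeros
    of p and the poles of x. *)
Lemma RR_defect_le s : RR_defect K s -> s <= G%:Z - 1.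
case=> r [P [m [d [l [Pi PP Pd Hl ->]]]]].
pose mu v : int := \sum_(i < r | P i == v) m i.
have muP i : mu (P i) = m i.
 rewrite /mu (bigD1 i) ?eqxx //= big1 ?addr0 // => i' /andP[/eqP/Pi->].
 by rewrite eqxx.
pose A : int := \sum_i `|m i|.
have muA v : `|mu v| <= A.
 apply: le_trans (ler_norm_sum _ _ _) _; rewrite /A [leRHS](bigID (fun i => P i == v)) /=.
 by rewrite lerDl sumr_ge0.
have [p [p0 Hp]] : exists p, p != 0 /\ forall i, val_ge (P i) 0 x -> m i <= P i (ev p).
 have ex i : exists q : {poly k}, q != 0 /\ (val_ge (P i) 0 x -> m i <= P i (ev q)).
  have [vx|nvx] := pselect (val_ge (P i) 0 x); last by exists 1; rewrite oner_neq0.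
  have [n [n0 vn]] := val_pos_poly M (PP i) vx.
  exists (n ^+ `|m i|); rewrite expf_neq0 //; split=> // _.
  rewrite pevXn vX // -mulr_natr natz; move: (P i (ev n)) vn (m i) => a a0 b; nia.
 have [q Hq] := choice ex; exists (\prod_i q i); split.
  by apply/prodf_neq0 => i _; case: (Hq i).
 move=> i vx; have [_ /(_ vx) le] := Hq i; apply: le_trans le _.
 rewrite (bigD1 i) //= pevM (vM (PP i)) ?(ev_eq0 M); first last.
 - by apply/prodf_neq0 => i' _; case: (Hq i').
 - by case: (Hq i).
 rewrite lerDl; have e0 : ev (\prod_(i0 < r | i0 != i) q i0) != 0.
  by rewrite (ev_eq0 M); apply/prodf_neq0 => i' _; case: (Hq i').
 by have [/eqP|//] := val_ge_pev (PP i) (\prod_(i0 < r | i0 != i) q i0) vx; rewrite (negPf e0).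
have [vs2 [us2 H2a H2b]] := enum_over jalg M S p0.
have [vs3 [us3 H3a H3b]] := enum_inf jalg M S.
pose vs1 := map P (enum 'I_r).
have us1 : uniq vs1 by rewrite map_inj_uniq ?enum_uniq.
have mem1 i : P i \in vs1 by apply: map_f; rewrite mem_enum.
pose vs := undup (vs1 ++ vs2 ++ vs3).
have us : uniq vs by apply: undup_uniq.
have vsP v : v \in vs -> is_valuation v.
 rewrite mem_undup !mem_cat => /or3P[/mapP[i _ ->] //|/H2a[] //|/H3a[] //].
pose dp := (size p).-1.
(* So large that the orders still to be imposed at the poles of x are non-negative, and at least G,
   so that level n has dimension 2 n + 2 - G. *)
pose n := (dp + `|A| + G)%N.
pose m0 v : int := if v x < 0 then v x * n%:Z else 0.
have A0 : 0 <= A by rewrite sumr_ge0.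
have mu0 v : v \notin vs1 -> mu v = 0.
 by move=> nv; rewrite /mu big1 // => i /eqP e; move: nv; rewrite -e mem1.
have nv0 v : v \in vs -> 0 <= v (ev p) - mu v - m0 v.
 move=> vvs; have vP := vsP v vvs; rewrite /m0; case: ltP => vx; last first.
  have gex : val_ge v 0 x by right.
  have [/mapP[i _ e]|/mu0->] := boolP (v \in vs1).
   by rewrite e muP subr0 subr_ge0; apply: Hp; rewrite -e.
  by rewrite !subr0; have [/eqP|//] := val_ge_pev vP p gex; rewrite (ev_eq0 M) (negPf p0).
 have [-> _] := val_ev_inf vP vx p0; have := muA v; rewrite /n -/dp.
 rewrite ler_norml => /andP[_ cB]; rewrite !PoszD (gez0_abs A0).
 have -> : v x * dp%:Z - mu v - v x * (dp%:Z + A + G%:Z) = - mu v + (- v x) * (A + G%:Z) by ring.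
 have : A + G%:Z <= (- v x) * (A + G%:Z) by rewrite ler_peMl ?addr_ge0 //; lia.
 lia.
(* [m0 v] is the order that level n guarantees at v; [nn v] is what must be added to reach v(p) - mu
   v. *)
pose nn (v : K -> int) : nat := absz (v (ev p) - mu v - m0 v)%R.
have := @free_mod_multi _ _ (Lspace x n) vs m0 nn (vdeg (K := K)) (n.+1 + (n.+1 - G))%N (kspace_Lspace x n).
case=> [v vvs| |g [Vg frg]].
- have vP := vsP v vvs; split=> //; first exact: (vdegP jalg M S).
 by move=> z Lz; rewrite /m0; have [L1 L2] := Lz v vP; case: ltP => vx; [exact: L2|apply: L1; right].
- exact: free_Lspace.
have evp0 : ev p != 0 by rewrite (ev_eq0 M).
have fRR : free_mod (RR_space P m) [set 0] (n.+1 + (n.+1 - G) - \sum_(v <- vs) nn v * vdeg v).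
 pose V := Lspace x n `&` [set z | forall v, v \in vs -> val_ge v (m0 v + (nn v)%:Z) z].
 apply: (free_mod_map (V := V) (g := (ev p)^-1)); rewrite ?invr_eq0 //; last by exists g.
 move=> z [Lz Hz].
 have key v : v \in vs -> val_ge v (- mu v) ((ev p)^-1 * z).
  move=> vvs; have vP := vsP v vvs; have := Hz v vvs.
  have -> : m0 v + (nn v)%:Z = v (ev p) - mu v.
   rewrite /nn gez0_abs ?nv0 //; lia.
  move=> hz; have -> : - mu v = - v (ev p) + (v (ev p) - mu v) by lia.
  by apply: (val_geM vP) => //; right; rewrite vV.
 split=> [i|v vP nvP].
  by rewrite -muP; apply: key; rewrite mem_undup mem_cat mem1.
 have nv1 : v \notin vs1 by apply/mapP => -[i _ e]; case: (nvP i).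
 have [vvs|nvs] := boolP (v \in vs); first by have := key v vvs; rewrite mu0 // oppr0.
 have vx : val_ge v 0 x.
  have [h0|h0] := leP 0 (v x); first by right.
  by move: nvs; rewrite mem_undup !mem_cat (H3b v vP h0) !orbT.
 have vp : v (ev p) <= 0.
  rewrite leNgt; apply/negP => h0.
  by move: nvs; rewrite mem_undup !mem_cat (H2b v vP vx h0) !orbT.
 have [L1 _] := Lz v vP; rewrite -(add0r 0); apply: (val_geM vP); last exact: L1.
 by right; rewrite (vV vP) oppr_ge0.
have lel := has_dim_free_le (kspace_RR m PP) Hl fRR.
have e1 : (\sum_(v <- vs) nn v * vdeg v)%N%:Z =
  \sum_(v <- vs) (v (ev p) - m0 v) * (vdeg v)%:Z - \sum_(v <- vs) mu v * (vdeg v)%:Z.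
 rewrite -natz natr_sum -sumrB big_seq [RHS]big_seq; apply: eq_bigr => v vvs.
 rewrite natz PoszM /nn gez0_abs ?nv0 //; ring.
have e2 : \sum_(v <- vs) mu v * (vdeg v)%:Z = \sum_(i < r) m i * (d i)%:Z.
 rewrite (big_subseq_eq us1 us); first last.
 - by move=> v /mu0 ->; rewrite mul0r.
 - by move=> v v1; rewrite mem_undup mem_cat v1.
 rewrite big_map big_enum /=; apply: eq_bigr => i _.
 by rewrite muP (vdegE jalg M S (PP i) (Pd i)).
have e3 : \sum_(v <- vs) (v (ev p) - m0 v) * (vdeg v)%:Z <= 2 * n%:Z.
 rewrite (bigID (fun v : K -> int => v x < 0)) /=.
 have fin : \sum_(v <- vs | ~~ (v x < 0)) (v (ev p) - m0 v) * (vdeg v)%:Z <= dp%:Z *+ 2.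
  rewrite -big_filter; apply: le_trans (sum_seq_poly jalg M S p0 (vs := [seq v <- vs | ~~ (v x < 0)]) _ _).
  - rewrite !big_filter; apply: ler_sum => v; rewrite -leNgt => vx.
   by rewrite /m0 ltNge vx subr0.
  - by rewrite filter_uniq.
  - by move=> v; rewrite mem_filter -leNgt => /andP[vx /vsP]; split=> //; right.
 have inf : \sum_(v <- vs | v x < 0) (v (ev p) - m0 v) * (vdeg v)%:Z <= 2 * (n - dp)%N%:Z.
  have := sum_seq_inf jalg M S (vs := [seq v <- vs | v x < 0]).
  rewrite filter_uniq // => /(_ isT) H.
  have {}H : - 2 <= \sum_(v <- [seq v <- vs | v x < 0]) v x * (vdeg v)%:Z.
   by apply: H => v; rewrite mem_filter => /andP[vx /vsP].
  rewrite -big_filter.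
  have -> : \sum_(v <- [seq v <- vs | v x < 0]) (v (ev p) - m0 v) * (vdeg v)%:Z =
    (\sum_(v <- [seq v <- vs | v x < 0]) v x * (vdeg v)%:Z) * (dp%:Z - n%:Z).
   rewrite mulr_suml big_seq [RHS]big_seq; apply: eq_bigr => v.
   rewrite mem_filter => /andP[vx vvs]; have [-> _] := val_ev_inf (vsP v vvs) vx p0.
   by rewrite /m0 vx -/dp; ring.
  move: H; move: (\sum_(v <- _) _) => a; rewrite /n; nia.
 apply: le_trans (lerD inf fin) _; rewrite /n; lia.
have e4 : (n.+1 + (n.+1 - G))%N%:Z = 2 * n%:Z + 2 - G%:Z by rewrite /n; lia.
rewrite e2 in e1; apply: RR_arith lel e1 e3 e4.
Qed.

(** G times the polar divisor of x attains the bound: it has degree 2 G and G + 2 independent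
    sections. *)
Lemma RR_defect_genus : (0 < G)%N -> RR_defect K (G%:Z - 1).
move=> G0; have [vs [us H1 H2]] := enum_inf jalg M S.
pose P (i : 'I_(size vs)) : K -> int := tnth (in_tuple vs) i.
have Pm i : P i \in vs by apply: mem_tnth.
have PP i : is_valuation (P i) by case: (H1 _ (Pm i)).
have Px i : P i x < 0 by case: (H1 _ (Pm i)).
exists (size vs), P, (fun i => - (P i x * G%:Z)), (fun i => vdeg (P i)), (G.+1 + (G.+1 - G))%N; split=> //.
- by apply/tuple_uniqP.
- by move=> i; apply: (vdegP jalg M S).
- have -> : RR_space P (fun i => - (P i x * G%:Z)) = Lspace x G.
 apply/seteqP; split=> z.
  move=> [h1 h2] v vP; split=> vx.
   apply: h2 => // i e; have := Px i; rewrite -e.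
   by case: vx => [->|]; [rewrite v0 ?ltxx|rewrite leNgt => /negbTE ->].
  have /(nthP v)[i lti e] := H2 v vP vx.
  have -> : v = P (Ordinal lti) by rewrite /P (tnth_nth v).
  by have := h1 (Ordinal lti); rewrite opprK.
 move=> Lz; split=> [i|v vP nv].
  by rewrite opprK; have [_] := Lz _ (PP i); apply.
 have [h0 _] := Lz v vP; apply: h0; right; rewrite leNgt; apply/negP => vx.
 have /(nthP v)[i lti e] := H2 v vP vx.
 by apply: (nv (Ordinal lti)); rewrite /P (tnth_nth v).
 have HL := has_dim_Lspace jalg M S G.
 exact HL.
have := sum_inf_eq jalg M S G0 us H1 H2; rewrite (big_tnth _ _ vs) => e.
have -> : \sum_(i < size vs) - (P i x * G%:Z) * (vdeg (P i))%:Z =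
 - G%:Z * \sum_(i < size vs) P i x * (vdeg (P i))%:Z.
 by rewrite mulr_sumr; apply: eq_bigr => i _; ring.
by rewrite e; lia.
Qed.

Lemma smooth_genus g : (0 < G)%N -> has_genus K g <-> g.+1 = G.
move=> G0; split=> [[h1 h2]|e].
 by have := RR_defect_le h1; have := h2 _ (RR_defect_genus G0); lia.
have -> : g = G.-1 by lia.
have e2 : G.-1%:Z = G%:Z - 1 by lia.
by split; rewrite e2; [exact: RR_defect_genus|exact: RR_defect_le].
Qed.

(** An algebraic element has no pole by [val_ev_inf], so it is a section of level 0, and these are
    the constants. *)
Lemma smooth_constants_closed : (0 < G)%N -> constants_closed K.
move=> G0 z [p p0 /eqP pz].
have Lz : Lspace x 0 z.
 have key v : is_valuation v -> val_ge v 0 z.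
  move=> vP; right; rewrite leNgt; apply/negP => vz.
  by have [_ /eqP] := val_ev_inf vP vz p0.
 by move=> v vP; split=> _; rewrite ?mulr0; apply: key.
have [a [b [-> s1 s2]]] := Lspace_affine jalg M S Lz.
have -> : b = 0 by apply/eqP; rewrite -size_poly_leq0; move: s2; lia.
by rewrite pev0 mul0r addr0 (size1_polyC s1) pevC; exists a`_0.
Qed.

End Riemann.

Definition disc (R : nzRingType) (h f : R) : R := h ^+ 2 + f *+ 4.

(** * Reduction of singular pairs *)

Section PairReduction.
Variables (k : fieldType).
Implicit Types (h f p b : {poly k}) (G : nat).

Lemma disc_shift (R : comNzRingType) (h f b : R) : disc (h + b *+ 2) (f - h * b - b ^+ 2) = disc h f.
Proof. by rewrite /disc; ring. Qed.

Lemma size_disc h f G : (size h <= G.+1)%N -> (size f <= (2 * G).+1)%N -> (size (disc h f) <= (2 * G).+1)%N.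
move=> sh sf; apply: leq_trans (size_polyD _ _) _; rewrite geq_max; apply/andP; split.
 by apply: leq_trans (size_polyMleq _ _) _; move: (size h) sh => ? ?; lia.
by rewrite -mulr_natr -polyC_natr mulrC mul_polyC; apply: leq_trans (size_scale_leq _ _) sf.
Qed.

(** The new pair belongs to (y - b0) / p. Replacing b by its remainder b0 modulo p keeps both
    divisibilities and makes the degree bounds hold; deg p <= G because p^2 divides the
    discriminant, of degree at most 2 G. *)
Lemma reduce_pair h f p b G : (size h <= G.+1)%N -> (size f <= (2 * G).+1)%N -> disc h f != 0 ->
 (1 < size p)%N -> p %| h + b *+ 2 -> p ^+ 2 %| f - h * b - b ^+ 2 ->
 exists b0 h' f', [/\ h + b0 *+ 2 = p * h', f - h * b0 - b0 ^+ 2 = p ^+ 2 * f',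
  ((size p).-1 <= G)%N, (size b0 < size p)%N &
  (size h' <= (G - (size p).-1).+1)%N /\ (size f' <= (2 * (G - (size p).-1)).+1)%N].
move=> sh sf D0 sp /dvdpP[h1 h1e] /dvdpP[f1 f1e].
have p0 : p != 0 by rewrite -size_poly_gt0; apply: ltnW.
have pG : ((size p).-1 <= G)%N.
 have : p ^+ 2 %| disc h f.
  rewrite -(disc_shift h f b) /disc h1e f1e exprMn; apply: dvdp_add; first exact: dvdp_mull.
  by rewrite -mulrnAl; exact: dvdp_mull.
 move=> /(dvdp_leq D0) le; have := leq_trans le (size_disc sh sf).
 rewrite size_exp_leq || rewrite expr2 size_mul //.
 by move: (size p) sp => ? ?; lia.
pose b0 := b %% p; pose s := b %/ p.
have be : b = s * p + b0 by apply: divp_eq.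
have e1 : h + b0 *+ 2 = p * (h1 - s *+ 2).
 transitivity (h + b *+ 2 - (s * p) *+ 2); first by rewrite be; ring.
 by rewrite h1e; ring.
have e2 : f - h * b0 - b0 ^+ 2 = p ^+ 2 * (f1 + h1 * s - s ^+ 2).
 transitivity (f - h * b - b ^+ 2 + (h + b *+ 2) * (s * p) - (s * p) ^+ 2); first by rewrite be; ring.
 by rewrite f1e h1e; ring.
have sb : (size b0 < size p)%N by rewrite ltn_modp.
have sz q n : (size (p * q)%R <= n.+1)%N -> (size q <= (n - (size p).-1).+1)%N.
 have [->|q0] := eqVneq q 0; first by rewrite size_poly0.
 rewrite size_mul //; have : (0 < size q)%N by rewrite size_poly_gt0.
 by move: (size p) (size q) sp => ? ? ?; lia.
exists b0, (h1 - s *+ 2), (f1 + h1 * s - s ^+ 2); split=> //; split.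
 apply: (sz); rewrite -e1; apply: leq_trans (size_polyD _ _) _; rewrite geq_max sh /=.
 rewrite mulr2n; apply: leq_trans (size_polyD _ _) _; rewrite maxnn.
 by move: (size b0) (size p) sb pG => ? ? ?; lia.
have -> : (2 * (G - (size p).-1) = 2 * G - (size p).-1 - (size p).-1)%N by lia.
apply: (sz); apply: (sz).
rewrite mulrA -expr2 -e2; apply: leq_trans (size_polyD _ _) _.
have sb0 : (size b0 <= G)%N by move: (size b0) (size p) sb pG => ? ? ?; lia.
rewrite geq_max size_polyN; apply/andP; split.
 apply: leq_trans (size_polyD _ _) _; rewrite geq_max sf /= size_polyN.
 by apply: leq_trans (size_polyMleq _ _) _; move: (size h) (size b0) sh sb0 => ? ? ? ?; lia.
by apply: leq_trans (size_polyMleq _ _) _; move: (size b0) sb0 => ? ?; lia.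
Qed.

(* The pair is singular at infinity, at the point where y / x^G takes the value c. *)
Definition inf_singular G h f (c : k) : Prop :=
 (size (h + (c *: 'X^G) *+ 2)%R <= G)%N /\
 (size (f - h * (c *: 'X^G) - (c *: 'X^G) ^+ 2)%R <= (2 * G).-1)%N.

Lemma size_le_coef (p : {poly k}) n : (size p <= n.+1)%N -> ((size p <= n)%N <-> p`_n = 0).
move=> sp; split=> [le|e]; first exact: nth_default.
 apply/leq_sizeP => i; rewrite leq_eqVlt => /orP[/eqP<- //|lt].
by rewrite nth_default // (leq_trans sp).
Qed.

Lemma inf_singular_coef G h f c : (size h <= G.+2)%N -> (size f <= (2 * G.+1).+1)%N ->
 (inf_singular G.+1 h f c <->
 [/\ h`_G.+1 + c *+ 2 = 0, f`_(2 * G.+1) - h`_G.+1 * c - c ^+ 2 = 0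
  & f`_(2 * G).+1 - h`_G * c = 0]).
move=> sh sf.
have s1 : (size (h + (c *: 'X^(G.+1)) *+ 2)%R <= G.+2)%N.
 apply: leq_trans (size_polyD _ _) _; rewrite geq_max sh /= scalerMnl.
 by apply: leq_trans (size_scale_leq _ _) _; rewrite size_polyXn.
set f1 := f - h * (c *: 'X^(G.+1)) - (c *: 'X^(G.+1)) ^+ 2.
have s2 : (size f1 <= (2 * G.+1).+1)%N.
 apply: leq_trans (size_polyD _ _) _; rewrite geq_max size_polyN; apply/andP; split.
  apply: leq_trans (size_polyD _ _) _; rewrite geq_max sf size_polyN -scalerAr.
  apply: leq_trans (size_scale_leq _ _) _; apply: leq_trans (size_polyMleq _ _) _.
  by rewrite size_polyXn; move: (size h) sh => ? ?; lia.
 by rewrite exprZn -exprM; apply: leq_trans (size_scale_leq _ _) _; rewrite size_polyXn; lia.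
have c1 : (h + (c *: 'X^(G.+1)) *+ 2)`_G.+1 = h`_G.+1 + c *+ 2.
 by rewrite coefD coefMn coefZ coefXn eqxx mulr1.
have c2 : f1`_(2 * G.+1) = f`_(2 * G.+1) - h`_G.+1 * c - c ^+ 2.
 rewrite /f1 !coefB -scalerAr coefZ coefMXn exprZn -exprM coefZ coefXn.
 have -> : (2 * G.+1 < G.+1)%N = false by lia.
 have -> : (2 * G.+1 - G.+1 = G.+1)%N by lia.
 by rewrite [(G.+1 * 2)%N]mulnC eqxx mulr1 [c * _]mulrC.
have c3 : f1`_(2 * G).+1 = f`_(2 * G).+1 - h`_G * c.
 rewrite /f1 !coefB -scalerAr coefZ coefMXn exprZn -exprM coefZ coefXn.
 have -> : ((2 * G).+1 < G.+1)%N = (G < 0)%N by lia.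
 rewrite ltn0; have -> : ((2 * G).+1 - G.+1 = G)%N by lia.
 have -> : ((2 * G).+1 == G.+1 * 2)%N = false by lia.
 by rewrite mulr0 subr0 [c * _]mulrC.
rewrite -c1 -c2 -c3 /inf_singular -/f1; have -> : ((2 * G.+1).-1 = (2 * G).+1)%N by lia.
have e2 : (2 * G.+1 = (2 * G).+2)%N by lia.
rewrite (size_le_coef s1); split=> [[-> le]|[-> e3 e4]].
 by split=> //; apply: nth_default; rewrite ?e2 (leq_trans le) // leqW.
split=> //; apply/size_le_coef => //; rewrite -e2 in s2 *.
by apply/size_le_coef.
Qed.

(** Modulo X^2 the coefficient b_1 enters only multiplied by the constant term of h + 2 b in the
    chart, which vanishes; so b may be taken constant. *)
Lemma nonsingular_inf G h f : (size h <= G.+2)%N -> (size f <= (2 * G.+1).+1)%N ->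
 (nonsingular (rev_poly G.+1 h) (rev_poly (2 * G.+1) f) 'X <-> forall c, ~ inf_singular G.+1 h f c).
move=> sh sf; set h' := rev_poly _ h; set f' := rev_poly _ f.
have h0 : h'`_0 = h`_G.+1 by rewrite coef_rev_poly // subn0.
have h1 : h'`_1 = h`_G by rewrite coef_rev_poly // subn1.
have f0 : f'`_0 = f`_(2 * G.+1) by rewrite coef_rev_poly // subn0.
have f1 : f'`_1 = f`_(2 * G).+1 by rewrite coef_rev_poly; [congr (f`_ _)|]; lia.
have dX (p : {poly k}) : 'X %| p <-> p`_0 = 0.
 rewrite -[X in X %| _]subr0 -polyC0 dvdp_XsubCl /root horner_coef0.
 by split=> /eqP.
have dX2 (p : {poly k}) : 'X ^+ 2 %| p <-> p`_0 = 0 /\ p`_1 = 0.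
 split=> [/dvdpP[q ->]|[p0 p1]]; first by rewrite !coefMXn.
 have /dX/dvdpP[q qe] := p0; have : q`_0 = 0 by have := p1; rewrite qe coefMX.
 by move=> /dX/dvdpP[r re]; rewrite qe re -mulrA -expr2 dvdp_mull.
have cM1 (p q : {poly k}) : (p * q)`_1 = p`_0 * q`_1 + p`_1 * q`_0.
 by rewrite coefM !big_ord_recl big_ord0 addr0.
have cM0 (p q : {poly k}) : (p * q)`_0 = p`_0 * q`_0 by rewrite coefM big_ord_recl big_ord0 addr0.
split=> H.
 move=> c /(inf_singular_coef c sh sf) [e1 e2 e3]; apply: (H c%:P).
  by apply/dX; rewrite coefD coefMn coefC /= h0.
 apply/dX2; rewrite !coefB expr2 !cM1 !cM0 !coefC /= h0 h1 f0 f1; split; first by rewrite -expr2.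
 by rewrite -[RHS]e3; ring.
move=> b /dX; rewrite coefD coefMn h0 => e1 /dX2; rewrite !coefB expr2 !cM1 !cM0 h0 h1 f0 f1 => -[e2 e3].
apply: (H b`_0); apply/(inf_singular_coef _ sh sf); split=> //.
have : f`_(2 * G).+1 - h`_G * b`_0 - (h`_G.+1 + b`_0 *+ 2) * b`_1 = 0 by rewrite -[RHS]e3; ring.
by rewrite e1 mul0r subr0.
Qed.

End PairReduction.

(** * Existence of smooth models *)

Section ModelReduction.
Variables (k : fieldType) (K : extension k).
Implicit Types (x y : K) (h f : {poly k}).
Notation ev x := (pev (emb K) x).

Lemma model_y_notin x y h f a : model x y h f -> y != ev x a.
move=> M; rewrite -subr_eq0; apply/eqP => e.
have [] := @model_free _ _ _ _ _ _ M (- a) 1; first by rewrite !pevE -e; ring.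
by move=> _ /eqP; rewrite oner_eq0.
Qed.

Lemma model_reduce x y h f p b h' f' : model x y h f -> p != 0 -> h + b *+ 2 = p * h' ->
 f - h * b - b ^+ 2 = p ^+ 2 * f' -> model x ((y - ev x b) / ev x p) h' f'.
move=> M p0 e1 e2; have ep0 : ev x p != 0 by rewrite (ev_eq0 M).
have E1 := congr1 (ev x) e1; have E2 := congr1 (ev x) e2.
rewrite !pevE in E1 E2; split.
- apply: (mulfI (expf_neq0 2 ep0)); rewrite -E2 -(model_eq M).
 transitivity ((y - ev x b) ^+ 2 + (ev x p * ev x h') * (y - ev x b)); last by rewrite -E1; ring.
 by field.
- move=> a c e; have [] := @model_free _ _ _ _ _ _ M (a * p - c * b) c.
  rewrite !pevE -(mul0r (ev x p)) -e; by field.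
 move=> e3 c0; move: e3; rewrite c0 mul0r subr0 => /eqP; rewrite mulf_eq0 (negPf p0) orbF.
 by move/eqP.
move=> z; have [a [c [d [d0 e]]]] := model_gen M z.
exists (a + c * b), (c * p), d; split=> //; rewrite e !pevE; by field.
Qed.

(** A singular point would give X - b^2 = s p^2. In characteristic 2 the derivative of the left side
    is 1 and that of the right side is a multiple of p. *)
Lemma smooth_char2 : (2%:R : k) = 0 -> smooth 1 (0 : {poly k}) 'X.
move=> two0.
have t0 (q : {poly k}) : q *+ 2 = 0 by rewrite -mulr_natr -polyC_natr two0 mulr0.
have sq' (q : {poly k}) : (q ^+ 2)^`() = 0 by rewrite expr2 derivM mulrC -mulr2n t0.
have ns (p : {poly k}) : (1 < size p)%N -> nonsingular 0 'X p.
 move=> sp b _; rewrite mul0r subr0 => /dvdpP[s e].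
 have := congr1 (fun q => q^`()) e; rewrite derivB derivX derivM !sq' subr0 mulr0 addr0 => e1.
 have : p %| 1 by rewrite e1 expr2 mulrA dvdp_mull.
 by rewrite dvdp1 => /eqP e2; rewrite e2 in sp.
split; rewrite ?size_poly0 ?size_polyX //.
have -> : rev_poly 1 (0 : {poly k}) = 0 by apply/polyP => i; rewrite coef_poly !coef0 if_same.
have -> : rev_poly (2 * 1) ('X : {poly k}) = 'X.
 by apply/polyP => -[|[|[|i]]]; rewrite coef_poly !coefX.
by apply: ns; rewrite size_polyX.
Qed.

End ModelReduction.

Section SmoothModel.
Variables (k : finFieldType) (K : extension k).
Implicit Types (x y : K) (h f : {poly k}).
Notation ev x := (pev (emb K) x).

Lemma sqrt_char2 : (2%:R : k) = 0 -> forall a : k, exists b, b ^+ 2 = a.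
move=> two0 a; have inj : injective (fun b : k => b ^+ 2).
 move=> b c /eqP; rewrite -subr_eq0 subr_sqr mulf_eq0 subr_eq0 addr_eq0.
 have -> : - c = c by apply/eqP; rewrite eq_sym -addr_eq0 -mulr2n -mulr_natr two0 mulr0.
 by rewrite orbb => /eqP.
have /codomP[b ->] : a \in codom (fun b : k => b ^+ 2) by rewrite (injF_onto inj).
by exists b.
Qed.

(** Discriminant 0 forces characteristic 2 and h = 0, a purely inseparable cover. As k is perfect, f
    = A^2 + x B^2, and (y - A) / B is a square root of x. *)
Lemma model_disc0 x y h f : model x y h f -> disc h f = 0 ->
 exists y', model x y' 0 'X /\ smooth 1 (0 : {poly k}) 'X.
move=> M; have [two0|two0] := eqVneq (2%:R : k) 0; last first.
 move=> /(congr1 (ev x)); rewrite /disc pevD pevXn pevMn pev0 => D0.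
 have : (y *+ 2 + ev x h) ^+ 2 = 0.
  by rewrite -D0 -(model_eq M); ring.
 move=> /eqP; rewrite sqrf_eq0 => /eqP e.
 have [] := @model_free _ _ _ _ _ _ M h 2%:R%:P; first by rewrite pevC rmorph_nat -e; ring.
 by move=> _ /eqP; rewrite polyC_eq0 (negPf two0).
have t0 (q : {poly k}) : q *+ 2 = 0 by rewrite -mulr_natr -polyC_natr two0 mulr0.
have -> : disc h f = h ^+ 2 by rewrite /disc (mulrnA f 2 2) t0 addr0.
move=> /eqP; rewrite expf_eq0 => /= /eqP h0; subst h.
have [s Hs] := choice (sqrt_char2 two0).
pose A := \poly_(i < size f) s f`_(2 * i); pose B := \poly_(i < size f) s f`_(2 * i).+1.
have sq (p : {poly k}) : p ^+ 2 = \sum_(i < size p) (p`_i) ^+ 2 *: 'X^(2 * i).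
 rewrite -{1}[p]coefK poly_def; elim: (size p) => [|m IH]; first by rewrite !big_ord0 expr0n.
 by rewrite !big_ord_recr /= sqrrD IH t0 addr0 exprZn -exprM mulnC.
have coef_sq (p : {poly k}) i : (p ^+ 2)`_(2 * i) = p`_i ^+ 2 /\ (p ^+ 2)`_(2 * i).+1 = 0.
 rewrite (sq p) !coef_sum; split.
  have [lt|ge] := ltnP i (size p).
   rewrite (bigD1 (Ordinal lt)) //= coefZ coefXn eqxx mulr1 big1 ?addr0 // => i' ni.
   rewrite coefZ coefXn; case: eqP => [e|]; last by rewrite mulr0.
   by case/eqP: ni; apply: val_inj => /=; lia.
  rewrite (nth_default _ ge) expr0n big1 // => i' _; rewrite coefZ coefXn.
  by case: eqP => [e|]; [have := ltn_ord i'; lia|rewrite mulr0].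
 rewrite big1 // => i' _; rewrite coefZ coefXn.
 by case: eqP => [e|]; [lia|rewrite mulr0].
have cA i : A`_i ^+ 2 = f`_(2 * i).
 rewrite coef_poly; case: ltnP => [_|ge]; first exact: Hs.
 by rewrite expr0n nth_default // (leq_trans ge) //; lia.
have cB i : B`_i ^+ 2 = f`_(2 * i).+1.
 rewrite coef_poly; case: ltnP => [_|ge]; first exact: Hs.
 by rewrite expr0n nth_default // (leq_trans ge) //; lia.
have fe : f = A ^+ 2 + B ^+ 2 * 'X.
 apply/polyP => i; rewrite coefD coefMX; have := odd_double_half i; rewrite -mul2n => <-.
 case: (odd i); rewrite ?add1n ?add0n /=.
  by rewrite (coef_sq A _).2 add0r (coef_sq B _).1 cB.
 rewrite (coef_sq A _).1 cA; case: i./2 => [|m]; first by rewrite muln0 eqxx addr0.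
 have -> : (2 * m.+1 = (2 * m).+2)%N by lia.
 by rewrite /= (coef_sq B _).2 addr0.
have B0 : B != 0.
 apply/eqP => B0; have := model_eq M; rewrite pev0 mul0r addr0 fe B0 expr0n mul0r addr0 pevXn => /eqP.
 rewrite eqf_sqr => /orP[/eqP e|/eqP e]; have := model_y_notin A M; rewrite ?e ?eqxx //.
 have -> : - ev x A = ev x (- A) by rewrite !pevE.
 have -> : - A = A by apply/eqP; rewrite eq_sym -addr_eq0 -mulr2n t0.
 by rewrite eqxx.
exists ((y - ev x A) / ev x B); split; last exact: (smooth_char2 two0).
apply: (model_reduce M B0); first by rewrite t0 mulr0 add0r.
by rewrite fe mul0r subr0; ring.
Qed.

(** Every singular point lowers G, so the reduction ends. At G = 0 the function y would be a
    constant, against [constants_closed]. The alternative G' = 1 records the inseparable case, where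
    the new level is 1 whatever G was. *)
Lemma smooth_model_ex x y h f G : constants_closed K -> model x y h f ->
 (size h <= G.+1)%N -> (size f <= (2 * G).+1)%N ->
 (0 < G)%N /\ (smooth G h f \/ exists G' y' h' f',
   [/\ (G' < G)%N \/ G' = 1%N, model x y' h' f' & smooth G' h' f']).
move=> cc; elim/ltn_ind: G y h f => G IH y h f M sh sf.
have G0 : (0 < G)%N.
 case: G {IH} sh sf => // /size1_polyC sh /size1_polyC sf; exfalso.
 move: M; rewrite sh sf; move: h`_0 f`_0 => a b M.
 have [|c _ e] := cc y; last by have := model_y_notin c%:P M; rewrite pevC e eqxx.
 exists ('X^2 + a *: 'X - b%:P).
  apply/eqP => /polyP/(_ 2%N)/eqP.
  by rewrite coefB coefD coefXn coefZ coefX coefC coef0 mulr0 addr0 subr0 oner_eq0.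
 have := model_eq M; rewrite !pevC => e; apply/eqP.
 by rewrite -/(pev (emb K) y _) pevB pevD pevXn pevZ pevX pevC e subrr.
split=> //; have [S|nS] := pselect (smooth G h f); [by left|right].
have [D0|D0] := eqVneq (disc h f) 0.
 by have [y' [M' S']] := model_disc0 M D0; exists 1%N, y', 0, 'X; split=> //; right.
have step G1 y1 h1 f1 : (G1 < G)%N -> model x y1 h1 f1 -> (size h1 <= G1.+1)%N -> (size f1 <= (2 * G1).+1)%N ->
 exists G' y' h' f', [/\ (G' < G)%N \/ G' = 1%N, model x y' h' f' & smooth G' h' f'].
 move=> lt M1 s1 s2; have [_ [S1|[G' [y' [h' [f' [lt' M' S']]]]]]] := IH _ lt _ _ _ M1 s1 s2.
  by exists G1, y1, h1, f1; split=> //; left.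
 by exists G', y', h', f'; split=> //; case: lt' => [lt'|]; [left; apply: ltn_trans lt|right].
have [fin|/existsNP[p /not_implyP[sp /existsNP[b /not_implyP[d1 /not_implyP[d2 _]]]]]] :=
 pselect (forall p : {poly k}, (1 < size p)%N -> nonsingular h f p); last first.
 have [b0 [h' [f' [e1 e2 pG sb [s1 s2]]]]] := reduce_pair sh sf D0 sp d1 d2.
 apply: step (model_reduce M _ e1 e2) s1 s2; last by rewrite -size_poly_gt0 ltnW.
 by move: (size p) sp pG => ? ?; lia.
case: G G0 {IH} sh sf step nS => // G _ sh sf step nS.
have [c [s1 s2]] : exists c, inf_singular G.+1 h f c.
 by apply: contrapT => /forallNP ns; apply: nS; split=> //; apply/nonsingular_inf.
have M1 : model x ((y - ev x (c *: 'X^(G.+1))) / ev x 1) (h + (c *: 'X^(G.+1)) *+ 2)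
  (f - h * (c *: 'X^(G.+1)) - (c *: 'X^(G.+1)) ^+ 2).
 by apply: (model_reduce M (oner_neq0 _)); rewrite ?expr1n mul1r.
apply: step M1 s1 _ => //; have e2 : (2 * G.+1).-1 = (2 * G).+1 by lia.
by rewrite -e2.
Qed.

End SmoothModel.

(** * Extensions of k(x) of degree 2 *)

Section SimpleExtension.
Variables (k : fieldType) (K : extension k) (x : K).
Notation ev := (pev (emb K) x).

Lemma model_transcendental y h f : model x y h f -> is_transcendental x.
move=> M [p p0 /rootP px]; have [] := model_free M (a := p) (b := 0).
 by rewrite pev0 mul0r addr0.
by move=> e; rewrite e eqxx in p0.
Qed.

Hypothesis tr : is_transcendental x.

Lemma ev_neq0 (p : {poly k}) : p != 0 -> ev p != 0.
Proof. by move=> p0; apply/eqP => e; apply: tr; exists p => //; apply/rootP. Qed.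

Lemma simple_extE z : simple_ext x z <-> exists p q, q != 0 /\ z * ev q = ev p.
split=> -[p [q [q0 e]]]; exists p, q; split=> //.
 by rewrite e mulfVK // ev_neq0.
by rewrite -/(ev q) -/(ev p) -e mulfK // ev_neq0.
Qed.

Lemma simple_ext_ev p : simple_ext x (ev p).
Proof. by apply/simple_extE; exists p, 1; rewrite oner_neq0 pev1 mulr1. Qed.

Lemma simple_extB u w : simple_ext x u -> simple_ext x w -> simple_ext x (u - w).
move=> /simple_extE[p [q [q0 e]]] /simple_extE[p' [q' [q0' e']]]; apply/simple_extE.
exists (p * q' - p' * q), (q * q'); rewrite mulf_neq0 //; split=> //.
rewrite !pevE -e -e'; ring.
Qed.

Lemma simple_extM u w : simple_ext x u -> simple_ext x w -> simple_ext x (u * w).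
move=> /simple_extE[p [q [q0 e]]] /simple_extE[p' [q' [q0' e']]]; apply/simple_extE.
exists (p * p'), (q * q'); rewrite mulf_neq0 //; split=> //.
rewrite !pevE -e -e'; ring.
Qed.

Lemma simple_extV u : simple_ext x u -> simple_ext x u^-1.
have [->|u0] := eqVneq u 0; first by rewrite invr0.
move=> /simple_extE[p [q [q0 e]]]; apply/simple_extE; exists q, p; split.
 by apply: contraTneq (mulf_neq0 u0 (ev_neq0 q0)) => p0; rewrite e p0 pev0 eqxx.
by rewrite -e mulKf.
Qed.

Lemma simple_ext0 : simple_ext x 0.
Proof. by rewrite -(pev0 (emb K) x); apply: simple_ext_ev. Qed.

(** Multiplying y by a common denominator q1 q2 of the coefficients of its equation makes the
    equation integral over k[x]. *)
Lemma model_of_basis y : ~ simple_ext x y ->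
 (forall z, exists a b, [/\ simple_ext x a, simple_ext x b & z = a + b * y]) ->
 exists y h f, model x y h f.
move=> ny sp; have [a [b [/simple_extE[p1 [q1 [q10 ea]]] /simple_extE[p2 [q2 [q20 eb]]] ey]]] := sp (y ^+ 2).
have eq0 : ev (q1 * q2) != 0 by rewrite ev_neq0 ?mulf_neq0.
exists (ev (q1 * q2) * y), (- (p2 * q1)), (p1 * q1 * q2 ^+ 2); split.
- rewrite exprMn ey !pevE -ea -eb; ring.
- move=> a' b' e.
 have b0 : b' = 0.
  apply/eqP; apply/negPn/negP => /ev_neq0 b0; apply: ny.
  have -> : y = (0 - ev a') * (ev b' * ev (q1 * q2))^-1.
   apply: (mulIf (mulf_neq0 b0 eq0)); rewrite divfK ?mulf_neq0 //.
   by rewrite sub0r; apply: (addrI (ev a')); rewrite subrr -[RHS]e; ring.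
  apply: simple_extM; first by apply: simple_extB; [apply: simple_ext0|apply: simple_ext_ev].
  by apply: simple_extV; rewrite -pevM; apply: simple_ext_ev.
 split=> //; move: e; rewrite b0 pev0 mul0r addr0 => e.
 by apply/eqP; apply: contra_eqT e => /ev_neq0.
- move=> z; have [u [w [/simple_extE[p [q [q0 eu]]] /simple_extE[p' [q' [q0' ew]]] ->]]] := sp z.
 exists (p * q' * q1 * q2), (p' * q), (q * q' * q1 * q2); rewrite !mulf_neq0 //; split=> //.
 rewrite !pevE -eu -ew; ring.
Qed.

Lemma span_with1 (u v : K) : ~ simple_ext x v ->
 (forall z, exists a b, [/\ simple_ext x a, simple_ext x b & z = a * u + b * v]) ->
 forall z, exists a b, [/\ simple_ext x a, simple_ext x b & z = a + b * v].
move=> nv sp z; have [c [d [Sc Sd e1]]] := sp 1; have [a [b [Sa Sb ez]]] := sp z.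
have c0 : c != 0.
 apply/eqP => c0; apply: nv; move: e1; rewrite c0 mul0r add0r => e1.
 have d0 : d != 0 by apply: contra_eq_neq e1 => ->; rewrite mul0r oner_neq0.
 by have -> : v = d^-1; [apply: (mulfI d0); rewrite -e1 mulfV|apply: simple_extV].
exists (a / c), (b - a / c * d); split.
- by apply: simple_extM => //; apply: simple_extV.
- by apply: simple_extB => //; apply: simple_extM => //; apply: simple_extM => //; apply: simple_extV.
- have eu : u = (1 - d * v) / c by apply: (mulIf c0); rewrite divfK // e1; ring.
 by rewrite ez eu; field.
Qed.

Lemma degree2_model : has_dim (simple_ext x) [set: K] [set 0] 2 -> exists y h f, model x y h f.
move=> [e [_ H]].
have sp z : exists a b, [/\ simple_ext x a, simple_ext x b & z = a * e 0 + b * e 1].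
 have [c [[Sc /eqP]]] := H z I; rewrite big_ord_recl big_ord1 subr_eq0 => /eqP -> _.
 have -> : lift ord0 ord0 = 1 :> 'I_2 by apply: val_inj.
 by exists (c 0), (c 1).
have sp' z : exists a b, [/\ simple_ext x a, simple_ext x b & z = a * e 1 + b * e 0].
 by have [a [b [? ? ->]]] := sp z; exists b, a; rewrite addrC.
have [S1|n1] := pselect (simple_ext x (e 1)); last exact: model_of_basis n1 (span_with1 n1 sp).
have [S0|n0] := pselect (simple_ext x (e 0)); last exact: model_of_basis n0 (span_with1 n0 sp').
(* With both basis vectors in k(x), the relation e 1 e 0 - e 0 e 1 = 0 is an admissible expansion of
   0, so uniqueness makes its coefficients vanish. *)
have zero (i : 'I_2) : e i = 0.
 have [c [_ U]] := H 0 I.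
 have u1 : c = [ffun=> 0].
  apply: U; split=> [l|]; first by rewrite ffunE; apply: simple_ext0.
  by rewrite /= big1 ?subr0 // => l _; rewrite ffunE mul0r.
 have := U [ffun l => if l == 0 then e 1 else - e 0].
 rewrite u1 => U2.
 have : [ffun=> 0] = [ffun l : 'I_2 => if l == 0 then e 1 else - e 0].
  apply: U2; split=> [l|].
   rewrite ffunE; case: eqP => _ //; rewrite -sub0r.
   by apply: simple_extB => //; apply: simple_ext0.
  rewrite /= big_ord_recl big_ord1 !ffunE /=.
  have -> : lift ord0 ord0 = 1 :> 'I_2 by apply: val_inj.
  ring.
 move=> /ffunP E; have := E 0; have := E 1; rewrite !ffunE /= => /eqP; rewrite eq_sym oppr_eq0 => /eqP e0 e1.
 by case: i => [[|[|//]]] li; [rewrite -[RHS]e0|rewrite [RHS]e1]; congr e; apply: val_inj.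
have [a [b [_ _ /eqP]]] := sp 1; rewrite !zero !mulr0 addr0.
by rewrite oner_eq0.
Qed.
End SimpleExtension.

Lemma model_degree2 (k : fieldType) (K : extension k) (x y : K) h f : model x y h f ->
 has_dim (simple_ext x) [set: K] [set 0] 2.
move=> M; have tr := model_transcendental M.
exists (fun i => if i == 0 then 1 else y); split=> // z _.
have [a [b [c [c0 ez]]]] := model_gen M z.
have ec0 := ev_neq0 tr c0.
exists [ffun i => if i == 0 then pev (emb K) x a / pev (emb K) x c else pev (emb K) x b / pev (emb K) x c].
split.
 split=> [i|]; first by rewrite ffunE; case: eqP => _; [exists a, c|exists b, c].
 rewrite /= big_ord_recl big_ord1 !ffunE /= mulr1.
 by apply: (mulIf ec0); rewrite mul0r mulrBl ez mulrDl divfK // mulrAC divfK // subrr.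
move=> g [Sg /eqP]; rewrite big_ord_recl big_ord1 /= mulr1 subr_eq0 => /eqP e.
have /(simple_extE tr)[p0 [q0 [q00 e0]]] := Sg 0.
have /(simple_extE tr)[p1 [q1 [q10 e1]]] := Sg 1.
have g0 : ord0 = 0 :> 'I_2 by apply: val_inj.
have g1 : lift ord0 ord0 = 1 :> 'I_2 by apply: val_inj.
rewrite g0 g1 in e.
have [A B] : (a * q0 * q1 - p0 * c * q1 = 0) /\ (b * q0 * q1 - p1 * c * q0 = 0).
 apply: (model_free M); rewrite !pevE -e0 -e1.
 transitivity (pev (emb K) x q0 * pev (emb K) x q1 * ((pev (emb K) x a + pev (emb K) x b * y) - pev (emb K) x c * (g 0 + g 1 * y))); first by ring.
 by rewrite -ez -e; ring.
apply/ffunP => i; rewrite ffunE; apply: (mulIf ec0); case: eqP => [->|ne].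
 rewrite divfK //; apply: (mulIf (ev_neq0 tr q00)); apply: (mulIf (ev_neq0 tr q10)).
 move/subr0_eq/(congr1 (pev (emb K) x)): A; rewrite !pevE => ->; rewrite -e0; ring.
have -> : i = 1 by case: i ne => [[|[|//]]] li ne; [case: ne|]; apply: val_inj.
rewrite divfK //; apply: (mulIf (ev_neq0 tr q00)); apply: (mulIf (ev_neq0 tr q10)).
move/subr0_eq/(congr1 (pev (emb K) x)): B; rewrite !pevE => ->; rewrite -e1; ring.
Qed.

(** * Uniqueness of the map of degree 2 *)

Section SmallMap.
Variables (k : fieldType) (K : extension k) (L : closedFieldType) (j : {rmorphism k -> L}) (jalg : forall z : L, algebraicOver j z) (x y x' y' : K) (h f h' f' : {poly k}) (G : nat) (M : model x y h f) (S : smooth G h f).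
Hypothesis M' : model x' y' h' f'.
Hypothesis S' : smooth G h' f'.
Notation ev := (pev (emb K) x).

Let tr := model_transcendental M.

(* Otherwise the x^i and x^i x' (i <= n) would be independent in L(n D + D'), where
  D and D' are the polar divisors of x and x'; since deg D' = 2 this would force
  2 n <= l(n D) = 2 n + 2 - G for large n. *)
Lemma smooth_x_simple : (2 < G)%N -> simple_ext x x'.
move=> G3; apply: contrapT => nx'.
(* This n is large enough: 2 G + 2 independent elements, less 2 for D', would have to fit into
   dimension G + 2, against G > 2. *)
pose n := G.
pose m0 (v : K -> int) : int := if v x < 0 then v x * n%:Z else 0.
have [vs [us H1 H2]] := enum_inf jalg M' S'.
pose V : set K := [set z | forall v, is_valuation v -> val_ge v (m0 v + Num.min 0 (v x')) z].
have kV : kspace V.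
 split=> [v vP|u w Vu Vw v vP|c w Vw v vP]; first by left.
  by apply: (val_geD vP); [apply: Vu|apply: Vw].
 by rewrite -[_ + _]add0r; apply: (val_geM vP); [apply: (val_geC vP)|apply: Vw].
have Lm0 z v : Lspace x n z -> is_valuation v -> val_ge v (m0 v) z.
 move=> Lz vP; have [L1 L2] := Lz v vP; rewrite /m0; case: ltP => vx; first exact: L2.
 by apply: L1; right.
have Vev (a : {poly k}) : (size a <= n.+1)%N -> V (ev a) /\ V (ev a * x').
 move=> sa; have La : Lspace x n (ev a).
  by have := affine_Lspace M S (a := a) (b := 0) sa; rewrite size_poly0 pev0 mul0r addr0; apply.
 split=> v vP.
  by apply: (val_ge_le _ (Lm0 _ _ La vP)); rewrite gerDl ge_min lexx.
 apply: (val_geM vP); first exact: Lm0.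
 by right; rewrite ge_min lexx orbT.
pose N := (n.+1 + n.+1)%N.
pose b (i : 'I_N) : K :=
 match fintype.split i with inl l => x ^+ l | inr l => x ^+ l * x' end.
have bE (A : 'I_N -> k) : \sum_i emb K (A i) * b i =
  ev (\poly_(i < n.+1) oapp (fun l => A (lshift _ l)) 0 (insub i)) +
  ev (\poly_(i < n.+1) oapp (fun l => A (rshift _ l)) 0 (insub i)) * x'.
 rewrite big_split_ord /= /pev; congr (_ + _).
  rewrite (horner_coef_wide (n := n.+1)) ?size_map_poly ?size_poly //.
  apply: eq_bigr => i _; rewrite coef_map coef_poly ltn_ord valK /=.
  by rewrite /b (unsplitK (inl _ i)).
 rewrite (horner_coef_wide (n := n.+1)) ?size_map_poly ?size_poly // mulr_suml.
 apply: eq_bigr => i _; rewrite coef_map coef_poly ltn_ord valK /=.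
 by rewrite /b (unsplitK (inr _ i)) mulrA.
have fV : free_mod V [set 0] N.
 exists b; split=> [i|c /= ].
  have := bE (fun i' => (i' == i)%:R); rewrite (bigD1 i) //= eqxx rmorph1 mul1r.
  rewrite big1 ?addr0 => [->|i' ni]; last by rewrite (negPf ni) rmorph0 mul0r.
  by case: kV => _ VD _; apply: VD; [apply: (proj1 (Vev _ _))|apply: (proj2 (Vev _ _))]; apply: size_poly.
 rewrite bE; set p := \poly_(i < _) _; set q := \poly_(i < _) _ => e.
 have q0 : q = 0.
  apply/eqP/negPn/negP => /(ev_neq0 tr) q0; apply: nx'.
  have -> : x' = ev (- p) * (ev q)^-1.
   by apply: (mulIf q0); rewrite mulfVK // pevN; apply/eqP; rewrite -addr_eq0 addrC mulrC e.
  by apply: (simple_extM tr); [|apply: (simple_extV tr)]; apply: (simple_ext_ev tr).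
 have p0 : p = 0.
  by apply/eqP; move: e; rewrite q0 pev0 mul0r addr0; apply: contra_eqT => /(ev_neq0 tr).
 move=> i; case: (split_ordP i) => l il.
  by have /polyP/(_ l) := p0; rewrite coef_poly ltn_ord valK coef0 /= -il.
 by have /polyP/(_ l) := q0; rewrite coef_poly ltn_ord valK coef0 /= -il.
have hv v : v \in vs -> [/\ is_valuation v, val_degree v (vdeg v) &
  forall z, V z -> val_ge v (m0 v + Num.min 0 (v x')) z].
 by move=> /H1[vP _]; split=> // [|z Vz]; [apply: (vdegP jalg M S)|apply: Vz].
have fr := free_mod_multi (fun v => `|v x'|%N) kV hv fV.
have sub z : (V `&` [set z | forall v, v \in vs -> val_ge v (m0 v + Num.min 0 (v x') + `|v x'|%N%:Z) z]) z ->
  Lspace x n z.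
 move=> [Vz Hz]; have key v : is_valuation v -> val_ge v (m0 v) z.
  move=> vP; have [vx'|vx'] := ltP (v x') 0.
   have := Hz v (H2 v vP vx'); have -> // : m0 v + Num.min 0 (v x') + `|v x'|%N%:Z = m0 v.
   by rewrite minElt ltNge (ltW vx') /= -addrA abszE ltr0_norm // subrr addr0.
  have -> : m0 v = m0 v + Num.min 0 (v x') by rewrite min_l // addr0.
  exact: Vz.
 move=> v vP; split=> vx; have := key v vP; rewrite /m0.
  by case: vx => [->|]; [rewrite v0 ?ltxx|rewrite leNgt => /negbTE ->].
 by rewrite vx.
have fr' : free_mod (Lspace x n) [set 0] (N - \sum_(v <- vs) `|v x'| * vdeg v).
 exact: free_mod_sub (leqnn _) sub fr.
have le := has_dim_free_le (kspace_Lspace x n) (has_dim_Lspace jalg M S n) fr'.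
have := sum_inf_eq jalg M' S' (ltnW (ltnW G3)) us H1 H2.
have -> : \sum_(v <- vs) v x' * (vdeg v)%:Z = - (\sum_(v <- vs) `|v x'| * vdeg v)%N%:Z.
 rewrite -natz natr_sum -sumrN big_seq [RHS]big_seq; apply: eq_bigr => v /H1[_ vx'].
 by rewrite natz PoszM abszE ltr0_norm // mulNr opprK.
move: le G3; rewrite /N /n; move: (\sum_(v <- vs) _)%N => s; lia.
Qed.

(** Let x' = p / q in lowest terms and let d be the larger of the two degrees. By a Bezout relation
    1 / q is u(x) x' + w(x), and the functions x^i / q with i <= d are sections of level 1 for x', a
    space of dimension 2 as G > 2. Hence d <= 1. *)
Lemma smooth_x_mobius : (2 < G)%N -> exists p q : {poly k},
 [/\ (size p <= 2)%N, (size q <= 2)%N, q != 0 & x' * ev q = ev p].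
move=> G3; have /(simple_extE tr)[p0 [q0 [q00 e0]]] := smooth_x_simple G3.
have tr' := model_transcendental M'.
have [p [q [q1 e cop]]] : exists p q : {poly k}, [/\ q != 0, x' * ev q = ev p & coprimep p q].
 exists (p0 %/ gcdp p0 q0), (q0 %/ gcdp p0 q0).
 have g0 : gcdp p0 q0 != 0 by rewrite gcdp_eq0 negb_and q00 orbT.
 have ep := divpK (dvdp_gcdl p0 q0); have eq := divpK (dvdp_gcdr p0 q0).
 split; first by apply: contraNneq q00 => e; rewrite -eq e mul0r.
  by apply: (mulIf (ev_neq0 tr g0)); rewrite -mulrA -!pevM ep eq.
 by apply: coprimep_div_gcd; rewrite q00 orbT.
have p1 : p != 0.
 apply: contraPneq tr' => p1; rewrite p1 pev0 in e.
 have -> : x' = 0 by apply: (mulIf (ev_neq0 tr q1)); rewrite e mul0r.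
 by case; exists 'X; rewrite ?polyX_eq0 ?map_polyX ?rootX.
have [[u w] /= uw] := Bezout_eq1_coprimepP _ _ cop.
pose d := maxn (size p).-1 (size q).-1.
have eq0 := ev_neq0 tr q1.
have x0 := model_x0 M.
have qV : (ev q)^-1 = ev u * x' + ev w.
 by apply: (mulIf eq0); rewrite mulVf // mulrDl -mulrA e -!pevM -pevD uw pev1.
have key i v : (i <= d)%N -> is_valuation v -> val_ge v (Num.min 0 (v x')) (x ^+ i * (ev q)^-1).
 move=> lei vP; have [vx|vx] := ltP (v x) 0.
  right; rewrite (vM vP) ?expf_neq0 ?invr_eq0 // (vX vP) (vV vP).
  have [vq _] := val_ev_inf vP vx q1; have [vp _] := val_ev_inf vP vx p1.
  have x'0 : x' != 0 by apply: contraTneq (ev_neq0 tr p1) => x'0; rewrite -e x'0 mul0r eqxx.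
  have := vM vP x'0 eq0; rewrite e vq vp => vx'.
  have {vx'} -> : v x' = v x * ((size p).-1%:Z - (size q).-1%:Z) by rewrite mulrBr vx' addrK.
  move: lei vx; rewrite /d -mulr_natr natz; move: (v x) (size p).-1 (size q).-1 => a P Q; nia.
 have vx' : val_ge v 0 x by right.
 rewrite -[Num.min _ _]add0r; apply: (val_geM vP); first exact: val_geX.
 rewrite qV; apply: (val_geD vP).
  rewrite -[Num.min _ _]add0r; apply: (val_geM vP); first exact: val_ge_pev.
  by right; rewrite ge_min lexx orbT.
 by apply: (val_ge_le _ (val_ge_pev vP _ vx')); rewrite ge_min lexx.
have fr : free_mod (Lspace x' 1) [set 0] d.+1.
 exists (fun i : 'I_d.+1 => x ^+ i * (ev q)^-1); split=> [i|c /= e'].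
  move=> v vP; have H := key i v (ltn_ord i) vP; split=> vx.
   apply: (val_ge_le _ H); rewrite le_min lexx /=.
   by case: vx => [->|//]; rewrite (v0 vP).
  by apply: (val_ge_le _ H); rewrite mulr1 le_min lexx (ltW vx).
 have : ev (\poly_(i < d.+1) oapp c 0 (insub i)) = 0.
  rewrite /pev (horner_coef_wide (n := d.+1)) ?size_map_poly ?size_poly //.
  apply: (mulIf (invr_neq0 eq0)); rewrite mul0r mulr_suml -[RHS]e'.
  by apply: eq_bigr => i _; rewrite coef_map coef_poly ltn_ord valK mulrA.
 move=> e2 i; have : \poly_(i < d.+1) oapp c 0 (insub i) = 0.
  by apply/eqP; apply: contra_eqT e2 => /(ev_neq0 tr).
 by move/polyP/(_ i); rewrite coef_poly ltn_ord valK coef0.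
have := has_dim_free_le (kspace_Lspace x' 1) (has_dim_Lspace jalg M' S' 1) fr.
rewrite /d => le; exists p, q; split=> //; move: le G3; move: (size p) (size q) => P Q; lia.
Qed.
End SmallMap.

(** * Coordinate changes *)

Section ModelChange.
Variables (k : fieldType) (K : extension k).
Notation ev x := (pev (emb K) x).

Record gmodel (G : nat) (x y : K) (h f : {poly k}) : Prop := GModel {
 gmodel_model :> model x y h f;
 gmodel_h : (size h <= G.+1)%N;
 gmodel_f : (size f <= (2 * G).+1)%N }.

Lemma model_uniq (x y : K) h f h' f' : model x y h f -> model x y h' f' -> h = h' /\ f = f'.
move=> M M'; have [] := model_free M (a := f' - f) (b := h - h').
 rewrite !pevE -(model_eq M) -(model_eq M'); ring.
by move=> /subr0_eq -> /subr0_eq ->.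
Qed.

Lemma gmodel_affine G (x y : K) h f e (r : {poly k}) : gmodel G x y h f -> e != 0 -> (size r <= G.+1)%N ->
 gmodel G x (emb K e * y + ev x r) (e *: h - r *+ 2) (e ^+ 2 *: f + e *: (h * r) - r ^+ 2).
move=> [M sh sf] e0 sr; have ee0 : emb K e != 0 by rewrite fmorph_eq0.
split; first split.
- by rewrite !pevE rmorphXn -(model_eq M); ring.
- move=> a b E; have [] := model_free M (a := a + b * r) (b := e *: b).
  by rewrite !pevE -[RHS]E; ring.
 move=> E1 /eqP; rewrite scaler_eq0 (negPf e0) /= => /eqP b0; split=> //.
 by move: E1; rewrite b0 mul0r addr0.
- move=> z; have [a [b [c [c0 E]]]] := model_gen M z.
 exists (a - e^-1 *: (b * r)), (e^-1 *: b), c; split=> //.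
 by rewrite E !pevE fmorphV; field.
- rewrite size_polyD_leq // size_polyN (leq_trans (size_scale_leq _ _)) //=.
 by rewrite -scaler_nat (leq_trans (size_scale_leq _ _)).
- have sM (p q : {poly k}) : (size p <= G.+1)%N -> (size q <= G.+1)%N -> (size (p * q)%R <= (2 * G).+1)%N.
  move=> sp sq; apply: leq_trans (size_polyMleq _ _) _.
  by move: sp sq; move: (size p) (size q) => ? ?; lia.
 rewrite size_polyD_leq // size_polyN expr2 sM // andbT.
 rewrite size_polyD_leq // !(leq_trans (size_scale_leq _ _)) // sM //.
Qed.

Lemma pev_comp x p q : ev x (p \Po q) = ev (ev x q) p.
Proof. by rewrite /pev map_comp_poly horner_comp. Qed.

Lemma gmodel_shift G x y h f a b : gmodel G x y h f -> a != 0 ->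
 exists h' f', gmodel G (emb K a * x + emb K b) y h' f'.
move=> [M sh sf] a0; have ea0 : emb K a != 0 by rewrite fmorph_eq0.
pose l : {poly k} := a^-1 *: 'X - (b / a)%:P; pose l' : {poly k} := a *: 'X + b%:P.
pose x' := emb K a * x + emb K b.
have lx : ev x' l = x by rewrite !pevE rmorphM fmorphV /x'; field.
have lx' : ev x l' = x' by rewrite !pevE.
have ll : l \Po l' = 'X.
 rewrite /l comp_polyB comp_polyZ comp_polyX comp_polyC /l' scalerDr scalerA mulVf // scale1r.
 by rewrite -mul_polyC -polyCM mulrC addrK.
have l1 : size l = 2.
 rewrite /l size_polyDl ?size_scale ?invr_eq0 ?size_polyX //.
 by rewrite -polyCN (leq_ltn_trans (size_polyC_leq1 _)).
have l1' : size l' = 2.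
 by rewrite /l' size_polyDl ?size_scale ?size_polyX // (leq_ltn_trans (size_polyC_leq1 _)).
exists (h \Po l), (f \Po l); split; first split.
- by rewrite !pev_comp lx (model_eq M).
- move=> A B; rewrite -/x' -lx' -!pev_comp => /(model_free M)[/eqP A0 /eqP B0].
 by move: A0 B0; rewrite !comp_poly2_eq0 // => /eqP -> /eqP ->.
- move=> z; have [A [B [C [C0 E]]]] := model_gen M z; exists (A \Po l), (B \Po l), (C \Po l).
 by rewrite comp_poly2_eq0 // C0 -/x' !pev_comp lx.
- by rewrite size_comp_poly2.
- by rewrite size_comp_poly2.
Qed.

Lemma gmodel_inv G x y h f : gmodel G x y h f -> exists h' f', gmodel G x^-1 (y / x ^+ G) h' f'.
move=> [M sh sf]; exists (rev_poly G h), (rev_poly (2 * G) f); split.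
- exact: model_inv.
- exact: size_rev_poly.
- exact: size_rev_poly.
Qed.
End ModelChange.

Section Parametrization.
Variables (k : finFieldType) (G : nat).

(** Each Moebius map occurs exactly once, as a x + b or as a + b / (x + d); the second component (e,
    r) sends y to e y + r(x) before division by the power of the denominator. The parameters form a
    product, so that the type is finite, and [is_change] selects the invertible ones. *)
Definition change : finType := ((k * k + k * k * k) * (k * 'rV[k]_G.+1))%type.

Definition is_change (t : change) : bool :=
 match t.1 with inl (a, b) => a != 0 | inr (a, b, d) => b != 0 end && (t.2.1 != 0).

Definition change_x (K : extension k) (x : K) (t : change) : K :=
 match t.1 with
 | inl (a, b) => emb K a * x + emb K b
 | inr (a, b, d) => emb K a + emb K b / (x + emb K d)
 end.

Definition change_den (K : extension k) (x : K) (t : change) : K :=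
 match t.1 with inl _ => 1 | inr (a, b, d) => x + emb K d end.

Definition change_y (K : extension k) (x y : K) (t : change) : K :=
 (emb K t.2.1 * y + pev (emb K) x (rVpoly t.2.2)) / change_den x t ^+ G.

(** The two shapes contribute q (q - 1) and q^2 (q - 1) Moebius maps. *)
Lemma card_is_change (q := #|k|) :
 #|[pred t | is_change t]| = ((q ^ 3 - q) * (q - 1) * q ^ G.+1)%N.
have q0 : (0 < q)%N by rewrite /q; apply/card_gt0P; exists 0.
have cN0 : #|[pred a : k | a != 0]| = (q - 1)%N by rewrite subn1 -(cardC1 (0 : k)).
pose A := [pred s : k * k + k * k * k | match s with inl (a, b) => a != 0 | inr (a, b, d) => b != 0 end].
pose B := [pred s : k * 'rV[k]_G.+1 | s.1 != 0].
have -> : #|[pred t | is_change t]| = (#|A| * #|B|)%N.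
 by rewrite -cardX; apply: eq_card => -[t s]; rewrite !inE /is_change /=.
have -> : #|B| = ((q - 1) * q ^ G.+1)%N.
 have -> : #|B| = #|[predX [pred a : k | a != 0] & predT : pred 'rV[k]_G.+1]|.
  by apply: eq_card => -[t s]; rewrite !inE /= andbT.
 by rewrite cardX cN0 card_mx mul1n.
have -> : #|A| = (q ^ 3 - q)%N.
 rewrite -sum1_card big_sumType /= (eq_bigl (mem [predX [pred a : k | a != 0] & predT])); last first.
  by move=> [a b]; rewrite !inE andbT.
 rewrite sum1_card cardX cN0 cardT.
 rewrite (eq_bigl (mem [predX [predX predT & [pred a : k | a != 0]] & predT])); last first.
  by move=> [[a b] d]; rewrite !inE andbT.
 rewrite sum1_card !cardX cN0 !cardT -cardE -/q; move: q0; rewrite /q; move: #|k| => n; nia.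
by rewrite mulnA.
Qed.
End Parametrization.

(** * All smooth models of a given curve *)

Section SmoothModels.
Variables (k : finFieldType) (K : extension k) (L : closedFieldType) (j : {rmorphism k -> L}) (jalg : forall z : L, algebraicOver j z).
Notation ev x := (pev (emb K) x).

(** A singular pair would lead to a smooth model with smaller G, or with G = 1, and thus to a
    different genus. *)
Lemma gmodel_smooth g (x y : K) h f : (0 < g)%N -> constants_closed K -> has_genus K g ->
 gmodel g.+1 x y h f -> smooth g.+1 h f.
move=> g0 cc gen [M sh sf].
have [_ [//|[G' [y' [h' [f' [H M' S']]]]]]] := smooth_model_ex cc M sh sf.
have [G'0 _] := smooth_model_ex cc M' (smooth_h S') (smooth_f S').
by have := (smooth_genus jalg M' S' g G'0).1 gen; lia.
Qed.

Lemma hyperelliptic_smooth_model g : (0 < g)%N -> is_hyperelliptic K g ->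
 exists (x y : K) h f, [/\ model x y h f, smooth g.+1 h f & disc h f != 0].
move=> g0 [[x [tr H]] cc gen]; have [y [h [f M]]] := degree2_model tr H.
have key y' h' f' G' : model x y' h' f' -> smooth G' h' f' ->
  exists (x y : K) h f, [/\ model x y h f, smooth g.+1 h f & disc h f != 0].
 move=> M' S'.
 have [G'0 _] := smooth_model_ex cc M' (smooth_h S') (smooth_f S').
 have e := (smooth_genus jalg M' S' g G'0).1 gen; rewrite -e in S'.
 exists x, y', h', f'; split=> //; apply/eqP => d0.
 have [y1 [M1 S1]] := model_disc0 M' d0.
 by have := (smooth_genus jalg M1 S1 g isT).1 gen; lia.
have sh : (size h <= (size h + size f).+1)%N by lia.
have sf : (size f <= (2 * (size h + size f)).+1)%N by lia.
have [_ [S|[G' [y' [h' [f' [_ M' S']]]]]]] := smooth_model_ex cc M sh sf; first exact: key M S.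
exact: key M' S'.
Qed.

Lemma smooth_hyperelliptic g (x y : K) h f : model x y h f -> smooth g.+1 h f -> is_hyperelliptic K g.
move=> M S; split.
- by exists x; split; [exact: model_transcendental M|exact: model_degree2 M].
- exact: (smooth_constants_closed jalg M S).
- by apply/(smooth_genus jalg M S).
Qed.

Lemma change_gmodel G (x y : K) h f t : gmodel G x y h f -> is_change t ->
 exists h' f', gmodel G (change_x x t) (@change_y k G K x y t) h' f'.
case: t => -[[a b]|[[a b] d]] [e r] M /andP[/= a0 e0].
 have Mr := gmodel_affine M e0 (size_poly _ _ : size (rVpoly r) <= G.+1)%N.
 by have [h' [f' M']] := gmodel_shift b Mr a0; exists h', f'; rewrite /change_y expr1n divr1.
have Mr := gmodel_affine M e0 (size_poly _ _ : size (rVpoly r) <= G.+1)%N.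
have [h1 [f1 M1]] := gmodel_shift d Mr (oner_neq0 k).
have [h2 [f2 M2]] := gmodel_inv M1.
have [h3 [f3 M3]] := gmodel_shift a M2 a0.
exists h3, f3; move: M3; rewrite rmorph1 mul1r /change_y /change_den /change_x /=.
by rewrite [emb K a + _]addrC.
Qed.

Variables (x y : K) (h f : {poly k}) (G : nat) (M : model x y h f) (S : smooth G h f).

Let tr := model_transcendental M.

Lemma xD_neq0 d : x + emb K d != 0.
have := ev_neq0 tr (p := 'X + d%:P); rewrite !pevE; apply.
by rewrite -size_poly_eq0 size_XaddC.
Qed.

Lemma change_den_neq0 (t : change k G) : change_den x t != 0.
Proof. by case: t => -[[a b]|[[a b] d]] [e r]; rewrite /change_den /= ?oner_neq0 ?xD_neq0. Qed.

Lemma ev_inj : injective (ev x).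
move=> p q e; apply/eqP; rewrite -subr_eq0; apply/eqP.
by have [] := model_free M (a := p - q) (b := 0) ltac:(by rewrite pev0 mul0r addr0 pevB e subrr).
Qed.

Lemma change_inj (t t' : change k G) : is_change t -> is_change t' ->
 change_x x t = change_x x t' -> change_y x y t = change_y x y t' -> t = t'.
move=> H H' ex ey.
have e1 : t.1 = t'.1.
 case: t t' H H' ex {ey} => -[[a b]|[[a b] d]] [e r] [] [[a' b']|[[a' b'] d']] [e' r'];
  rewrite /is_change /change_x /= => /andP[a0 _] /andP[a0' _] ex.
 - have /polyP E : a *: 'X + b%:P = a' *: 'X + b'%:P by apply: ev_inj; rewrite !pevE.
  have := E 0%N; have := E 1%N.
  by rewrite !coefD !coefZ !coefX !coefC /= !mulr1 !mulr0 !addr0 !add0r => -> ->.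
 - have /polyP E : (a *: 'X + (b - a')%:P) * ('X + d'%:P) = b'%:P.
   apply: ev_inj; rewrite !pevE rmorphB; have := xD_neq0 d' => dd.
   transitivity ((emb K a * x + emb K b - emb K a') * (x + emb K d')); first by ring.
   by rewrite ex; field.
  have := E 2; rewrite mulrDr -[_ * d'%:P]mulrC mul_polyC coefD coefMX coefZ !coefD !coefZ !coefX !coefC /=.
  by rewrite mulr1 addr0 mulr0 addr0 mulr0 addr0 => e0; rewrite e0 eqxx in a0.
 - have /polyP E : (a' *: 'X + (b' - a)%:P) * ('X + d%:P) = b%:P.
   apply: ev_inj; rewrite !pevE rmorphB; have := xD_neq0 d => dd.
   transitivity ((emb K a' * x + emb K b' - emb K a) * (x + emb K d)); first by ring.
   by rewrite -ex; field.
  have := E 2; rewrite mulrDr -[_ * d%:P]mulrC mul_polyC coefD coefMX coefZ !coefD !coefZ !coefX !coefC /=.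
  by rewrite mulr1 addr0 mulr0 addr0 mulr0 addr0 => e0; rewrite e0 eqxx in a0'.
 - have /polyP E : (a - a') *: (('X + d%:P) * ('X + d'%:P)) + b *: ('X + d'%:P) - b' *: ('X + d%:P) = 0.
   apply: ev_inj; rewrite !pevE rmorphB; have dd := xD_neq0 d; have dd' := xD_neq0 d'.
   transitivity (((emb K a + emb K b / (x + emb K d)) - (emb K a' + emb K b' / (x + emb K d'))) *
    ((x + emb K d) * (x + emb K d'))); first by field; rewrite dd dd'.
   by rewrite ex subrr mul0r rmorph0.
  have c2 : (('X + d%:P) * ('X + d'%:P))`_2 = 1 :> k.
   by rewrite mulrDl coefD coefXM coefCM !coefD !coefX !coefC /= !(addr0, mulr0).
  have := E 2; rewrite !coefD coefN !coefZ c2 !coefD !coefX !coefC /= mulr1 !(addr0, mulr0, subr0).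
  move=> /subr0_eq ea; subst a'; have := E 1%N; have := E 0%N.
  rewrite !coefD !coefN !coefZ subrr !mul0r !coefD !coefX !coefC /= !addr0 !add0r !mulr1 => e00 /subr0_eq eb.
  by subst b'; move/subr0_eq: e00 => /(mulfI a0) ->.
have eden : change_den x t = change_den x t' by rewrite /change_den e1.
have nz := expf_neq0 G (change_den_neq0 t').
move: ey; rewrite /change_y eden => /(mulIf (invr_neq0 nz)) ey.
have [] := model_free M (a := rVpoly t.2.2 - rVpoly t'.2.2) (b := (t.2.1 - t'.2.1)%:P).
 apply/eqP; rewrite !pevE rmorphB -(subrr (emb K t.2.1 * y + ev x (rVpoly t.2.2))) {2}ey; apply/eqP; ring.
move=> /subr0_eq/(congr1 (poly_rV (d := G.+1))); rewrite !rVpolyK => e3 /eqP.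
rewrite polyC_eq0 subr_eq0 => /eqP e2.
by case: t t' e1 e2 e3 {H H' ex ey eden nz} => [? [? ?]] [? [? ?]] /= -> -> ->.
Qed.

Lemma simple_ext_pev u p : simple_ext x u -> simple_ext x (ev u p).
move=> Su; rewrite /pev horner_coef; apply: big_ind => [|a b Sa Sb|i _]; first exact: simple_ext0.
- rewrite -[b]opprK -[- b]sub0r.
 by do 2!apply: (simple_extB tr) => //; apply: simple_ext0.
- rewrite coef_map; apply: (simple_extM tr).
  by have := simple_ext_ev tr (p`_i)%:P; rewrite pevC.
 elim: (nat_of_ord i) => [|n IH]; last by rewrite exprS; apply: (simple_extM tr).
 by rewrite expr0 -(pev1 (emb K) x); apply: simple_ext_ev.
Qed.

(** x' is a Moebius transform of x with denominator den. Comparing poles shows that den^G y' is a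
    section of level G, hence of the form a + b y with b constant. If b were 0, y' would lie in
    k(x), and so would y. *)
Lemma change_surj x' y' h' f' : (2 < G)%N -> model x' y' h' f' -> smooth G h' f' ->
 exists t : change k G, [/\ is_change t, change_x x t = x' & change_y x y t = y'].
move=> G3 M' S'; have tr' := model_transcendental M'.
have sx := smooth_x_simple jalg M S M' S' G3.
have [p [q [sp sq q0 epq]]] := smooth_x_mobius jalg M S M' S' G3.
have lin (r : {poly k}) : (size r <= 2)%N -> ev x r = emb K r`_1 * x + emb K r`_0.
 move=> sr; rewrite /pev (horner_coef_wide (n := 2)) ?size_map_poly // big_ord_recl big_ord1 !coef_map /=.
 by rewrite expr0 mulr1 expr1 addrC.
have nC c : x' <> emb K c.
 move=> e; apply: tr'; exists ('X - c%:P); first by rewrite polyXsubC_eq0.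
 by rewrite rmorphB /= map_polyX map_polyC root_XsubC e.
have e0 (c : k) : c != 0 -> emb K c != 0 by rewrite fmorph_eq0.
have [s [s0 es]] : exists s, match s with inl (a, b) => a != 0 | inr (a, b, d) => b != 0 end /\
  forall u, change_x x ((s, u) : change k G) = x'.
 move: epq; rewrite !lin //; have [q1|q1] := eqVneq q`_1 0.
  rewrite q1 rmorph0 mul0r add0r => epq.
  have q00 : q`_0 != 0.
   apply: contraNneq q0 => q00; apply/eqP/polyP => -[|[|i]]; rewrite coef0 //.
   by rewrite nth_default // (leq_trans sq).
  have e00 := e0 _ q00; exists (inl (p`_1 / q`_0, p`_0 / q`_0)).
  have ex : emb K (p`_1 / q`_0) * x + emb K (p`_0 / q`_0) = x'.
   by apply: (mulIf e00); rewrite epq !rmorphM !fmorphV; field.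
  split=> //; rewrite mulf_neq0 ?invr_eq0 //; apply/eqP => p1.
  by apply: (nC (p`_0 / q`_0)); rewrite -ex p1 mul0r rmorph0 mul0r add0r.
 move=> epq; have e01 := e0 _ q1.
 exists (inr (p`_1 / q`_1, (p`_0 - p`_1 * q`_0 / q`_1) / q`_1, q`_0 / q`_1)).
 have dd := xD_neq0 (q`_0 / q`_1).
 have dd' : emb K q`_1 * x + emb K q`_0 != 0.
  by have := mulf_neq0 e01 dd; rewrite mulrDr rmorphM fmorphV mulrCA mulfV // mulr1.
 have ex : emb K (p`_1 / q`_1) + emb K ((p`_0 - p`_1 * q`_0 / q`_1) / q`_1) / (x + emb K (q`_0 / q`_1)) = x'.
  apply: (mulIf dd'); rewrite epq.
  move: dd; rewrite !rmorphM !rmorphB !rmorphM !fmorphV => dd.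
  by field; rewrite ?e01 //= ?mulrA ?dd' // mulrC.
 split=> //; apply/eqP => e; apply: (nC (p`_1 / q`_1)); rewrite -ex.
 by rewrite /= in e; rewrite e rmorph0 mul0r addr0.
pose den := change_den x ((s, (1, 0)) : change k G).
have den0 : den != 0 by apply: change_den_neq0.
have bound v : is_valuation v -> Num.min 0 (v x) <= Num.min 0 (v x') + v den.
 move=> vP; have x'0 : x' != 0 by apply/eqP => e; apply: (nC 0); rewrite e rmorph0.
 have vx c : val_ge v (Num.min 0 (v x)) (x + emb K c).
  apply: (val_geD vP); first by right; rewrite ge_min lexx orbT.
  by apply: (val_ge_le _ (val_geC vP c)); rewrite ge_min lexx.
 move: s0 den0 (es (1, 0)); rewrite /den /change_x /change_den; case: (s) => [[a b]|[[a b] d]] /= a0 dd ex.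
  have [/eqP|] : val_ge v (Num.min 0 (v x)) x'; last by rewrite (v1 vP) addr0 => vx'; rewrite le_min vx' ge_min lexx.
   rewrite -ex -[Num.min _ _]add0r; have -> : emb K a * x + emb K b = emb K a * (x + emb K (b / a)).
    by rewrite mulrDr -rmorphM mulrCA mulfV // mulr1.
   by apply: (val_geM vP); [apply: (val_geC vP)|apply: vx].
  by rewrite (negPf x'0).
 have vd : Num.min 0 (v x) <= v (x + emb K d).
  by case: (vx d) => // /eqP; rewrite (negPf dd).
 suff [/eqP|vx'] : val_ge v (Num.min 0 (- v (x + emb K d))) x'.
 - by rewrite (negPf x'0).
 - by move: vd vx'; lia.
 rewrite -ex; apply: (val_geD vP).
  by apply: (val_ge_le _ (val_geC vP a)); rewrite ge_min lexx.
 rewrite -[Num.min _ _]add0r; apply: (val_geM vP); first exact: (val_geC vP).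
 by right; rewrite (vV vP) ge_min lexx orbT.
have Lz : Lspace x G (y' * den ^+ G).
 have key v : is_valuation v -> val_ge v (Num.min 0 (v x) * G%:Z) (y' * den ^+ G).
  move=> vP; have vd : v (den ^+ G) = v den * G%:Z by rewrite (vX vP) -mulr_natr natz.
  have y'v : val_ge v (Num.min 0 (v x') * G%:Z) y'.
   have [vx'|vx'] := ltP (v x') 0; first exact: (val_y_inf M' S').
   by rewrite mul0r; apply: (val_y M' vP); right.
  have : val_ge v ((Num.min 0 (v x') + v den) * G%:Z) (y' * den ^+ G).
   by rewrite mulrDl; apply: (val_geM vP) => //; right; rewrite vd.
  by apply: val_ge_le; rewrite ler_wpM2r ?bound.
 move=> v vP; have := key v vP; split=> vx.
  by move: H; case: vx => [->|vx]; rewrite ?(v0 vP) ?(min_l vx) ?minxx mul0r.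
 by rewrite (min_r (ltW vx)) in H.
have [a [b [ez sa sb]]] := Lspace_affine jalg M S Lz.
have b0 : b`_0 != 0.
 apply/eqP => b0; move: sb; rewrite subSnn => sb; move: ez; rewrite (size1_polyC sb) b0 pev0 mul0r addr0 => ez.
 have denG0 := expf_neq0 G den0.
 have Sd : simple_ext x (den ^+ G).
  have Sd : exists p, den = ev x p.
   rewrite /den /change_den; case: (s) => [[? ?]|[[? ?] d]] /=; first by exists 1; rewrite pev1.
   by exists ('X + d%:P); rewrite !pevE.
  by have [r ->] := Sd; rewrite -pevXn; apply: simple_ext_ev.
 have Sy' : simple_ext x y'.
  have -> : y' = ev x a * (den ^+ G)^-1 by rewrite -ez mulfK.
  by apply: (simple_extM tr); [apply: simple_ext_ev|apply: (simple_extV tr)].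
 have [A [B [C [C0 E]]]] := model_gen M' y; have C0' := ev_neq0 tr' C0.
 have : simple_ext x y.
  have -> : y = (ev x' A - (0 - ev x' B) * y') * (ev x' C)^-1.
   by apply: (mulIf C0'); rewrite mulfVK // E; ring.
  apply: (simple_extM tr); last by apply: (simple_extV tr); apply: simple_ext_pev.
  apply: (simple_extB tr); first exact: simple_ext_pev.
  apply: (simple_extM tr) => //; apply: (simple_extB tr); last exact: simple_ext_pev.
  exact: simple_ext0.
 move=> /(simple_extE tr)[P [Q [Q0 E2]]].
 have [_ Q00] := model_free M (a := - P) (b := Q) ltac:(by rewrite pevN -E2; ring).
 by rewrite Q00 eqxx in Q0.
exists (s, (b`_0, poly_rV a)); split; first by rewrite /is_change /= b0 andbT; case: (s) s0 => [[? ?]|[[? ?] ?]].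
 exact: es.
rewrite subSnn in sb.
rewrite /change_y /= poly_rV_K // -(pevC (emb K) x) -(size1_polyC sb).
have -> : change_den x ((s, (b`_0, poly_rV a)) : change k G) = den by [].
by rewrite [_ + ev x a]addrC -ez mulfK // expf_neq0.
Qed.
End SmoothModels.

(** * Isomorphisms between models *)

Section ModelIso.
Variables (k : fieldType) (K1 K2 : extension k) (x1 y1 : K1) (x2 y2 : K2) (h f : {poly k}) (M1 : model x1 y1 h f) (M2 : model x2 y2 h f).
Notation ev1 := (pev (emb K1) x1).
Notation ev2 := (pev (emb K2) x2).

(** The map (a + b y1) / c -> (a + b y2) / c is built as a graph because its argument has many such
    expressions. *)
Let graph (z : K1) (w : K2) : Prop := exists a b c,
 [/\ c != 0, z * ev1 c = ev1 a + ev1 b * y1 & w * ev2 c = ev2 a + ev2 b * y2].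

Let graph_total z : exists w, graph z w.
have [a [b [c [c0 e]]]] := model_gen M1 z.
have c0' : ev2 c != 0 by rewrite (ev_eq0 M2).
by exists ((ev2 a + ev2 b * y2) / ev2 c), a, b, c; split=> //; rewrite divfK.
Qed.

Let graph_fun z w w' : graph z w -> graph z w' -> w = w'.
move=> [a [b [c [c0 e1 e2]]]] [a' [b' [c' [c0' e1' e2']]]].
have nz : ev2 c != 0 by rewrite (ev_eq0 M2).
have nz' : ev2 c' != 0 by rewrite (ev_eq0 M2).
have [] := model_free M1 (a := a * c' - a' * c) (b := b * c' - b' * c).
 rewrite !pevE; transitivity ((ev1 a + ev1 b * y1) * ev1 c' - (ev1 a' + ev1 b' * y1) * ev1 c); first by ring.
 by rewrite -e1 -e1'; ring.
move=> /subr0_eq/(congr1 ev2); rewrite !pevE => ea /subr0_eq/(congr1 ev2); rewrite !pevE => eb.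
apply: (mulIf (mulf_neq0 nz nz')); rewrite mulrA e2 mulrCA [w' * _]mulrC mulrA -mulrA [ev2 c' * w']mulrC e2'.
by rewrite mulrDl mulrAC ea eb; ring.
Qed.

Let phi z := projT1 (cid (graph_total z)).
Let phiP z : graph z (phi z) := projT2 (cid (graph_total z)).
Let phiE z w : graph z w -> phi z = w := fun H => graph_fun (phiP z) H.

Let graphB z w z' w' : graph z w -> graph z' w' -> graph (z - z') (w - w').
move=> [a [b [c [c0 e1 e2]]]] [a' [b' [c' [c0' e1' e2']]]].
exists (a * c' - a' * c), (b * c' - b' * c), (c * c'); rewrite mulf_neq0 //; split=> //; rewrite !pevE.
 transitivity ((z * ev1 c) * ev1 c' - (z' * ev1 c') * ev1 c); first by ring.
 by rewrite e1 e1'; ring.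
transitivity ((w * ev2 c) * ev2 c' - (w' * ev2 c') * ev2 c); first by ring.
by rewrite e2 e2'; ring.
Qed.

Let graphM z w z' w' : graph z w -> graph z' w' -> graph (z * z') (w * w').
move=> [a [b [c [c0 e1 e2]]]] [a' [b' [c' [c0' e1' e2']]]].
exists (a * a' + b * b' * f), (a * b' + b * a' - b * b' * h), (c * c').
rewrite mulf_neq0 //; split=> //.
 by rewrite -(aff_mul M1) -e1 -e1' pevM; ring.
by rewrite -(aff_mul M2) -e2 -e2' pevM; ring.
Qed.

Let graphC a : graph (emb K1 a) (emb K2 a).
Proof. by exists a%:P, 0, 1; rewrite oner_neq0 !pevE !mulr1 !mul0r !addr0. Qed.

Lemma model_iso_ex : exists F : {rmorphism K1 -> K2},
 [/\ forall a, F (emb K1 a) = emb K2 a, F x1 = x2 & F y1 = y2].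
have fB : zmod_morphism phi by move=> u v; apply: phiE; apply: graphB.
have fM : monoid_morphism phi.
 split; last by move=> u v; apply: phiE; apply: graphM.
 by apply: phiE; rewrite -(rmorph1 (emb K1)) -(rmorph1 (emb K2)); apply: graphC.
pose fA := GRing.isZmodMorphism.Build K1 K2 phi fB.
pose fMM := GRing.isMonoidMorphism.Build K1 K2 phi fM.
pose F : {rmorphism K1 -> K2} := HB.pack phi fA fMM.
exists F; split=> [a||]; apply: phiE.
- exact: graphC.
- by exists 'X, 0, 1; rewrite oner_neq0 !pevE !mulr1 !mul0r !addr0.
- by exists 0, 1, 1; rewrite oner_neq0 !pevE !mulr1 !mul1r !add0r.
Qed.
End ModelIso.

Section Isomorphisms.
Variable k : fieldType.
Implicit Types K : extension k.

Lemma morph_pev K1 K2 (F : {rmorphism K1 -> K2}) x p :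
 (forall a, F (emb K1 a) = emb K2 a) -> F (pev (emb K1) x p) = pev (emb K2) (F x) p.
move=> Fe; rewrite /pev !horner_coef !size_map_poly rmorph_sum; apply: eq_bigr => i _.
by rewrite rmorphM rmorphXn !coef_map Fe.
Qed.

Lemma model_morph_uniq K1 K2 (F F' : {rmorphism K1 -> K2}) x y h f : model x y h f ->
 (forall a, F (emb K1 a) = emb K2 a) -> (forall a, F' (emb K1 a) = emb K2 a) ->
 F x = F' x -> F y = F' y -> F =1 F'.
move=> M Fe Fe' ex ey z; have [a [b [c [c0 e]]]] := model_gen M z.
have nz : pev (emb K2) (F x) c != 0.
 by rewrite -(morph_pev _ _ Fe) fmorph_eq0 (ev_eq0 M).
apply: (mulIf nz); rewrite {2}ex -(morph_pev _ _ Fe) -(morph_pev _ _ Fe') -!rmorphM e.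
by rewrite !rmorphD !rmorphM !(morph_pev _ _ Fe) !(morph_pev _ _ Fe') ex ey.
Qed.

Lemma model_iso K1 K2 (x1 y1 : K1) (x2 y2 : K2) h f : model x1 y1 h f -> model x2 y2 h f ->
 exists phi, [/\ isos K1 K2 phi, phi x1 = x2 & phi y1 = y2].
move=> M1 M2; have [F [Fe Fx Fy]] := model_iso_ex M1 M2.
have [F' [Fe' Fx' Fy']] := model_iso_ex M2 M1.
exists F; split=> //; exists F; split=> //; exists F'.
 move=> z; apply: (model_morph_uniq (F := F' \o F) (F' := idfun) M1) => //= [a||].
 - by rewrite Fe Fe'.
 - by rewrite Fx.
 - by rewrite Fy.
move=> z; apply: (model_morph_uniq (F := F \o F') (F' := idfun) M2) => //= [a||].
- by rewrite Fe' Fe.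
- by rewrite Fx'.
- by rewrite Fy'.
Qed.

Lemma iso_model K1 K2 phi (x y : K1) h f : isos K1 K2 phi -> model x y h f -> model (phi x) (phi y) h f.
move=> [F [-> [F' FK F'K] Fe]] M; have mp := morph_pev _ _ Fe; split.
- by rewrite -!mp -(model_eq M) rmorphD rmorphXn rmorphM.
- by move=> a b; rewrite -!mp -rmorphM -rmorphD => /eqP; rewrite fmorph_eq0 => /eqP/(model_free M).
- move=> z; have [a [b [c [c0 e]]]] := model_gen M (F' z); exists a, b, c; split=> //.
 by rewrite -!mp -rmorphM -rmorphD -e rmorphM F'K.
Qed.

Lemma iso_uniq K1 K2 phi phi' (x y : K1) h f : isos K1 K2 phi -> isos K1 K2 phi' -> model x y h f ->
 phi x = phi' x -> phi y = phi' y -> phi = phi'.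
move=> [F [-> _ Fe]] [F' [-> _ Fe']] M ex ey; apply: functional_extensionality_dep => z.
exact: (model_morph_uniq M).
Qed.

Lemma iso_sym K1 K2 : isomorphic K1 K2 -> isomorphic K2 K1.
move=> [_ [F [_ [F' FK F'K] Fe]]].
have fB : zmod_morphism F' by move=> u v; apply: (can_inj FK); rewrite rmorphB !F'K.
have fM : monoid_morphism F'.
 split; first by rewrite -(rmorph1 F) FK.
 by move=> u v; apply: (can_inj FK); rewrite rmorphM !F'K.
pose fA := GRing.isZmodMorphism.Build K2 K1 F' fB.
pose fMM := GRing.isMonoidMorphism.Build K2 K1 F' fM.
pose G : {rmorphism K2 -> K1} := HB.pack F' fA fMM.
exists G, G; split=> //; first by exists F.
by move=> a; rewrite -Fe /= FK.
Qed.

Lemma iso_trans K1 K2 K3 : isomorphic K1 K2 -> isomorphic K2 K3 -> isomorphic K1 K3.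
move=> [_ [F [_ Fb Fe]]] [_ [F' [_ Fb' Fe']]]; exists (F' \o F), (F' \o F); split=> //.
 exact: bij_comp.
by move=> a /=; rewrite Fe.
Qed.
End Isomorphisms.

Lemma fraction_gen (R : idomainType) (z : {fraction R}) :
 exists n d, d != 0 /\ z * FracField.tofrac d = FracField.tofrac n.
elim/quotW: z => r; exists r.1, r.2; split; first exact: denom_ratioP.
unlock FracField.tofrac; rewrite -[LHS]FracField.pi_mul; apply/eqmodP.
rewrite /= FracField.equivfE /FracField.mulf !numden_Ratio ?mulf_neq0 ?oner_neq0 ?denom_ratioP //.
by rewrite !mulr1 mulrC.
Qed.

Lemma linear_poly_eq0 (R : nzRingType) (a b : R) : a%:P + b%:P * 'X = 0 -> a = 0 /\ b = 0.
move/polyP => E; have := E 0; have := E 1.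
by rewrite !coefD !coefMX !coefC /= add0r addr0.
Qed.

Lemma linear_poly_clear (R : comNzRingType) (u w d d' n n' : R) : u * d = n -> w * d' = n' ->
 (u%:P + w *: 'X) * (d * d')%:P = (n * d')%:P + (n' * d)%:P * 'X.
Proof. move=> <- <-; rewrite !polyCM -mul_polyC; ring. Qed.

(** * Function field of a pair without root *)

Section FunctionField.
Variables (k : fieldType) (h f : {poly k}) (noroot : forall r : {poly k}, r ^+ 2 + h * r != f).

Let F : fieldType := {fraction {poly k}}.
Let tf : {rmorphism {poly k} -> F} := @FracField.tofrac {poly k}.
Let P : {poly F} := 'X^2 + (tf h) *: 'X - (tf f)%:P.

Let P_size : size P = 3.
rewrite /P -addrA size_polyDl size_polyXn // -[tf f]opprK polyCN opprK.
rewrite (leq_ltn_trans (size_polyD _ _)) // gtn_max (leq_ltn_trans (size_scale_leq _ _)) ?size_polyX //=.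
by rewrite (leq_ltn_trans (size_polyC_leq1 _)).
Qed.

Let P_monic : P \is monic.
Proof. by rewrite monicE /lead_coef P_size /P !coefD coefXn coefZ coefX coefN coefC /= mulr0 addr0 subr0. Qed.

Let tf_inj : injective tf.
Proof. by move=> p q /eqP; rewrite tofrac_eq => /eqP. Qed.

Let tf_neq0 p : p != 0 -> tf p != 0.
Proof. by move=> p0; rewrite tofrac_eq0. Qed.

(* k[x] is integrally closed. *)
Let P_noroot (z : F) : ~~ root P z.
apply/negP => /eqP; rewrite /P !hornerE => /eqP; rewrite subr_eq0 => /eqP ez.
have [n0 [d0 [d00 e0]]] := fraction_gen z.
have g0 : gcdp n0 d0 != 0 by rewrite gcdp_eq0 negb_and d00 orbT.
have en := divpK (dvdp_gcdl n0 d0); have ed := divpK (dvdp_gcdr n0 d0).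
pose n := n0 %/ gcdp n0 d0; pose d := d0 %/ gcdp n0 d0.
have dn0 : d != 0 by apply: contraNneq d00 => e; rewrite -ed -/d e mul0r.
have e : z * tf d = tf n.
 by apply: (mulIf (tf_neq0 g0)); rewrite -mulrA -!rmorphM /n /d ed en.
have E : n ^+ 2 + h * n * d = f * d ^+ 2.
 apply: tf_inj; rewrite rmorphD rmorphXn -mulrA [tf (h * _)]rmorphM [tf (n * d)]rmorphM.
 by rewrite [tf (f * _)]rmorphM rmorphXn -ez -e; ring.
have : d %| n ^+ 2.
 have -> : n ^+ 2 = (f * d - h * n) * d by rewrite mulrBl -mulrA -expr2 -E addrK.
 exact: dvdp_mull.
have cop : coprimep d (n ^+ 2).
 by apply: coprimep_expr; rewrite coprimep_sym; apply: coprimep_div_gcd; rewrite d00 orbT.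
move=> dn; have sd : size d == 1 by rewrite -(eqp_size (dvdp_gcd_idl dn)).
have dC : d = (d`_0)%:P by apply: size1_polyC; rewrite (eqP sd).
have c0 : d`_0 != 0 by apply: contraNneq dn0 => e0'; rewrite dC e0'.
case/eqP: (noroot ((d`_0)^-1 *: n)).
have -> : f = (d`_0 ^+ 2)^-1 *: (f * d ^+ 2).
 by rewrite [in d ^+ 2]dC -polyC_exp mulrC mul_polyC scalerA mulVf ?scale1r // expf_neq0.
have -> : d`_0 ^- 2 *: (f * d ^+ 2) = d`_0 ^- 2 *: n ^+ 2 + (d`_0)^-1 *: (h * n).
 rewrite -E scalerDr; congr (_ + _).
 by rewrite {2}dC mulrC mul_polyC scalerA; congr (_ *: _); field.
by rewrite exprZn exprVn -scalerAr.
Qed.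

Let P_irr : monic_irreducible_poly P.
Proof. by split=> //; apply: cubic_irreducible; rewrite ?P_size // => z; apply: P_noroot. Qed.

Let K : fieldType := {poly %/ P with P_irr}.
Let phi : {rmorphism {poly F} -> K} := in_qpoly P.

Let P_mk : mk_monic P = P.
Proof. by rewrite /mk_monic P_size P_monic. Qed.

Let phi_eq0 (p : {poly F}) : (size p < 3)%N -> phi p = 0 -> p = 0.
by move=> sp /(congr1 (fun z : {poly %/ P} => z : {poly F})); rewrite in_qpoly_small // P_mk P_size.
Qed.

Let phi_surj (z : K) : exists a b : F, z = phi (a%:P + b *: 'X).
pose p : {poly F} := (z : {poly %/ P}).
have sp : (size p < 3)%N by apply: leq_ltn_trans (size_npoly (z : {poly %/ P})) _; rewrite P_mk P_size.
exists p`_0, p`_1; have -> : (p`_0)%:P + p`_1 *: 'X = p.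
 apply/polyP => -[|[|i]]; rewrite coefD coefC coefZ coefX /= ?mulr0 ?mulr1 ?addr0 ?add0r //.
 by rewrite nth_default // -ltnS; apply: leq_trans sp _.
apply/esym/val_inj; apply: (etrans (in_qpoly_small _)) => //; by rewrite P_mk P_size.
Qed.

Lemma function_field_ex : exists (K : extension k) (x y : K), model x y h f.
pose e : {rmorphism k -> K} := phi \o (polyC \o (tf \o polyC)).
pose E := Extension e; pose x : E := phi (tf 'X)%:P; pose y : E := phi 'X.
have evE p : pev (emb E) x p = phi (tf p)%:P.
 rewrite /pev -[in RHS](coefK p) poly_def horner_coef size_map_poly !rmorph_sum.
 apply: eq_bigr => i _; rewrite coef_map /= -mul_polyC !rmorphM !rmorphXn //.
exists E, x, y; split.
- rewrite !evE -rmorphXn -!rmorphM -!rmorphD; apply/eqP; rewrite -subr_eq0 -rmorphB; apply/eqP.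
 have -> : 'X ^+ 2 + (tf h)%:P * 'X - (tf f)%:P = P by rewrite mul_polyC.
 by apply: val_inj; rewrite /= P_mk Pdiv.RingMonic.rmodpp.
- move=> a b; rewrite !evE -rmorphM -rmorphD => /phi_eq0 H.
 have {}H : (tf a)%:P + (tf b)%:P * 'X = 0.
  apply: H; rewrite addrC size_MXaddC; case: ifP => // _.
  by rewrite ltnS (leq_ltn_trans (size_polyC_leq1 _)).
 have [ea eb] := linear_poly_eq0 H.
 by split; apply: tf_inj; rewrite rmorph0.
- move=> z; have [u [w ->]] := phi_surj z.
 have [n [d [d0 e1]]] := fraction_gen u; have [n' [d' [d0' e2]]] := fraction_gen w.
 exists (n * d'), (n' * d), (d * d'); rewrite mulf_neq0 //; split=> //.
 rewrite !evE -!rmorphM -rmorphD; congr (phi _).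
 rewrite (rmorphM tf d d') (rmorphM tf n d') (rmorphM tf n' d).
 exact: linear_poly_clear e1 e2.
Qed.
End FunctionField.

Lemma card_eq_seq (U : Type) (T : eqType) (S : set U) (s : seq T) (F : U -> T) : uniq s ->
 (forall u, S u -> F u \in s) -> (forall u u', S u -> S u' -> F u = F u' -> u = u') ->
 (forall t, t \in s -> exists u, S u /\ F u = t) -> (S #= `I_(size s))%card.
move=> us Fs Fi Fsurj.
have b : set_bij S `I_(size s) (fun u => index (F u) s).
 split=> [u Su|u u'|i /= lti].
 - by rewrite /= index_mem; apply: Fs.
 - rewrite !inE => Su Su' e; apply: Fi => //.
  by rewrite -(nth_index (F u) (Fs u Su)) e nth_index // Fs.
 - have [t ts] : exists t, t \in s by case: (s) lti => // t s' _; exists t; rewrite mem_head.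
  have [u [Su e]] := Fsurj _ (mem_nth t lti).
  by exists u => //; rewrite e index_uniq.
by apply/card_set_bijP; exists (fun u => index (F u) s).
Qed.

Lemma coefM_top (R : comNzRingType) (p q : {poly R}) n : (size p <= n.+2)%N -> (size q <= n.+2)%N ->
 (p * q)`_(2 * n.+1) = p`_n.+1 * q`_n.+1 /\ (p * q)`_(2 * n).+1 = p`_n.+1 * q`_n + p`_n * q`_n.+1.
have top (r : {poly R}) : (size r <= n.+2)%N -> exists r', [/\ r = r`_n.+1 *: 'X^(n.+1) + r', (size r' <= n.+1)%N & r'`_n = r`_n].
 move=> sr; exists (r - r`_n.+1 *: 'X^(n.+1)); split; first by rewrite addrC subrK.
  apply/leq_sizeP => i; rewrite leq_eqVlt => /orP[/eqP <-|lt]; rewrite coefB coefZ coefXn.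
   by rewrite eqxx mulr1 subrr.
  by rewrite gtn_eqF // mulr0 subr0 nth_default // (leq_trans sr).
 by rewrite coefB coefZ coefXn ltn_eqF // mulr0 subr0.
move=> /top[p' [ep sp' p'n]] /top[q' [eq sq' q'n]].
have spq : (size (p' * q')%R <= (2 * n).+1)%N.
 by apply: leq_trans (size_polyMleq _ _) _; move: sp' sq'; move: (size p') (size q') => a b; lia.
have -> : p * q = p' * q' + p`_n.+1 *: (q' * 'X^(n.+1)) + q`_n.+1 *: (p' * 'X^(n.+1)) +
  (p`_n.+1 * q`_n.+1) *: 'X^(2 * n.+1).
 by rewrite {1}ep {1}eq -!mul_polyC polyCM mul2n -addnn exprD; ring.
rewrite !coefD !coefZ !coefMXn !coefXn eqxx.
have -> : (2 * n.+1 < n.+1)%N = false by lia.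
have -> : ((2 * n).+1 < n.+1)%N = (n < 0)%N by lia.
have -> : (2 * n.+1 - n.+1 = n.+1)%N by lia.
have -> : ((2 * n).+1 - n.+1 = n)%N by lia.
have -> : ((2 * n).+1 == 2 * n.+1)%N = false by lia.
have z1 i : (2 * n < i)%N -> (p' * q')`_i = 0 by move=> lti; rewrite nth_default // (leq_trans spq).
by rewrite ltn0 !z1 ?(nth_default _ sp') ?(nth_default _ sq') ?p'n ?q'n ?leqnn //; [rewrite !mulr0 mulr1 !addr0 !add0r; split=> //; rewrite [q`_n.+1 * _]mulrC|lia].
Qed.

(** * From isomorphism classes to pairs *)

Section GroupoidCount.
Variables (k : finFieldType) (L : closedFieldType) (j : {rmorphism k -> L}) (jalg : forall z : L, algebraicOver j z) (G : nat).

Definition pair_poly : finType := ('rV[k]_G.+1 * 'rV[k]_(2 * G).+1)%type.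
Definition hpoly (u : pair_poly) : {poly k} := rVpoly u.1.
Definition fpoly (u : pair_poly) : {poly k} := rVpoly u.2.

Definition smooth_pair (u : pair_poly) : bool :=
 `[< smooth G (hpoly u) (fpoly u) >] && (disc (hpoly u) (fpoly u) != 0).

Lemma size_hpoly u : (size (hpoly u) <= G.+1)%N.
Proof. exact: size_poly. Qed.

Lemma size_fpoly u : (size (fpoly u) <= (2 * G).+1)%N.
Proof. exact: size_poly. Qed.

Lemma pair_poly_ex (h f : {poly k}) : (size h <= G.+1)%N -> (size f <= (2 * G).+1)%N ->
 exists u, hpoly u = h /\ fpoly u = f.
Proof. by move=> sh sf; exists (poly_rV h, poly_rV f); rewrite /hpoly /fpoly !poly_rV_K. Qed.

Lemma pair_poly_inj u w : hpoly u = hpoly w -> fpoly u = fpoly w -> u = w.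
move: u w => [a b] [a' b']; rewrite /hpoly /fpoly /= => /(congr1 (poly_rV (d := G.+1))) + /(congr1 (poly_rV (d := (2 * G).+1))).
by rewrite !rVpolyK => -> ->.
Qed.

(* A root of y^2 + h y = f in k[x] makes every zero of h + 2r, at infinity if there is
  no other, a singular point. *)
Lemma smooth_noroot h f : (0 < G)%N -> smooth G h f -> disc h f != 0 ->
 forall r : {poly k}, r ^+ 2 + h * r != f.
move=> G0 S d0 r; apply/eqP => e.
have f0 : f - h * r - r ^+ 2 = 0 by rewrite -e; ring.
have d1 : disc h f = (h + r *+ 2) ^+ 2 by rewrite /disc -e; ring.
have [lt|] := ltnP 1 (size (h + r *+ 2)).
 by apply: (smooth_fin S lt (b := r)); rewrite ?dvdpp // f0 dvdp0.
move=> s1; have sh := smooth_h S; have sf := smooth_f S.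
have sr : (size r <= G.+1)%N.
 rewrite leqNgt; apply/negP => lt.
 have r0 : r != 0 by rewrite -size_poly_gt0 (leq_ltn_trans _ lt).
 have srh : size (r + h) = size r by rewrite size_polyDl // (leq_ltn_trans sh).
 have : size f = (size r + size r).-1.
  rewrite -e (_ : r ^+ 2 + h * r = r * (r + h)); last by ring.
  by rewrite size_mul // ?srh // -size_poly_gt0 srh size_poly_gt0.
 by move: lt sf; move: (size r) (size f) => a b; lia.
case: G G0 S sh sf sr => // G' _ S sh sf sr.
have /(nonsingular_inf sh sf)/(_ r`_G'.+1) := smooth_inf S.
case; apply/(inf_singular_coef _ sh sf).
have c1 : h`_G'.+1 + r`_G'.+1 *+ 2 = 0.
 by have := nth_default 0 (leq_trans s1 (ltn0Sn G') : (size (h + r *+ 2)%R <= G'.+1)%N); rewrite coefD coefMn.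
have s2 : f = r * (r + h) by rewrite -e; ring.
have srh : (size (r + h)%R <= G'.+2)%N by rewrite size_polyD_leq // sr.
have [t1 t2] := coefM_top sr srh; rewrite s2 t1 t2 !coefD; split=> //; first by ring.
have c1' : r`_G'.+1 + h`_G'.+1 = - r`_G'.+1 
 by transitivity ((h`_G'.+1 + r`_G'.+1 *+ 2) - r`_G'.+1); [ring|rewrite c1 sub0r].
rewrite c1'; ring.
Qed.

Lemma smooth_ext_ex u : (0 < G)%N -> smooth_pair u ->
 exists (K : extension k) (x y : K), model x y (hpoly u) (fpoly u).
move=> G0 /andP[/asboolP S d0]; apply: function_field_ex; exact: smooth_noroot S d0.
Qed.

Definition transforms (K : extension k) (x y : K) (w : pair_poly) : {set change k G} :=
 [set t | is_change t & `[< model (change_x x t) (change_y x y t) (hpoly w) (fpoly w) >]].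

(** One change t0 leading to w identifies the automorphisms with all such changes: phi corresponds
    to the change that produces the images under phi of the coordinates given by t0. *)
Lemma card_isos (K : extension k) (x y : K) u w : (2 < G)%N -> model x y (hpoly u) (fpoly u) ->
 smooth G (hpoly u) (fpoly u) -> smooth G (hpoly w) (fpoly w) -> (0 < #|transforms x y w|)%N ->
 (isos K K #= `I_#|transforms x y w|)%card.
move=> G3 M S Sw /card_gt0P[t0]; rewrite inE => /andP[ch0 /asboolP M0].
set x1 := change_x x t0 in M0; set y1 := change_y x y t0 in M0.
have key phi : isos K K phi -> exists t, [/\ t \in transforms x y w, change_x x t = phi x1 & change_y x y t = phi y1].
 move=> Hphi; have M1 := iso_model Hphi M0.
 have [t [ct ex ey]] := change_surj jalg M S G3 M1 Sw.
 by exists t; split=> //; rewrite inE ct ex ey; apply/asboolP.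
pose F (phi : K -> K) := xget t0 [set t | [/\ t \in transforms x y w, change_x x t = phi x1 & change_y x y t = phi y1]].
have FP phi : isos K K phi -> [/\ F phi \in transforms x y w, change_x x (F phi) = phi x1 & change_y x y (F phi) = phi y1].
 by move=> /key; rewrite /F; case: xgetP => [t _ //|+ [t Ht]] => /(_ t).
rewrite cardE; apply: (card_eq_seq (F := F)); rewrite ?enum_uniq //.
- by move=> phi /FP[H _ _]; rewrite mem_enum.
- move=> phi phi' H H' e; have [_ ex ey] := FP _ H; have [_ ex' ey'] := FP _ H'.
 by apply: (iso_uniq H H' M0); rewrite -?ex -?ey e.
- move=> t; rewrite mem_enum inE => /andP[ct /asboolP Mt].
 have [phi [Hphi ex ey]] := model_iso M0 Mt; exists phi; split=> //.
 have [] := FP _ Hphi; rewrite inE => /andP[ct' _] ex' ey'.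
 by apply: (change_inj M) => //; rewrite ?ex' ?ey' ?ex ?ey.
Qed.

(** Each change leads to exactly one pair, and this pair is smooth because genus and constants
    belong to K and not to the coordinates. *)
Lemma card_all_transforms (K : extension k) (x y : K) u (q := #|k|) : (1 < G)%N ->
 model x y (hpoly u) (fpoly u) -> smooth G (hpoly u) (fpoly u) ->
 (\sum_(w | smooth_pair w) #|transforms x y w|)%N = ((q ^ 3 - q) * (q - 1) * q ^ G.+1)%N.
move=> G1 M S; rewrite -card_is_change -sum1_card (eq_bigr (fun w => \sum_(t | t \in transforms x y w) 1)%N); last first.
 by move=> w _; rewrite sum1_card.
rewrite (exchange_big_dep [pred t | is_change t]) /= => [|w t _]; last by rewrite inE => /andP[].
apply: eq_bigr => t ct.
have [w Hw] : exists w, smooth_pair w /\ t \in transforms x y w.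
 have [h [f Mt]] := change_gmodel (GModel M (smooth_h S) (smooth_f S)) ct.
 have [w [eh ef]] := pair_poly_ex (gmodel_h Mt) (gmodel_f Mt).
 exists w; rewrite inE ct /smooth_pair eh ef; split; last by apply/asboolP; case: Mt.
 have gen : has_genus K G.-1 by apply/(smooth_genus jalg M S); lia.
 have cc := smooth_constants_closed jalg M S (ltnW G1).
 apply/andP; split.
  apply/asboolP; have g0 : (0 < G.-1)%N by lia.
  have := @gmodel_smooth _ _ _ _ jalg G.-1 (change_x x t) (change_y x y t) h f g0 cc gen.
  by rewrite prednK; [apply|lia].
 apply/eqP => d0; have [y1 [M1 S1]] := model_disc0 (gmodel_model Mt) d0.
 by have := (smooth_genus jalg M1 S1 G.-1 isT).1 gen; lia.
rewrite (bigD1 w) /=; last by apply/andP.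
rewrite big1 ?addn0 // => w' /andP[/andP[_ Ht'] /eqP]; case.
move: Hw Ht' => [_]; rewrite !inE => /andP[_ /asboolP Mw] /andP[_ /asboolP Mw'].
by have [eh ef] := model_uniq Mw Mw'; apply/pair_poly_inj.
Qed.

Variables (iota_n : nat) (sigma : 'S_iota_n) (cnt : pair_poly -> nat).
Hypothesis cntP : forall (K : extension k) (x y : K) u, model x y (hpoly u) (fpoly u) ->
 smooth_pair u -> (fixed_tuples j (K := K) sigma #= `I_(cnt u))%card.

(* Orbit counting: the pairs (h, f) attached to K form a single orbit of the change of
  coordinates, with stabiliser Aut(K). *)
Lemma is_count_pairs g (q := #|k|) : (1 < g)%N -> G = g.+1 ->
 is_count j g sigma ((\sum_(u | smooth_pair u) (cnt u)%:R) /
  (((q ^ 3 - q) * (q - 1) * q ^ G.+1)%N)%:R).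
move=> g1 eG; have G0 : (0 < G)%N by lia.
have G3 : (2 < G)%N by lia.
have ex u : exists K : extension k, smooth_pair u -> exists (x y : K), model x y (hpoly u) (fpoly u).
 have [Su|nS] := pselect (smooth_pair u); last by exists (Extension (idfun : {rmorphism k -> k})).
 by have [K H] := smooth_ext_ex G0 Su; exists K.
pose Kx u := projT1 (cid (ex u)).
have KxP u : smooth_pair u -> exists (x y : Kx u), model x y (hpoly u) (fpoly u) := projT2 (cid (ex u)).
have smP u : smooth_pair u -> smooth G (hpoly u) (fpoly u) by case/andP => /asboolP.
have isoP (K : extension k) (x y : K) u : smooth_pair u -> model x y (hpoly u) (fpoly u) -> isomorphic (Kx u) K.
 by move=> /KxP[x' [y' M']] M; have [phi [? _ _]] := model_iso M' M; exists phi.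
have isoR K : isomorphic K (K : extension k).
 by exists idfun, idfun; split=> //; exists idfun.
pose r u v := smooth_pair v && `[< isomorphic (Kx u) (Kx v) >].
have rE u v : smooth_pair u -> smooth_pair v -> reflect (isomorphic (Kx u) (Kx v)) (r u v).
 by move=> Su Sv; rewrite /r Sv; apply: asboolP.
(* [pick] depends only on the predicate [r u], so isomorphic pairs get the same representative. *)
pose rep u := odflt u [pick v | r u v].
have repP u : smooth_pair u -> smooth_pair (rep u) /\ isomorphic (Kx u) (Kx (rep u)).
 by move=> Su; rewrite /rep; case: pickP => [v /andP[Sv /asboolP]|].
have rep_eq u v : smooth_pair u -> smooth_pair v -> isomorphic (Kx u) (Kx v) -> rep u = rep v.
 move=> Su Sv i; rewrite /rep (@eq_pick _ (r u) (r v)); last first.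
  move=> w; rewrite /r; case Sw : (smooth_pair w) => //=.
  by apply/asboolP/asboolP; apply: iso_trans => //; apply: iso_sym.
 case: pickP => // /(_ v); rewrite /r Sv => /asboolP; case; exact: isoR.
pose R := [pred v | smooth_pair v && (rep v == v)].
have RP v : v \in R -> smooth_pair v /\ rep v = v by rewrite inE => /andP[Sv /eqP].
have Rrep u : smooth_pair u -> rep u \in R.
 by move=> Su; have [Sr i] := repP u Su; rewrite inE Sr; apply/eqP/esym/rep_eq.
(* Orbit and stabilizer: every pair in the class of u is reached by as many changes as K has
   automorphisms, and all the changes together are counted by [card_all_transforms]. *)
have data u : exists a : nat, smooth_pair u -> (isos (Kx u) (Kx u) #= `I_a)%card /\
  (a * #|[pred w | smooth_pair w && (rep w == rep u)]| = (q ^ 3 - q) * (q - 1) * q ^ G.+1)%N.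
 have [Su|nS] := boolP (smooth_pair u); last by exists 0%N.
 have [x [y M]] := KxP u Su; have S := smP u Su; exists #|transforms x y u| => _.
 have ne w : smooth_pair w -> ((0 < #|transforms x y w|)%N <-> rep w = rep u).
  move=> Sw; split=> [/card_gt0P[t]|e].
   rewrite inE => /andP[_ /asboolP Mt]; apply: rep_eq => //; exact: isoP Mt.
  have i : isomorphic (Kx w) (Kx u).
   have [_ i1] := repP w Sw; have [_ i2] := repP u Su.
   by apply: iso_trans i1 _; rewrite e; apply: iso_sym.
  have [x' [y' M']] := KxP w Sw; have [phi Hphi] := i; have M1 := iso_model Hphi M'.
  have [t [ct etx ety]] := change_surj jalg M S G3 M1 (smP w Sw).
  by apply/card_gt0P; exists t; rewrite inE ct etx ety; apply/asboolP.
 have ca w : smooth_pair w -> rep w = rep u -> (isos (Kx u) (Kx u) #= `I_#|transforms x y w|)%card.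
  by move=> Sw e; apply: (card_isos G3 M S (smP w Sw)); apply/ne.
 split; first exact: ca.
 rewrite -(card_all_transforms (ltnW G3) M S) (bigID (fun w => rep w == rep u)) /=.
 rewrite [X in (_ + X)%N]big1 ?addn0; last first.
  move=> w /andP[Sw /eqP nr]; apply/eqP; rewrite -leqn0 leqNgt; apply/negP => lt.
  by apply: nr; apply/ne.
 rewrite mulnC -sum_nat_const; apply: eq_bigr => w; rewrite inE => /andP[Sw /eqP e].
 apply/card_eq_II; apply: card_eq_trans (ca w Sw e).
 by rewrite card_eq_sym; apply: ca.
have [a aP] := choice data.
exists #|R|, (fun i => Kx (enum_val i)), (fun i => cnt (enum_val i)), (fun i => a (enum_val i)).
have Ri (i : 'I_#|R|) : smooth_pair (enum_val i) /\ rep (enum_val i) = enum_val i.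
 by apply: RP; apply: enum_valP.
split.
- move=> i; have [Su _] := Ri i; have [x [y M]] := KxP _ Su; have S := smP _ Su.
 by rewrite eG in S; apply: (smooth_hyperelliptic jalg M S).
- move=> i i' iso; have [Su e] := Ri i; have [Su' e'] := Ri i'.
 by apply: enum_val_inj; rewrite -e -e'; apply: rep_eq.
- move=> K /(hyperelliptic_smooth_model jalg (ltnW g1))[x [y [h [f [M S d0]]]]].
 rewrite -eG in S; have [u [eh ef]] := pair_poly_ex (smooth_h S) (smooth_f S).
 have Su : smooth_pair u by rewrite /smooth_pair eh ef d0 andbT; apply/asboolP.
 have Mu : model x y (hpoly u) (fpoly u) by rewrite eh ef.
 have rR := Rrep u Su.
 exists (enum_rank_in rR (rep u)); rewrite enum_rankK_in //.
 have [_ i] := repP u Su; apply: iso_trans i; apply: iso_sym; exact: isoP Mu.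
- move=> i; have [Su _] := Ri i; have [x [y M]] := KxP _ Su; split; first exact: cntP M Su.
 by case: (aP _ Su).
- rewrite (partition_big rep (mem R)) /=; last by move=> u; apply: Rrep.
 rewrite mulr_suml -(big_enum_val (fun u => (cnt u)%:R / (a u)%:R)) /=.
 apply: eq_bigr => v vR; have [Sv ev] := RP v vR; have [_ av] := aP v Sv.
 have cc u : smooth_pair u && (rep u == v) -> (cnt u)%:R = (cnt v)%:R :> rat.
  move=> /andP[Su /eqP eu]; congr (_%:R).
  have [x [y M]] := KxP u Su; have [_ i] := repP u Su; rewrite eu in i.
  have [x' [y' M']] := KxP v Sv; have [phi Hphi] := iso_sym i; have M1 := iso_model Hphi M'.
  apply/card_eq_II; apply: card_eq_trans (cntP M1 Sv); rewrite card_eq_sym; exact: cntP M Su.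
 rewrite (eq_bigr _ cc) sumr_const -av natrM.
 have -> : #|[pred w | smooth_pair w && (rep w == rep v)]| = #|[pred i | smooth_pair i && (rep i == v)]|.
  by rewrite ev.
 set N := #|_|; have N0 : N%:R != 0 :> rat.
  by rewrite pnatr_eq0 -lt0n; apply/card_gt0P; exists v; rewrite unfold_in Sv ev eqxx.
 by rewrite -[_ *+ N]mulr_natr invfM mulrACA [N%:R / _]mulfV // mulr1.
Qed.
End GroupoidCount.

(** * Frobenius and the fields F_(q^d) *)

Section Frobenius.
Variables (k : finFieldType) (L : closedFieldType) (j : {rmorphism k -> L}).
Notation q := #|k|.

Lemma card_gt1 : (1 < q)%N.
Proof. exact: finNzRing_gt1. Qed.

Lemma pchar_nat d : [pchar L].-nat (q ^ d)%N.
have [p pp pk] := finPcharP k.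
have e : q = (p ^ logn p q)%N := card_pprimeChar pk.
rewrite e -expnM pnatX; apply/orP; left.
by rewrite pnatE //; apply: rmorph_pchar pk.
Qed.

Definition fr (d : nat) (z : L) : L := z ^+ (q ^ d).

Lemma frD d : {morph fr d : x y / x + y}.
Proof. by move=> x y; rewrite /fr exprDn_pchar // pchar_nat. Qed.

Lemma frN d z : fr d (- z) = - fr d z.
Proof. by rewrite /fr exprNn_pchar // pchar_nat. Qed.

Lemma frB d : {morph fr d : x y / x - y}.
Proof. by move=> x y; rewrite frD frN. Qed.

Lemma frM d : {morph fr d : x y / x * y}.
Proof. by move=> x y; rewrite /fr exprMn. Qed.

Lemma fr0 d : fr d 0 = 0.
Proof. by rewrite /fr expr0n expn_eq0 gtn_eqF // ltnW // card_gt1. Qed.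

Lemma fr1 d : fr d 1 = 1.
Proof. exact: expr1n. Qed.

Lemma frX d n z : fr d (z ^+ n) = fr d z ^+ n.
Proof. by rewrite /fr -!exprM mulnC. Qed.

Lemma frV d z : fr d z^-1 = (fr d z)^-1.
Proof. by rewrite /fr exprVn. Qed.

Lemma fr_add d e z : fr (d + e) z = fr d (fr e z).
Proof. by rewrite /fr -exprM -expnD addnC. Qed.

Lemma frC d e z : fr d (fr e z) = fr e (fr d z).
Proof. by rewrite -!fr_add addnC. Qed.

Lemma fr_id z : fr 0 z = z.
Proof. by rewrite /fr expn0 expr1. Qed.

Lemma fr_eq0 d z : (fr d z == 0) = (z == 0).
Proof. by rewrite /fr expf_eq0 expn_gt0 ltnW ?card_gt1. Qed.

Lemma fr_inj d : injective (fr d).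
Proof. by move=> x y e; apply/eqP; rewrite -subr_eq0 -(fr_eq0 d) frB e subrr. Qed.

Lemma fr_j d a : fr d (j a) = j a.
rewrite /fr -rmorphXn; congr (j _); elim: d => [|d IH]; first by rewrite expn0 expr1.
by rewrite expnS mulnC exprM IH expf_card.
Qed.

Lemma fr_pev d z p : fr d (pev j z p) = pev j (fr d z) p.
rewrite /pev !horner_coef size_map_poly (big_morph (fr d) (frD d) (fr0 d)).
by apply: eq_bigr => i _; rewrite frM frX coef_map fr_j.
Qed.

Lemma fixed_points_ex d : (0 < d)%N ->
 exists s : seq L, [/\ uniq s, size s = (q ^ d)%N & forall z, (z \in s) = (fr d z == z)].
move=> d0; pose P : {poly L} := 'X^(q ^ d) - 'X.
have qd : (1 < q ^ d)%N by rewrite -{1}(exp1n d) ltn_exp2r // card_gt1.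
have sP : size P = (q ^ d).+1 by rewrite /P size_polyDl size_polyXn // size_polyN size_polyX.
have [s e] := closed_field_poly_normal P.
have lP : lead_coef P = 1.
 by rewrite /P lead_coefDl ?lead_coefXn // size_polyN size_polyX size_polyXn.
rewrite lP scale1r in e.
have memP z : (z \in s) = (fr d z == z).
 by rewrite -root_prod_XsubC -e /root /P !hornerE subr_eq0.
exists s; split=> //; last by move: sP; rewrite e size_prod_XsubC => -[].
rewrite -separable_prod_XsubC -e unlock /P derivB derivXn derivX.
have -> : 'X^((q ^ d)%N.-1) *+ (q ^ d) = 0 :> {poly L}.
 have [p pp pk] := finPcharP k; have pL := rmorph_pchar j pk.
 have e1 : q = (p ^ logn p q)%N := card_pprimeChar pk.
 have /dvdnP[m ->] : (p %| q ^ d)%N.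
  rewrite e1 -expnM dvdn_exp // muln_gt0 d0 andbT -(ltn_exp2l _ _ (prime_gt1 pp)) expn0 -e1.
  exact: card_gt1.
 by rewrite mulrnA -[_ *+ p]mulr_natr -polyC_natr (pcharf0 pL) mulr0.
by rewrite sub0r -(scaleN1r (1 : {poly L})) coprimepZr ?coprimep1 // oppr_eq0 oner_eq0.
Qed.

Definition fixed_points (d : nat) : seq L :=
 xget [::] [set s : seq L | [/\ uniq s, size s = (q ^ d)%N & forall z, (z \in s) = (fr d z == z)]].

Lemma fixed_pointsP d : (0 < d)%N -> [/\ uniq (fixed_points d), size (fixed_points d) = (q ^ d)%N &
 forall z, (z \in fixed_points d) = (fr d z == z)].
by move=> /fixed_points_ex[s Hs]; rewrite /fixed_points; case: xgetP => [s' -> //|/(_ s)]; case.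
Qed.
End Frobenius.

(** * Lists of periodic points in distinct orbits *)

Section Dynamics.
Variables (T : eqType) (phi : T -> T) (phi_inj : injective phi).

Definition has_period (d : nat) (x : T) : bool :=
 [&& (0 < d)%N, iter d phi x == x & all (fun e => iter e phi x != x) (iota 1 d.-1)].

Lemma has_periodP d x : reflect
 [/\ (0 < d)%N, iter d phi x = x & forall e, (0 < e < d)%N -> iter e phi x <> x] (has_period d x).
apply: (iffP and3P) => [[d0 /eqP e /allP H]|[d0 e H]]; split=> //.
- by move=> i lti; apply/eqP/H; rewrite mem_iota; move: lti; lia.
- exact/eqP.
- by apply/allP => i; rewrite mem_iota => lti; apply/eqP/H; move: lti; lia.
Qed.

Lemma has_period_uniq d e x : has_period d x -> has_period e x -> d = e.
move=> /has_periodP[d0 ed Hd] /has_periodP[e0 ee He].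
by case: (ltngtP d e) => // lt; [case: (He d)|case: (Hd e)]; rewrite ?lt ?d0 ?e0.
Qed.

Lemma iter_periodM d n x : iter d phi x = x -> iter (n * d) phi x = x.
Proof. by move=> e; elim: n => // n IH; rewrite mulSn iterD IH. Qed.

Lemma iter_mod d n x : iter d phi x = x -> iter n phi x = iter (n %% d) phi x.
Proof. by move=> e; rewrite {1}(divn_eq n d) addnC iterD iter_periodM. Qed.

Lemma has_period_dvd d n x : has_period d x -> (iter n phi x = x) <-> (d %| n)%N.
move=> /has_periodP[d0 e H]; split=> [en|/dvdnP[m ->]]; last exact: iter_periodM.
rewrite /dvdn; apply/eqP; move: en; rewrite (iter_mod n e) => en.
by apply/eqP; rewrite -leqn0 leqNgt; apply/negP => lt; case: (H (n %% d)%N) => //; rewrite lt ltn_pmod.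
Qed.

Lemma has_period_ex n x : (0 < n)%N -> iter n phi x = x -> exists d, has_period d x.
move=> n0 e; have ex : exists d, (0 < d)%N && (iter d phi x == x) by exists n; rewrite n0 e eqxx.
case: (ex_minnP ex) => d /andP[d0 /eqP ed] H; exists d; apply/has_periodP; split=> // i /andP[i0 lti] ei.
by have := H i; rewrite i0 ei eqxx => /(_ isT); rewrite leqNgt lti.
Qed.

Lemma iter_inj n : injective (iter n phi).
Proof. by elim: n => [|n IH] x y //= /phi_inj/IH. Qed.

Lemma has_period_iter d n x : has_period d x -> has_period d (iter n phi x).
move=> /has_periodP[d0 e H]; apply/has_periodP; split=> // [|i lti].
 by rewrite -iterD addnC iterD e.
by rewrite -iterD addnC iterD => /iter_inj; apply: H.
Qed.

Lemma traject_uniq d x : has_period d x -> uniq (traject phi x d).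
move=> px; have /has_periodP[d0 e H] := px.
rewrite (_ : traject phi x d = [seq iter i phi x | i <- iota 0 d]); last first.
 by apply: (@eq_from_nth _ x); rewrite ?size_map ?size_traject ?size_iota // => i lti;
   rewrite nth_traject // (nth_map 0%N) ?size_iota // nth_iota.
rewrite map_inj_in_uniq ?iota_uniq // => a b; rewrite !mem_iota /= => lta ltb.
wlog le : a b lta ltb / (a <= b)%N.
 by move=> W e'; case/orP: (leq_total a b) => l; [apply: W|apply/esym/W].
rewrite -(subnK le) addnC iterD => /iter_inj; have [->|nz] := posnP (b - a); first by rewrite addn0.
by move=> e'; case: (H (b - a)%N) => //; rewrite nz; lia.
Qed.

Lemma traject_sym d x y : iter d phi y = y -> x \in traject phi y d -> y \in traject phi x d.
move=> e /trajectP[i lti ->]; apply/trajectP; exists ((d - i) %% d)%N; first by rewrite ltn_pmod; lia.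
have e2 : iter d phi (iter i phi y) = iter i phi y by rewrite -iterD addnC iterD e.
by rewrite -(iter_mod (d - i) e2) -iterD subnK ?e // ltnW.
Qed.

Lemma traject_trans d x y z : iter d phi z = z -> x \in traject phi y d -> y \in traject phi z d ->
 x \in traject phi z d.
move=> e /trajectP[i lti ->] /trajectP[i' lti' ->]; rewrite -iterD (iter_mod _ e).
by apply/trajectP; exists ((i + i') %% d)%N => //; rewrite ltn_pmod; lia.
Qed.

Variables (E : nat -> seq T) (E_uniq : forall d, uniq (E d)) (E_period : forall d x, x \in E d -> has_period d x) (E_phi : forall d x, x \in E d -> phi x \in E d).

(** With d the period of a, testing d iterates of each b is enough: points of different periods
    never share an orbit. *)
Definition indep d (a : T) (t : seq T) : bool := all (fun b => a \notin traject phi b d) t.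

(** An equivariant injection is known from the images of one point per cycle: these have the cycle
    lengths ds as exact periods and lie in pairwise distinct orbits. *)
Fixpoint cfg (ds : seq nat) : seq (seq T) :=
 if ds is d :: ds' then flatten [seq [seq a :: t | a <- E d & indep d a t] | t <- cfg ds']
 else [:: [::]].

Lemma mem_cfg_cons d ds a t : (a :: t \in cfg (d :: ds)) = [&& a \in E d, indep d a t & t \in cfg ds].
apply/flattenP/and3P => [[_ /mapP[t' t'c ->] /mapP[a']]|[aE ind tc]].
 by rewrite mem_filter => /andP[ind aE] [-> ->].
by exists [seq a :: t | a <- E d & indep d a t]; [exact: map_f|apply: map_f; rewrite mem_filter ind].
Qed.

Lemma cfg_size ds t : t \in cfg ds -> size t = size ds.
elim: ds t => [|d ds IH] t; first by rewrite inE => /eqP ->.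
by case: t => [|a t]; [case/flattenP=> _ /mapP[? _ ->] /mapP[]|rewrite mem_cfg_cons => /and3P[_ _ /IH /= ->]].
Qed.

Lemma cfg_uniq ds : uniq (cfg ds).
elim: ds => [//|d ds IH] /=; elim: (cfg ds) IH => [//|t s IH2] /= /andP[nt us].
rewrite cat_uniq IH2 // andbT map_inj_uniq ?filter_uniq //=; last by move=> ? ? [].
apply/hasPn => x /flattenP[_ /mapP[t' t's ->] /mapP[a _ ->]]; apply/negP => /mapP[a' _ [_ e]].
by rewrite -e t's in nt.
Qed.

Lemma sum_cfg_cons (R : nmodType) (F : seq T -> R) d ds :
 \sum_(t <- cfg (d :: ds)) F t = \sum_(t <- cfg ds) \sum_(a <- E d | indep d a t) F (a :: t).
Proof. by rewrite /= big_flatten big_map; apply: eq_bigr => t _; rewrite big_map big_filter. Qed.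

Lemma cfg_period ds t c : t \in cfg ds -> c \in t -> exists d, has_period d c.
elim: ds t => [|d ds IH] t; first by rewrite inE => /eqP ->.
case: t => [//|a t]; rewrite mem_cfg_cons => /and3P[aE _ /IH H]; rewrite inE => /orP[/eqP ->|/H //].
by exists d; apply: E_period.
Qed.

Lemma conj_period a c n d d' : has_period d' c -> has_period d a -> a \in traject phi c n -> d' = d.
Proof. by move=> pc pa /trajectP[i _ e]; move: pa; rewrite e => /(has_period_uniq (has_period_iter i pc)). Qed.

Lemma cfg_zip_period ds t b d : t \in cfg ds -> (b, d) \in zip t ds -> has_period d b.
elim: ds t => [|e ds IH] [|c t] //; rewrite mem_cfg_cons inE => /and3P[cE _ tc] /orP[/eqP[-> ->]|bt].
 exact: E_period.
exact: IH bt.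
Qed.

Lemma cfg_orbits_uniq ds t : t \in cfg ds -> uniq (flatten [seq traject phi p.1 p.2 | p <- zip t ds]).
elim: ds t => [|d ds IH] [|a t] //.
rewrite mem_cfg_cons => /and3P[aE ind tc] /=; rewrite cat_uniq IH // andbT.
have pa := E_period aE; rewrite traject_uniq //=; apply/hasPn => x /flattenP[_ /mapP[[b d'] /= bt ->] xb].
apply/negP => xa.
have bt' : b \in t by have := map_f fst bt; rewrite -/(unzip1 (zip t ds)) unzip1_zip // (cfg_size tc).
have pb := cfg_zip_period tc bt.
have px : has_period d x by move: xa => /trajectP[i _ ->]; apply: has_period_iter.
have ed := conj_period pb px xb; subst d'.
have /allP/(_ b bt')/negP := ind; case.
have /has_periodP[_ ea _] := pa; have /has_periodP[_ eb _] := pb.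
exact: traject_trans eb (traject_sym ea xa) xb.
Qed.

(** The points of E d that are not independent of t form the orbits of the entries of t of period d;
    each such orbit has d points, on which g is constant. *)
Lemma E_sum_split (R : nmodType) (g : T -> R) d ds t : t \in cfg ds ->
 (forall a, a \in E d -> g (phi a) = g a) ->
 \sum_(a <- E d) g a = \sum_(a <- E d | indep d a t) g a +
  \sum_(p <- zip t ds | p.2 == d) g p.1 *+ d.
move=> tc ginv; rewrite (bigID (fun a => indep d a t)) /=; congr (_ + _).
elim: ds t tc => [|d' ds IH] t; first by rewrite inE => /eqP ->; rewrite big_nil big_pred0.
case: t => [|b t]; first by move=> /cfg_size.
rewrite mem_cfg_cons => /and3P[bE ind tc] /=; rewrite big_cons /= -(IH t tc).
have pb := E_period bE.
case: eqP => [ed|ne]; last first.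
 rewrite -big_filter -[RHS]big_filter; apply: perm_big; apply: uniq_perm; rewrite ?filter_uniq // => a.
 rewrite !mem_filter; case aE: (a \in E d); rewrite ?andbF // !andbT negb_and negbK.
 by apply: orb_idl => /(conj_period pb (E_period aE)).
subst d'; have gtr n : \sum_(a <- traject phi b n) g a = g b *+ n.
 elim: n b {ind pb} bE => [|n IHn] b bE; first by rewrite big_nil mulr0n.
 by rewrite /= big_cons IHn ?E_phi // ginv // mulrS.
have sub a : a \in traject phi b d -> a \in E d.
 by move=> /trajectP[i _ ->]; elim: i => [//|i IHi]; exact/E_phi/IHi.
rewrite -gtr // -[X in _ + X]big_filter -big_cat -big_filter; apply: perm_big; apply: uniq_perm; rewrite ?filter_uniq //.
 rewrite cat_uniq traject_uniq ?filter_uniq //= andbT; apply/hasPn => a.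
 rewrite mem_filter => /andP[/allPn[c ct /negPn ac] aE]; apply/negP => ab.
 have [dc pc] := cfg_period tc ct; have e := conj_period pc (E_period aE) ac; subst dc.
 have /allP/(_ c ct)/negP := ind; case.
 have /has_periodP[_ ec _] := pc; have /has_periodP[_ eb _] := pb.
 exact: traject_trans ec (traject_sym eb ab) ac.
move=> a; rewrite mem_cat !mem_filter negb_and negbK andb_orl; congr (_ || _).
by apply: andb_idr; apply: sub.
Qed.

Lemma size_cfg_cons d ds :
 (size (cfg (d :: ds)))%:Z = (size (cfg ds))%:Z * ((size (E d))%:Z - (d * count_mem d ds)%N%:Z).
have sumsize (U : Type) (s : seq U) : (size s)%:Z = \sum_(x <- s) 1 by rewrite big_const_seq count_predT iter_addr addr0 natz.
rewrite (sumsize _ (cfg (d :: ds))) sum_cfg_cons (sumsize _ (cfg ds)) mulr_suml.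
rewrite big_seq [RHS]big_seq; apply: eq_bigr => t tc; rewrite mul1r (sumsize _ (E d)).
suff -> : (d * count_mem d ds)%N%:Z = \sum_(p <- zip t ds | p.2 == d) (1 : int) *+ d.
 by rewrite [in RHS](E_sum_split tc) // addrK.
move: (cfg_size tc) => {tc}; elim: ds t => [|e ds IH] [|b t] //=; first by rewrite big_nil muln0.
move=> [st].
rewrite big_cons /= mulnDr PoszD (IH t st); case: eqP => _ /=; last by rewrite muln0 add0r.
by rewrite muln1 natz.
Qed.

Section WeightedSums.
Variables (R : comNzRingType) (tau : nat -> T -> R) (tau_phi : forall d a, a \in E d -> tau d (phi a) = tau d a) (tau3 : forall d a, tau d a ^+ 3 = tau d a).

(** An entry (d, e) of l asks for the factor tau_d(a)^e at a point a of exact degree d. *)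
Definition weight (t : seq T) (l : seq (nat * nat)) : R := \prod_(p <- zip t l) tau p.2.1 p.1 ^+ p.2.2.

Definition cfg_sum (l : seq (nat * nat)) : R := \sum_(t <- cfg (unzip1 l)) weight t l.

(* The exponents matter only up to parity, since tau^3 = tau. *)
Fixpoint bump (d e : nat) (l : seq (nat * nat)) : seq (seq (nat * nat)) :=
 if l is x :: l' then
  (if x.1 == d then [:: (d, if odd (x.2 + e) then 1%N else 2) :: l'] else [::]) ++ map (cons x) (bump d e l')
 else [::].

Lemma tau_parity d a n : (0 < n)%N -> tau d a ^+ n = tau d a ^+ (if odd n then 1%N else 2).
move=> n0; have H m : tau d a ^+ m.+3 = tau d a ^+ m.+1 by rewrite -addn3 exprD tau3 -exprSr.
elim/ltn_ind: n n0 => -[//|[|[|n]]] IH _ //.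
by rewrite H IH //= negbK.
Qed.

Lemma weight_bump d e t l : (0 < e)%N -> all (fun x => 0 < x.2)%N l -> size t = size l ->
 (\sum_(p <- zip t (unzip1 l) | p.2 == d) tau d p.1 ^+ e) * weight t l = \sum_(l' <- bump d e l) weight t l'.
move=> e0; elim: l t => [|[d' e'] l IH] [|a t] //=; first by rewrite !big_nil mul0r.
move=> /andP[e'0 al] [st]; rewrite big_cons big_cat big_map /weight /= big_cons /=.
have key : (\sum_(p <- zip t (unzip1 l) | p.2 == d) tau d p.1 ^+ e) * (tau d' a ^+ e' * weight t l) =
  \sum_(l' <- bump d e l) \prod_(p <- zip (a :: t) ((d', e') :: l')) tau p.2.1 p.1 ^+ p.2.2.
 rewrite mulrCA IH // mulr_sumr; apply: eq_bigr => l' _; rewrite /= big_cons //.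
case: eqP => [ed|_]; last by rewrite big_nil add0r key.
subst d'; rewrite mulrDl; congr (_ + _); last exact: key.
by rewrite big_seq1 /= big_cons /= -tau_parity ?addn_gt0 ?e0 ?orbT // exprD; ring.
Qed.

(** The additional point lies in a new orbit, or is one of the d conjugates of an entry of degree d,
    whose exponent it then raises by e. *)
Lemma cfg_sum_mul d e l : (0 < e)%N -> all (fun x => 0 < x.2)%N l ->
 (\sum_(a <- E d) tau d a ^+ e) * cfg_sum l =
 cfg_sum ((d, e) :: l) + \sum_(l' <- bump d e l) cfg_sum l' *+ d.
move=> e0 al; rewrite /cfg_sum [unzip1 (_ :: _)]/= sum_cfg_cons mulr_sumr.
have bE l' : l' \in bump d e l -> unzip1 l' = unzip1 l.
 elim: l l' {al} => [//|[d' e'] l IH] l' /=; rewrite mem_cat => /orP[|/mapP[l'' /IH e1 ->]]; last by rewrite /= e1.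
 by case: eqP => [->|_]; rewrite ?inE // => /eqP ->.
have -> : \sum_(l' <- bump d e l) (\sum_(t <- cfg (unzip1 l')) weight t l') *+ d =
  \sum_(t <- cfg (unzip1 l)) (\sum_(l' <- bump d e l) weight t l') *+ d.
 rewrite (eq_big_seq (fun l' => \sum_(t <- cfg (unzip1 l)) weight t l' *+ d)); last first.
  by move=> l' /bE ->; rewrite sumrMnl.
 by rewrite exchange_big /=; apply: eq_bigr => t _; rewrite sumrMnl.
rewrite -big_split; apply: eq_big_seq => t tc /=.
have st : size t = size l by rewrite (cfg_size tc) size_map.
rewrite -weight_bump // (E_sum_split tc); last by move=> a aE; rewrite tau_phi.
rewrite mulrDl sumrMnl mulrnAl; congr (_ + _).
by rewrite mulr_suml; apply: eq_bigr => a _; rewrite /weight /= big_cons.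
Qed.
End WeightedSums.

End Dynamics.

(** * Tuples fixed by F sigma *)

Section EquivariantInjections.
Variables (T : eqType) (phi : T -> T) (phi_inj : injective phi) (E : nat -> seq T) (E_uniq : forall d, uniq (E d)) (E_period : forall d x, x \in E d -> has_period phi d x) (E_phi : forall d x, x \in E d -> phi x \in E d).
Notation cfg := (cfg phi E).
Variables (U : Type) (S : set U) (psi : U -> U) (co : U -> T) (co_inj : forall u u', S u -> S u' -> co u = co u' -> u = u') (psi_S : forall u, S u -> S (psi u)) (co_psi : forall u, S u -> co (psi u) = phi (co u)) (co_E : forall u d, S u -> has_period phi d (co u) -> co u \in E d) (E_co : forall d x, x \in E d -> exists u, S u /\ co u = x) (n : nat) (sigma : 'S_n).

Definition cycle_reps : seq 'I_n := enum (froots sigma).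
Definition cycle_type : seq nat := [seq fingraph.order sigma r | r <- cycle_reps].

Let sinj : injective sigma := @perm_inj _ sigma.

Let connsym : connect_sym (frel sigma) := fconnect_sym sinj.

Lemma order_period r : has_period sigma (fingraph.order sigma r) r.
apply/has_periodP; split; [exact: fingraph.order_gt0|exact: iter_order|].
move=> e /andP[e0 lte] er.
have := fingraph.orbit_uniq sigma r; rewrite /fingraph.orbit -(prednK (fingraph.order_gt0 sigma r)) /= => /andP[/negP H _].
apply: H; rewrite -{1}er; apply/trajectP; exists e.-1; first by move: e0 lte; lia.
by rewrite -iterSr prednK.
Qed.

Lemma cfg_map_sep (I : eqType) (rs : seq I) (f : I -> T) (o : I -> nat) : uniq rs ->
 [seq f r | r <- rs] \in cfg [seq o r | r <- rs] ->
 (forall r, r \in rs -> f r \in E (o r)) /\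
 (forall r r' i, r \in rs -> r' \in rs -> f r = iter i phi (f r') -> r = r').
elim: rs => [//|r rs IH] /= /andP[nr urs]; rewrite mem_cfg_cons => /and3P[fE ind /(IH urs)[H1 H2]].
have {}H1 r1 : r1 \in r :: rs -> f r1 \in E (o r1) by rewrite inE => /orP[/eqP ->|/H1].
split=> // r1 r2 i.
have sep r' l : r' \in rs -> f r = iter l phi (f r') -> False.
 move=> r'rs e; have pr' := E_period (H1 r' _); rewrite inE r'rs orbT in pr'.
 have eo : o r' = o r.
  by apply: (has_period_uniq (has_period_iter phi_inj l (pr' isT))); rewrite -e; apply: E_period.
 have /has_periodP[o0 eq _] := pr' isT.
 have /allP/(_ (f r') (map_f _ r'rs))/negP := ind; case; rewrite e (iter_mod l eq) -eo.
 by apply/trajectP; exists (l %% o r')%N => //; rewrite ltn_pmod.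
rewrite !inE => /orP[/eqP ->|r1rs] /orP[/eqP ->|r2rs] //; last exact: H2.
 by move=> e; case: (sep _ _ r2rs e).
move=> e; have /has_periodP[o0 eq _] := E_period fE.
case: (sep r1 (o r - i %% o r)%N r1rs).
by rewrite e (iter_mod i eq) -iterD subnK ?eq // ltnW // ltn_pmod.
Qed.

(** Since psi (p (sigma i)) = p i, a tuple is determined on each cycle by its value at the root of
    the cycle, and injectivity makes the period of that value equal to the cycle length. *)
Lemma card_equivariant :
 ([set p : 'I_n -> U | [/\ forall i, S (p i), injective p & forall i, psi (p (sigma i)) = p i]]
  #= `I_(size (cfg cycle_type)))%card.
apply: (card_eq_seq (F := fun p => [seq co (p r) | r <- cycle_reps])); first exact: cfg_uniq.
- move=> p [Sp pinj eqv].
 have cpi x y : co (p x) = co (p y) -> x = y by move=> /(co_inj (Sp x) (Sp y))/pinj.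
 have step i x : co (p x) = iter i phi (co (p (iter i sigma x))).
  by elim: i => [//|i IH]; rewrite IH iterSr iterS -co_psi // eqv.
 have per r : co (p r) \in E (fingraph.order sigma r).
  apply: co_E => //; apply/has_periodP; split; first exact: fingraph.order_gt0.
   by rewrite {2}(step (fingraph.order sigma r) r) iter_order.
  move=> e lte; rewrite {2}(step e r) => /(iter_inj phi_inj)/cpi er.
  by have /has_periodP[_ _ /(_ e lte)] := order_period r; rewrite -er.
 rewrite /cycle_type /cycle_reps.
 have : {subset enum (froots sigma) <= froots sigma} by move=> x; rewrite mem_enum.
 have := enum_uniq (froots sigma); elim: (enum _) => [//|r rs IH] /= /andP[nr urs] sub.
 rewrite mem_cfg_cons per IH // ?andbT; last by move=> x xr; apply: sub; rewrite inE xr orbT.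
 apply/allP => _ /mapP[r' r'rs ->]; apply/negP => /trajectP[i _ ei].
 pose y := iter i (finv sigma) r'.
 have ry : iter i sigma y = r'.
  by rewrite /y; elim: i {ei y} r' {r'rs} => [//|i IHi] z; rewrite iterSr iterS f_finv.
 have := step i y; rewrite ry -ei => /cpi e.
 have c : fconnect sigma r r' by rewrite -e -ry fconnect_iter.
 have Rr : r \in froots sigma by apply: sub; rewrite mem_head.
 have Rr' : r' \in froots sigma by apply: sub; rewrite inE r'rs orbT.
 move/(fingraph.rootP connsym): c; rewrite (eqP Rr) (eqP Rr') => er.
 by rewrite er r'rs in nr.
- move=> p p' [Sp pinj eqv] [Sp' pinj' eqv'] e; apply: functional_extensionality_dep => x.
 have stepU i w (Sw : forall i, S (w i)) : (forall i, psi (w (sigma i)) = w i) ->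
   w x = iter i psi (w (iter i sigma x)).
  by move=> ew; elim: i => [//|i IH]; rewrite IH iterSr iterS ew.
 have er := iter_findex (connect_root (frel sigma) x).
 rewrite (stepU (findex sigma x (froot sigma x)) p) // (stepU (findex sigma x (froot sigma x)) p') //.
 rewrite er; congr (iter _ _ _); apply: co_inj => //.
 have /eq_in_map := e; apply; rewrite mem_enum; exact: roots_root.
- move=> t tc; rewrite /cycle_type in tc.
 pose m x := index (froot sigma x) cycle_reps.
 (* As sigma needs i x steps from x to its root, p x has to be the i x-th iterate of the point
    chosen at the root. *)
 pose i x := findex sigma x (froot sigma x).
 have rin x : froot sigma x \in cycle_reps by rewrite mem_enum; apply: roots_root.
 have st : size t = size cycle_reps by rewrite (cfg_size tc) size_map.
 case: t tc st => [|b t'] tc st.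
  have none (x : 'I_n) : False by have := rin x; rewrite (size0nil (esym st)).
  exists (fun x => False_rect _ (none x)); split; first by split=> x; case: (none x).
  by rewrite (size0nil (esym st)).
 set t := b :: t' in tc st *; pose tb r := nth b t (index r cycle_reps).
 have ur : uniq cycle_reps by apply: enum_uniq.
 have et : [seq tb r | r <- cycle_reps] = t.
  apply: (@eq_from_nth _ b); rewrite ?size_map // => l ltl.
  have [x0 _] : exists x0 : 'I_n, true by case: (cycle_reps) ltl => // x0; exists x0.
  by rewrite (nth_map x0) // /tb index_uniq.
 rewrite -et in tc; have [H1 H2] := cfg_map_sep ur tc.
 have q_shift r a c y : froot sigma y = r -> iter a sigma y = r -> iter c phi (tb r) = iter a phi (tb r) ->
   (a <= c)%N -> iter c sigma y = r.
  move=> ey ea e le; have rr : r \in cycle_reps by rewrite -ey.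
  rewrite -(subnK le) iterD ea; apply/(has_period_dvd _ (order_period r)).
  apply/(has_period_dvd _ (E_period (H1 r rr))); apply: (iter_inj phi_inj (n := a)).
  by rewrite -iterD addnC subnK.
 have iP x : iter (i x) sigma x = froot sigma x by apply/iter_findex/connect_root.
 have step x a : iter a sigma x = froot sigma x -> iter a phi (tb (froot sigma x)) = iter (i x) phi (tb (froot sigma x)).
  move=> ea; set r := froot sigma x in ea *.
  have key a' c : (a' <= c)%N -> iter a' sigma x = r -> iter c sigma x = r -> iter c phi (tb r) = iter a' phi (tb r).
   move=> le e1 e2; rewrite -(subnK le) addnC iterD; congr (iter _ _ _).
   apply/(has_period_dvd _ (E_period (H1 r (rin x)))); apply/(has_period_dvd _ (order_period r)).
   by rewrite -{1}e1 -iterD subnK.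
  by case/orP: (leq_total a (i x)) => le; [apply/esym|]; apply: key => //; apply: iP.
 have qE x : iter (i x) phi (tb (froot sigma x)) \in E (fingraph.order sigma (froot sigma x)).
  by elim: (i x) => [|l IH]; [apply: H1|apply: E_phi].
 have [p pP] := choice (fun x => E_co (qE x)).
 exists p; split; last first.
  rewrite -[RHS]et; apply/eq_in_map => r rr; have [_ ->] := pP r.
  have er : froot sigma r = r by apply/eqP; move: rr; rewrite mem_enum.
  by rewrite -(step r 0%N) ?er.
 split=> [x|x x' e|x]; first by case: (pP x).
  have [_ e1] := pP x; have [_ e2] := pP x'; rewrite e e2 in e1.
  wlog le : x x' e e1 e2 / (i x <= i x')%N.
   by move=> W; case/orP: (leq_total (i x) (i x')) => le; [apply: W|apply/esym/W => //; case: (pP x)].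
  have er : froot sigma x = froot sigma x'.
   apply: (H2 _ _ (i x' - i x)%N) => //; apply: (iter_inj phi_inj (n := i x)).
   by rewrite -iterD addnC subnK.
  have := q_shift (froot sigma x') (i x) (i x') x er; rewrite -{1}er iP => /(_ (erefl _)).
  by rewrite e1 er => /(_ (erefl _) le); rewrite -(iP x') => /(iter_inj sinj).
 have [Sx cx] := pP x; have [Sx' cx'] := pP (sigma x).
 apply: co_inj => //; [exact: psi_S|rewrite co_psi // cx cx' -iterS].
 have er : froot sigma (sigma x) = froot sigma x.
  by apply/esym/(fingraph.rootP connsym)/connect1; rewrite /= eqxx.
 by rewrite er; apply: step; rewrite iterSr iP.
Qed.
End EquivariantInjections.

(** * Points of P^1 and local traces *)

Section ProjectiveLine.
Variables (k : finFieldType) (L : closedFieldType) (j : {rmorphism k -> L}).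
Notation q := #|k|.
Notation fr := (@fr k L).
Notation Fx := (fixed_points k L).

Definition frP (a : option L) : option L := omap (fr 1) a.

Lemma frP_inj : injective frP.
Proof. by move=> [x|] [y|] //= [] /(fr_inj j) ->. Qed.

Lemma iter_frP d a : iter d frP a = omap (fr d) a.
elim: d a => [|d IH] a; first by case: a => //= z; rewrite fr_id.
by rewrite iterS IH; case: a => //= z; rewrite -fr_add add1n.
Qed.

Definition P1_pts (d : nat) : seq (option L) :=
 [seq a <- None :: map Some (Fx d) | has_period frP d a].

Lemma P1_pts_uniq d : uniq (P1_pts d).
case: d => [|d]; first by rewrite /P1_pts (@eq_filter _ _ pred0) ?filter_pred0.
rewrite filter_uniq //= map_inj_uniq; last by move=> ? ? [].
by have [-> _ _] := fixed_pointsP j (ltn0Sn d); rewrite andbT; apply/mapP => -[].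
Qed.

Lemma mem_P1_pts d a : (a \in P1_pts d) = has_period frP d a.
rewrite mem_filter; apply: andb_idr => /has_periodP[d0 e _]; rewrite inE.
have [_ _ mF] := fixed_pointsP j d0.
by case: a e => [z|//]; rewrite iter_frP /= => -[e]; rewrite map_f // mF e.
Qed.

Lemma P1_pts_fr d a : a \in P1_pts d -> frP a \in P1_pts d.
Proof. by rewrite !mem_P1_pts => /(has_period_iter frP_inj 1). Qed.

Lemma sum_P1_pts r : (0 < r)%N -> (\sum_(d <- divisors r) size (P1_pts d))%N = (q ^ r).+1.
move=> r0; have [uF sF mF] := fixed_pointsP j r0.
rewrite -sF -(size_map Some) -[(size _).+1]/(size (None :: map Some (Fx r))).
have -> : (\sum_(d <- divisors r) size (P1_pts d))%N = size (flatten [seq P1_pts d | d <- divisors r]).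
 by rewrite size_flatten /shape -map_comp sumnE big_map.
apply: perm_size; apply: uniq_perm.
- have := divisors_uniq r; elim: (divisors r) => [//|d ds IH] /= /andP[nd /IH u].
 rewrite cat_uniq P1_pts_uniq u andbT /=; apply/hasPn => a /flattenP[_ /mapP[e ee ->]].
 rewrite mem_P1_pts => ae; apply/negP; rewrite mem_P1_pts => /has_period_uniq/(_ ae) ed.
 by rewrite ed ee in nd.
- rewrite /= map_inj_uniq ?uF ?andbT; last by move=> ? ? [].
 by apply/mapP => -[].
- move=> a; apply/flattenP/idP => [[_ /mapP[d dr ->]]|].
  rewrite mem_P1_pts => pa; rewrite -dvdn_divisors // in dr.
  have := (has_period_dvd r pa).2 dr; rewrite iter_frP.
  by case: a {pa} => [z|] //= [e]; rewrite inE map_f // mF e.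
 move=> ai; have e : iter r frP a = a.
  rewrite iter_frP; move: ai; rewrite inE => /orP[/eqP -> //|/mapP[z]].
  by rewrite mF => /eqP e -> /=; rewrite e.
 have [d pd] := has_period_ex r0 e.
 exists (P1_pts d); last by rewrite mem_P1_pts.
 by apply/map_f; rewrite -dvdn_divisors //; apply/(has_period_dvd r pd).
Qed.

(** p is read as a binary form of degree N, whose value at infinity is its N-th coefficient. The
    explicit N makes evaluation multiplicative there too, see [evpM]. *)
Definition evp (N : nat) (p : {poly k}) (a : option L) : L :=
 if a is Some z then pev j z p else j p`_N.

Lemma evpD N p r a : evp N (p + r) a = evp N p a + evp N r a.
Proof. by case: a => [z|] /=; rewrite ?pevD // coefD rmorphD. Qed.

Lemma evpN N p a : evp N (- p) a = - evp N p a.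
Proof. by case: a => [z|] /=; rewrite ?pevN // coefN rmorphN. Qed.

Lemma evpB N p r a : evp N (p - r) a = evp N p a - evp N r a.
Proof. by rewrite evpD evpN. Qed.

Lemma evpZ N c p a : evp N (c *: p) a = j c * evp N p a.
Proof. by case: a => [z|] /=; rewrite ?pevZ // coefZ rmorphM. Qed.

Lemma evp0 N a : evp N 0 a = 0.
Proof. by case: a => [z|] /=; rewrite ?pev0 // coef0 rmorph0. Qed.

Lemma evpM m n (p r : {poly k}) a : (size p <= m.+1)%N -> (size r <= n.+1)%N ->
 evp (m + n) (p * r) a = evp m p a * evp n r a.
move=> sp sr; case: a => [z|] /=; rewrite ?pevM // -rmorphM; congr (j _).
rewrite coefM (bigD1 (inord m)) //= inordK ?ltnS ?leq_addr // addKn big1 ?addr0 // => i ne.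
have [lt|gt|e] := ltngtP i m; last by rewrite -(inj_eq val_inj) /= inordK ?ltnS ?leq_addr // e eqxx in ne.
 by rewrite [r`_ _]nth_default ?mulr0 // (leq_trans sr) //; move: (ltn_ord i) lt; lia.
by rewrite [p`_ _]nth_default ?mul0r // (leq_trans sp).
Qed.

Lemma fr_evp N p d a : fr d (evp N p a) = evp N p (iter d frP a).
Proof. by rewrite iter_frP; case: a => [z|] /=; rewrite ?fr_pev ?fr_j. Qed.

(** For odd q this is the quadratic character of H^2 + 4 F in F_(q^d); for even q it is an additive
    character of F / H^2, or 0 when H = 0. Counting roots covers both at once. *)
Definition tau_root (d : nat) (H F : L) : rat := (count (fun y => y ^+ 2 + H * y == F) (Fx d))%:R - 1.

Lemma tau_rootE d H F y : (0 < d)%N -> fr d H = H -> fr d F = F -> y ^+ 2 + H * y = F ->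
 tau_root d H F = if y *+ 2 + H == 0 then 0 else if fr d y == y then 1 else -1.
move=> d0 eH eF ey; have [uF _ mF] := fixed_pointsP j d0.
pose y' := - H - y.
have roots z : (z ^+ 2 + H * z == F) = (z == y) || (z == y').
 rewrite -[z == y]subr_eq0 -[z == y']subr_eq0 -mulf_eq0 -subr_eq0 -ey; congr (_ == 0).
 by rewrite /y'; ring.
have fy : fr d y ^+ 2 + H * fr d y = F by rewrite -[in RHS]eF -ey (frD j) frM frX eH.
rewrite /tau_root (eq_count (a2 := pred2 y y')) //.
have e2 : (y *+ 2 + H == 0) = (y == y').
 by rewrite -[RHS]subr_eq0 /y'; congr (_ == 0); ring.
rewrite e2; case: eqP => [e|ne].
 have : (fr d y == y) || (fr d y == y') by rewrite -roots fy.
 rewrite -e orbb -mF => yF.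
 by rewrite (eq_count (a2 := pred1 y)) ?count_uniq_mem ?yF ?subrr // => z /=; rewrite orbb.
have cE : count (pred2 y y') (Fx d) = ((y \in Fx d) + (y' \in Fx d))%N.
 rewrite -!count_uniq_mem // -count_predUI [X in (_ = _ + X)%N](eq_count (a2 := pred0)).
  by rewrite count_pred0 addn0.
 by move=> z /=; apply/negP => /andP[/eqP -> /eqP].
rewrite cE !mF; have -> : (fr d y' == y') = (fr d y == y).
 by rewrite /y' (frB j) (frN j) eH (inj_eq (addrI _)) (inj_eq oppr_inj).
by case: ifP => _; rewrite ?sub0r // -natrB.
Qed.

Definition tau (G : nat) (h f : {poly k}) (d : nat) (a : option L) : rat :=
 tau_root d (evp G h a) (evp (2 * G) f a).

Lemma tau_root3 d H F : tau_root d H F ^+ 3 = tau_root d H F.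
have [y ey] := quad_root H F.
have uF : uniq (Fx d) by rewrite /fixed_points; case: xgetP => [s _ []|_].
have : (count (fun y : L => (y ^+ 2 + H * y)%R == F) (Fx d) <= 2)%N.
 apply: (@leq_trans (count (mem [:: y; - H - y]) (Fx d))).
  apply: sub_count => z /=; rewrite -ey -subr_eq0.
  have -> : z ^+ 2 + H * z - (y ^+ 2 + H * y) = (z - y) * (z - (- H - y)) by ring.
  by rewrite mulf_eq0 !subr_eq0 !inE.
 rewrite -size_filter; apply: (uniq_leq_size (s2 := [:: y; - H - y])); first exact: filter_uniq.
 by move=> z; rewrite mem_filter => /andP[].
by rewrite /tau_root; case: (count _ _) => [|[|[|//]]] _.
Qed.

Lemma tau3 G h f d a : tau G h f d a ^+ 3 = tau G h f d a.
Proof. exact: tau_root3. Qed.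

Lemma tauE G h f d a y : has_period frP d a -> y ^+ 2 + evp G h a * y = evp (2 * G) f a ->
 tau G h f d a = if y *+ 2 + evp G h a == 0 then 0 else if fr d y == y then 1 else -1.
Proof. by move=> /has_periodP[d0 ea _]; apply: tau_rootE; rewrite // fr_evp ea. Qed.

Lemma tau_fr G h f d a : a \in P1_pts d -> tau G h f d (frP a) = tau G h f d a.
rewrite mem_P1_pts => pa; have pa' := has_period_iter frP_inj 1 pa.
have [y ey] := quad_root (evp G h a) (evp (2 * G) f a).
have ey' : fr 1 y ^+ 2 + evp G h (frP a) * fr 1 y = evp (2 * G) f (frP a).
 by rewrite -!(fr_evp _ _ 1) -ey (frD j) frM frX.
rewrite (tauE pa ey) (tauE pa' ey') -(fr_evp _ _ 1) frC (inj_eq (fr_inj j (d := 1))).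
by rewrite !mulr2n -!(frD j) fr_eq0.
Qed.
End ProjectiveLine.

(** * Averaging over translations *)

Section ProductSeq.
Variable T : eqType.

Fixpoint prodseq (ss : seq (seq T)) : seq (seq T) :=
 if ss is s :: ss' then [seq x :: v | x <- s, v <- prodseq ss'] else [:: [::]].

Lemma mem_prodseq_cons s ss x v : (x :: v \in prodseq (s :: ss)) = (x \in s) && (v \in prodseq ss).
Proof. by apply/allpairsP/andP => [[[y w] /= [ys ws [-> ->]]]|[xs vs]]; [|exists (x, v)]. Qed.

Lemma prodseq_uniq ss : all uniq ss -> uniq (prodseq ss).
elim: ss => [//|s ss IH] /= /andP[us /IH uss].
by apply: allpairs_uniq => // -[x v] [x' v'] _ _ [-> ->].
Qed.

Lemma size_prodseq ss : size (prodseq ss) = (\prod_(s <- ss) size s)%N.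
Proof. by elim: ss => [|s ss IH]; rewrite ?big_nil // big_cons /= size_allpairs IH. Qed.

Lemma sum_prodseq (R : comNzRingType) (gs : seq (T -> R)) ss : size gs = size ss ->
 \sum_(v <- prodseq ss) \prod_(p <- zip gs v) p.1 p.2 = \prod_(p <- zip gs ss) \sum_(x <- p.2) p.1 x.
elim: ss gs => [|s ss IH] [|g gs] //=; first by rewrite big_seq1 !big_nil.
move=> [sg]; rewrite [RHS]big_cons -IH // big_allpairs_dep mulr_suml; apply: eq_bigr => x _.
by rewrite mulr_sumr; apply: eq_bigr => v _; rewrite big_cons.
Qed.
End ProductSeq.

(** Sum over x and f in both orders: acting by x permutes V, while for fixed f the values run once
    through A. *)
Lemma average_sum (R : comNzRingType) (X V : finType) (S : eqType) (A : seq S) (act : V -> X -> V)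
  (ev : V -> S) (Phi : S -> R) : uniq A -> #|X| = size A -> (forall x, injective (act^~ x)) ->
 (forall f, injective (fun x => ev (act f x))) -> (forall f, ev f \in A) ->
 (size A)%:R * \sum_f Phi (ev f) = #|V|%:R * \sum_(v <- A) Phi v.
move=> uA cX ai ei evA.
have inner f : \sum_(x : X) Phi (ev (act f x)) = \sum_(v <- A) Phi v.
 rewrite -(big_map (fun x => ev (act f x)) predT Phi) /= -[index_enum X]enumT.
 apply: perm_big; apply: uniq_perm => //; first by rewrite map_inj_uniq ?enum_uniq.
 have us : uniq [seq ev (act f x) | x <- enum X] by rewrite map_inj_uniq ?enum_uniq.
 have sub : {subset [seq ev (act f x) | x <- enum X] <= A} by move=> _ /mapP[x _ ->].
 have le : (size A <= size [seq ev (act f x) | x <- enum X])%N by rewrite size_map -cardE cX.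
 exact: (uniq_min_size us sub le).2.
transitivity (\sum_(x : X) \sum_f Phi (ev f)).
 by rewrite sumr_const cX mulr_natl.
transitivity (\sum_f \sum_(x : X) Phi (ev (act f x))).
 rewrite [RHS]exchange_big /=; apply: eq_bigr => x _.
 by rewrite (reindex_inj (ai x)).
by rewrite (eq_bigr _ (fun f _ => inner f)) sumr_const mulr_natl.
Qed.

(** * Interpolation at points of P^1 *)

Section Interpolation.
Variables (k : finFieldType) (L : closedFieldType) (j : {rmorphism k -> L}).
Notation q := #|k|.
Notation Fx := (fixed_points k L).
Notation cfg := (cfg (@frP k L) (@P1_pts k L)).
Notation evp := (evp j).

Definition evs N (t : seq (option L)) (p : {poly k}) : seq L := [seq evp N p a | a <- t].

(** By Frobenius p vanishes at all conjugates of the entries of t, which are [sumn ds] distinct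
    points of P^1; a nonzero form of degree N has at most N zeros there. *)
Lemma evs_eq0 N ds t (p : {poly k}) : t \in cfg ds -> (size p <= N.+1)%N -> (N.+1 <= sumn ds)%N ->
 (forall a, a \in t -> evp N p a = 0) -> p = 0.
move=> tc sp le ev0.
pose O := flatten [seq traject (@frP k L) x.1 x.2 | x <- zip t ds].
have uO : uniq O.
 by apply: (cfg_orbits_uniq (frP_inj j) _ tc) => d x; rewrite (mem_P1_pts j).
have st := cfg_size tc.
have sO : size O = sumn ds.
 rewrite /O size_flatten /shape -map_comp; congr (sumn _).
 rewrite -{2}(unzip2_zip (s := t) (t := ds)) ?st //; apply: eq_map => x /=.
 by rewrite size_traject.
have evO b : b \in O -> evp N p b = 0.
 move=> /flattenP[_ /mapP[[a d] /= at_ ->] /trajectP[i _ ->]].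
 have /ev0 e0 : a \in t by have := map_f fst at_; rewrite -/(unzip1 (zip t ds)) unzip1_zip // st.
 by rewrite -fr_evp e0 fr0.
apply/eqP; apply: contraT => p0.
have uR : uniq (pmap id O) by apply: (pmap_uniq (g := Some)) => //; case.
have rR : all (root (map_poly j p)) (pmap id O).
 by apply/allP => z; rewrite mem_pmap map_id => /evO /= /eqP.
have := max_poly_roots _ rR uR; rewrite map_poly_eq0 => /(_ p0); rewrite size_map_poly size_pmap.
have cE : count isSome O = (sumn ds - (None \in O))%N.
 rewrite -sO -(count_uniq_mem None uO) -(count_predC isSome O).
 by rewrite [X in (_ + X - _)%N](@eq_count _ _ (pred1 None)) ?addnK //; case.
rewrite (eq_count (a2 := isSome)) // cE; case: (boolP (None \in O)) => [nO|_]; last first.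
 by rewrite subn0 => lt; have := leq_trans lt (leq_trans sp le); rewrite ltnn.
have c0 : p`_N = 0 by apply/eqP; rewrite -(fmorph_eq0 j); apply/eqP; apply: evO nO.
have sp' : (size p <= N)%N by apply/(size_le_coef sp).
by rewrite subn1 => lt; have := leq_trans lt sp'; move: le; lia.
Qed.

Lemma evs_mem N ds t p : t \in cfg ds -> evs N t p \in prodseq [seq Fx d | d <- ds].
elim: ds t => [|d ds IH] [|a t] //; first by case/flattenP => _ /mapP[? _ ->] /mapP[].
rewrite mem_cfg_cons => /and3P[aE _ tc]; rewrite [map _ _]/= mem_prodseq_cons IH // andbT.
move: aE; rewrite (mem_P1_pts j) => /has_periodP[d0 ea _].
by have [_ _ ->] := fixed_pointsP j d0; rewrite fr_evp ea.
Qed.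

Lemma cfg_pos ds t : t \in cfg ds -> all (fun d => 0 < d)%N ds.
elim: ds t => [|d ds IH] [|a t] //=; first by case/flattenP => _ /mapP[? _ ->] /mapP[].
rewrite mem_cfg_cons => /and3P[+ _ /IH ->]; rewrite (mem_P1_pts j) andbT.
by case/has_periodP.
Qed.

Lemma prodseq_Fx ds : all (fun d => 0 < d)%N ds ->
 uniq (prodseq [seq Fx d | d <- ds]) /\ size (prodseq [seq Fx d | d <- ds]) = (q ^ sumn ds)%N.
move=> pos; split.
 by apply: prodseq_uniq; apply/allP => _ /mapP[d dd ->]; have [] := fixed_pointsP j (allP pos d dd).
rewrite size_prodseq big_map; elim: ds pos => [|d ds IH] /=; first by rewrite big_nil.
move=> /andP[d0 pos]; rewrite big_cons IH // expnD.
by have [_ -> _] := fixed_pointsP j d0.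
Qed.

(* A family of polynomials of degree at most N on which evaluation at t is bijective. *)
Definition interpolant (N E : nat) (inf : bool) (x : 'rV[k]_E) : {poly k} :=
 if inf then \poly_(i < N.+1) (if (i < E.-1)%N then (rVpoly x)`_i else if i == N then (rVpoly x)`_E.-1 else 0)
 else rVpoly x.

Lemma interpolant_inj N ds t E : t \in cfg ds -> E = sumn ds -> (E <= N.+1)%N ->
 (forall x : 'rV[k]_E, (size (interpolant N (None \in t) x) <= N.+1)%N) /\
 (forall f, injective (fun x : 'rV[k]_E => evs N t (f + interpolant N (None \in t) x))).
move=> tc eE leE; split=> [x|f x y e].
 by rewrite /interpolant; case: ifP => _; rewrite ?size_poly // (leq_trans (size_poly _ _)).
have E0 : None \in t -> (0 < E)%N.
 move=> nt; rewrite eE lt0n; apply: contraL nt => /eqP s0.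
 have := cfg_pos tc; have := cfg_size tc; case: (ds) s0 => [_ /size0nil -> //|d ds' /=].
 by case: d.
have ev0 a : a \in t -> evp N (interpolant N (None \in t) x - interpolant N (None \in t) y) a = 0.
 move=> at_; have /eq_in_map/(_ a at_) := e; rewrite !evpD evpN.
 by move=> /addrI ->; rewrite subrr.
suff e2 : rVpoly x = rVpoly y by rewrite -(rVpolyK x) e2 rVpolyK.
move: ev0 E0 e => + + _; rewrite /interpolant; case: (boolP (None \in t)) => nt ev0 E0; last first.
 apply: subr0_eq; case: E eE leE x y ev0 E0 => [|E'] eE leE x y ev0 _.
  by apply/polyP => i; rewrite coef0 nth_default // size_polyD_leq // size_polyN !(leq_trans (size_poly _ _)).
 apply: (evs_eq0 (N := E') tc); rewrite -?eE //.
  by rewrite size_polyD_leq // size_polyN !size_poly.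
 move=> [z|] at_; last by rewrite at_ in nt.
 exact: ev0 at_.
have {}E0 := E0 isT.
have sX : (size (rVpoly x) <= E)%N := size_poly _ _.
have sY : (size (rVpoly y) <= E)%N := size_poly _ _.
move: (rVpoly x) (rVpoly y) sX sY ev0 => X Y sX sY ev0.
set P := _ - _ in ev0.
pose Q : {poly k} := \poly_(i < E.-1) (P`_i).
have PN : P`_N = X`_E.-1 - Y`_E.-1.
 by rewrite /P coefB !coef_poly ltnSn eqxx; have -> : (N < E.-1)%N = false by lia.
have top : X`_E.-1 = Y`_E.-1.
 by apply/eqP; rewrite -subr_eq0 -PN -(fmorph_eq0 j); apply/eqP; apply: (ev0 None).
have PQ : P = Q.
 apply/polyP => i; rewrite /Q coef_poly; case: ltnP => // le.
 rewrite /P coefB !coef_poly; case: ifP => _; rewrite ?subrr //.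
 by rewrite ltnNge le /=; case: ifP => _; rewrite ?top subrr.
have P0 : P = 0.
 apply: (evs_eq0 (N := E.-1) tc); rewrite ?prednK // -?eE // ?PQ ?(leq_trans (size_poly _ _)) ?leq_pred //.
 by move=> [z|] at_; [rewrite -PQ; apply: ev0 at_|rewrite /= coef_poly ltnn rmorph0].
apply/polyP => i; have [lt|] := ltnP i E; last first.
 by move=> le; rewrite !nth_default // ?(leq_trans sX) ?(leq_trans sY).
have [lt2|le2] := ltnP i E.-1; last by have -> : i = E.-1 by lia.
have := congr1 (fun p : {poly k} => p`_i) P0; rewrite /P coefB !coef_poly lt2 coef0.
have -> : (i < N.+1)%N by lia.
by move/subr0_eq.
Qed.

(** Translating by interpolating polynomials shows that the tuples of values at t are
    equidistributed in the product of the F_(q^d), so the sum factors. *)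
Lemma interp_sum (R : comNzRingType) N ds t (gs : seq (L -> R)) : t \in cfg ds -> (sumn ds <= N.+1)%N ->
 size gs = size ds ->
 (q ^ sumn ds)%:R * \sum_(f : 'rV[k]_N.+1) \prod_(p <- zip gs (evs N t (rVpoly f))) p.1 p.2 =
 (q ^ N.+1)%:R * \prod_(p <- zip gs ds) \sum_(x <- Fx p.2) p.1 x.
move=> tc le sg; have [uA sA] := prodseq_Fx (cfg_pos tc).
have [sI iI] := interpolant_inj tc erefl le.
pose act (f : 'rV[k]_N.+1) (x : 'rV[k]_(sumn ds)) := f + poly_rV (interpolant N (None \in t) x).
have := @average_sum R 'rV[k]_(sumn ds) 'rV[k]_N.+1 _ (prodseq [seq Fx d | d <- ds]) act
 (fun f => evs N t (rVpoly f)) (fun v => \prod_(p <- zip gs v) p.1 p.2) uA.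
rewrite sA !card_mx !mul1n => -> //.
- rewrite sum_prodseq ?size_map //; congr (_ * _).
 elim: (ds) (gs) sg => [|d ds' IH] [|g gs'] //=; first by rewrite !big_nil.
 by move=> [sg]; rewrite !big_cons IH.
- by move=> x f f'; apply: addIr.
- move=> f x y; rewrite /act !linearD /= !poly_rV_K //; exact: iI.
- by move=> f; apply: evs_mem.
Qed.
End Interpolation.

(** * Local moments and sums with a first power *)

Section PointSums.
Variables (k : finFieldType) (L : closedFieldType) (j : {rmorphism k -> L}).
Notation q := #|k|.
Notation fr := (@fr k L).
Notation Fx := (fixed_points k L).
Notation cfg := (cfg (@frP k L) (@P1_pts k L)).
Notation evp := (evp j).

Lemma odd_card_two : odd q = (2%:R != 0 :> L).
have [p pp pk] := finPcharP k; have e : q = (p ^ logn p q)%N := card_pprimeChar pk.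
have lg : (0 < logn p q)%N by rewrite lt0n; apply: contraTneq (card_gt1 k) => e0; rewrite e e0.
rewrite {1}e oddX (gtn_eqF lg) /=; have pL := rmorph_pchar j pk.
case: (even_prime pp) => [p2|op].
 by move: pL; rewrite p2 => /pcharf0 ->; rewrite eqxx.
rewrite op; apply/esym; rewrite -(dvdn_pcharf pL).
by apply/negP => /(dvdn_leq (ltn0Sn _)); case: p pp op {pk e lg pL} => [|[|[|p]]].
Qed.

Lemma count_sum (T : eqType) (P : pred T) s : (count P s)%:R = \sum_(y <- s) (P y)%:R :> rat.
Proof. by rewrite -sum1_count natr_sum [LHS]big_mkcond; apply: eq_bigr => y _; case: (P y). Qed.

Lemma sum_pick (T : eqType) (s : seq T) (x : T) : uniq s -> x \in s -> \sum_(v <- s) (x == v)%:R = 1 :> rat.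
move=> us xs; rewrite (bigD1_seq x) //= eqxx big1 ?addr0 // => v /negPf.
by rewrite eq_sym => ->.
Qed.

Lemma count_pred2 (T : eqType) (x y : T) s : uniq s -> x != y ->
 count (pred2 x y) s = ((x \in s) + (y \in s))%N.
move=> us ne; rewrite -!count_uniq_mem // -count_predUI [X in (_ = _ + X)%N](eq_count (a2 := pred0)).
 by rewrite count_pred0 addn0.
by move=> z /=; apply/negP => /andP[/eqP -> /eqP e]; rewrite e eqxx in ne.
Qed.

Section LocalSums.
Variables (d : nat) (H : L) (d0 : (0 < d)%N) (eH : fr d H = H).

Let uF : uniq (Fx d). Proof. by have [] := fixed_pointsP j d0. Qed.
Let sF : size (Fx d) = (q ^ d)%N. Proof. by have [] := fixed_pointsP j d0. Qed.
Let mF z : (z \in Fx d) = (fr d z == z). Proof. by have [] := fixed_pointsP j d0. Qed.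
Let sum1 : \sum_(y <- Fx d) 1 = (q ^ d)%:R :> rat.
Proof. by rewrite -sF big_const_seq count_predT iter_addr_0. Qed.

Let sum_count : \sum_(v <- Fx d) (count (fun y => y ^+ 2 + H * y == v) (Fx d))%:R = (q ^ d)%:R :> rat.
under eq_bigr do rewrite count_sum; rewrite exchange_big -sum1 big_seq [RHS]big_seq /=.
apply: eq_bigr => y; rewrite mF => /eqP ey; apply: sum_pick => //.
by rewrite mF (frD j) frM frX ey eH.
Qed.

Lemma sum_tau : \sum_(v <- Fx d) tau_root k d H v = 0.
Proof. by rewrite sumrB sum_count sum1 subrr. Qed.

(** The squared fibre sizes count pairs of roots with the same value, and y has a single partner -H
    - y, equal to y exactly when 2 y + H = 0. *)
Lemma sum_tau2 : \sum_(v <- Fx d) tau_root k d H v ^+ 2 =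
 (q ^ d)%:R - (count (fun y => y *+ 2 + H == 0) (Fx d))%:R.
have sq : \sum_(v <- Fx d) (count (fun y => y ^+ 2 + H * y == v) (Fx d))%:R ^+ 2 =
  (q ^ d)%:R *+ 2 - (count (fun y => y *+ 2 + H == 0) (Fx d))%:R :> rat.
 transitivity (\sum_(y <- Fx d) (2 - (y *+ 2 + H == 0)%:R) : rat); last first.
  by rewrite sumrB -count_sum -sum1 -sumrMnl; congr (_ - _); apply: eq_bigr => y _.
 under eq_bigr do rewrite expr2 {1}count_sum mulr_suml.
 rewrite exchange_big big_seq [RHS]big_seq /=; apply: eq_bigr => y yF.
 rewrite (bigD1_seq (y ^+ 2 + H * y)) //=; last first.
  by move: yF; rewrite !mF => /eqP ey; rewrite (frD j) frM frX ey eH.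
 rewrite eqxx mul1r big1 ?addr0 => [|v /negPf ne]; last by rewrite eq_sym ne mul0r.
 have y'F : - H - y \in Fx d by move: yF; rewrite !mF => /eqP ey; rewrite (frB j) (frN j) eH ey.
 rewrite (eq_count (a2 := pred2 y (- H - y))) => [|z]; last first.
  rewrite /= -subr_eq0; have -> : z ^+ 2 + H * z - (y ^+ 2 + H * y) = (z - y) * (z - (- H - y)) by ring.
  by rewrite mulf_eq0 !subr_eq0.
 have e2 : (y *+ 2 + H == 0) = (y == - H - y) by rewrite -[RHS]subr_eq0; congr (_ == 0); ring.
 rewrite e2; case: eqP => [<-|ne].
  have -> : count (pred2 y y) (Fx d) = 1%N; last by [].
  by rewrite (eq_count (a2 := pred1 y)) ?count_uniq_mem ?yF // => z /=; rewrite orbb.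
 by rewrite subr0 count_pred2 ?yF ?y'F //; apply/eqP.
transitivity (\sum_(v <- Fx d) ((count (fun y => y ^+ 2 + H * y == v) (Fx d))%:R ^+ 2
  - (count (fun y => y ^+ 2 + H * y == v) (Fx d))%:R *+ 2 + 1) : rat).
 by apply: eq_bigr => v _; rewrite /tau_root; ring.
by rewrite big_split sumrB sumrMnl /= sq sum_count sum1; ring.
Qed.

(** For odd q there is one ramified value. For even q the condition 2 y + H = 0 reads H = 0: this is
    where the parity of q enters. *)
Lemma count_half : count (fun y => y *+ 2 + H == 0) (Fx d) =
 if odd q then 1%N else if H == 0 then (q ^ d)%N else 0%N.
rewrite odd_card_two; case: eqP => [t0|/eqP t0] /=.
 rewrite (eq_count (a2 := fun=> H == 0)) => [|y]; last by rewrite -mulr_natr t0 mulr0 add0r.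
 by case: (H == 0); rewrite ?count_predT ?sF ?count_pred0.
have f2 : fr d 2%:R = 2%:R by rewrite -(rmorph_nat j 2) fr_j.
rewrite (eq_count (a2 := pred1 (- H / 2%:R))) => [|y].
 by rewrite count_uniq_mem // mF frM (frN j) frV f2 eH eqxx.
by rewrite /= addr_eq0 -[y *+ 2]mulr_natr; apply/eqP/eqP => [e|->]; [rewrite -e mulfK|rewrite divfK].
Qed.
End LocalSums.

Notation wt G h f t l := (weight (tau j G h f) t l).

Lemma weight_evs G h f (t : seq (option L)) (l : seq (nat * nat)) : size t = size l ->
 wt G h f t l = \prod_(p <- zip [seq (fun v => tau_root k x.2.1 (evp G h x.1) v ^+ x.2.2) | x <- zip t l]
  (evs j (2 * G) t f)) p.1 p.2.
rewrite /weight; elim: t l => [|a t IH] [|x l] //=; first by rewrite !big_nil.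
by move=> [st]; rewrite !big_cons IH.
Qed.

Definition disc_pair G (u : pair_poly k G) : bool := disc (hpoly u) (fpoly u) != 0.

Definition pair_sum G t l : rat := \sum_(u : pair_poly k G | disc_pair u) wt G (hpoly u) (fpoly u) t l.

Lemma sum_pairs (R : nmodType) G (F : {poly k} -> {poly k} -> R) :
 \sum_(u : pair_poly k G) F (hpoly u) (fpoly u) =
 \sum_(h : 'rV[k]_G.+1) \sum_(f : 'rV[k]_(2 * G).+1) F (rVpoly h) (rVpoly f).
Proof. by rewrite [RHS]pair_bigA. Qed.

Lemma evpMn N (p : {poly k}) n a : evp N (p *+ n) a = evp N p a *+ n.
Proof. by elim: n => [|n IH]; rewrite ?evp0 // !mulrS evpD IH. Qed.

Lemma tau_disc0 G (h f : {poly k}) d a : (size h <= G.+1)%N -> (size f <= (2 * G).+1)%N -> disc h f = 0 ->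
 has_period (@frP k L) d a -> tau j G h f d a = 0.
move=> sh sf d0 pa; have [y ey] := quad_root (evp G h a) (evp (2 * G) f a).
rewrite (tauE pa ey); have -> // : y *+ 2 + evp G h a == 0.
rewrite -sqrf_eq0; have -> : (y *+ 2 + evp G h a) ^+ 2 = evp G h a ^+ 2 + evp (2 * G) f a *+ 4 by rewrite -ey; ring.
have := congr1 (fun p => evp (2 * G) p a) d0; rewrite /disc evpD evp0 expr2 {1}mul2n -addnn evpM // -expr2.
by rewrite evpMn => ->.
Qed.

Lemma weight_disc0 G (h f : {poly k}) ds t l : (size h <= G.+1)%N -> (size f <= (2 * G).+1)%N -> disc h f = 0 ->
 t \in cfg ds -> ds = unzip1 l -> all (fun x => 0 < x.2)%N l -> l != [::] -> wt G h f t l = 0.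
move=> sh sf d0 tc eds; case: l eds => [//|[d e] l] eds /= /andP[/= e0 _] _.
move: tc; rewrite eds; case: t => [|a t]; first by case/flattenP => _ /mapP[? _ ->] /mapP[].
rewrite mem_cfg_cons => /and3P[aE _ _]; rewrite /weight /= big_cons /=.
by rewrite tau_disc0 -?(mem_P1_pts j) // expr0n gtn_eqF // mul0r.
Qed.

(** On pairs of discriminant 0 all traces vanish, so these pairs may be included, after which h and
    f vary independently. *)
Lemma pair_sum_all G t l : t \in cfg (unzip1 l) -> all (fun x => 0 < x.2)%N l -> l != [::] ->
 pair_sum G t l = \sum_(h : 'rV[k]_G.+1) \sum_(f : 'rV[k]_(2 * G).+1) wt G (rVpoly h) (rVpoly f) t l.
move=> tc al nl; rewrite -(@sum_pairs _ G (fun h f => wt G h f t l)) /pair_sum [LHS]big_mkcond.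
apply: eq_bigr => u _; case: ifP => // /negbFE/eqP d0.
by rewrite (weight_disc0 (size_hpoly u) (size_fpoly u) d0 tc).
Qed.

Lemma inner_sum G h t l : t \in cfg (unzip1 l) -> (sumn (unzip1 l) <= (2 * G).+1)%N ->
 (q ^ sumn (unzip1 l))%:R * \sum_(f : 'rV[k]_(2 * G).+1) wt G h (rVpoly f) t l =
 (q ^ (2 * G).+1)%:R * \prod_(x <- zip t l) \sum_(v <- Fx x.2.1) tau_root k x.2.1 (evp G h x.1) v ^+ x.2.2.
move=> tc le; have st : size t = size l by rewrite (cfg_size tc) size_map.
rewrite (eq_bigr _ (fun f _ => weight_evs G h (rVpoly f) st)).
rewrite (interp_sum j (gs := [seq (fun v => tau_root k x.2.1 (evp G h x.1) v ^+ x.2.2) | x <- zip t l]) tc le); last first.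
 by rewrite size_map size1_zip ?st // size_map.
congr (_ * _); elim: t l {tc le} st => [|a t IH] [|x l] //=; first by rewrite !big_nil.
by move=> [st]; rewrite !big_cons /= IH.
Qed.

Lemma zip_period (t : seq (option L)) (l : seq (nat * nat)) x : t \in cfg (unzip1 l) -> x \in zip t l -> has_period (@frP k L) x.2.1 x.1.
elim: t l => [|a t IH] [|y l] //=; rewrite mem_cfg_cons => /and3P[aE _ tc].
by rewrite inE => /orP[/eqP ->|]; [rewrite -(mem_P1_pts j)|apply: IH].
Qed.

(** An exponent 1 contributes a first moment, which is 0. *)
Lemma pair_sum_odd G t l : t \in cfg (unzip1 l) -> all (fun x => 0 < x.2)%N l ->
 (sumn (unzip1 l) <= (2 * G).+1)%N -> has (fun x => x.2 == 1%N) l -> pair_sum G t l = 0.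
move=> tc al le h1; have nl : l != [::] by case: (l) h1.
rewrite pair_sum_all // big1 // => h _.
have q0 : (q ^ sumn (unzip1 l))%:R != 0 :> rat by rewrite pnatr_eq0 expn_eq0 gtn_eqF // ltnW // card_gt1.
apply: (mulfI q0); rewrite inner_sum // mulr0; apply/eqP; rewrite mulf_eq0; apply/orP; right.
have /hasP[x xz /eqP x1] : has (fun x => x.2.2 == 1%N) (zip t l).
 have st : size t = size l by rewrite (cfg_size tc) size_map.
 by rewrite -[l](unzip2_zip (s := t)) ?st // has_map in h1.
have /has_periodP[d0 ea _] := zip_period tc xz.
rewrite (big_rem x) //= x1 (eq_bigr (fun v => tau_root k x.2.1 (evp G (rVpoly h) x.1) v)); last by move=> v _; rewrite expr1.
by rewrite sum_tau ?mul0r // fr_evp ea.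
Qed.
End PointSums.

(** * Sums of squares of traces *)

Section PairSums.
Variables (k : finFieldType) (L : closedFieldType) (j : {rmorphism k -> L}).
Notation q := #|k|.
Notation fr := (@fr k L).
Notation Fx := (fixed_points k L).
Notation cfg := (cfg (@frP k L) (@P1_pts k L)).
Notation evp := (evp j).
Notation wt G h f t l := (weight (tau j G h f) t l).
Notation qr := (q%:R : rat).

Lemma qr_neq0 : qr != 0.
Proof. by rewrite pnatr_eq0 gtn_eqF // ltnW // card_gt1. Qed.

Lemma prod_zip_l (t : seq (option L)) (l : seq (nat * nat)) (F : nat * nat -> rat) : size t = size l ->
 \prod_(x <- zip t l) F x.2 = \prod_(x <- l) F x.
Proof. by elim: t l => [|a t IH] [|x l] //=; rewrite ?big_nil // => -[st]; rewrite !big_cons IH. Qed.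

Lemma prod_q (l : seq (nat * nat)) : \prod_(x <- l) qr ^+ x.1 = qr ^+ sumn (unzip1 l).
Proof. by elim: l => [|x l IH]; rewrite ?big_nil ?expr0 // big_cons IH -exprD. Qed.

Lemma sum_tau2_prod G h (t : seq (option L)) (l : seq (nat * nat)) : t \in cfg (unzip1 l) -> all (fun x => x.2 == 2) l ->
 \prod_(x <- zip t l) \sum_(v <- Fx x.2.1) tau_root k x.2.1 (evp G h x.1) v ^+ x.2.2 =
 if odd q then \prod_(x <- l) (qr ^+ x.1 - 1)
 else \prod_(x <- zip t l) (qr ^+ x.2.1 * (evp G h x.1 != 0)%:R).
move=> tc a2; have st : size t = size l by rewrite (cfg_size tc) size_map.
have fac x : x \in zip t l -> \sum_(v <- Fx x.2.1) tau_root k x.2.1 (evp G h x.1) v ^+ x.2.2 =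
  if odd q then qr ^+ x.2.1 - 1 else qr ^+ x.2.1 * (evp G h x.1 != 0)%:R.
 move=> xz; have /has_periodP[d0 ea _] := zip_period j tc xz.
 have xl : x.2 \in l by have := map_f snd xz; rewrite -/(unzip2 (zip t l)) unzip2_zip ?st.
 rewrite (eqP (allP a2 _ xl)) (sum_tau2 j) ?(count_half j) ?fr_evp ?ea //.
 case: (odd q); first by rewrite natrX.
 by case: eqP => _ /=; rewrite ?subrr ?mulr0 // subr0 mulr1 natrX.
rewrite (eq_big_seq _ fac); case: (odd q) => //; exact: (prod_zip_l (fun x => qr ^+ x.1 - 1)).
Qed.

Lemma nonvanishing_sum N (t : seq (option L)) (l : seq (nat * nat)) : t \in cfg (unzip1 l) -> (sumn (unzip1 l) <= N.+1)%N ->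
 qr ^+ sumn (unzip1 l) * \sum_(h : 'rV[k]_N.+1) \prod_(x <- zip t l) (evp N (rVpoly h) x.1 != 0)%:R =
 qr ^+ N.+1 * \prod_(x <- l) (qr ^+ x.1 - 1).
move=> tc le; have st : size t = size l by rewrite (cfg_size tc) size_map.
have := interp_sum j (gs := nseq (size l) (fun v : L => (v != 0)%:R : rat)) tc le.
rewrite size_nseq size_map => /(_ erefl); rewrite !natrX => E.
transitivity (qr ^+ N.+1 * \prod_(p <- zip (nseq (size l) (fun v : L => (v != 0)%:R : rat)) (unzip1 l))
  \sum_(x <- Fx p.2) p.1 x).
 rewrite -E; congr (_ * _); apply: eq_bigr => h _.
 elim: t l {tc le E} st => [|a t IH] [|x l] //=; first by rewrite !big_nil.
 by move=> [st]; rewrite !big_cons IH.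
congr (_ * _); have := cfg_pos j tc; elim: (l) => [|[d e] l' IH] /=; first by rewrite !big_nil.
move=> /andP[d0 pos]; rewrite !big_cons /= IH //; congr (_ * _).
have [uF sF mF] := fixed_pointsP j d0.
have S0 : \sum_(v <- Fx d) (0 == v)%:R = 1 :> rat by rewrite sum_pick // mF fr0.
rewrite -natrX -sF -(count_predT (Fx d)) count_sum -[X in _ - X]S0 -sumrB.
by apply: eq_bigr => v _; rewrite [0 == v]eq_sym /=; case: (v == 0).
Qed.

(** For odd q the second moments are independent of h. For even q they demand that h be nonzero on
    t, which is interpolated in degree G; hence the sharper bound G + 1 on the total degree. *)
Lemma pair_sum_even G (t : seq (option L)) (l : seq (nat * nat)) : t \in cfg (unzip1 l) -> l != [::] -> all (fun x => x.2 == 2) l ->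
 (sumn (unzip1 l) <= (2 * G).+1)%N -> odd q || (sumn (unzip1 l) <= G.+1)%N ->
 qr ^+ sumn (unzip1 l) * pair_sum j G t l = qr ^+ (3 * G).+2 * \prod_(x <- l) (qr ^+ x.1 - 1).
move=> tc nl a2 le le2; have al : all (fun x => 0 < x.2)%N l by apply: sub_all a2 => x /eqP ->.
have st : size t = size l by rewrite (cfg_size tc) size_map.
rewrite pair_sum_all // mulr_sumr.
have e3 : ((3 * G).+2 = (2 * G).+1 + G.+1)%N by lia.
have H (h : 'rV[k]_G.+1) : qr ^+ sumn (unzip1 l) * \sum_(f : 'rV[k]_(2 * G).+1) wt G (rVpoly h) (rVpoly f) t l =
  qr ^+ (2 * G).+1 * if odd q then \prod_(x <- l) (qr ^+ x.1 - 1)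
  else \prod_(x <- zip t l) (qr ^+ x.2.1 * (evp G (rVpoly h) x.1 != 0)%:R).
 by rewrite -sum_tau2_prod // -!natrX inner_sum.
rewrite (eq_bigr _ (fun h _ => H h)) -mulr_sumr e3 exprD -!mulrA; congr (_ * _).
case: (boolP (odd q)) le2 => [_ _|_ /= le2].
 by rewrite sumr_const card_mx mul1n -natrX mulr_natl.
rewrite -(nonvanishing_sum tc) // mulr_sumr; apply: eq_bigr => h _.
by rewrite big_split /= (prod_zip_l (fun x => qr ^+ x.1)) // prod_q.
Qed.

(** A nonzero linear form has a single zero on P^1, of degree 1, so at most one factor vanishes and
    the product equals 1 minus a sum. *)
Lemma nonvanishing_lin (t : seq (option L)) (l : seq (nat * nat)) : t \in cfg (unzip1 l) ->
 \sum_(h : 'rV[k]_2) \prod_(x <- zip t l) (evp 1 (rVpoly h) x.1 != 0)%:R =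
  if l is [::] then qr ^+ 2 else qr ^+ 2 - 1 - (count (fun x => x.1 == 1%N) l)%:R * (qr - 1).
move=> tc; case: l tc => [|[d0 e0] l0] tc.
 have := cfg_size tc => /size0nil ->; under eq_bigr do rewrite big_nil.
 by rewrite sumr_const card_mx mul1n natrX.
have st := cfg_size tc; rewrite size_map in st.
have key (h : {poly k}) (t' : seq (option L)) (l' : seq (nat * nat)) : h != 0 -> (size h <= 2)%N ->
  t' \in cfg (unzip1 l') -> \prod_(x <- zip t' l') (evp 1 h x.1 != 0)%:R =
  1 - \sum_(x <- zip t' l' | x.2.1 == 1%N) (evp 1 h x.1 == 0)%:R :> rat.
 move=> h0 sh; elim: t' l' => [|a t' IH] [|[d e] l'] //; first by rewrite !big_nil subr0.
  by case/flattenP => _ /mapP[? _ ->] /mapP[].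
 rewrite mem_cfg_cons => /and3P[aE ind tc']; rewrite !big_cons IH //=.
 case: (eqVneq (evp 1 h a) 0) => ea; last by rewrite mul1r; case: ifP; rewrite ?add0r.
 have d1 : d = 1%N.
  apply/eqP; rewrite -[_ == _]negbK; apply/negP => d1; case/eqP: h0.
  apply: (evs_eq0 (j := j) (N := 1) (t := [:: a]) (ds := [:: d])) => //.
  - by rewrite mem_cfg_cons aE.
  - by move: aE; rewrite (mem_P1_pts j) => /has_periodP[d0' _ _]; rewrite /= addn0 ltn_neqAle eq_sym d1.
  - by move=> b; rewrite inE => /eqP ->.
 subst d; rewrite eqxx mul0r /= big_seq_cond big1 ?addr0 ?subrr // => x /andP[xz /eqP x1].
 case: eqP => // ex; case/eqP: h0.
 have st' : size t' = size l' by rewrite (cfg_size tc') size_map.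
 have xt : x.1 \in t' by have := map_f fst xz; rewrite -/(unzip1 (zip t' l')) unzip1_zip ?st'.
 apply: (evs_eq0 (j := j) (N := 1) (t := [:: a; x.1]) (ds := [:: 1%N; 1%N])) => //.
  rewrite !mem_cfg_cons aE /= (allP ind _ xt) /= (mem_P1_pts j).
  by rewrite -[in has_period _ _ _]x1 (zip_period j tc' xz).
 by move=> b; rewrite !inE => /orP[] /eqP ->.
have zsum (a : option L) : has_period (@frP k L) 1 a -> \sum_(h : 'rV[k]_2) (evp 1 (rVpoly h) a == 0)%:R = qr.
 move=> pa; have ac : [:: a] \in cfg [:: 1%N] by rewrite mem_cfg_cons (mem_P1_pts j) pa.
 have := @interp_sum _ _ j rat 1 [:: 1%N] [:: a] [:: fun v : L => (v == 0)%:R] ac isT erefl.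
 rewrite (eq_bigr (fun h : 'rV[k]_2 => (evp 1 (rVpoly h) a == 0)%:R)); last by move=> h _; rewrite big_seq1.
 have S1 : \sum_(x <- Fx 1) (x == 0)%:R = 1 :> rat.
  have [u1 _ m1] := fixed_pointsP j (isT : 0 < 1)%N.
  by rewrite (eq_bigr (fun x => (0 == x)%:R)) ?sum_pick ?m1 ?fr0 // => x _; rewrite eq_sym.
 rewrite (_ : sumn [:: 1%N] = 1%N) // [zip _ [:: 1%N]]/= big_seq1 S1 mulr1 !natrX expr1 expr2.
 by move/(mulfI qr_neq0).
have rV0 (h : 'rV[k]_2) : (rVpoly h == 0) = (h == 0).
 by rewrite -(inj_eq (can_inj (@rVpolyK _ 2))) linear0.
case: t st tc => [//|a t] st tc; rewrite (bigD1 0) //=.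
rewrite [X in X + _](_ : _ = 0) ?add0r; last by rewrite linear0 big_cons evp0 eqxx mul0r.
rewrite (eq_bigr (fun h : 'rV[k]_2 => 1 - \sum_(x <- zip (a :: t) ((d0, e0) :: l0) | x.2.1 == 1%N) (evp 1 (rVpoly h) x.1 == 0)%:R)); last first.
 by move=> h hn; rewrite -(key _ _ ((d0, e0) :: l0)) ?rV0 // ?big_cons // size_poly.
have T : \sum_(h : 'rV[k]_2) 1 = qr ^+ 2 by rewrite sumr_const card_mx mul1n natrX.
rewrite sumrB; congr (_ - _); first by rewrite -T [in RHS](bigD1 0) //= addrAC subrr add0r.
rewrite exchange_big big_seq_cond (eq_bigr (fun=> qr - 1)); last first.
 move=> x /andP[xz /eqP x1]; have px := zip_period j tc xz; rewrite x1 in px.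
 have := zsum x.1 px; rewrite (bigD1 0) //= linear0 evp0 eqxx /= mulr1n => <-.
 by rewrite addrAC subrr add0r.
rewrite -big_seq_cond big_const_seq iter_addr_0 mulr_natl; congr (_ *+ _).
rewrite -[RHS]/(count (fun x : nat * nat => x.1 == 1%N) ((d0, e0) :: l0)).
elim: (a :: t) ((d0, e0) :: l0) st {tc} => [|b u IH] [|x l'] //= e.
by rewrite IH //; case: e.
Qed.

(** Total degree 3 exceeds G + 1 = 2, out of reach of [pair_sum_even] for even q. The value is not
    that of odd q, and this is what separates the two polynomials from n = 6 on. *)
Lemma pair_sum_even_special (t : seq (option L)) (l : seq (nat * nat)) : ~~ odd q -> t \in cfg (unzip1 l) -> l != [::] ->
 all (fun x => x.2 == 2) l -> sumn (unzip1 l) = 3 ->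
 pair_sum j 1 t l = qr ^+ 3 * (qr ^+ 2 - 1 - (count (fun x => x.1 == 1%N) l)%:R * (qr - 1)).
move=> ev tc nl a2 e3; have al : all (fun x => 0 < x.2)%N l by apply: sub_all a2 => x /eqP ->.
have st : size t = size l by rewrite (cfg_size tc) size_map.
rewrite pair_sum_all //.
have H (h : 'rV[k]_2) : \sum_(f : 'rV[k]_(2 * 1).+1) wt 1 (rVpoly h) (rVpoly f) t l =
  qr ^+ 3 * \prod_(x <- zip t l) (evp 1 (rVpoly h) x.1 != 0)%:R.
 apply: (mulfI (expf_neq0 3 qr_neq0)); rewrite -[X in qr ^+ X * _ = _]e3 -natrX inner_sum ?e3 // sum_tau2_prod // (negPf ev).
 by rewrite big_split /= (prod_zip_l (fun x => qr ^+ x.1)) // prod_q e3 natrX.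
rewrite (eq_bigr _ (fun h _ => H h)) -mulr_sumr nonvanishing_lin //.
by case: (l) nl.
Qed.
End PairSums.

(** * Discriminant 0, constant pairs and the quadratic twist *)

Section Twist.
Variables (k : finFieldType) (L : closedFieldType) (j : {rmorphism k -> L}).
Notation q := #|k|.
Notation fr := (@fr k L).
Notation Fx := (fixed_points k L).
Notation cfg := (cfg (@frP k L) (@P1_pts k L)).
Notation evp := (evp j).
Notation wt G h f t l := (weight (tau j G h f) t l).
Notation qr := (q%:R : rat).

Lemma odd_card_two_k : odd q = (2%:R != 0 :> k).
Proof. by rewrite (odd_card_two j) -(rmorph_nat j) fmorph_eq0. Qed.

(** h^2 + 4 f = 0 determines f from h when q is odd, and means h = 0 with f arbitrary when q is
    even. *)
Lemma pair_sum_nil G : pair_sum j G [::] [::] =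
 qr ^+ (3 * G).+2 - (if odd q then qr ^+ G.+1 else qr ^+ (2 * G).+1).
have -> : pair_sum j G [::] [::] =
  \sum_(u : pair_poly k G) (1 - (disc (hpoly u) (fpoly u) == 0)%:R).
 rewrite /pair_sum big_mkcond; apply: eq_bigr => u _; rewrite /weight big_nil /disc_pair.
 by case: eqP => _ /=; rewrite ?subrr ?subr0.
rewrite sumrB sumr_const card_prod !card_mx !mul1n -expnD natrX.
have -> : (G.+1 + (2 * G).+1 = (3 * G).+2)%N by lia.
congr (_ - _); rewrite (@sum_pairs _ _ G (fun h f => (disc h f == 0)%:R)).
case: ifPn => [o|ev].
 rewrite (eq_bigr (fun=> 1)) ?sumr_const ?card_mx ?mul1n ?natrX // => h _.
 have t0 : (2%:R : k) != 0 by rewrite -odd_card_two_k.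
 have t4 : (4%:R : k) != 0 by rewrite (natrM _ 2 2) mulf_neq0.
 pose f0 : {poly k} := - (4%:R^-1 *: rVpoly h ^+ 2).
 have sf0 : (size f0 <= (2 * G).+1)%N.
  rewrite size_polyN (leq_trans (size_scale_leq _ _)) // expr2 (leq_trans (size_polyMleq _ _)) //.
  by have := size_poly G.+1 (fun i => 0 : k); have : (size (rVpoly h) <= G.+1)%N := size_poly _ _; move: (size (rVpoly h)) => n; lia.
 rewrite (bigD1 (poly_rV f0)) //= poly_rV_K // big1 ?addr0.
  have -> // : disc (rVpoly h) f0 == 0.
  by rewrite /disc /f0 mulNrn -scaler_nat scalerA mulfV // scale1r subrr.
 move=> f nf; case: eqP => // d0; case/eqP: nf.
 rewrite -[f]rVpolyK; congr poly_rV; apply: (scalerI t4).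
 rewrite /f0 scalerN scalerA mulfV // scale1r scaler_nat; apply/eqP.
 by rewrite -addr_eq0 addrC; apply/eqP.
have t0 : (2%:R : k) = 0 by apply/eqP; move: ev; rewrite odd_card_two_k negbK.
have t4 : (4%:R : k) = 0 by rewrite (natrM _ 2 2) t0 mul0r.
have dE (h f : {poly k}) : disc h f = h ^+ 2 by rewrite /disc -scaler_nat t4 scale0r addr0.
rewrite (bigD1 0) //= [X in _ + X]big1 ?addr0 => [|h nh].
 rewrite (eq_bigr (fun=> 1)) ?sumr_const ?card_mx ?mul1n ?natrX // => f _.
 by rewrite dE linear0 expr0n eqxx.
rewrite big1 // => f _; rewrite dE sqrf_eq0; have [e|//] := eqVneq (rVpoly h) 0.
by case/eqP: nh; rewrite -[h]rVpolyK e linear0.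
Qed.

Lemma fixed1_image z : fr 1 z = z -> exists a, z = j a.
move=> ez; have [uF sF mF] := fixed_pointsP j (isT : 0 < 1)%N.
have us : uniq [seq j a | a <- enum k] by rewrite map_inj_uniq ?enum_uniq //; apply: fmorph_inj.
have sub : {subset [seq j a | a <- enum k] <= Fx 1} by move=> _ /mapP[a _ ->]; rewrite mF fr_j.
have le : (size (Fx 1) <= size [seq j a | a <- enum k])%N by rewrite size_map -cardE sF expn1.
have /mapP[a _ ->] : z \in [seq j a | a <- enum k] by rewrite (uniq_min_size us sub le).2 mF ez.
by exists a.
Qed.

Lemma fr_swap (c z : L) d : fr 1 c = c -> fr 1 z = c - z -> fr d z = if odd d then c - z else z.
move=> ec ez; elim: d => [|d IH]; first by rewrite fr_id.
rewrite -addn1 fr_add ez (frB j) IH oddD addbT.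
have -> : fr d c = c by elim: d {IH} => [|d IHd]; rewrite ?fr_id // -addn1 fr_add ec.
by case: (odd d) => //=; rewrite opprB addrC subrK.
Qed.

Lemma fr_swap_id (z : L) d : fr 1 z = z -> fr d z = z.
Proof. by move=> ez; elim: d => [|d IHd]; rewrite ?fr_id // -addn1 fr_add ez. Qed.

Definition total_weight (l : seq (nat * nat)) : nat := sumn [seq (x.1 * x.2)%N | x <- l].

Lemma weight_sign (e : rat) (t : seq (option L)) (l : seq (nat * nat)) : size t = size l ->
 \prod_(x <- zip t l) (e ^+ x.2.1) ^+ x.2.2 = e ^+ total_weight l.
rewrite /total_weight; elim: t l => [|a t IH] [|x l] //=; first by rewrite big_nil.
by case=> st; rewrite big_cons /= IH // -exprM -exprD.
Qed.

(** A pair of constants splits over k or over its quadratic extension, so tau_d is 1 or (-1)^d at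
    every point of degree d, and an even weight makes the product 1. *)
Lemma pair_sum_level0 (t : seq (option L)) (l : seq (nat * nat)) : t \in cfg (unzip1 l) ->
 ~~ odd (total_weight l) -> pair_sum j 0 t l = pair_sum j 0 [::] [::].
move=> tc ev; have st : size t = size l by rewrite (cfg_size tc) size_map.
apply: eq_bigr => u; rewrite /disc_pair => d0; rewrite [RHS]/weight big_nil.
have sh := size_hpoly u; have sf := size_fpoly u; rewrite muln0 in sf.
move: (hpoly u) (fpoly u) sh sf d0 => h f sh sf; rewrite (size1_polyC sh) (size1_polyC sf).
move: h`_0 f`_0 => c b d0.
have evC N a e : N = 0%N -> evp N e%:P a = j e by move=> ->; case: a => [z|] /=; rewrite ?pevC // coefC eqxx.
have [y ey] := quad_root (j c) (j b).
have y0 : y *+ 2 + j c != 0.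
 apply: contraNneq d0 => y0; rewrite /disc -polyC_exp -polyCMn -polyCD polyC_eq0 -(fmorph_eq0 j).
 rewrite rmorphD rmorphXn rmorphMn -ey; have -> : j c ^+ 2 + (y ^+ 2 + j c * y) *+ 4 = (y *+ 2 + j c) ^+ 2 by ring.
 by rewrite y0 expr0n.
have fy : fr 1 y = y \/ fr 1 y = - j c - y.
 have : (fr 1 y - y) * (fr 1 y - (- j c - y)) = 0.
  transitivity (fr 1 y ^+ 2 + fr 1 (j c) * fr 1 y - (y ^+ 2 + j c * y)); first by rewrite fr_j; ring.
  by rewrite -frX -frM -(frD j) ey fr_j subrr.
 by move/eqP; rewrite mulf_eq0 !subr_eq0 => /orP[] /eqP; [left|right].
pose e : rat := if fr 1 y == y then 1 else -1.
rewrite /weight -[RHS](_ : e ^+ total_weight l = 1); last first.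
 by rewrite /e; case: eqP => _; rewrite ?expr1n // -signr_odd (negPf ev).
rewrite -(weight_sign e st); apply: eq_big_seq => x xz; congr (_ ^+ _).
have px := zip_period j tc xz.
rewrite (tauE (j := j) (y := y) px) ?evC // (negPf y0) /e.
case: fy => fy; first by rewrite fy eqxx fr_swap_id // eqxx expr1n.
have ne : fr 1 y != y.
 by rewrite fy; apply: contraNneq y0 => e'; rewrite -{1}e' mulr2n {1}e'; apply/eqP; ring.
rewrite (negPf ne) -signr_odd (fr_swap (c := - j c)) ?(frN j) ?fr_j //.
by case: (odd _); rewrite ?eqxx // -fy (negPf ne).
Qed.

(** The map y -> y^2 + y takes the same value at 0 and -1, so it is not injective and hence not
    onto. *)
Lemma nonsplit_ex : exists nu : k, (forall y : k, y ^+ 2 + y != nu) /\ 1 + nu *+ 4 != 0.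
have [nu Hnu] : exists nu : k, forall y : k, y ^+ 2 + y != nu.
 pose g (y : k) := y ^+ 2 + y.
 have : (#|[set g y | y in [set: k]%SET]%SET| < #|[set: k]%SET|)%N.
  rewrite ltn_neqAle leq_imset_card andbT; apply/imset_injP => /(_ 0 (-1)).
  rewrite !inE /g expr0n sqrrN expr1n subrr addr0 => /(_ isT isT erefl)/eqP.
  by rewrite eq_sym oppr_eq0 oner_eq0.
 rewrite ltnNge => /negP H; have /subsetPn[nu _ Hnu] : ~~ ([set: k]%SET \subset [set g y | y in [set: k]%SET]%SET).
  by apply/negP => /subset_leq_card.
 by exists nu => y; apply: contraNneq Hnu => <-; apply: imset_f.
exists nu; split=> //; have [t0|t0] := eqVneq (2%:R : k) 0.
 by rewrite -mulr_natr (natrM _ 2 2) t0 !mulr0 addr0 oner_neq0.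
apply: contraNneq (Hnu (- 2%:R^-1)) => e; apply/eqP.
have t4 : (4%:R : k) != 0 by rewrite (natrM _ 2 2) mulf_neq0.
have -> : nu = - 4%:R^-1.
 apply: (mulIf t4); rewrite mulNr mulVf // mulr_natr; apply/eqP; rewrite -subr_eq0 opprK addrC.
 by apply/eqP.
by rewrite (natrM _ 2 2) invfM; field.
Qed.

(* The quadratic twist: with omega^2 + omega = nu, the root y of y^2 + h y = f is
  replaced by y + omega (2 y + h), so that tau_d is multiplied by (-1)^d. *)
Lemma tau_twist G (h f : {poly k}) nu d a : (forall y : k, y ^+ 2 + y != nu) -> 1 + nu *+ 4 != 0 ->
 (size h <= G.+1)%N -> (size f <= (2 * G).+1)%N -> has_period (@frP k L) d a ->
 tau j G h (f + nu *: disc h f) d a = (-1) ^+ d * tau j G h f d a.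
move=> Hnu nu4 sh sf pa; have /has_periodP[d0 ea _] := pa.
have [w ew] := quad_root (1 : L) (j nu); rewrite mul1r in ew.
have [y ey] := quad_root (evp G h a) (evp (2 * G) f a).
set H := evp G h a in ey *; set F := evp (2 * G) f a in ey *.
have eH : fr d H = H by rewrite fr_evp ea.
have eF : fr d F = F by rewrite fr_evp ea.
have w0 : 1 + w *+ 2 != 0.
 rewrite -sqrf_eq0; have -> : (1 + w *+ 2) ^+ 2 = 1 + (w ^+ 2 + w) *+ 4 by ring.
 by rewrite ew -rmorphMn -(rmorph1 j) -rmorphD fmorph_eq0.
have fw : fr 1 w = -1 - w.
 have : (fr 1 w - w) * (fr 1 w - (-1 - w)) = 0.
  transitivity (fr 1 w ^+ 2 + fr 1 w - (w ^+ 2 + w)); first by ring.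
  by rewrite -frX -(frD j) ew fr_j subrr.
 move/eqP; rewrite mulf_eq0 !subr_eq0 => /orP[] /eqP // e.
 have [b eb] := fixed1_image e; case/eqP: (Hnu b); apply: (fmorph_inj j).
 by rewrite rmorphD rmorphXn -eb.
have fdw : fr d w = if odd d then -1 - w else w by apply: fr_swap => //; rewrite (frN j) fr1.
have ey' : (y + w * (y *+ 2 + H)) ^+ 2 + evp G h a * (y + w * (y *+ 2 + H)) = evp (2 * G) (f + nu *: disc h f) a.
 have eh2 : evp (2 * G) (h ^+ 2) a = H ^+ 2 by rewrite mul2n -addnn expr2 evpM // -expr2.
 by rewrite evpD evpZ /disc evpD evpMn eh2 -/H -/F -ew -ey; ring.
rewrite (tauE pa ey) (tauE pa ey') -/H.
have -> : (y + w * (y *+ 2 + H)) *+ 2 + H = (1 + w *+ 2) * (y *+ 2 + H) by ring.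
rewrite mulf_eq0 (negPf w0) /=; have [//|e0] := eqVneq (y *+ 2 + H) 0; first by rewrite mulr0.
have f2 z : fr d (z *+ 2) = fr d z *+ 2 by rewrite !mulr2n (frD j).
have ne u : (1 + w *+ 2) * (y *+ 2 + H) = u -> (u == 0) = false by move=> <-; rewrite mulf_eq0 (negPf w0) (negPf e0).
have fy : fr d y = y \/ fr d y = - H - y.
 have : (fr d y - y) * (fr d y - (- H - y)) = 0.
  transitivity (fr d y ^+ 2 + fr d H * fr d y - (y ^+ 2 + H * y)); first by rewrite eH; ring.
  by rewrite -frX -frM -(frD j) ey eF subrr.
 by move/eqP; rewrite mulf_eq0 !subr_eq0 => /orP[] /eqP; [left|right].
rewrite (frD j) frM fdw (frD j) f2 eH -signr_odd -subr_eq0 -[fr d y == y]subr_eq0.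
have ny : (- H - y - y == 0) = false by rewrite -oppr_eq0 -(negPf e0); congr (_ == 0); ring.
case: (odd d); case: fy => ->; rewrite ?subrr ?eqxx ?ny ?expr1 ?expr0 ?mul1r ?mulN1r ?opprK //.
- by rewrite -oppr_eq0 ne //; ring.
- by have -> : - H - y + (-1 - w) * ((- H - y) *+ 2 + H) - (y + w * (y *+ 2 + H)) = 0; [ring|rewrite eqxx].
- by rewrite -oppr_eq0 ne //; ring.
Qed.

(** The twist permutes the pairs of nonzero discriminant and multiplies every term by -1 to the
    power of the weight, so for odd weight the sum is its own negative. *)
Lemma pair_sum_twist G (t : seq (option L)) (l : seq (nat * nat)) : t \in cfg (unzip1 l) ->
 odd (total_weight l) -> pair_sum j G t l = 0.
move=> tc ol; have st : size t = size l by rewrite (cfg_size tc) size_map.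
have [nu [Hnu nu4]] := nonsplit_ex.
pose tw (u : pair_poly k G) : pair_poly k G := (u.1, poly_rV (fpoly u + nu *: disc (hpoly u) (fpoly u))).
have hE u : hpoly (tw u) = hpoly u by [].
have fE u : fpoly (tw u) = fpoly u + nu *: disc (hpoly u) (fpoly u).
 rewrite /fpoly /= poly_rV_K // size_polyD_leq // size_fpoly.
 by rewrite (leq_trans (size_scale_leq _ _)) // size_disc ?size_hpoly ?size_fpoly.
have dE u : disc (hpoly (tw u)) (fpoly (tw u)) = (1 + nu *+ 4) *: disc (hpoly u) (fpoly u).
 rewrite hE fE {1}/disc mulrnDl addrA -/(disc _ _) scalerDl scale1r; congr (_ + _).
 by rewrite -scaler_nat scalerA mulr_natl.
have tw_inj : injective tw.
 move=> u u' e; have eh : hpoly u = hpoly u' := congr1 (@hpoly k G) e.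
 apply: pair_poly_inj => //.
 have : disc (hpoly u) (fpoly u) = disc (hpoly u') (fpoly u') by apply: (scalerI nu4); rewrite -(dE u) -(dE u') e.
 by have := fE u; rewrite e fE => + ed; rewrite ed => /addIr.
suff : pair_sum j G t l = - pair_sum j G t l.
 move/eqP; rewrite -addr_eq0 -mulr2n mulrn_eq0 /= => /eqP //.
rewrite {1}/pair_sum (reindex_inj tw_inj) /= -sumrN; apply: eq_big => [u|u _].
 by rewrite /disc_pair dE scaler_eq0 (negPf nu4).
rewrite -mulN1r /weight -(_ : \prod_(x <- zip t l) ((-1) ^+ x.2.1) ^+ x.2.2 = -1); last first.
 by rewrite weight_sign // -signr_odd ol.
rewrite -big_split; apply: eq_big_seq => x xz /=.
by rewrite hE fE tau_twist ?exprMn ?size_hpoly ?size_fpoly //; apply: zip_period xz.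
Qed.
End Twist.

(** * First powers in total degree 2 G + 2 *)

Section TopOdd.
Variables (k : finFieldType) (L : closedFieldType) (j : {rmorphism k -> L}).
Notation q := #|k|.
Notation fr := (@fr k L).
Notation Fx := (fixed_points k L).
Notation cfg := (cfg (@frP k L) (@P1_pts k L)).
Notation evp := (evp j).
Notation qr := (q%:R : rat).

Lemma cfg_remove ds1 d ds2 (t1 : seq (option L)) a t2 : size t1 = size ds1 ->
 t1 ++ a :: t2 \in cfg (ds1 ++ d :: ds2) -> t1 ++ t2 \in cfg (ds1 ++ ds2).
elim: ds1 t1 => [|d1 ds1 IH] [|a1 t1] //=; first by rewrite mem_cfg_cons => _ /and3P[].
move=> [st]; rewrite !mem_cfg_cons => /and3P[-> ind tc]; rewrite IH // andbT /=.
by move: ind; rewrite /indep !all_cat /= => /and3P[-> _ ->].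
Qed.

Lemma interp_sum_attached N (s : seq (option L * nat * (L -> rat))) :
 [seq x.1.1 | x <- s] \in cfg [seq x.1.2 | x <- s] -> (sumn [seq x.1.2 | x <- s] <= N.+1)%N ->
 qr ^+ sumn [seq x.1.2 | x <- s] * \sum_(f : 'rV[k]_N.+1) \prod_(x <- s) x.2 (evp N (rVpoly f) x.1.1) =
 qr ^+ N.+1 * \prod_(x <- s) \sum_(v <- Fx x.1.2) x.2 v.
move=> tc le; have := interp_sum j (gs := [seq x.2 | x <- s]) tc le; rewrite !size_map !natrX => /(_ erefl).
have -> : \prod_(p <- zip [seq x.2 | x <- s] [seq x.1.2 | x <- s]) \sum_(x <- Fx p.2) p.1 x =
     \prod_(x <- s) \sum_(v <- Fx x.1.2) x.2 v by rewrite zip_map big_map.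
move=> <-; congr (_ * _); apply: eq_bigr => f _.
by rewrite /evs -map_comp zip_map big_map.
Qed.

Definition fibre_card (h : option L -> L) (x : option L * nat) (v : L) : rat :=
 (count (fun y => y ^+ 2 + h x.1 * y == v) (Fx x.2))%:R.

(* In degree 2G+2 every product in which a factor is replaced by 1 can be
  interpolated, so expanding the factors r - 1 one at a time leaves one term. *)
Lemma sum_tau_fibre G (h : {poly k}) (s1 s2 : seq (option L * nat)) (H := fun a => evp G h a) :
 unzip1 (s1 ++ s2) \in cfg (unzip2 (s1 ++ s2)) -> sumn (unzip2 (s1 ++ s2)) = (2 * G).+2 -> s1 != [::] ->
 \sum_(f : 'rV[k]_(2 * G).+1) (\prod_(x <- s1) (fibre_card H x (evp (2 * G) (rVpoly f) x.1) - 1)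
   * \prod_(x <- s2) fibre_card H x (evp (2 * G) (rVpoly f) x.1)) =
 \sum_(f : 'rV[k]_(2 * G).+1) \prod_(x <- s1 ++ s2) fibre_card H x (evp (2 * G) (rVpoly f) x.1)
  - qr ^+ (2 * G).+1.
elim/last_ind: s1 s2 => [//|s1 x IH] s2; rewrite cat_rcons => tc es _.
have per y : y \in s1 ++ x :: s2 -> has_period (@frP k L) y.2 y.1.
 move=> ys; have st : size (unzip1 (s1 ++ x :: s2)) = size (unzip2 (s1 ++ x :: s2)) by rewrite !size_map.
 rewrite -(mem_P1_pts j); move: tc ys; elim: (s1 ++ x :: s2) => [//|z s IHs].
 rewrite [unzip1 _]/= [unzip2 _]/= mem_cfg_cons => /and3P[zE _ tc].
 by rewrite inE => /orP[/eqP -> //|]; apply: IHs.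
have dx : (0 < x.2)%N.
 have xin : x \in s1 ++ x :: s2 by rewrite mem_cat inE eqxx orbT.
 by have /has_periodP[] := per x xin.
have fix_ y : y \in s1 ++ x :: s2 -> (0 < y.2)%N /\ fr y.2 (H y.1) = H y.1.
 by move=> /per /has_periodP[d0 e _]; rewrite fr_evp e.
have key : \sum_(f : 'rV[k]_(2 * G).+1) (\prod_(y <- s1) (fibre_card H y (evp (2 * G) (rVpoly f) y.1) - 1)
   * \prod_(y <- s2) fibre_card H y (evp (2 * G) (rVpoly f) y.1)) = if s1 is [::] then qr ^+ (2 * G).+1 else 0.
 pose s := [seq (y, fun v => fibre_card H y v - 1) | y <- s1] ++ [seq (y, fibre_card H y) | y <- s2].
 have e1 : [seq y.1.1 | y <- s] = unzip1 (s1 ++ s2) by rewrite /s map_cat -!map_comp /unzip1 map_cat.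
 have e2 : [seq y.1.2 | y <- s] = unzip2 (s1 ++ s2) by rewrite /s map_cat -!map_comp /unzip2 map_cat.
 have := @interp_sum_attached (2 * G) s; rewrite e1 e2.
 have -> : unzip1 (s1 ++ s2) \in cfg (unzip2 (s1 ++ s2)).
  move: tc; rewrite /unzip1 /unzip2 !map_cat /= => tc.
  by apply: cfg_remove tc; rewrite !size_map.
 have le : (sumn (unzip2 (s1 ++ s2)) < (2 * G).+2)%N.
  by rewrite -es /unzip2 !map_cat !sumn_cat /=; move: dx; lia.
 have sE (F : option L * nat * (L -> rat) -> rat) : \prod_(y <- s) F y =
   \prod_(y <- s1) F (y, fun v => fibre_card H y v - 1) * \prod_(y <- s2) F (y, fibre_card H y).
  by rewrite /s big_cat !big_map.
 have sumE : \sum_(f : 'rV[k]_(2 * G).+1) \prod_(y <- s) y.2 (evp (2 * G) (rVpoly f) y.1.1) =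
   \sum_(f : 'rV[k]_(2 * G).+1) (\prod_(y <- s1) (fibre_card H y (evp (2 * G) (rVpoly f) y.1) - 1)
    * \prod_(y <- s2) fibre_card H y (evp (2 * G) (rVpoly f) y.1)).
  by apply: eq_bigr => f _; rewrite sE.
 move=> /(_ isT le); rewrite sumE sE /= => E.
 apply: (mulfI (expf_neq0 (sumn (unzip2 (s1 ++ s2))) (qr_neq0 k))); rewrite {}E.
 have r1 y : y \in s1 ++ x :: s2 -> \sum_(v <- Fx y.2) fibre_card H y v = qr ^+ y.2.
  move=> /fix_ [d0 eH]; have := sum_tau j d0 eH; rewrite sumrB => /subr0_eq ->.
  by have [_ sF _] := fixed_pointsP j d0; rewrite big_const_seq count_predT iter_addr_0 sF natrX.
 clear sumE sE e1 e2 s; case: s1 {IH} tc es fix_ le r1 per => [|y s1] tc es fix_ le r1 per.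
  rewrite big_nil mul1r mulrC; congr (_ * _).
  rewrite (eq_big_seq (fun y => qr ^+ y.2)); last by move=> y ys; rewrite r1 // inE ys orbT.
  by elim: (s2) => [|y s2' IHs]; rewrite ?big_nil ?expr0 // big_cons IHs -exprD.
 rewrite mulr0 big_cons; have yin : y \in (y :: s1) ++ x :: s2 by rewrite inE eqxx.
 have [d0 eH] := fix_ y yin; have := sum_tau j d0 eH; rewrite /tau_root => ->.
 by rewrite !mul0r mulr0.
transitivity (\sum_(f : 'rV[k]_(2 * G).+1) (\prod_(y <- s1) (fibre_card H y (evp (2 * G) (rVpoly f) y.1) - 1)
   * \prod_(y <- x :: s2) fibre_card H y (evp (2 * G) (rVpoly f) y.1))
 - \sum_(f : 'rV[k]_(2 * G).+1) (\prod_(y <- s1) (fibre_card H y (evp (2 * G) (rVpoly f) y.1) - 1)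
   * \prod_(y <- s2) fibre_card H y (evp (2 * G) (rVpoly f) y.1))).
 rewrite -sumrB; apply: eq_bigr => f _; rewrite -cats1 big_cat big_seq1 big_cons /=; ring.
rewrite key; case: s1 IH tc es {fix_ per key} => [|y s1] IH tc es.
 by congr (_ - _); apply: eq_bigr => f _; rewrite big_nil mul1r.
by rewrite IH // subr0.
Qed.

Lemma prod_fibre_card (h f : option L -> L) (t : seq (option L)) ds : size t = size ds ->
 \prod_(x <- zip t ds) fibre_card h x (f x.1) =
 \sum_(y <- prodseq [seq Fx d | d <- ds]) ([seq f x.1 - h x.1 * x.2 | x <- zip t y] == [seq z ^+ 2 | z <- y])%:R.
elim: t ds => [|a t IH] [|d ds] //=; first by rewrite big_nil big_seq1.
move=> [st]; rewrite big_cons IH // /fibre_card count_sum mulr_suml big_allpairs_dep; apply: eq_bigr => y _.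
rewrite mulr_sumr; apply: eq_bigr => v _ /=; rewrite eqseq_cons -natrM mulnb.
by rewrite subr_eq [f a == _]eq_sym.
Qed.

Lemma defect_mem G (h f : {poly k}) ds (t : seq (option L)) (y : seq L) : t \in cfg ds ->
 y \in prodseq [seq Fx d | d <- ds] ->
 [seq evp (2 * G) f x.1 - evp G h x.1 * x.2 | x <- zip t y] \in prodseq [seq Fx d | d <- ds].
elim: ds t y => [|d ds IH] [|a t] [|b y] //; try by case/allpairsP => -[? ?] [].
 by case/flattenP => _ /mapP[? _ ->] /mapP[].
rewrite mem_cfg_cons [map _ _]/= [[seq _ | _ <- zip _ _]]/= !mem_prodseq_cons => /and3P[aE _ tc] /andP[bF /(IH _ _ tc) ->].
move: aE; rewrite (mem_P1_pts j) andbT => /has_periodP[d0 ea _]; move: bF.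
have [_ _ mF] := fixed_pointsP j d0; rewrite !mF (frB j) frM !fr_evp ea => /eqP -> //.
Qed.

Lemma sq_mem ds (y : seq L) : all (fun d => 0 < d)%N ds -> y \in prodseq [seq Fx d | d <- ds] ->
 [seq z ^+ 2 | z <- y] \in prodseq [seq Fx d | d <- ds].
elim: ds y => [|d ds IH] [|b y] // /andP[d0 pos]; rewrite [map _ _]/= [map _ (b :: y)]/= !mem_prodseq_cons.
by move=> /andP[bF /(IH _ pos) ->]; move: bF; have [_ _ mF] := fixed_pointsP j d0; rewrite !mF frX andbT => /eqP ->.
Qed.

Section Fibre.
Variables (G : nat) (ds : seq nat) (t : seq (option L)) (tc : t \in cfg ds) (es : sumn ds = (2 * G).+2).
Notation A := (prodseq [seq Fx d | d <- ds]).
Let st : size t = size ds. Proof. exact: (cfg_size tc). Qed.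

Let pev_eq0 (p : {poly k}) N : (size p <= N.+1)%N -> (N <= (2 * G).+1)%N ->
 (forall a, a \in t -> evp N p a = 0) -> p = 0.
Proof. by move=> sp le; apply: (evs_eq0 tc) => //; rewrite es. Qed.

Definition defect_at (y : seq L) (u : pair_poly k G) : seq L :=
 [seq evp (2 * G) (fpoly u) x.1 - evp G (hpoly u) x.1 * x.2 | x <- zip t y].

(** If the roots are interpolated by Y of degree at most G, then f - h Y - Y^2 has degree at most 2
    G and 2 G + 2 zeros; so f is determined by h. *)
Lemma fibre_section (Y : {poly k}) : (size Y <= G.+1)%N ->
 \sum_(u : pair_poly k G) (defect_at (evs j G t Y) u == [seq z ^+ 2 | z <- evs j G t Y])%:R = qr ^+ G.+1.
move=> sY; rewrite /pair_poly.
have cond u : (defect_at (evs j G t Y) u == [seq z ^+ 2 | z <- evs j G t Y]) = (fpoly u == Y * (hpoly u + Y)).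
 have sP : (size (Y * (hpoly u + Y))%R <= (2 * G).+1)%N.
  rewrite (leq_trans (size_polyMleq _ _)) //.
  have : (size (hpoly u + Y)%R <= G.+1)%N by rewrite size_polyD_leq // size_hpoly.
  by move: (size _) => n; lia.
 have sR : (size (fpoly u - Y * (hpoly u + Y))%R <= (2 * G).+1)%N.
  by rewrite size_polyD_leq // size_polyN sP size_fpoly.
 have ev a : evp (2 * G) (Y * (hpoly u + Y)) a = evp G Y a * (evp G (hpoly u) a + evp G Y a).
  rewrite {1}mul2n -addnn evpM ?evpD //.
  by rewrite size_polyD_leq // size_hpoly.
 have -> : (defect_at (evs j G t Y) u == [seq z ^+ 2 | z <- evs j G t Y]) =
   all (fun a => evp (2 * G) (fpoly u - Y * (hpoly u + Y)) a == 0) t.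
  rewrite /defect_at /evs; elim: (t) => [|a s IH] //=; rewrite eqseq_cons IH; congr (_ && _).
  by rewrite evpB ev -subr_eq0; congr (_ == 0); ring.
 apply/allP/eqP => [e|-> a _]; last by rewrite subrr evp0.
 by apply/eqP; rewrite -subr_eq0; apply/eqP; apply: (pev_eq0 sR) => // a /e /eqP.
under eq_bigr do rewrite cond.
rewrite (@sum_pairs _ _ G (fun h f => (f == Y * (h + Y))%:R)).
rewrite (eq_bigr (fun=> 1)) ?sumr_const ?card_mx ?mul1n ?natrX // => h _.
have sP : (size (Y * (rVpoly h + Y))%R <= (2 * G).+1)%N.
 rewrite (leq_trans (size_polyMleq _ _)) //.
 have : (size (rVpoly h + Y)%R <= G.+1)%N by rewrite size_polyD_leq // size_poly.
 by move: (size _) => n; lia.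
rewrite (bigD1 (poly_rV (Y * (rVpoly h + Y)))) //= poly_rV_K // eqxx big1 ?addr0 // => f nf.
by case: eqP => // e; rewrite -e rVpolyK eqxx in nf.
Qed.

(** Values of f alone miss one dimension. If for some i <= G the values a^i y_a are not interpolated
    in degree 2 G, adding multiples of X^i to h supplies it and [average_sum] applies. Otherwise let
    Z_i interpolate them: Z_(i+1) and X Z_i agree at 2 G + 2 points, so Z_G = X^G Z_0 has degree at
    most 2 G, and Z_0 is a section through y. *)
Lemma fibre_no_section (y : seq L) : y \in A -> (forall Y : {poly k}, (size Y <= G.+1)%N -> evs j G t Y <> y) ->
 \sum_(u : pair_poly k G) (defect_at y u == [seq z ^+ 2 | z <- y])%:R = qr ^+ G.
move=> yA ny; have [uA sA] := prodseq_Fx j (cfg_pos j tc).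
have sy : size y = size t.
 rewrite st; elim: (ds) (y) yA => [|d ds' IH] [|z v] //; first by move=> /allpairsP[? []].
 by rewrite mem_prodseq_cons => /andP[_ /IH /= ->].
pose w i := [seq evp G 'X^i x.1 * x.2 | x <- zip t y].
have [[i [iG Hi]]|H] := pselect (exists i, (i <= G)%N /\
  forall Z : {poly k}, (size Z <= (2 * G).+1)%N -> evs j (2 * G) t Z <> w i).
 pose X := ('rV[k]_(2 * G).+1 * k)%type.
 pose act (u : pair_poly k G) (x : X) : pair_poly k G :=
  (u.1 + poly_rV (x.2 *: 'X^i), u.2 + x.1).
 have sXi c : (size (c *: 'X^i : {poly k}) <= G.+1)%N.
  by rewrite (leq_trans (size_scale_leq _ _)) // size_polyXn.
 have := @average_sum rat X (pair_poly k G) _ A act (defect_at y) (fun v => (v == [seq z ^+ 2 | z <- y])%:R) uA.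
 have cE : #|{: X}| = size A by rewrite card_prod card_mx mul1n sA es -expnSr.
 move=> /(_ cE) E.
 have {E} : (size A)%:R * \sum_(u : pair_poly k G) (defect_at y u == [seq z ^+ 2 | z <- y])%:R =
   #|{: pair_poly k G}|%:R * \sum_(v <- A) (v == [seq z ^+ 2 | z <- y])%:R :> rat.
  apply: E.
  - by move=> x [u1 u2] [v1 v2] [] /addIr -> /addIr ->.
  - move=> u [f c] [f' c'] e.
   have eq1 x : x \in zip t y -> evp (2 * G) (rVpoly f - rVpoly f') x.1 = j (c - c') * (evp G 'X^i x.1 * x.2).
    move=> xz; have /eq_in_map/(_ x xz) := e.
    rewrite /act /hpoly /fpoly /= !linearD /= !poly_rV_K // !evpD !evpZ evpN => e1.
    by rewrite rmorphB /=; apply/eqP; rewrite -subr_eq0; move/eqP: e1; rewrite -subr_eq0 => /eqP <-; apply/eqP; ring.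
   have sD : (size (rVpoly f - rVpoly f')%R <= (2 * G).+1)%N.
    by rewrite size_polyD_leq // size_polyN !size_poly.
   have cc : c = c'.
    apply/eqP; apply: contraT => nc; have nc0 : c - c' != 0 by rewrite subr_eq0.
    case: (Hi ((c - c')^-1 *: (rVpoly f - rVpoly f'))); first by rewrite (leq_trans (size_scale_leq _ _)).
    rewrite /evs /w -{1}(unzip1_zip (s := t) (t := y)) ?sy // /unzip1 -map_comp.
    apply/eq_in_map => x xz /=; rewrite evpZ eq1 // mulrA -rmorphM mulVf // rmorph1 mul1r //.
   subst c'; congr (_, _); rewrite -[f]rVpolyK -[f']rVpolyK; congr poly_rV.
   apply: subr0_eq; apply: (pev_eq0 sD) => // a at_.
   have : a \in unzip1 (zip t y) by rewrite unzip1_zip ?sy.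
   by move=> /mapP[x xz ->]; rewrite eq1 // subrr rmorph0 mul0r.
  - by move=> u; apply: defect_mem.
 have -> : \sum_(v <- A) (v == [seq z ^+ 2 | z <- y])%:R = 1 :> rat.
  rewrite (eq_bigr (fun v => ([seq z ^+ 2 | z <- y] == v)%:R)); last by move=> v _; rewrite eq_sym.
  by rewrite sum_pick //; apply: sq_mem => //; apply: cfg_pos tc.
 rewrite mulr1 sA es card_prod !card_mx !mul1n -expnD !natrX => E.
 apply: (mulfI (expf_neq0 (2 * G).+2 (qr_neq0 k))); rewrite E -exprD; congr (_ ^+ _); lia.
have {}H i : (i <= G)%N -> exists2 Z : {poly k}, (size Z <= (2 * G).+1)%N & evs j (2 * G) t Z = w i.
 move=> iG; apply: contrapT => N; apply: H; exists i; split=> // Z sZ e; apply: N; by exists Z.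
exfalso.
have ZE i (Z : {poly k}) x : evs j (2 * G) t Z = w i -> x \in zip t y -> evp (2 * G) Z x.1 = evp G 'X^i x.1 * x.2.
 by rewrite /evs /w -{1}(unzip1_zip (s := t) (t := y)) ?sy // /unzip1 -map_comp => /eq_in_map e /e.
have [Z0 sZ0 e0] := H 0%N isT.
have shift i : (i <= G)%N -> exists2 Z : {poly k}, (size Z <= (2 * G).+1)%N & evs j (2 * G) t Z = w i /\ Z = 'X^i * Z0.
 elim: i => [_|i IH iG]; first by exists Z0; rewrite // expr0 mul1r.
 have [Z sZ [eZ ZZ]] := IH (ltnW iG); have [Z' sZ' eZ'] := H _ iG.
 exists Z' => //; split=> //; rewrite exprS -mulrA -ZZ; apply: subr0_eq.
 apply: (pev_eq0 (N := (2 * G).+1)) => //.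
  rewrite size_polyD_leq // size_polyN (leq_trans sZ') // (leq_trans (size_polyMleq _ _)) //.
  by rewrite size_polyX.
 move=> a at_; have : a \in unzip1 (zip t y) by rewrite unzip1_zip ?sy.
 move=> /mapP[x xz ->]; have := ZE _ _ _ eZ xz; have := ZE _ _ _ eZ' xz.
 case: x.1 => [z|] /= E' E.
  by rewrite pevB pevM E' E !pevXn pevX exprS mulrA subrr.
 rewrite coefB coefXM /= [Z'`_ _]nth_default // sub0r.
 move: E; rewrite coefXn (gtn_eqF (_ : i < G)%N) // rmorph0 mul0r => E.
 by rewrite rmorphN E oppr0.
have [Z sZ [eZ ZZ]] := shift G (leqnn G).
have sZ0' : (size Z0 <= G.+1)%N.
 have [->|z0] := eqVneq Z0 0; first by rewrite size_poly0.
 by move: sZ; rewrite ZZ mulrC size_mulXn //; lia.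
case: (ny Z0 sZ0'); rewrite /evs -{1}(unzip1_zip (s := t) (t := y)) ?sy // -[RHS](unzip2_zip (s := t)) ?sy //.
rewrite /unzip1 /unzip2 -map_comp; apply/eq_in_map => x xz /=.
have := ZE _ _ _ eZ xz; have := ZE _ _ _ e0 xz; rewrite ZZ.
case: x.1 => [z|] /=; first by rewrite pevXn expr0 mul1r.
by move=> _; rewrite mul2n -addnn [_ * Z0]mulrC coefMXn ltnNge leq_addr addnK coefXn eqxx rmorph1 mul1r.
Qed.
End Fibre.

(** All q^(2 G + 2) tuples of roots contribute q^G pairs, which cancels the term subtracted in
    [sum_tau_fibre]; the q^(G + 1) tuples coming from sections contribute q^(G + 1) - q^G more. *)
Lemma pair_sum_top G (t : seq (option L)) (l : seq (nat * nat)) : t \in cfg (unzip1 l) ->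
 all (fun x => x.2 == 1%N) l -> sumn (unzip1 l) = (2 * G).+2 ->
 pair_sum j G t l = qr ^+ (2 * G).+2 - qr ^+ (2 * G).+1.
move=> tc a1 es; have al : all (fun x => 0 < x.2)%N l by apply: sub_all a1 => x /eqP ->.
have nl : l != [::] by case: (l) es.
have st := cfg_size tc; set ds := unzip1 l in tc es st *.
have tE (h f : {poly k}) : weight (tau j G h f) t l =
  \prod_(x <- zip t ds) (fibre_card (fun a => evp G h a) x (evp (2 * G) f x.1) - 1).
 rewrite /ds /weight; move: st a1; rewrite /ds; elim: (t) (l) => [|a s IH] [|[d e] l'] //=; first by rewrite !big_nil.
 by move=> [sl] /andP[/eqP /= -> a1]; rewrite !big_cons /= IH // expr1.
have [uA sA] := prodseq_Fx j (cfg_pos j tc).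
rewrite pair_sum_all //; under eq_bigr do under eq_bigr do rewrite tE.
have tz : zip t ds != [::] by rewrite -size_eq0 size_zip st minnn size_map size_eq0.
have T (h : {poly k}) : \sum_(f : 'rV[k]_(2 * G).+1) \prod_(x <- zip t ds) (fibre_card (fun a => evp G h a) x (evp (2 * G) (rVpoly f) x.1) - 1)
  = \sum_(f : 'rV[k]_(2 * G).+1) \prod_(x <- zip t ds) fibre_card (fun a => evp G h a) x (evp (2 * G) (rVpoly f) x.1)
   - qr ^+ (2 * G).+1.
 have := @sum_tau_fibre G h (zip t ds) [::]; rewrite cats0 unzip1_zip ?unzip2_zip ?st // => /(_ tc es tz) <-.
 by apply: eq_bigr => f _; rewrite big_nil mulr1.
under eq_bigr do rewrite T.
rewrite sumrB sumr_const card_mx mul1n -[X in _ - X]mulr_natl natrX -exprD.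
have -> : \sum_(h : 'rV[k]_G.+1) \sum_(f : 'rV[k]_(2 * G).+1)
  \prod_(x <- zip t ds) fibre_card (fun a => evp G (rVpoly h) a) x (evp (2 * G) (rVpoly f) x.1) =
 \sum_(y <- prodseq [seq Fx d | d <- ds]) \sum_(u : pair_poly k G) (defect_at t y u == [seq z ^+ 2 | z <- y])%:R.
 rewrite [RHS]exchange_big -(@sum_pairs _ _ G (fun h f => \prod_(x <- zip t ds) fibre_card (fun a => evp G h a) x (evp (2 * G) f x.1))).
 by apply: eq_bigr => u _; rewrite (prod_fibre_card (fun a => evp G (hpoly u) a) (fun a => evp (2 * G) (fpoly u) a)).
pose I := [seq evs j G t (rVpoly v) | v <- enum 'rV[k]_G.+1].
have sI : size I = (q ^ G.+1)%N by rewrite size_map -cardE card_mx mul1n.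
have uI : uniq I.
 rewrite map_inj_uniq ?enum_uniq // => v v' e; rewrite -[v]rVpolyK -[v']rVpolyK; congr poly_rV; apply: subr0_eq.
 apply: (evs_eq0 (j := j) (N := G) tc).
 - by rewrite size_polyD_leq // size_polyN !size_poly.
 - by rewrite es; lia.
 - by move=> a at_; have /eq_in_map/(_ a at_) := e; rewrite evpB => ->; rewrite subrr.
have IA : {subset I <= prodseq [seq Fx d | d <- ds]} by move=> _ /mapP[v _ ->]; apply: evs_mem.
rewrite (eq_big_seq (fun y => qr ^+ G + (y \in I)%:R * (qr ^+ G.+1 - qr ^+ G))); last first.
 move=> y yA; case: (boolP (y \in I)) => [/mapP[v _ ->]|nI].
  by rewrite (fibre_section tc es) ?size_poly // mul1r addrC subrK.
 rewrite mul0r addr0 (fibre_no_section tc es yA) // => Y sY e; case/negP: nI.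
 by rewrite -e -(poly_rV_K sY); apply: map_f; rewrite mem_enum.
rewrite big_split /= -mulr_suml big_const_seq count_predT iter_addr_0 sA es -[_ ^+ _ *+ _]mulr_natr natrX.
rewrite -(count_sum (fun y => y \in I)).
have -> : count (fun y => y \in I) (prodseq [seq Fx d | d <- ds]) = (q ^ G.+1)%N.
 rewrite -sI -size_filter; apply: perm_size; apply: uniq_perm; rewrite ?filter_uniq // => y.
 by rewrite mem_filter; apply: andb_idr => /IA.
have -> : (2 * G).+2 = (G.+1 + G.+1)%N by lia.
have -> : (2 * G).+1 = (G.+1 + G)%N by lia.
by rewrite natrX !exprD !exprS; ring.
Qed.
End TopOdd.

(** * Existence and uniqueness of the conductor *)

Section Conductor.
Variable k : fieldType.
Implicit Types (h f c r s p b : {poly k}) (G : nat).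

Lemma smooth_ninf G h f (c : k) : smooth G.+1 h f -> ~ inf_singular G.+1 h f c.
Proof. by move=> S; have /(nonsingular_inf (smooth_h S) (smooth_f S)) := smooth_inf S; apply. Qed.

(** For G = 0 regularity at infinity is automatic: by [reduce_pair] a singularity along p requires
    deg p <= G. *)
Lemma smooth_intro G h f : (size h <= G.+1)%N -> (size f <= (2 * G).+1)%N -> disc h f != 0 ->
 (forall p, (1 < size p)%N -> nonsingular h f p) ->
 ((0 < G)%N -> forall c : k, ~ inf_singular G h f c) -> smooth G h f.
move=> sh sf d0 fin inf; split=> //; case: G sh sf inf => [|G] sh sf inf; last first.
 by apply/nonsingular_inf => // c; apply: inf.
have rev0 p : (size p <= 1)%N -> rev_poly 0 p = p.
 by move=> sp; rewrite /rev_poly poly_def big_ord1 expr0 subnn [RHS]size1_polyC // alg_polyC.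
move: sf; rewrite muln0 => sf; rewrite !rev0 // => b d1 d2.
have sX : (1 < size ('X : {poly k}))%N by rewrite size_polyX.
have [b0 [h' [f' [_ _ + _ _]]]] := @reduce_pair _ h f 'X b 0 sh sf d0 sX d1 d2.
by rewrite size_polyX.
Qed.

Lemma dvdp_integral (g B C e : {poly k}) : e ^+ 2 + g * B * e = g ^+ 2 * C -> g != 0 -> g %| e.
move=> E g0; have d0 : gcdp g e != 0 by rewrite gcdp_eq0 (negPf g0).
have /dvdpP[g' eg] := dvdp_gcdl g e; have /dvdpP[e' ee] := dvdp_gcdr g e.
have cop : coprimep g' e'.
 have n0 : (g != 0) || (e != 0) by rewrite g0.
 have qa : g %/ gcdp g e = g' by rewrite {1}eg mulpK.
 have qb : e %/ gcdp g e = e' by rewrite {1}ee mulpK.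
 by have := coprimep_div_gcd n0; rewrite qa qb.
have : e' ^+ 2 + g' * B * e' = g' ^+ 2 * C.
 apply: (mulIf (expf_neq0 2 d0)); transitivity (g ^+ 2 * C).
  by rewrite -E; move: (gcdp g e) eg ee => D -> ->; ring.
 by move: (gcdp g e) eg => D ->; ring.
move=> E'; have : g' %| e' ^+ 2.
 have -> : e' ^+ 2 = g' * (g' * C - B * e') by rewrite -[LHS](addrK (g' * B * e')) E'; ring.
 exact: dvdp_mulr.
rewrite expr2 Gauss_dvdpr // => /dvdpP[w ew]; apply/dvdpP; exists w.
by rewrite {1}ee ew -mulrA -eg.
Qed.

Lemma size_integral m (B C e : {poly k}) : e ^+ 2 + B * e = C -> (size B <= m.+1)%N ->
 (size C <= (2 * m).+1)%N -> (size e <= m.+1)%N.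
move=> E sB sC; rewrite leqNgt; apply/negP => lt.
have e0 : e != 0 by rewrite -size_poly_gt0 (leq_ltn_trans _ lt).
have s : size (e + B) = size e by rewrite size_polyDl // (leq_ltn_trans sB).
have : size C = (size e + size e).-1.
 rewrite -E (_ : _ + _ = e * (e + B)); last by ring.
 by rewrite size_mul // ?s // -size_poly_gt0 s size_poly_gt0.
by move: lt sC; move: (size e) (size C) => a b; lia.
Qed.

(** [lift_h] and [lift_f] form the pair of the function c y + r when y has the pair (h, f). *)
Definition lift_h c h r := c * h - r *+ 2.
Definition lift_f c h f r := c ^+ 2 * f + c * h * r - r ^+ 2.

Lemma disc_lift c h f r : disc (lift_h c h r) (lift_f c h f r) = c ^+ 2 * disc h f.
Proof. by rewrite /disc /lift_h /lift_f; ring. Qed.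

(** c y + r is also c (y - s) + (r + c s), so the data below a lift are determined only up to s. *)
Lemma lift_shift c h f r s :
 lift_h c (h + s *+ 2) (r + c * s) = lift_h c h r /\
 lift_f c (h + s *+ 2) (f - h * s - s ^+ 2) (r + c * s) = lift_f c h f r.
Proof. by rewrite /lift_h /lift_f; split; ring. Qed.

Lemma size_lift c h f r d m : (size c <= d.+1)%N -> (size h <= m.+1)%N -> (size f <= (2 * m).+1)%N ->
 (size r <= (d + m).+1)%N ->
 (size (lift_h c h r) <= (d + m).+1)%N /\ (size (lift_f c h f r) <= (2 * (d + m)).+1)%N.
move=> sc sh sf sr; have mul p b x y : (size p <= x.+1)%N -> (size b <= y.+1)%N -> (size (p * b)%R <= (x + y).+1)%N.
 by move=> sp sb; rewrite (leq_trans (size_polyMleq _ _)) //; move: (size p) (size b) sp sb => a b'; lia.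
split; first by rewrite size_polyD_leq // size_polyN mul // -scaler_nat (leq_trans (size_scale_leq _ _)).
rewrite size_polyD_leq // size_polyN; apply/andP; split.
 rewrite size_polyD_leq //; apply/andP; split.
  have -> : (2 * (d + m) = (d + d) + 2 * m)%N by lia.
  by rewrite expr2 !mul.
 have -> : (2 * (d + m) = (d + m) + (d + m))%N by lia.
 by rewrite mul // mul.
have -> : (2 * (d + m) = (d + m) + (d + m))%N by lia.
by rewrite expr2 mul.
Qed.

Lemma smooth_shift m h f s : smooth m h f -> disc h f != 0 -> (size s <= m.+1)%N ->
 smooth m (h + s *+ 2) (f - h * s - s ^+ 2).
move=> S d0 ss; have [] := @size_lift 1 h f (- s) 0 m.
- by rewrite size_poly1.
- exact: smooth_h S.
- exact: smooth_f S.
- by rewrite size_polyN.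
have -> : lift_h 1 h (- s) = h + s *+ 2 by rewrite /lift_h; ring.
have -> : lift_f 1 h f (- s) = f - h * s - s ^+ 2 by rewrite /lift_f; ring.
rewrite add0n => sh' sf'; apply: smooth_intro => //; first by rewrite disc_shift.
 move=> p sp b d1 d2; apply: (smooth_fin S sp (b := b + s)).
  by have -> : h + (b + s) *+ 2 = h + s *+ 2 + b *+ 2 by ring.
 by have -> : f - h * (b + s) - (b + s) ^+ 2 = f - h * s - s ^+ 2 - (h + s *+ 2) * b - b ^+ 2 by ring.
case: m S ss sh' sf' => // m S ss sh' sf' _ c /(inf_singular_coef c sh' sf') [e1 e2 e3].
apply: (smooth_ninf (c := c + s`_m.+1) S); apply/(inf_singular_coef _ (smooth_h S) (smooth_f S)).
have [t1 t2] := coefM_top (smooth_h S) ss; have [t3 t4] := coefM_top ss ss.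
move: e1 e2 e3; rewrite !coefD !coefN ?coefMn ?expr2 t1 t2 t3 t4 => e1 e2 e3; split.
- by rewrite -[RHS]e1; ring.
- by rewrite -[RHS]e2; ring.
- transitivity (f`_(2 * m).+1 - (h`_m.+1 * s`_m + h`_m * s`_m.+1) - (s`_m.+1 * s`_m + s`_m * s`_m.+1)
  - (h`_m + (s`_m + s`_m)) * c + s`_m * (h`_m.+1 + (s`_m.+1 + s`_m.+1) + c *+ 2)); first by ring.
 by rewrite e3 e1 mulr0 addr0.
Qed.

(** Singularities are removed one at a time. A finite one multiplies c by a monic p, one at infinity
    only raises d; so d - deg c is the part of the conductor at infinity. *)
Lemma conductor_ex G h f : (size h <= G.+1)%N -> (size f <= (2 * G).+1)%N -> disc h f != 0 ->
 exists d c r h' f', [/\ (d <= G)%N, c \is monic /\ (size c <= d.+1)%N, (size r <= G.+1)%N,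
  smooth (G - d) h' f' /\ disc h' f' != 0 & h = lift_h c h' r /\ f = lift_f c h' f' r].
have [n] := ubnP G; elim: n G h f => // n IH G h f lt sh sf d0.
have [S|S] := pselect (smooth G h f).
 exists 0%N, 1, 0, h, f; rewrite monic1 size_poly1 size_poly0 subn0 /lift_h /lift_f; split=> //.
 by split; ring.
have [[p [b [sp d1 d2]]]|nfin] := pselect (exists p b, [/\ (1 < size p)%N, p %| h + b *+ 2 & p ^+ 2 %| f - h * b - b ^+ 2]).
 have p0 : p != 0 by rewrite -size_poly_gt0 ltnW.
 have l0 : lead_coef p != 0 by rewrite lead_coef_eq0.
 pose p1 := (lead_coef p)^-1 *: p.
 have sp1 : size p1 = size p by rewrite size_scale // invr_eq0.
 have mp1 : p1 \is monic by rewrite monicE lead_coefZ mulVf.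
 have ass : p1 %= p by rewrite eqp_scale // invr_eq0.
 have [] := @reduce_pair _ h f p1 b G sh sf d0; rewrite ?sp1 ?(eqp_dvdl _ ass) //.
  by rewrite (eqp_dvdl _ (eqp_exp 2 ass)).
 move=> b0 [h1 [f1 [e1 e2 pG sb [sh1 sf1]]]].
 have eh : h = p1 * h1 - b0 *+ 2 by rewrite -e1; ring.
 have ef : f = p1 ^+ 2 * f1 + p1 * h1 * b0 - b0 ^+ 2 by rewrite -e1 -e2; ring.
 have d0' : disc h1 f1 != 0.
  apply: contraNneq d0 => e; rewrite eh ef -/(lift_h _ _ _) -/(lift_f _ _ _ _) disc_lift e mulr0 //.
 have lt' : (G - (size p).-1 < n)%N by move: (size p) sp lt pG => a; clear; lia.
 have [d [c [r [h' [f' [dG [mc sc] sr SD [eh1 ef1]]]]]]] := IH _ h1 f1 lt' sh1 sf1 d0'.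
 exists (d + (size p).-1)%N, (p1 * c), (p1 * r + b0), h', f'; split.
 - by move: (size p) sp pG dG => a; clear; lia.
 - split; first by rewrite monicMl.
  rewrite (leq_trans (size_polyMleq _ _)) // sp1.
  by move: (size p) (size c) sp sc => a b'; clear; lia.
 - rewrite size_polyD_leq //; apply/andP; split; last by move: (size b0) (size p) sb pG => x y; clear; lia.
  rewrite (leq_trans (size_polyMleq _ _)) // sp1.
  by move: (size p) (size r) sp sr pG => a b'; clear; lia.
 - by rewrite addnC subnDA.
 - by rewrite {1}eh {1}ef eh1 ef1 /lift_h /lift_f; split; ring.
case: G lt sh sf S => [|G] lt sh sf S.
 case: S; apply: smooth_intro => // p sp b d1 d2; apply: nfin; by exists p, b.
have [c sing] : exists c : k, inf_singular G.+1 h f c.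
 apply: contrapT => ninf; apply: S; apply: smooth_intro => // [p sp b d1 d2|_ c sing].
  by apply: nfin; exists p, b.
 by apply: ninf; exists c.
set r0 := c *: 'X^(G.+1); set h1 := h + r0 *+ 2; set f1 := f - h * r0 - r0 ^+ 2.
have d0' : disc h1 f1 != 0 by rewrite disc_shift.
have [sh1 sf1] := sing.
have sf1' : (size f1 <= (2 * G).+1)%N by move: sf1; have -> : ((2 * G.+1).-1 = (2 * G).+1)%N by lia.
have [d [c' [r [h' [f' [dG [mc sc] sr SD [eh1 ef1]]]]]]] := IH _ h1 f1 lt sh1 sf1' d0'.
exists d.+1, c', (r + r0), h', f'; split=> //.
- by rewrite mc leqW.
- rewrite size_polyD_leq // (leq_trans sr) //=.
 by rewrite (leq_trans (size_scale_leq _ _)) // size_polyXn.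
- have -> : h = h1 - r0 *+ 2 by rewrite /h1; ring.
 have -> : f = f1 + h1 * r0 - r0 ^+ 2 by rewrite /f1 /h1; ring.
 by rewrite eh1 ef1 /lift_h /lift_f; split; ring.
Qed.

Section Uniqueness.
Variables (c1 c2 h1 h2 f1 f2 r1 r2 : {poly k}) (m1 m2 : nat) (mc1 : c1 \is monic) (mc2 : c2 \is monic) (S1 : smooth m1 h1 f1) (S2 : smooth m2 h2 f2) (eh : lift_h c1 h1 r1 = lift_h c2 h2 r2) (ef : lift_f c1 h1 f1 r1 = lift_f c2 h2 f2 r2).

(** Equating the two lifts gives a quadratic equation for r1 - r2 that is integral after division by
    the common factor g, so [dvdp_integral] applies. *)
Lemma lift_diff g a b : c1 = g * a -> c2 = g * b -> g != 0 ->
 exists e, [/\ r1 - r2 = g * e, e *+ 2 = a * h1 - b * h2 & e ^+ 2 + b * h2 * e = b ^+ 2 * f2 - a ^+ 2 * f1].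
move=> ec1 ec2 g0; pose dl := r1 - r2.
have e1 : dl *+ 2 = g * (a * h1 - b * h2).
 rewrite /dl; transitivity (c1 * h1 - c2 * h2 - (lift_h c1 h1 r1 - lift_h c2 h2 r2)); first by rewrite /lift_h; ring.
 by rewrite eh subrr subr0 ec1 ec2; ring.
have e2 : dl ^+ 2 + g * (b * h2) * dl = g ^+ 2 * (b ^+ 2 * f2 - a ^+ 2 * f1).
 transitivity (g ^+ 2 * (b ^+ 2 * f2 - a ^+ 2 * f1) + (lift_f c1 h1 f1 r1 - lift_f c2 h2 f2 r2)
   - (lift_h c1 h1 r1 - lift_h c2 h2 r2) * r1); last by rewrite ef eh !subrr mul0r addr0 subr0.
 by rewrite /dl /lift_f /lift_h ec1 ec2; ring.
have /dvdpP[e ee] := dvdp_integral e2 g0.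
exists e; rewrite -/dl; split; first by rewrite ee mulrC.
 by apply: (mulIf g0); rewrite [RHS]mulrC -e1 ee; ring.
apply: (mulIf (expf_neq0 2 g0)); rewrite [RHS]mulrC -e2 ee; ring.
Qed.

(* A common conductor divisor a of one side only would make (h2, f2) singular along a. *)
Lemma lift_cofactor g a b : c1 = g * a -> c2 = g * b -> g != 0 -> coprimep a b -> (size a <= 1)%N.
move=> ec1 ec2 g0 cop; have [e [_ e1 e2]] := lift_diff ec1 ec2 g0.
rewrite leqNgt; apply/negP => sa.
have cop2 : coprimep (a ^+ 2) b by rewrite coprimep_expl.
have [[u v] euv] : exists w : {poly k} * {poly k}, w.1 * a ^+ 2 + w.2 * b = 1 by apply/Bezout_eq1_coprimepP.
have vb : v * b = 1 - u * a ^+ 2 by rewrite -euv /=; ring.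
apply: (smooth_fin S2 sa (b := v * e)).
 have -> : h2 + (v * e) *+ 2 = a * (v * h1 + u * a * h2).
  transitivity (h2 + v * (a * h1) - (v * b) * h2); first by rewrite -[a * h1](subrK (b * h2)) -e1; ring.
  by rewrite vb; ring.
 exact: dvdp_mulr.
have copb : coprimep (a ^+ 2) (b ^+ 2) by rewrite coprimep_expr.
rewrite -(Gauss_dvdpr _ copb).
have -> : b ^+ 2 * (f2 - h2 * (v * e) - (v * e) ^+ 2) =
  a ^+ 2 * (f1 + u * b * h2 * e + (u *+ 2 - u ^+ 2 * a ^+ 2) * e ^+ 2).
 transitivity (b ^+ 2 * f2 - b * h2 * e * (v * b) - (v * b) ^+ 2 * e ^+ 2); first by ring.
 rewrite vb -[b ^+ 2 * f2](subrK (a ^+ 2 * f1)) -e2; ring.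
exact: dvdp_mulr.
Qed.

(** The pair of higher level would be a shift by e of a pair of lower level, hence singular at
    infinity, at the value given by the top coefficient of -e. *)
Lemma lift_same_level : c1 = c2 -> (m2 < m1)%N -> False.
move=> ec lt; have g0 : c1 != 0 by apply: monic_neq0.
have ec2 : c2 = c1 * 1 by rewrite mulr1 ec.
have [e [_ e1 e2]] := lift_diff (esym (mulr1 c1)) ec2 g0.
case: m1 S1 lt => // m S1' lt.
have sh2 : (size h2 <= m.+1)%N by rewrite (leq_trans (smooth_h S2)).
have sf2 : (size f2 <= (2 * m).+1)%N by rewrite (leq_trans (smooth_f S2)) // ltnS leq_mul2l.
have se : (size e <= m.+2)%N.
 apply: (size_integral e2); rewrite ?mul1r ?expr1n ?mul1r.
  by rewrite (leq_trans sh2).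
 rewrite ?expr1n ?mul1r size_polyD_leq // size_polyN (smooth_f S1') andbT.
 by rewrite (leq_trans sf2) //; lia.
have eh1 : h1 = h2 + e *+ 2 by rewrite e1; ring.
have ef1 : f1 = f2 - h2 * e - e ^+ 2.
 have : e ^+ 2 + h2 * e = f2 - f1 by rewrite -[h2]mul1r e2 expr1n !mul1r.
 by move=> e3; rewrite -addrA -opprD [h2 * e + _]addrC e3; ring.
apply: (smooth_ninf (c := - e`_m.+1) S1'); apply/(inf_singular_coef _ (smooth_h S1') (smooth_f S1')).
have [t1 t2] := coefM_top (leqW sh2) se; have [t3 t4] := coefM_top se se.
have z1 : h2`_m.+1 = 0 by rewrite nth_default.
have z2 : f2`_(2 * m.+1) = 0 by rewrite nth_default // (leq_trans sf2) //; lia.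
have z3 : f2`_(2 * m).+1 = 0 by rewrite nth_default.
by rewrite eh1 ef1 !coefD !coefN ?coefMn ?expr2 t1 t2 t3 t4 z1 z2 z3; split; ring.
Qed.
End Uniqueness.

Lemma conductor_uniq (c1 c2 h1 h2 f1 f2 r1 r2 : {poly k}) m1 m2 : c1 \is monic -> c2 \is monic ->
 smooth m1 h1 f1 -> smooth m2 h2 f2 -> lift_h c1 h1 r1 = lift_h c2 h2 r2 ->
 lift_f c1 h1 f1 r1 = lift_f c2 h2 f2 r2 ->
 [/\ c1 = c2, m1 = m2 & exists s, [/\ (size s <= m1.+1)%N & r1 = r2 + c1 * s]].
move=> mc1 mc2 S1 S2 eh ef; have c10 := monic_neq0 mc1.
have d0 : gcdp c1 c2 != 0 by rewrite gcdp_eq0 (negPf c10).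
have /dvdpP[a ea] := dvdp_gcdl c1 c2; have /dvdpP[b eb] := dvdp_gcdr c1 c2.
have cop : coprimep a b.
 have n0 : (c1 != 0) || (c2 != 0) by rewrite c10.
 have qa : c1 %/ gcdp c1 c2 = a by rewrite {1}ea mulpK.
 have qb : c2 %/ gcdp c1 c2 = b by rewrite {1}eb mulpK.
 by have := coprimep_div_gcd n0; rewrite qa qb.
rewrite mulrC in ea; rewrite mulrC in eb.
have sa := lift_cofactor S2 eh ef ea eb d0 cop.
have sb : (size b <= 1)%N by apply: (lift_cofactor S1 (esym eh) (esym ef) eb ea d0); rewrite coprimep_sym.
have ec : c1 = c2.
 apply/eqP; rewrite -eqp_monic //; apply/eqpP.
 have ua : size a == 1%N.
  by rewrite eqn_leq sa size_poly_gt0; apply: contraNneq c10 => e; rewrite ea e mulr0.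
 have ub : size b == 1%N.
  rewrite eqn_leq sb size_poly_gt0; apply: contraNneq (monic_neq0 mc2) => e; by rewrite eb e mulr0.
 move: ua ub => /size_poly1P[x x0 ex] /size_poly1P[y y0 ey].
 exists (y, x); rewrite ?x0 ?y0 //=; move: (gcdp c1 c2) ea eb => D -> ->.
 by rewrite ex ey -!mul_polyC; ring.
have em : m1 = m2.
 case: (ltngtP m1 m2) => // lt.
  by case: (lift_same_level mc2 mc1 S2 S1 (esym eh) (esym ef) (esym ec) lt).
 by case: (lift_same_level mc1 mc2 S1 S2 eh ef ec lt).
have ec2 : c2 = c1 * 1 by rewrite mulr1 ec.
have [e [e0 e1 e2]] := lift_diff eh ef (esym (mulr1 c1)) ec2 c10.
split=> //; exists e; split; last by rewrite -e0 addrC subrK.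
apply: (size_integral e2); first by rewrite mul1r em (smooth_h S2).
rewrite ?expr1n ?mul1r size_polyD_leq // size_polyN (smooth_f S1) andbT.
by rewrite em (smooth_f S2).
Qed.
End Conductor.

(** * Sieve by the conductor *)

Section Sieve.
Variables (k : finFieldType) (L : closedFieldType) (j : {rmorphism k -> L}).
Notation q := #|k|.
Notation fr := (@fr k L).
Notation Fx := (fixed_points k L).
Notation cfg := (cfg (@frP k L) (@P1_pts k L)).
Notation evp := (evp j).
Notation wt G h f t l := (weight (tau j G h f) t l).
Notation qr := (q%:R : rat).

Definition smooth_sum G t l : rat := \sum_(u : pair_poly k G | smooth_pair u) wt G (hpoly u) (fpoly u) t l.

(** A monic polynomial of degree at most d stands for an effective divisor of degree d on P^1, the
    missing degree being its multiplicity at infinity. Such divisors are the conductors prime to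
    t. *)
Definition coprime_form d (t : seq (option L)) (c : 'rV[k]_d.+1) : bool :=
 (rVpoly c \is monic) && all (fun a => evp d (rVpoly c) a != 0) t.

(** Where c vanishes the lifted equation has a double root; elsewhere y -> C y + R is a bijection
    between the roots, compatible with Frobenius. *)
Lemma tau_lift d m (c h f r : {poly k}) n a : (size c <= d.+1)%N -> (size h <= m.+1)%N ->
 (size f <= (2 * m).+1)%N -> (size r <= (d + m).+1)%N -> has_period (@frP k L) n a ->
 tau j (d + m) (lift_h c h r) (lift_f c h f r) n a = if evp d c a == 0 then 0 else tau j m h f n a.
move=> sc sh sf sr pa; have /has_periodP[n0 ea _] := pa.
have [y ey] := quad_root (evp m h a) (evp (2 * m) f a).
set C := evp d c a; set H := evp m h a in ey *; set F := evp (2 * m) f a in ey *; set R := evp (d + m) r a.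
have eC : fr n C = C by rewrite fr_evp ea.
have eR : fr n R = R by rewrite fr_evp ea.
have eH : evp (d + m) (lift_h c h r) a = C * H - R *+ 2 by rewrite /lift_h evpB evpM // evpMn.
have eF : evp (2 * (d + m)) (lift_f c h f r) a = C ^+ 2 * F + C * H * R - R ^+ 2.
 have e1 : evp (2 * (d + m)) (c ^+ 2 * f) a = C ^+ 2 * F.
  have -> : (2 * (d + m) = (d + d) + 2 * m)%N by lia.
  rewrite !expr2 evpM ?evpM //; apply: leq_trans (size_polyMleq _ _) _.
  by move: (size c) sc => x; lia.
 have e2 : evp (2 * (d + m)) (c * h * r) a = C * H * R.
  have -> : (2 * (d + m) = (d + m) + (d + m))%N by lia.
  rewrite evpM ?evpM //; apply: leq_trans (size_polyMleq _ _) _.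
  by move: (size c) (size h) sc sh => x x'; lia.
 have e3 : evp (2 * (d + m)) (r ^+ 2) a = R ^+ 2.
  have -> : (2 * (d + m) = (d + m) + (d + m))%N by lia.
  by rewrite !expr2 evpM.
 by rewrite /lift_f evpB evpD e1 e2 e3.
have eY : (C * y + R) ^+ 2 + evp (d + m) (lift_h c h r) a * (C * y + R) = evp (2 * (d + m)) (lift_f c h f r) a.
 by rewrite eH eF -ey; ring.
rewrite (tauE pa eY) (tauE pa ey) -/H eH.
have -> : (C * y + R) *+ 2 + (C * H - R *+ 2) = C * (y *+ 2 + H) by ring.
rewrite mulf_eq0; have [//|C0] := eqVneq C 0; rewrite /=; case: ifP => // _.
by rewrite (frD j) frM eC eR (inj_eq (addIr _)) (inj_eq (mulfI C0)).
Qed.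

Lemma weight_lift d m (c h f r : {poly k}) t l : (size c <= d.+1)%N -> (size h <= m.+1)%N ->
 (size f <= (2 * m).+1)%N -> (size r <= (d + m).+1)%N -> t \in cfg (unzip1 l) -> all (fun x => 0 < x.2)%N l ->
 wt (d + m) (lift_h c h r) (lift_f c h f r) t l = (all (fun a => evp d c a != 0) t)%:R * wt m h f t l.
move=> sc sh sf sr; elim: t l => [|a t IH] [|[n e] l] //; try by rewrite /weight !big_nil mul1r.
rewrite mem_cfg_cons => /and3P[aE _ tc] /= /andP[e0 al].
move: (IH _ tc al); rewrite /weight !big_cons /= => ->; rewrite tau_lift -?(mem_P1_pts j) //.
by case: (evp d c a == 0) => /=; rewrite ?expr0n ?(gtn_eqF e0) ?mul0r // mulrCA.
Qed.

Section Level.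
Variable G : nat.

Definition lift_pair (d : 'I_G.+1) (c : 'rV[k]_d.+1) (r : 'rV[k]_G.+1) (u : pair_poly k (G - d)) : pair_poly k G :=
 (poly_rV (lift_h (rVpoly c) (hpoly u) (rVpoly r)), poly_rV (lift_f (rVpoly c) (hpoly u) (fpoly u) (rVpoly r))).

Lemma lift_pairE (d : 'I_G.+1) (c : 'rV[k]_d.+1) r (u : pair_poly k (G - d)) :
 hpoly (lift_pair c r u) = lift_h (rVpoly c) (hpoly u) (rVpoly r) /\
 fpoly (lift_pair c r u) = lift_f (rVpoly c) (hpoly u) (fpoly u) (rVpoly r).
have dG : (d + (G - d) = G)%N by rewrite subnKC // -ltnS.
have [] := @size_lift k (rVpoly c) (hpoly u) (fpoly u) (rVpoly r) d (G - d).
- exact: size_poly.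
- exact: size_hpoly.
- exact: size_fpoly.
- by rewrite dG size_poly.
by rewrite dG => s1 s2; rewrite /hpoly /fpoly /lift_pair /= !poly_rV_K.
Qed.

Lemma card_lift_pair (d : 'I_G.+1) (c : 'rV[k]_d.+1) r0 u0 : rVpoly c \is monic -> smooth_pair u0 ->
 #|[pred p : 'rV[k]_G.+1 * pair_poly k (G - d) | smooth_pair p.2 && (lift_pair c p.1 p.2 == lift_pair c r0 u0)]| =
 (q ^ (G - d).+1)%N.
move=> mc /andP[/asboolP S0 D0]; have c0 := monic_neq0 mc.
have dG : (d + (G - d) = G)%N by rewrite subnKC // -ltnS.
have sr (s : {poly k}) : (size s <= (G - d).+1)%N -> (size (rVpoly r0 + rVpoly c * s)%R <= G.+1)%N.
 move=> ss; rewrite size_polyD_leq // size_poly (leq_trans (size_polyMleq _ _)) //.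
 by have := size_poly d.+1 (fun i : nat => 0 : k); have : (size (rVpoly c) <= d.+1)%N := size_poly _ _; move: (size (rVpoly c)) (size s) ss (dG) => x y; clear; lia.
pose F (s : 'rV[k]_(G - d).+1) : 'rV[k]_G.+1 * pair_poly k (G - d) :=
 (poly_rV (rVpoly r0 + rVpoly c * rVpoly s),
  (poly_rV (hpoly u0 + rVpoly s *+ 2), poly_rV (fpoly u0 - hpoly u0 * rVpoly s - rVpoly s ^+ 2))).
have ss (s : 'rV[k]_(G - d).+1) : (size (rVpoly s) <= (G - d).+1)%N := size_poly _ _.
have SS s := smooth_shift S0 D0 (ss s).
have FE s : [/\ rVpoly (F s).1 = rVpoly r0 + rVpoly c * rVpoly s, hpoly (F s).2 = hpoly u0 + rVpoly s *+ 2
  & fpoly (F s).2 = fpoly u0 - hpoly u0 * rVpoly s - rVpoly s ^+ 2].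
 by rewrite /hpoly /fpoly /= !poly_rV_K ?sr ?(smooth_h (SS s)) ?(smooth_f (SS s)).
clearbody F.
have F_inj : injective F.
 move=> s s' e; have [e1 _ _] := FE s; have [e2 _ _] := FE s'.
 rewrite -[s]rVpolyK -[s']rVpolyK; congr poly_rV; apply: (mulfI c0); apply: (addrI (rVpoly r0)).
 by rewrite -e1 -e2 e.
rewrite -[RHS](_ : #|codom F| = _); last by rewrite card_codom // card_mx mul1n.
apply: eq_card => -[r u]; rewrite !inE /=; apply/andP/codomP => [[/andP[/asboolP S D] /eqP e]|[s es]].
 have [eh ef] := lift_pairE c r u; have [eh0 ef0] := lift_pairE c r0 u0.
 have eh' : lift_h (rVpoly c) (hpoly u) (rVpoly r) = lift_h (rVpoly c) (hpoly u0) (rVpoly r0) by rewrite -eh -eh0 e.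
 have ef' : lift_f (rVpoly c) (hpoly u) (fpoly u) (rVpoly r) = lift_f (rVpoly c) (hpoly u0) (fpoly u0) (rVpoly r0) by rewrite -ef -ef0 e.
 have [_ _ [s [sz er]]] := conductor_uniq mc mc S S0 eh' ef'.
 have [es1 es2] := lift_shift (rVpoly c) (hpoly u0) (fpoly u0) (rVpoly r0) s.
 exists (poly_rV s); have [f1 f2 f3] := FE (poly_rV s); rewrite poly_rV_K // in f1 f2 f3.
 have hu : hpoly u = hpoly u0 + s *+ 2.
  apply: (mulfI c0); apply: (addIr (- (rVpoly r *+ 2))); rewrite -/(lift_h _ _ _) eh' -es1 er //.
 have fu : fpoly u = fpoly u0 - hpoly u0 * s - s ^+ 2.
  apply: (mulfI (expf_neq0 2 c0)); apply: (addIr (rVpoly c * hpoly u * rVpoly r)); apply: (addIr (- rVpoly r ^+ 2)).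
  by rewrite -/(lift_f _ _ _ _) ef' -es2 er hu.
 rewrite [F _]surjective_pairing; congr (_, _).
  by rewrite -[r]rVpolyK -[(F _).1]rVpolyK f1 er.
 by apply: pair_poly_inj; rewrite ?f2 ?f3.
have [f1 f2 f3] := FE s; have -> : r = (F s).1 by rewrite -es.
have -> : u = (F s).2 by rewrite -es.
split.
 by apply/andP; rewrite f2 f3 disc_shift; split=> //; apply/asboolP.
have [es1 es2] := lift_shift (rVpoly c) (hpoly u0) (fpoly u0) (rVpoly r0) (rVpoly s).
have [eh ef] := lift_pairE c (F s).1 (F s).2; have [eh0 ef0] := lift_pairE c r0 u0.
by apply/eqP; apply: pair_poly_inj; rewrite ?eh ?ef ?eh0 ?ef0 f1 f2 ?f3.
Qed.

(** The conductor exists and is unique, and the denominator q^(G - d + 1) counts the shifts by s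
    that yield the same pair. *)
Lemma lift_partition (u : pair_poly k G) : disc_pair u ->
 \sum_(d < G.+1) \sum_(c : 'rV[k]_d.+1 | rVpoly c \is monic) \sum_(r : 'rV[k]_G.+1)
  \sum_(v : pair_poly k (G - d) | smooth_pair v) (lift_pair c r v == u)%:R / qr ^+ (G - d).+1 = 1.
move=> D; have [d0 [c0 [r0 [h0 [f0 [dG [mc sc] sr [S0 D0] [eh ef]]]]]]] := conductor_ex (size_hpoly u) (size_fpoly u) D.
have [u0 [eu0 eu0']] := pair_poly_ex (smooth_h S0) (smooth_f S0).
pose d : 'I_G.+1 := Ordinal (dG : (d0 < G.+1)%N).
pose c : 'rV[k]_d.+1 := poly_rV c0; have cE : rVpoly c = c0 by rewrite poly_rV_K.
pose r : 'rV[k]_G.+1 := poly_rV r0; have rE : rVpoly r = r0 by rewrite poly_rV_K.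
have uE : lift_pair c r (u0 : pair_poly k (G - d)) = u.
 have [e1 e2] := lift_pairE c r (u0 : pair_poly k (G - d)).
 by apply: pair_poly_inj; rewrite ?e1 ?e2 cE rE eu0 ?eu0'.
have Su0 : smooth_pair (u0 : pair_poly k (G - d)) by rewrite /smooth_pair eu0 eu0' D0 andbT; apply/asboolP.
have mc' : rVpoly c \is monic by rewrite cE.
have uniq (d1 : 'I_G.+1) (c1 : 'rV[k]_d1.+1) r1 v : rVpoly c1 \is monic -> smooth_pair v -> lift_pair c1 r1 v = u ->
  rVpoly c1 = rVpoly c /\ d1 = d.
 move=> mc1 /andP[/asboolP S1 _] e; have [e1 e2] := lift_pairE c1 r1 v.
 have eh' : lift_h (rVpoly c1) (hpoly v) (rVpoly r1) = lift_h c0 h0 r0 by rewrite -e1 e.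
 have ef' : lift_f (rVpoly c1) (hpoly v) (fpoly v) (rVpoly r1) = lift_f c0 h0 f0 r0 by rewrite -e2 e.
 have [ec em _] := conductor_uniq mc1 mc S1 S0 eh' ef'.
 split; first by rewrite ec cE.
 apply: val_inj => /=; have := ltn_ord d1; move: em (dG); clear; lia.
rewrite (bigD1 d) //= [X in _ + X]big1 ?addr0 => [|d1 nd]; last first.
 rewrite big1 // => c1 mc1; rewrite big1 // => r1 _; rewrite big1 // => v Sv.
 by case: eqP => [e|_]; rewrite ?mul0r //; have [_ ed] := uniq _ _ _ _ mc1 Sv e; rewrite ed eqxx in nd.
rewrite (bigD1 c) //= [X in _ + X]big1 ?addr0 => [|c1 /andP[mc1 nc]]; last first.
 rewrite big1 // => r1 _; rewrite big1 // => v Sv.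
 case: eqP => [e|_]; rewrite ?mul0r //; have [ec _] := uniq d c1 r1 v mc1 Sv e.
 by case/eqP: nc; rewrite -[c1]rVpolyK ec rVpolyK.
under eq_bigr do rewrite -mulr_suml.
rewrite -mulr_suml; set N := \sum_i _.
suff -> : N = (q ^ (G - d).+1)%:R by rewrite natrX mulfV // expf_neq0 // qr_neq0.
rewrite -(card_lift_pair r mc' Su0) uE -sum1_card natr_sum /N pair_big_dep /= [LHS]big_mkcond [RHS]big_mkcond.
by apply: eq_bigr => -[r1 v] _; rewrite inE /=; case: (smooth_pair v) => //=; case: eqP.
Qed.

(** The factor q^d is the number q^(G + 1) of choices of r divided by the q^(G - d + 1) shifts. *)
Lemma pair_sum_sieve (t : seq (option L)) (l : seq (nat * nat)) : t \in cfg (unzip1 l) -> all (fun x => 0 < x.2)%N l ->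
 pair_sum j G t l = \sum_(d < G.+1) qr ^+ d * #|@coprime_form d t|%:R * smooth_sum (G - d) t l.
move=> tc al; pose W (u : pair_poly k G) := wt G (hpoly u) (fpoly u) t l.
transitivity (\sum_(u : pair_poly k G | disc_pair u) \sum_(d < G.+1) \sum_(c : 'rV[k]_d.+1 | rVpoly c \is monic) \sum_(r : 'rV[k]_G.+1)
  \sum_(v : pair_poly k (G - d) | smooth_pair v) W u * ((lift_pair c r v == u)%:R / qr ^+ (G - d).+1)).
 apply: eq_bigr => u D; rewrite -[LHS]mulr1 -[X in _ * X = _](lift_partition D).
 rewrite mulr_sumr; apply: eq_bigr => d _; rewrite mulr_sumr; apply: eq_bigr => c _.
 by rewrite mulr_sumr; apply: eq_bigr => r _; rewrite mulr_sumr.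
rewrite exchange_big; apply: eq_bigr => d _ /=.
have dG : (d + (G - d) = G)%N by rewrite subnKC // -ltnS.
have q0 : qr ^+ (G - d).+1 != 0 by rewrite expf_neq0 // qr_neq0.
rewrite exchange_big /=.
transitivity (\sum_(c : 'rV[k]_d.+1 | rVpoly c \is monic) qr ^+ d * (all (fun a => evp d (rVpoly c) a != 0) t)%:R * smooth_sum (G - d) t l).
 apply: eq_bigr => c mc; rewrite exchange_big /=.
 transitivity (\sum_(r : 'rV[k]_G.+1) (all (fun a => evp d (rVpoly c) a != 0) t)%:R * smooth_sum (G - d) t l / qr ^+ (G - d).+1).
  apply: eq_bigr => r _; rewrite exchange_big /= /smooth_sum mulr_sumr mulr_suml; apply: eq_bigr => v Sv.
  have [eh ef] := lift_pairE c r v.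
  have D : disc_pair (lift_pair c r v).
   rewrite /disc_pair eh ef disc_lift mulf_neq0 //; first by rewrite expf_neq0 // monic_neq0.
   by case/andP: Sv.
  rewrite (bigD1 (lift_pair c r v)) //= eqxx big1 ?addr0 => [|u /andP[_ nu]]; last first.
   by rewrite eq_sym (negPf nu) mul0r mulr0.
  have sr : (size (rVpoly r) <= (d + (G - d)).+1)%N by rewrite dG size_poly.
  have e := weight_lift (size_poly _ _ : (size (rVpoly c) <= d.+1)%N) (size_hpoly v) (size_fpoly v) sr tc al.
  by rewrite dG in e; rewrite /W eh ef mul1r e.
 rewrite sumr_const card_mx mul1n -[LHS]mulr_natr natrX -[G.+1]/((G).+1) -[in qr ^+ G.+1]dG -addnS exprD.
 by move: q0; set w := qr ^+ (G - d).+1 => q0; field.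
rewrite -mulr_suml -mulr_sumr; congr (_ * _ * _).
rewrite -sum1_card natr_sum [LHS]big_mkcond [RHS]big_mkcond; apply: eq_bigr => c _.
have -> : (c \in @coprime_form d t) = (rVpoly c \is monic) && all (fun a => evp d (rVpoly c) a != 0) t by [].
by case: (rVpoly c \is monic) => //=; case: (all _ _).
Qed.
End Level.
End Sieve.

(** * Counting conductors prime to given points *)

Section FormCount.
Variables (k : finFieldType) (L : closedFieldType) (j : {rmorphism k -> L}).
Notation q := #|k|.
Notation fr := (@fr k L).
Notation Fx := (fixed_points k L).
Notation cfg := (cfg (@frP k L) (@P1_pts k L)).
Notation evp := (evp j).
Notation nform d t := #|@coprime_form k L j d t|.

Lemma cfg1 e a : has_period (@frP k L) e a -> [:: a] \in cfg [:: e].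
Proof. by move=> pa; rewrite mem_cfg_cons (mem_P1_pts j) pa. Qed.

Lemma vanishing_poly e z : has_period (@frP k L) e (Some z) ->
 exists p : {poly k}, [/\ p != 0, (size p <= e.+1)%N & pev j z p = 0].
move=> pa; have /has_periodP[e0 ea _] := pa; have [uF sF mF] := fixed_pointsP j e0.
pose g (v : 'rV[k]_e.+1) := pev j z (rVpoly v).
have /injectivePn[v [v' nv ev]] : ~~ injectiveb g.
 apply/negP => /injectiveP inj; have : (size [seq g v | v <- enum 'rV[k]_e.+1] <= size (Fx e))%N.
  apply: uniq_leq_size; first by rewrite map_inj_uniq ?enum_uniq.
  by move=> _ /mapP[v _ ->]; rewrite mF fr_pev; move: ea; rewrite iter_frP => -[->].
 by rewrite size_map -cardE card_mx mul1n sF leq_exp2l ?card_gt1 // ltnn.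
exists (rVpoly v - rVpoly v'); split.
- by rewrite subr_eq0; apply: contraNneq nv => e'; rewrite -[v]rVpolyK e' rVpolyK.
- by rewrite size_polyD_leq // size_polyN !size_poly.
- by rewrite pevB -/(g v) ev subrr.
Qed.

Lemma local_form e a : has_period (@frP k L) e a -> exists p : {poly k},
 [/\ p \is monic, (size p <= e.+1)%N, evp e p a = 0 &
  forall d (c : {poly k}), (size c <= d.+1)%N -> c != 0 -> evp d c a = 0 ->
   (e <= d)%N /\ exists2 c', c = p * c' & (size c' <= (d - e).+1)%N].
move=> pa; have /has_periodP[e0 ea emin] := pa.
have ed d (c : {poly k}) : (size c <= d.+1)%N -> c != 0 -> evp d c a = 0 -> (e <= d)%N.
 move=> sc c0 ev; rewrite leqNgt; apply/negP => lt; case/eqP: c0.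
 apply: (evs_eq0 (j := j) (N := d) (cfg1 pa)) => //; first by rewrite /= addn0.
 by move=> b; rewrite inE => /eqP ->.
case: a pa ea emin ed => [z|] pa ea emin ed; last first.
 have e1 : e = 1%N by apply: (has_period_uniq pa); apply/has_periodP; split=> // i /andP[]; case: i.
 exists 1; rewrite e1 monic1 size_poly1 /= coef1 rmorph0; split=> // d c sc c0 ev.
 have dp := ed _ _ sc c0 ev; rewrite e1 in dp; split=> //; exists c; first by rewrite mul1r.
 rewrite subn1 prednK //; apply/(size_le_coef sc); apply/eqP; rewrite -(fmorph_eq0 j); apply/eqP; exact: ev.
have [p0 [p0n sp0 p0z]] := vanishing_poly pa.
have [p mp] : exists p, is_minpoly j z p.
 by apply: minpoly_ex; exists p0 => //; apply/eqP; apply: p0z.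
have [monp sp dv] := mp; have pz : pev j z p = 0 := minpoly_root mp.
have spe : size p = e.+1.
 apply/eqP; rewrite eqn_leq; apply/andP; split.
  by apply: leq_trans sp0; apply: dvdp_leq => //; apply/dv.
 have := ed (size p).-1 p; rewrite prednK ?(ltnW sp) // leqnn => /(_ isT (monic_neq0 monp) pz).
 by move: sp; case: (size p).
exists p; rewrite spe; split=> // d c sc c0 ev; have dp := ed _ _ sc c0 ev; split=> //.
have /dvdpP[c' ec] : p %| c by apply/dv.
exists c'; first by rewrite mulrC.
have c'0 : c' != 0 by apply: contraNneq c0 => c'0; rewrite ec c'0 mul0r.
by move: sc; rewrite ec size_mul ?(monic_neq0 monp) // spe; move: (size c') dp => x; lia.
Qed.

Lemma nform_nil d : nform d [::] = (\sum_(i < d.+1) q ^ i)%N.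
have card_lt i : (i <= d)%N -> #|[pred c : 'rV[k]_d.+1 | (size (rVpoly c) == i.+1) && (rVpoly c \is monic)]| = (q ^ i)%N.
 move=> id; pose F (v : 'rV[k]_i) : 'rV[k]_d.+1 := poly_rV ('X^i + rVpoly v).
 have sX (v : 'rV[k]_i) : size ('X^i + rVpoly v) = i.+1 by rewrite size_polyDl size_polyXn // ltnS size_poly.
 have FE v : rVpoly (F v) = 'X^i + rVpoly v by rewrite poly_rV_K // sX.
 rewrite -[RHS](_ : #|codom F| = _); last first.
  rewrite card_codom ?card_mx ?mul1n // => v v' e; rewrite -[v]rVpolyK -[v']rVpolyK; congr poly_rV.
  by apply: (addrI 'X^i); rewrite -!FE e.
 apply: eq_card => c; rewrite inE; apply/andP/codomP => [[/eqP sc mc]|[v ->]]; last first.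
  rewrite FE sX; split=> //; rewrite monicE lead_coefDl ?lead_coefXn // size_polyXn ltnS size_poly //.
 have sr : (size (rVpoly c - 'X^i)%R <= i)%N.
  apply/(size_le_coef (n := i)).
   by rewrite size_polyD_leq // size_polyN size_polyXn sc leqnn.
  by rewrite coefB coefXn eqxx; move: mc; rewrite monicE lead_coefE sc => /eqP ->; rewrite subrr.
 by exists (poly_rV (rVpoly c - 'X^i)); rewrite /F poly_rV_K // addrC subrK rVpolyK.
rewrite -sum1_card (partition_big (fun c : 'rV[k]_d.+1 => inord (size (rVpoly c)).-1 : 'I_d.+1) predT) //=.
apply: eq_bigr => i _; have id : (i <= d)%N by rewrite -ltnS.
rewrite sum1_card -(card_lt i id); apply: eq_card => c; rewrite [RHS]inE.
rewrite -[LHS]/((rVpoly c \is monic) && true && (inord (size (rVpoly c)).-1 == i)) andbT andbC.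
case mc : (rVpoly c \is monic); rewrite ?andbF // !andbT -(inj_eq val_inj) /=.
have s0 : (0 < size (rVpoly c))%N by rewrite size_poly_gt0 monic_neq0.
by rewrite inordK ?prednK ?size_poly //; case: (size _) s0.
Qed.

(** A form vanishing at a is the prime form of a times a form of degree d - e, and the prime form
    does not vanish on t. *)
Lemma nform_cons d e (ds : seq nat) a t : a :: t \in cfg (e :: ds) ->
 (nform d (a :: t) + (if e <= d then nform (d - e) t else 0))%N = nform d t.
rewrite mem_cfg_cons => /and3P[aE ind tc]; have pa : has_period (@frP k L) e a by rewrite -(mem_P1_pts j).
have [p [mp sp pa0 dv]] := local_form pa; have p0 := monic_neq0 mp.
rewrite -(cardID [pred c : 'rV[k]_d.+1 | evp d (rVpoly c) a != 0] (@coprime_form k L j d t)).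
rewrite [X in _ = (_ + X)%N](_ : _ = if (e <= d)%N then nform (d - e) t else 0%N).
 congr (_ + _)%N; apply: eq_card => c.
 rewrite -[LHS]/((rVpoly c \is monic) && ((evp d (rVpoly c) a != 0) && all (fun b => evp d (rVpoly c) b != 0) t)).
 rewrite -[RHS]/(((rVpoly c \is monic) && all (fun b => evp d (rVpoly c) b != 0) t) && (evp d (rVpoly c) a != 0)).
 by rewrite -andbA [X in _ && X]andbC.
have pb b : b \in t -> evp e p b != 0.
 move=> bt; apply/negP => /eqP e0; case/eqP: p0.
 have [e' pb] : exists e', has_period (@frP k L) e' b.
  by apply: (cfg_period (E := @P1_pts k L)) tc bt => n x; rewrite (mem_P1_pts j).
 apply: (evs_eq0 (j := j) (N := e) (t := [:: a; b]) (ds := [:: e; e'])) => //.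
 - by rewrite !mem_cfg_cons aE (mem_P1_pts j) pb /indep /= andbT (allP ind _ bt).
 - by rewrite /= addn0 -addn1 leq_add2l; case/has_periodP: pb.
 - by move=> b'; rewrite !inE => /orP[] /eqP ->.
case: leqP => [le|lt]; last first.
 apply/eqP; rewrite -leqn0 leqNgt; apply/negP => /card_gt0P[c]; rewrite !inE negbK => /and3P[/eqP ev mc _].
 have [] := dv d (rVpoly c) (size_poly _ _) (monic_neq0 mc) ev; move: lt; clear; lia.
have sm (c : 'rV[k]_(d - e).+1) : (size (p * rVpoly c)%R <= d.+1)%N.
 rewrite (leq_trans (size_polyMleq _ _)) //.
 by have : (size (rVpoly c) <= (d - e).+1)%N := size_poly _ _; move: (size (rVpoly c)) (size p) sp le => x y; clear; lia.
pose F (c : 'rV[k]_(d - e).+1) : 'rV[k]_d.+1 := poly_rV (p * rVpoly c).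
have FE c : rVpoly (F c) = p * rVpoly c by rewrite poly_rV_K.
have F_inj : injective F.
 move=> c c' ec; rewrite -[c]rVpolyK -[c']rVpolyK; congr poly_rV; apply: (mulfI p0).
 by rewrite -!FE ec.
clearbody F; rewrite -(fintype.card_image F_inj); apply: eq_card => c.
rewrite -[LHS]/(~~ (evp d (rVpoly c) a != 0) && ((rVpoly c \is monic) && all (fun b => evp d (rVpoly c) b != 0) t)) negbK.
have evF b (c' : {poly k}) : (size c' <= (d - e).+1)%N -> evp d (p * c') b = evp e p b * evp (d - e) c' b.
 by move=> sc'; rewrite -evpM // subnKC.
have allF (c' : {poly k}) : (size c' <= (d - e).+1)%N ->
  all (fun b => evp d (p * c') b != 0) t = all (fun b => evp (d - e) c' b != 0) t.
 by move=> sc'; apply: eq_in_all => b bt; rewrite evF // mulf_eq0 (negPf (pb b bt)).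
apply/and3P/fintype.imageP => [[/eqP ev mc cop]|[c' + ->]]; last first.
 rewrite unfold_in => /andP[mc' cop']; rewrite FE evF ?size_poly // pa0 mul0r eqxx allF ?size_poly //; split=> //.
 by rewrite monicMl.
have [_ [c' ec sc']] := dv d (rVpoly c) (size_poly _ _) (monic_neq0 mc) ev.
exists (poly_rV c'); last by rewrite -[LHS]rVpolyK -[RHS]rVpolyK FE poly_rV_K // ec.
rewrite unfold_in /coprime_form poly_rV_K // -allF // -ec cop andbT.
by rewrite -(monicMl _ mp) -ec.
Qed.
End FormCount.

(** * The extension of k of degree r inside L *)

Section FixedField.
Variables (k : finFieldType) (L : closedFieldType) (j : {rmorphism k -> L}) (r : nat) (r0 : (0 < r)%N).
Notation q := #|k|.
Notation fr := (@fr k L).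

Definition fixed_by : {pred L} := [pred z | fr r z == z].

Fact fixed_by_divring : divring_closed fixed_by.
split=> [|x y|x y]; rewrite !inE; first by rewrite fr1.
 by move=> /eqP ex /eqP ey; rewrite (frB j) ex ey.
by move=> /eqP ex /eqP ey; rewrite frM frV ex ey.
Qed.

HB.instance Definition _ := GRing.isDivringClosed.Build L fixed_by fixed_by_divring.

Definition fixed_field := {z : L | z \in fixed_by}.

HB.instance Definition _ := SubType.on fixed_field.
HB.instance Definition _ := [Choice of fixed_field by <:].
HB.instance Definition _ := [SubChoice_isSubIntegralDomain of fixed_field by <:].
HB.instance Definition _ := [SubIntegralDomain_isSubField of fixed_field by <:].

Definition fixed_field_enum : seq fixed_field := pmap insub (fixed_points k L r).

Fact fixed_field_enumP : Finite.axiom fixed_field_enum.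
have [uF _ mF] := fixed_pointsP j r0.
apply: Finite.uniq_enumP; first exact: pmap_sub_uniq.
by move=> z; rewrite mem_pmap_sub mF; have := valP z; rewrite inE.
Qed.

Fact fixed_field_pickleK : pcancel (fun z => index z fixed_field_enum) (nth None [seq Some z | z <- fixed_field_enum]).
move=> z; have zi : z \in fixed_field_enum by rewrite -has_pred1 has_count fixed_field_enumP.
by rewrite (nth_map z) ?index_mem // nth_index.
Qed.

HB.instance Definition _ := isCountable.Build fixed_field fixed_field_pickleK.
HB.instance Definition _ := isFinite.Build fixed_field fixed_field_enumP.

Lemma fixed_field_ex : exists (K : finFieldType) (jK : {rmorphism K -> L}) (i : {rmorphism k -> K}),
 #|K| = (q ^ r)%N /\ forall a, jK (i a) = j a.
have iP a : j a \in fixed_by by rewrite inE fr_j.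
pose i a : fixed_field := Sub (j a) (iP a).
have iB : zmod_morphism i by move=> a b; apply: val_inj; rewrite !SubK rmorphB.
have iM : monoid_morphism i.
 by split=> [|a b]; apply: val_inj; rewrite !SubK ?rmorph1 // rmorphM.
pose iA := GRing.isZmodMorphism.Build k fixed_field i iB.
pose iMM := GRing.isMonoidMorphism.Build k fixed_field i iM.
pose im : {rmorphism k -> fixed_field} := HB.pack i iA iMM.
exists (fixed_field : finFieldType), (val : {rmorphism fixed_field -> L}), im; split=> [|a] //.
have [uF sF mF] := fixed_pointsP j r0.
rewrite cardE enumT unlock /= size_pmap_sub -sF; apply/eqP; rewrite -all_count; apply/allP => z.
by rewrite mF inE.
Qed.
End FixedField.

(** * Smoothness of conics *)

Section ConicDiscriminant.
Variable k : fieldType.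
Implicit Types h f p b : {poly k}.

(* The discriminant of the ternary quadratic form y^2 + h y z - f z^2. *)
Definition conic_disc h f : k :=
 f`_2 * f`_0 *+ 4 - f`_1 * h`_0 * h`_1 - f`_1 ^+ 2 + f`_2 * h`_0 ^+ 2 + f`_0 * h`_1 ^+ 2.

Lemma polyE2 p : (size p <= 2)%N -> p = (p`_1)%:P * 'X + (p`_0)%:P.
move=> sp; apply/polyP => -[|[|i]]; rewrite coefD coefMX !coefC ?add0r ?addr0 //=.
by rewrite nth_default // (leq_trans sp).
Qed.

Lemma polyE3 p : (size p <= 3)%N -> p = (p`_2)%:P * 'X^2 + (p`_1)%:P * 'X + (p`_0)%:P.
move=> sp; apply/polyP => -[|[|[|i]]]; rewrite !coefD coefMXn coefMX !coefC ?add0r ?addr0 //=.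
by rewrite nth_default // (leq_trans sp).
Qed.

(** A polynomial in the coefficients stays nonzero after extension of the base field. Together with
    [smooth_conic] this makes smooth conics stay smooth, which [conic_trace] relies on. *)
Lemma conic_smooth h f : (size h <= 2)%N -> (size f <= 3)%N -> disc h f != 0 -> conic_disc h f != 0 -> smooth 1 h f.
move=> sh sf d0 c0; apply: smooth_intro => // [p sp b d1 d2|_ c sing]; case/eqP: c0; rewrite /conic_disc.
 have [b0 [h' [f' [eh ef sp2 sb [sh' sf']]]]] := @reduce_pair _ h f p b 1 sh sf d0 sp d1 d2.
 have s2 : size p = 2 by move: (size p) sp sp2 => [|[|[|x]]].
 rewrite s2 /= subnn muln0 in sb sh' sf'.
 have eh' : h = (h'`_0)%:P * p - (b0`_0)%:P *+ 2 by rewrite -!size1_polyC // mulrC -eh addrK.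
 have ef' : f = (f'`_0)%:P * p ^+ 2 + (h'`_0)%:P * (b0`_0)%:P * p - (b0`_0)%:P ^+ 2.
  rewrite -!size1_polyC //; transitivity (p ^+ 2 * f' + (p * h') * b0 - b0 ^+ 2); last by ring.
  by rewrite -eh -ef; ring.
 move: eh' ef'; have := polyE2 (eq_leq s2); move: p`_1 p`_0 h'`_0 f'`_0 b0`_0 => p1 p0 x y z -> -> ->.
 rewrite (_ : y%:P * (p1%:P * 'X + p0%:P) ^+ 2 + x%:P * z%:P * (p1%:P * 'X + p0%:P) - z%:P ^+ 2 =
   (y * p1 ^+ 2)%:P * 'X^2 + (y * p1 * p0 *+ 2 + x * z * p1)%:P * 'X + (y * p0 ^+ 2 + x * z * p0 - z ^+ 2)%:P); last first.
  by rewrite !(polyCD, polyCM, polyCN, polyCMn, polyC_exp); ring.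
 rewrite (_ : x%:P * (p1%:P * 'X + p0%:P) - z%:P *+ 2 = (x * p1)%:P * 'X + (x * p0 - z *+ 2)%:P); last first.
  by rewrite !(polyCD, polyCM, polyCN, polyCMn); ring.
 rewrite !coefD !coefMXn !coefMX !coefC /= !add0r !addr0; ring.
have /(inf_singular_coef _ sh sf) [e1 e2 e3] := sing.
have -> : f`_1 = h`_0 * c by apply/eqP; rewrite -subr_eq0; apply/eqP.
have -> : f`_2 = h`_1 * c + c ^+ 2 by apply/eqP; rewrite -subr_eq0; apply/eqP; rewrite -[RHS]e2; ring.
have -> : h`_1 = - (c *+ 2) by apply/eqP; rewrite -subr_eq0 opprK; apply/eqP.
ring.
Qed.

(** Vanishing of the determinant produces a singular point: a finite one if the coefficient D2 of
    x^2 in the discriminant is nonzero, one at infinity otherwise. *)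
Lemma smooth_conic h f : smooth 1 h f -> disc h f != 0 -> conic_disc h f != 0.
move=> S d0; have sh := smooth_h S; have sf := smooth_f S; apply/eqP.
have eh := polyE2 sh; have ef := polyE3 sf.
rewrite /conic_disc; move: eh ef; set h1 := h`_1; set h0 := h`_0; set f2 := f`_2; set f1 := f`_1; set f0 := f`_0.
move=> eh ef c0; pose D2 := h1 ^+ 2 + f2 *+ 4.
have [D20|D20] := eqVneq D2 0; last first.
 (* z and b solve the two linear equations, of determinant D2, saying that both partial derivatives
    vanish at (z, b). *)
 pose z := - (h0 * h1 + f1 *+ 2) / D2; pose b := (h1 * f1 - f2 * h0 *+ 2) / D2.
 have zD : z * D2 = - (h0 * h1 + f1 *+ 2) by rewrite divfK.
 have bD : b * D2 = h1 * f1 - f2 * h0 *+ 2 by rewrite divfK.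
 have e1 : h0 = - (h1 * z) - b *+ 2.
  apply: (mulIf D20); transitivity (- (h1 * (z * D2)) - (b * D2) *+ 2); last by ring.
  by rewrite zD bD /D2; ring.
 have e2 : f1 = h1 * b - (f2 * z) *+ 2.
  apply: (mulIf D20); transitivity (h1 * (b * D2) - (f2 * (z * D2)) *+ 2); last by ring.
  by rewrite zD bD /D2; ring.
 clearbody z b.
 have e3 : f0 = h0 * b + b ^+ 2 + f2 * z ^+ 2.
  apply: (mulfI D20); rewrite /D2; apply/eqP; rewrite -subr_eq0 -[X in _ == X]c0 e1 e2; apply/eqP.
  ring.
 have s2 : (1 < size ('X - z%:P)%R)%N by rewrite size_XsubC.
 apply: (smooth_fin S s2 (b := b%:P)).
  suff -> : h + b%:P *+ 2 = h1%:P * ('X - z%:P) by exact: dvdp_mull.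
  by rewrite eh e1 !(polyCD, polyCM, polyCN, polyCMn); ring.
 suff -> : f - h * b%:P - b%:P ^+ 2 = f2%:P * ('X - z%:P) ^+ 2 by exact: dvdp_mull.
 by rewrite ef eh e3 e2 e1 !(polyCD, polyCM, polyCN, polyCMn, polyC_exp); ring.
have [t0|t0] := eqVneq (2%:R : k) 0.
 have t4 : (4%:R : k) = 0 by rewrite (natrM _ 2 2) t0 mul0r.
 have h10 : h1 = 0.
  have : h1 ^+ 2 = 0 by rewrite -[RHS]D20 /D2 -mulr_natr t4 mulr0 addr0.
  by move/eqP; rewrite sqrf_eq0 => /eqP.
 have h0n : h0 != 0.
  apply: contraNneq d0 => h00; rewrite /disc -scaler_nat t4 scale0r addr0.
  by rewrite eh h10 h00 mul0r addr0 expr0n.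
 apply: (smooth_ninf (c := f1 / h0) S); apply/(inf_singular_coef _ sh sf); rewrite -/h1 -/h0 -/f1 -/f2 h10; split.
 - by rewrite add0r -mulr_natr t0 mulr0.
 - have e : f2 * h0 ^+ 2 - f1 ^+ 2 = 0 by rewrite -[RHS]c0 h10 -mulr_natr t4; ring.
  by rewrite mul0r subr0; apply: (mulIf (expf_neq0 2 h0n)); rewrite mul0r mulrBl -exprMn divfK.
 - by field; exact: h0n.
have t4 : (4%:R : k) != 0 by rewrite (natrM _ 2 2) mulf_neq0.
have ef2 : f2 = - (h1 ^+ 2) / 4%:R.
 by apply: (mulIf t4); rewrite mulfVK // mulr_natr; apply/eqP; rewrite -addr_eq0 addrC; apply/eqP.
have ef1 : f1 = - (h1 * h0) / 2%:R.
 have : (h1 * h0 + f1 *+ 2) ^+ 2 = 0.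
  transitivity (D2 * (h0 ^+ 2 + f0 *+ 4) - (f2 * f0 *+ 4 - f1 * h0 * h1 - f1 ^+ 2 + f2 * h0 ^+ 2 + f0 * h1 ^+ 2) *+ 4).
   by rewrite /D2; ring.
  by rewrite D20 c0 mul0r mul0rn subr0.
 move/eqP; rewrite sqrf_eq0 addrC addr_eq0 => /eqP e; apply: (mulIf t0).
 by rewrite mulfVK // mulr_natr.
apply: (smooth_ninf (c := - h1 / 2%:R) S); apply/(inf_singular_coef _ sh sf); rewrite -/h1 -/h0 -/f1 -/f2; split.
- by field; exact: t0.
- by rewrite ef2; field; rewrite ?t4 ?t0.
- by rewrite ef1; field; exact: t0.
Qed.
End ConicDiscriminant.

(** * Sums over smooth pairs and over point configurations *)

Section SmoothSums.
Variables (k : finFieldType) (L : closedFieldType) (j : {rmorphism k -> L}).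
Notation q := #|k|.
Notation cfg := (cfg (@frP k L) (@P1_pts k L)).
Notation qr := (q%:R : rat).
Notation pts := (P1_pts k L).

Definition point_sum G (u : pair_poly k G) l : rat :=
 cfg_sum (@frP k L) pts (tau j G (hpoly u) (fpoly u)) l.

Lemma point_sum_mul G (u : pair_poly k G) d e l : (0 < e)%N -> all (fun x => 0 < x.2)%N l ->
 (\sum_(a <- pts d) tau j G (hpoly u) (fpoly u) d a ^+ e) * point_sum u l =
 point_sum u ((d, e) :: l) + \sum_(l' <- bump d e l) point_sum u l' *+ d.
apply: cfg_sum_mul; [exact: frP_inj|exact: P1_pts_uniq| | | |].
- by move=> n x; rewrite (mem_P1_pts j).
- exact: P1_pts_fr.
- by move=> n a; apply: tau_fr.
- by move=> n a; apply: tau3.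
Qed.

Lemma point_sum_nil G (u : pair_poly k G) : point_sum u [::] = 1.
Proof. by rewrite /point_sum /cfg_sum big_seq1 /weight big_nil. Qed.

Lemma point_sum1 G (u : pair_poly k G) d e : (0 < e)%N ->
 point_sum u [:: (d, e)] = \sum_(a <- pts d) tau j G (hpoly u) (fpoly u) d a ^+ e.
Proof. by move=> e0; have := @point_sum_mul G u d e [::] e0 isT; rewrite point_sum_nil mulr1 big_nil addr0. Qed.

Definition family_sum G l : rat := \sum_(u : pair_poly k G | smooth_pair u) point_sum u l.

Lemma family_sumE G l : family_sum G l = \sum_(t <- cfg (unzip1 l)) smooth_sum j G t l.
Proof. exact: exchange_big. Qed.

Fixpoint form_count (ds : seq nat) (d : nat) : rat :=
 if ds is e :: ds' then form_count ds' d - (if (e <= d)%N then form_count ds' (d - e) else 0)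
 else \sum_(i < d.+1) qr ^+ i.

Lemma nform_count d ds t : t \in cfg ds -> #|@coprime_form k L j d t|%:R = form_count ds d.
elim: ds t d => [|e ds IH] t d.
 by rewrite inE => /eqP ->; rewrite nform_nil natr_sum; apply: eq_bigr => i _; rewrite natrX.
case: t => [|a t tc]; first by case/flattenP => _ /mapP[? _ ->] /mapP[].
have tc' : t \in cfg ds by move: tc; rewrite mem_cfg_cons => /and3P[].
have /(congr1 (fun n => n%:R : rat)) := nform_cons j d tc; rewrite /= natrD (IH t d tc') => <-.
by case: ifP => _; rewrite ?(IH t _ tc') addrK.
Qed.

Definition family_pair_sum G l : rat := \sum_(t <- cfg (unzip1 l)) pair_sum j G t l.

Lemma family_sieve G l : all (fun x => 0 < x.2)%N l ->
 family_pair_sum G l = \sum_(d < G.+1) qr ^+ d * form_count (unzip1 l) d * family_sum (G - d) l.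
move=> al; rewrite /family_pair_sum.
under [RHS]eq_bigr do rewrite family_sumE mulr_sumr.
rewrite [RHS]exchange_big /=; apply: eq_big_seq => t tc; rewrite pair_sum_sieve //.
by apply: eq_bigr => d _; rewrite (nform_count _ tc).
Qed.

Lemma family_pair_sum_const G l c : (forall t, t \in cfg (unzip1 l) -> pair_sum j G t l = c) ->
 family_pair_sum G l = (size (cfg (unzip1 l)))%:R * c.
by move=> H; rewrite /family_pair_sum (eq_big_seq _ H) big_const_seq count_predT iter_addr_0 mulr_natl.
Qed.

Lemma size_cfg_consr d ds : (size (cfg (d :: ds)))%:R =
 (size (cfg ds))%:R * ((size (pts d))%:R - (d * count_mem d ds)%:R) :> rat.
have per n x : x \in pts n -> has_period (@frP k L) n x by rewrite (mem_P1_pts j).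
have := size_cfg_cons (frP_inj j) (P1_pts_uniq j) per (P1_pts_fr j) d ds.
by move/(congr1 (intr : int -> rat)); rewrite rmorphM rmorphB /=.
Qed.

Lemma card_P1_1 : size (pts 1) = q.+1.
Proof. by have := sum_P1_pts j (isT : 0 < 1)%N; rewrite big_seq1 expn1. Qed.
End SmoothSums.

(** * Traces of smooth conics over k *)

Section ConicTrace.
Variables (k : finFieldType) (L : closedFieldType) (j : {rmorphism k -> L}).
Notation q := #|k|.
Notation qr := (q%:R : rat).

Lemma size_cfg1 : (size (cfg (@frP k L) (P1_pts k L) [:: 1%N]))%:R = qr + 1 /\
 (size (cfg (@frP k L) (P1_pts k L) [:: 1%N; 1%N]))%:R = (qr + 1) * qr.
rewrite !(size_cfg_consr j) (card_P1_1 j) /= addn0 muln0 muln1 subr0 mul1r -natr1.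
by split=> //; congr (_ * _); rewrite addrK.
Qed.

(* Over all smooth conics the squares of the traces add up to zero. *)
Lemma conic_trace1 (u : pair_poly k 1) : smooth_pair u -> point_sum j u [:: (1%N, 1%N)] = 0.
move=> Su; have x0 := qr_neq0 k.
pose l2 := [:: (1%N, 1%N); (1%N, 1%N)]; pose l1 := [:: (1%N, 2%N)].
have [s1 s2] := size_cfg1.
have lev0 l : ~~ odd (total_weight l) -> family_pair_sum j 0 l = (size (cfg (@frP k L) (P1_pts k L) (unzip1 l)))%:R * (qr ^+ 2 - qr).
 move=> ev; apply: family_pair_sum_const => t tc; rewrite (pair_sum_level0 j tc ev) pair_sum_nil muln0.
 by case: ifP => _; rewrite expr1.
have A0 := family_sieve j 0 (isT : all (fun x => 0 < x.2)%N l2).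
have A1 := family_sieve j 1 (isT : all (fun x => 0 < x.2)%N l2).
have B0 := family_sieve j 0 (isT : all (fun x => 0 < x.2)%N l1).
have B1 := family_sieve j 1 (isT : all (fun x => 0 < x.2)%N l1).
rewrite lev0 // s2 in A0; rewrite lev0 // s1 in B0.
rewrite (family_pair_sum_const (c := 0)) in A1; last by move=> t tc; apply: (pair_sum_odd j tc).
rewrite (family_pair_sum_const (c := qr ^+ 4 * (qr - 1))) in B1; last first.
 move=> t tc; apply: (mulfI x0); have := @pair_sum_even _ _ j 1 t l1 tc isT isT isT.
 by rewrite orbT /= expr1 => -> //; rewrite big_seq1 expr1 !exprS expr0; ring.
rewrite mulr0 in A1; rewrite s1 in B1; rewrite !big_ord_recl big_ord0 /= !big_ord_recl !big_ord0 /= in A0 A1 B0 B1.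
have sq (v : pair_poly k 1) : point_sum j v [:: (1%N, 1%N)] ^+ 2 = point_sum j v l2 + point_sum j v l1.
 have := point_sum_mul j v 1 (e := 1) (l := [:: (1%N, 1%N)]) isT isT.
 by rewrite -point_sum1 // -expr2 => ->; rewrite /= big_seq1.
(* The sieve at levels 0 and 1 evaluates the sums for l2 and l1, which turn out to be opposite. The
   squares being non-negative, each of them is 0. *)
have tot : \sum_(v : pair_poly k 1 | smooth_pair v) point_sum j v [:: (1%N, 1%N)] ^+ 2 = 0.
 under eq_bigr do rewrite sq; rewrite big_split /= -!/(family_sum j 1 _).
 move: A0 A1 B0 B1; rewrite -!/l2 -!/l1.
 move: (family_sum j 1 l2) (family_sum j 0 l2) (family_sum j 1 l1) (family_sum j 0 l1) => a1 a0 b1 b0.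
 rewrite /fintype.bump /= !expr0 ?expr1 => A0 A1 B0 B1.
 move: qr A0 A1 B0 B1 {x0 s1 s2 lev0} => x A0 A1 B0 B1.
 have ea0 : a0 = (x + 1) * x * (x ^+ 2 - x) by rewrite A0; ring.
 have eb0 : b0 = (x + 1) * (x ^+ 2 - x) by rewrite B0; ring.
 have ea1 : a1 = - (x * (x - 1) * a0) by apply/eqP; rewrite -addr_eq0 [X in _ == X]A1; apply/eqP; ring.
 have eb1 : b1 = (x + 1) * (x ^+ 4 * (x - 1)) - x * x * b0 by rewrite B1; ring.
 by rewrite ea1 eb1 ea0 eb0; ring.
apply/eqP; rewrite -sqrf_eq0; apply/eqP.
have ge (v : pair_poly k 1) : smooth_pair v -> 0 <= point_sum j v [:: (1%N, 1%N)] ^+ 2 by rewrite sqr_ge0.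
by have := psumr_eq0P ge tot; apply.
Qed.

Lemma P1_pts_flatten r : (0 < r)%N -> uniq (flatten [seq P1_pts k L d | d <- divisors r]) /\
 forall a, (a \in flatten [seq P1_pts k L d | d <- divisors r]) = (iter r (@frP k L) a == a).
move=> r0; split=> [|a].
 have := divisors_uniq r; elim: (divisors r) => [//|d ds IH] /= /andP[nd /IH u].
 rewrite cat_uniq (P1_pts_uniq j) u andbT /=; apply/hasPn => a /flattenP[_ /mapP[e ee ->]].
 rewrite (mem_P1_pts j) => ae; apply/negP; rewrite (mem_P1_pts j) => /has_period_uniq/(_ ae) ed.
 by rewrite ed ee in nd.
apply/flattenP/eqP => [[_ /mapP[d dr ->]]|e].
 by rewrite (mem_P1_pts j) => pa; rewrite -dvdn_divisors // in dr; apply/(has_period_dvd r pa).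
have [d pd] := has_period_ex r0 e.
exists (P1_pts k L d); last by rewrite (mem_P1_pts j).
by apply/map_f; rewrite -dvdn_divisors //; apply/(has_period_dvd r pd).
Qed.
End ConicTrace.

(** * Traces of conics over extensions of k *)

Section BaseChange.
Variables (k : finFieldType) (L : closedFieldType) (j : {rmorphism k -> L}).
Notation q := #|k|.
Notation frk := (@fr k L).

(** The Frobenius of degree r is the (r / e)-th power of that of degree e, so two exchanged roots
    remain exchanged exactly when r / e is odd. *)
Lemma tau_base_change (K : finFieldType) (jK : {rmorphism K -> L}) (i : {rmorphism k -> K}) r G (h f : {poly k}) e a :
 #|K| = (q ^ r)%N -> (forall b, jK (i b) = j b) -> (0 < r)%N -> (e %| r)%N -> has_period (@frP k L) e a ->
 tau jK G (map_poly i h) (map_poly i f) 1 a = tau j G h f e a ^+ (r %/ e).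
move=> cK ji r0 er pa; have /has_periodP[e0 ea _] := pa.
have frK z : @fr K L 1 z = frk r z by rewrite /fr cK expn1.
have m0 : (0 < r %/ e)%N by rewrite divn_gt0 // dvdn_leq.
have ra : iter r (@frP k L) a = a by apply/(has_period_dvd r pa).
have pK : has_period (@frP K L) 1 a.
 apply/has_periodP; split=> //; last by move=> [|n].
 by move: ra; rewrite iter_frP /=; case: (a) => [z|] //= [e1]; rewrite frK e1.
have ev N (p : {poly k}) : evp jK N (map_poly i p) a = evp j N p a.
 case: (a) => [z|] /=; last by rewrite coef_map ji.
 by rewrite /pev -map_poly_comp; congr (_.[z]); apply: eq_map_poly.
have [y ey] := quad_root (evp j G h a) (evp j (2 * G) f a).
have eyK : y ^+ 2 + evp jK G (map_poly i h) a * y = evp jK (2 * G) (map_poly i f) a by rewrite !ev.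
rewrite (tauE pK eyK) (tauE pa ey) !ev frK; set H := evp j G h a in ey *.
case: ifPn => [_|y0]; first by rewrite expr0n gtn_eqF.
have eH : frk e H = H by rewrite fr_evp ea.
have swap z : z ^+ 2 + H * z = evp j (2 * G) f a -> z = y \/ z = - H - y.
 rewrite -ey => e1; have : (z - y) * (z - (- H - y)) = 0.
  by transitivity (z ^+ 2 + H * z - (y ^+ 2 + H * y)); [ring|rewrite e1 subrr].
 by move/eqP; rewrite mulf_eq0 !subr_eq0 => /orP[] /eqP; [left|right].
have eF : frk e (evp j (2 * G) f a) = evp j (2 * G) f a by rewrite fr_evp ea.
have ney : - H - y != y.
 by apply: contraNneq y0 => e'; rewrite mulr2n -{1}e'; apply/eqP; ring.
have iterE m : frk (m * e) y = if (frk e y == y) || ~~ odd m then y else - H - y.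
 elim: m => [|m IH]; first by rewrite mul0n fr_id orbT.
 rewrite mulSn fr_add IH /= negbK.
 have [fy|fy] : frk e y = y \/ frk e y = - H - y.
 - by apply: swap; rewrite -[in RHS]eF -ey (frD j) frX frM eH.
 - by rewrite fy eqxx /= fy.
 rewrite fy (negPf ney) /=; case: (odd m) => //=.
 by rewrite (frB j) (frN j) eH fy opprB addrC subrK.
rewrite -{1}(divnK er) iterE; case: (frk e y == y) => /=; first by rewrite eqxx expr1n.
by rewrite -signr_odd; case: (odd _); rewrite ?eqxx // (negPf ney).
Qed.

(** This is [conic_trace1] over the extension of degree r, with its rational points sorted by their
    degree e over k. *)
Lemma conic_trace r (u : pair_poly k 1) : smooth_pair u -> (0 < r)%N ->
 \sum_(e <- divisors r) \sum_(a <- P1_pts k L e) tau j 1 (hpoly u) (fpoly u) e a ^+ (r %/ e) = 0.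
move=> /andP[/asboolP S d0] r0; have [K [jK [i [cK ji]]]] := fixed_field_ex j r0.
set h := hpoly u in S d0 *; set f := fpoly u in S d0 *.
have sh : (size (map_poly i h) <= 2)%N by rewrite size_map_poly size_hpoly.
have sf : (size (map_poly i f) <= 3)%N by rewrite size_map_poly size_fpoly.
have d0K : disc (map_poly i h) (map_poly i f) != 0.
 by rewrite /disc -rmorphXn -rmorphMn -rmorphD map_poly_eq0.
have c0K : conic_disc (map_poly i h) (map_poly i f) != 0.
 have := smooth_conic S d0; rewrite -(fmorph_eq0 i); congr (_ != 0).
 by rewrite /conic_disc !coef_map !(rmorphD, rmorphB, rmorphN, rmorphM, rmorphMn, rmorphXn).
have [v [eh ef]] := pair_poly_ex sh sf.
have Sv : smooth_pair v by rewrite /smooth_pair eh ef d0K andbT; apply/asboolP; apply: conic_smooth.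
have [uO mO] := P1_pts_flatten j r0.
have := conic_trace1 jK Sv; rewrite point_sum1 // eh ef => T.
rewrite -[RHS]T (perm_big (flatten [seq P1_pts k L d | d <- divisors r])) /=; last first.
 apply: uniq_perm; rewrite ?(P1_pts_uniq jK) // => a; rewrite mO (mem_P1_pts jK).
 have frK z : @fr K L 1 z = frk r z by rewrite /fr cK expn1.
 apply/has_periodP/eqP => [[_ + _]|]; rewrite iter_frP /=; first by case: (a) => [z|] //= [e1]; rewrite -frK e1.
 move=> e; split=> //; last by case=> // n /andP[].
 by case: (a) e => [z|] //= [e]; rewrite frK e.
rewrite big_flatten big_map; apply: eq_big_seq => e; rewrite -dvdn_divisors // => er.
apply: eq_big_seq => a; rewrite (mem_P1_pts j) expr1 => pa.
by rewrite (tau_base_change 1 h f cK ji r0 er pa).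
Qed.

(* The traces of a smooth conic in terms of the numbers of unramified points. *)
Definition conic_rel (d : nat) : seq (nat * int) :=
 match d with 2 => [:: (1%N, -1)] | 4 => [:: (2, -1); (1%N, -1)] | 6 => [:: (3, -1)] | _ => [::] end.

(** [conic_trace] for r = d gives the relation, its terms reduced modulo tau^3 = tau; for d = 3 and
    5 that of r = 1 is subtracted, for d = 6 that of r = 2. *)
Lemma conic_relP d (u : pair_poly k 1) : smooth_pair u -> (0 < d <= 6)%N ->
 point_sum j u [:: (d, 1%N)] = \sum_(x <- conic_rel d) x.2%:~R * point_sum j u [:: (x.1, 2)].
move=> Su; have red e n : (0 < n)%N -> \sum_(a <- P1_pts k L e) tau j 1 (hpoly u) (fpoly u) e a ^+ n =
  point_sum j u [:: (e, if odd n then 1%N else 2)].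
 move=> n0; rewrite point_sum1; last by case: odd.
 by apply: eq_bigr => a _; apply: tau_parity => // ? ?; apply: tau3.
have T r : (0 < r)%N -> \sum_(e <- divisors r) point_sum j u [:: (e, if odd (r %/ e) then 1%N else 2)] = 0.
 move=> r0; rewrite -[RHS](conic_trace Su r0); apply: eq_big_seq => e; rewrite -dvdn_divisors // => er.
 have n0 : (0 < r %/ e)%N by rewrite divn_gt0 ?(dvdn_gt0 r0 er) // dvdn_leq.
 exact: (esym (red e _ n0)).
have T1 := T 1%N isT; have T2 := T 2 isT; have T3 := T 3 isT; have T4 := T 4 isT; have T5 := T 5 isT; have T6 := T 6 isT.
rewrite !big_cons !big_nil /= !addr0 in T1 T2 T3 T4 T5 T6.
rewrite T1 !add0r in T3 T5.
case: d => [|[|[|[|[|[|[|d]]]]]]] // _; rewrite /= ?big_cons ?big_nil ?addr0 //=.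
- by rewrite mulN1r; apply/eqP; rewrite -addr_eq0 addrC T2.
- by rewrite !mulN1r; apply/eqP; rewrite -subr_eq0 -[X in _ == X]T4; apply/eqP; ring.
- rewrite mulN1r; apply/eqP; rewrite -subr_eq0 -[X in _ == X]T6 -[X in _ == X]subr0 -[X in _ == _ - X]T2; apply/eqP; ring.
Qed.
End BaseChange.

(** * Points of the curve above points of P^1 *)

Section CurvePoints.
Variables (k : finFieldType) (L : closedFieldType) (j : {rmorphism k -> L}).
Notation q := #|k|.
Notation frk := (@fr k L).
Notation Fx := (fixed_points k L).
Notation evp := (evp j).
Notation pts := (P1_pts k L).

Definition frobC (x : option L * L) : option L * L := (@frP k L x.1, frk 1 x.2).

Lemma frC_inj : injective frobC.
Proof. by move=> [a b] [a' b'] [] /frP_inj -> // /(fr_inj j) ->. Qed.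

Lemma iter_frC n x : iter n frobC x = (iter n (@frP k L) x.1, frk n x.2).
elim: n => [|n IH]; first by rewrite fr_id; case: x.
by rewrite iterS IH /frobC /= -fr_add add1n.
Qed.

Section Counting.
Variables (G : nat) (h f : {poly k}).

Definition on_model (x : option L * L) : bool := x.2 ^+ 2 + evp G h x.1 * x.2 == evp (2 * G) f x.1.

(** A point of degree c lies above a point of degree c of P^1, or above one of degree c / 2 whose
    two preimages are exchanged by Frobenius. *)
Definition curve_pts (c : nat) : seq (option L * L) :=
 [seq (a, b) | a <- pts c, b <- [seq b <- Fx c | on_model (a, b)]] ++
 (if odd c then [::] else [seq (a, b) | a <- pts c./2, b <- [seq b <- Fx c | on_model (a, b) && (frk c./2 b != b)]]).

Lemma on_model_conj d a b : has_period (@frP k L) d a -> on_model (a, b) ->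
 frk d b = b \/ frk d b = - evp G h a - b.
move=> /has_periodP[d0 ea _] /eqP /= e.
have : (frk d b - b) * (frk d b - (- evp G h a - b)) = 0.
 transitivity (frk d b ^+ 2 + frk d (evp G h a) * frk d b - (b ^+ 2 + evp G h a * b)).
  by rewrite fr_evp ea; ring.
 by rewrite -frX -frM -(frD j) e fr_evp ea subrr.
by move/eqP; rewrite mulf_eq0 !subr_eq0 => /orP[] /eqP; [left|right].
Qed.

Lemma mem_curve_pts c x : (x \in curve_pts c) = has_period frobC c x && on_model x.
case: x => a b; rewrite mem_cat; apply/orP/andP => [[]|[pc oc]].
- move=> /allpairsPdep[a' [b' [+ + [-> ->]]]]; rewrite (mem_P1_pts j) mem_filter => pa /andP[oc bF].
 split=> //; have /has_periodP[c0 ea emin] := pa; have [_ _ mF] := fixed_pointsP j c0.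
 apply/has_periodP; split=> //; first by rewrite iter_frC /= ea; move: bF; rewrite mF => /eqP ->.
 by move=> e /emin ne; rewrite iter_frC => -[].
- case: ifP => // /negbT ec /allpairsPdep[a' [b' [+ + [-> ->]]]].
 rewrite (mem_P1_pts j) mem_filter => pa /andP[/andP[oc nb] bF].
 split=> //; have /has_periodP[c0 ea emin] := pa; have c20 : (0 < c)%N by case: (c) c0.
 have [_ _ mF] := fixed_pointsP j c20; have e2 : (c = c./2 * 2)%N by rewrite muln2 even_halfK.
 apply/has_periodP; split=> //.
  by rewrite iter_frC /= {1}e2 mulnC iter_periodM //; move: bF; rewrite mF => /eqP ->.
 move=> e /andP[e0 lte]; rewrite iter_frC => -[ea' eb].
 have /dvdnP[n en] := (has_period_dvd e pa).1 ea'.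
 have n1 : n = 1%N.
  have lt2 : (c./2 * n < c./2 * 2)%N by rewrite -e2 mulnC -en.
  by move: e0 lt2; rewrite en ltn_pmul2l // muln_gt0 => /andP[n0 _]; case: n n0 {en} => [|[|n]].
 by case/eqP: nb; rewrite -[in RHS]eb en n1 mul1n.
have /has_periodP[c0 ec _] := pc; rewrite iter_frC in ec; case: ec => /= ea eb.
have [_ _ mF] := fixed_pointsP j c0.
have bF : b \in [seq b <- Fx c | on_model (a, b)] by rewrite mem_filter mF eb eqxx andbT; exact: oc.
have [d pd] := has_period_ex c0 ea; have /has_periodP[d0 eda _] := pd.
have dc := (has_period_dvd c pd).1 ea.
have [fb|fb] := on_model_conj pd oc.
 left; apply/allpairsPdep; exists a, b; rewrite (mem_P1_pts j); split=> //.
 suff -> : c = d by [].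
 apply/eqP; rewrite eqn_dvd dc andbT; apply/(has_period_dvd d pc).
 by rewrite iter_frC /= eda fb.
have [nb|nb] := eqVneq (frk d b) b.
 left; apply/allpairsPdep; exists a, b; rewrite (mem_P1_pts j); split=> //.
 suff -> : c = d by [].
 apply/eqP; rewrite eqn_dvd dc andbT; apply/(has_period_dvd d pc).
 by rewrite iter_frC /= eda nb.
have f2 : frk (d + d) b = b by rewrite fr_add fb (frB j) (frN j) fr_evp eda fb opprB addrC subrK.
have c2 : (c %| d + d)%N by apply/(has_period_dvd _ pc); rewrite iter_frC /= iterD !eda f2.
have {c2} ec : c = (d + d)%N.
 have /dvdnP[n en] := dc; have n2 : n != 1%N.
  by apply: contraNneq nb => n1; move: eb; rewrite en n1 mul1n => ->.
 move: c2 c0; rewrite en addnn -mul2n dvdn_pmul2r //.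
 by case: n n2 {en} => [|[|[|n]]] // _ /(dvdn_leq (isT : 0 < 2)%N).
right; rewrite ec addnn odd_double doubleK; apply/allpairsPdep; exists a, b.
rewrite (mem_P1_pts j); split=> //; rewrite mem_filter -addnn -ec mF eb eqxx andbT nb andbT; exact: oc.
Qed.

Lemma allpairs_sep_uniq (s : seq (option L)) (P : option L -> L -> bool) c : uniq s -> (0 < c)%N ->
 uniq [seq (a, b) | a <- s, b <- [seq b <- Fx c | P a b]].
move=> us c0; have [uF _ _] := fixed_pointsP j c0.
apply: allpairs_uniq_dep => // [a _|[a b] [a' b'] _ _ [-> ->] //]; exact: filter_uniq.
Qed.

Lemma curve_pts0 : curve_pts 0 = [::].
rewrite /curve_pts /= (_ : pts 0 = [::]) //.
by apply/eqP; rewrite -size_eq0 -leqn0 leqNgt -has_predT; apply/hasPn => a; rewrite (mem_P1_pts j).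
Qed.

Lemma curve_pts_uniq c : uniq (curve_pts c).
have [->|c0] := posnP c; first by rewrite curve_pts0.
rewrite cat_uniq allpairs_sep_uniq ?(P1_pts_uniq j) //=; case: ifP => // /negbT ec.
rewrite allpairs_sep_uniq ?(P1_pts_uniq j) // andbT; apply/hasPn => -[a b].
move=> /allpairsPdep[a' [b' [+ + [-> ->]]]]; rewrite (mem_P1_pts j) => pa _.
apply/negP => /allpairsPdep[a2 [b2 [+ _ [e _]]]]; rewrite -e (mem_P1_pts j) => /(has_period_uniq pa) ee.
by move: c0; rewrite -{1}(even_halfK ec) -ee -addnn -{2}[c./2]addn0; move: ee; case: (c) => //= n; lia.
Qed.

Lemma curve_pts_frC c x : x \in curve_pts c -> frobC x \in curve_pts c.
rewrite !mem_curve_pts => /andP[/(has_period_iter frC_inj 1) -> /eqP e] /=.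
by apply/eqP; rewrite /= -!(fr_evp j _ _ 1) -e (frD j) frM frX.
Qed.

(** Above a point of degree c / 2 there are two exchanged preimages exactly when tau = -1, that is,
    tau^2 - tau of them in all cases. *)
Lemma size_curve_pts c : (0 < c)%N -> (size (curve_pts c))%:R =
 (size (pts c))%:R + \sum_(a <- pts c) tau j G h f c a
 + (if odd c then 0 else \sum_(a <- pts c./2) tau j G h f c./2 a ^+ 2 - \sum_(a <- pts c./2) tau j G h f c./2 a).
move=> c0; rewrite size_cat natrD; congr (_ + _).
 rewrite size_allpairs_dep sumnE big_map natr_sum -[size (pts c)]/(size (pts c)) -sum1_size natr_sum -big_split.
 by apply: eq_bigr => a _; rewrite size_filter /= /tau /tau_root addrC subrK.
case: ifP => // /negbT ec; rewrite size_allpairs_dep sumnE big_map natr_sum -sumrB.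
apply: eq_big_seq => a; rewrite (mem_P1_pts j) => pa; rewrite size_filter.
have [y ey] := quad_root (evp G h a) (evp (2 * G) f a); set H := evp G h a in ey *.
have [uF _ mF] := fixed_pointsP j c0; have /has_periodP[d0 ea _] := pa.
have oy : on_model (a, y) by apply/eqP.
have eH : frk c./2 H = H by rewrite fr_evp ea.
have roots b : on_model (a, b) = (b == y) || (b == - H - y).
 rewrite /on_model /= -/H -ey -subr_eq0.
 have -> : b ^+ 2 + H * b - (y ^+ 2 + H * y) = (b - y) * (b - (- H - y)) by ring.
 by rewrite mulf_eq0 !subr_eq0.
rewrite (tauE pa ey) -/H; have cc := on_model_conj pa oy; rewrite -/H in cc.
have [y0|y0] := eqVneq (y *+ 2 + H) 0.
 have yy : - H - y = y by apply: subr0_eq; rewrite -[RHS]oppr0 -y0; ring.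
 rewrite (eq_count (a2 := pred0)) ?count_pred0 ?expr0n ?subrr // => b; rewrite roots yy orbb /=.
 by case: eqP => // ->; case: cc => ->; rewrite ?yy eqxx.
have [fy|fy] := eqVneq (frk c./2 y) y.
 rewrite (eq_count (a2 := pred0)) ?count_pred0 ?expr1n ?subrr // => b; rewrite roots /=.
 by case: eqP => [->|_] /=; [by rewrite fy eqxx|case: eqP => [->|//]]; rewrite (frB j) (frN j) eH fy eqxx.
have fy' : frk c./2 y = - H - y by case: cc => // e; rewrite e eqxx in fy.
have ny : y != - H - y by rewrite -fy' eq_sym.
have fH : frk c./2 (- H - y) = y by rewrite (frB j) (frN j) eH fy' opprB addrC subrK.
have ec2 : c = (c./2 + c./2)%N by rewrite addnn even_halfK.
rewrite (eq_count (a2 := pred2 y (- H - y))) => [|b]; last first.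
 rewrite roots /=; case: eqP => [->|_] /=; first by rewrite fy.
 by case: eqP => // ->; rewrite fH ny.
rewrite count_pred2 // !mF {1 2}ec2 !fr_add fy' fH fy' !eqxx.
by rewrite sqrrN expr1n opprK -[(true + true)%N]/(1 + 1)%N natrD.
Qed.
End Counting.
End CurvePoints.

(** * Points of the function field as coordinates *)

Section ModelPoints.
Variables (k : finFieldType) (L : closedFieldType) (j : {rmorphism k -> L}) (jalg : forall z : L, algebraicOver j z).
Notation q := #|k|.
Notation frk := (@fr k L).
Notation evp := (evp j).
Variables (K : extension k) (x y : K) (G : nat) (h f : {poly k}) (M : model x y h f) (S : smooth G h f).

Let sh := smooth_h S.
Let sf := smooth_f S.
Let x0 : x != 0. Proof. exact: (model_x0 M). Qed.
Let Mi := model_inv M sh sf.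

Lemma point1 (p : K -> option L) : is_point j p -> p 1 = Some 1.
Proof. by case=> pC _ _ _ _; rewrite -(rmorph1 (emb K)) pC rmorph1. Qed.

(** A pole of y1 where x1 is finite is impossible: dividing the equation by y1^2 would give 1 = 0 at
    the point. *)
Lemma point_affine (p : K -> option L) (x1 y1 : K) (h1 f1 : {poly k}) al : is_point j p -> model x1 y1 h1 f1 -> p x1 = Some al ->
 exists be, p y1 = Some be /\ be ^+ 2 + pev j al h1 * be = pev j al f1.
move=> P M1 px; have [pC pD pM pV _] := P.
have ph := place_pev h1 P px; have pf := place_pev f1 P px.
case py: (p y1) => [be|].
 exists be; split=> //; have e := congr1 p (model_eq M1).
 rewrite pf expr2 (pD _ _ _ _ (pM _ _ _ _ py py) (pM _ _ _ _ ph py)) in e.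
 by case: e; rewrite -expr2.
have y10 : y1 != 0 by apply/eqP => y10; move: py; rewrite y10 -(rmorph0 (emb K)) pC.
have pi := pV _ py; have := pM _ _ _ _ pf (pM _ _ _ _ pi pi).
rewrite -(model_eq M1) mul0r mulr0.
have -> : (y1 ^+ 2 + pev (emb K) x1 h1 * y1) * (y1^-1 * y1^-1) = 1 + pev (emb K) x1 h1 * y1^-1 by field.
rewrite (pD _ _ _ _ (point1 P) (pM _ _ _ _ ph pi)) mulr0 addr0 => -[] /eqP.
by rewrite oner_eq0.
Qed.

Definition coordinates (p : K -> option L) : option L * L :=
 if p x is Some z then (Some z, odflt 0 (p y)) else (None, odflt 0 (p (y / x ^+ G))).

Lemma coordinates_fin p al : is_point j p -> p x = Some al ->
 exists2 be, p y = Some be & coordinates p = (Some al, be) /\ on_model j G h f (Some al, be).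
move=> P px; have [be [py e]] := point_affine P M px.
by exists be; rewrite // /coordinates px py; split=> //; apply/eqP.
Qed.

Lemma coordinates_inf p : is_point j p -> p x = None ->
 p x^-1 = Some 0 /\
 exists2 be, p (y / x ^+ G) = Some be & coordinates p = (None, be) /\ on_model j G h f (None, be).
move=> P px; have [_ _ _ pV _] := P; have pxi := pV _ px; split=> //.
have [be [py e]] := point_affine P Mi pxi; exists be; rewrite // /coordinates px py; split=> //.
apply/eqP; move: e; rewrite !/(pev _ _ _) -!(rmorph0 j) !horner_map /= !horner_coef0.
by rewrite !coef_rev_poly // !subn0.
Qed.

Lemma coordinates_on_curve p : is_point j p -> on_model j G h f (coordinates p).
move=> P; case px: (p x) => [al|]; first by have [be _ [-> ]] := coordinates_fin P px.
by have [_ [be _ [->]]] := coordinates_inf P px.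
Qed.

Lemma coordinates_inj p p' : is_point j p -> is_point j p' -> coordinates p = coordinates p' -> p = p'.
move=> P P'; case px: (p x) => [al|]; case px': (p' x) => [al'|].
- have [be py [-> oc]] := coordinates_fin P px; have [be' py' [-> _]] := coordinates_fin P' px' => -[ea eb].
 subst al' be'; have [pi mp] := minpoly_ex (jalg al); have [_ sp _] := mp.
 exact: (place_at_uniq M (eqP oc) mp (smooth_fin S sp)) P P' px py px' py'.
- by have [be _ [-> _]] := coordinates_fin P px; have [_ [be' _ [-> _]]] := coordinates_inf P' px'.
- by have [be _ [-> _]] := coordinates_fin P' px'; have [_ [be' _ [-> _]]] := coordinates_inf P px.
- have [pxi [be py [-> oc]]] := coordinates_inf P px; have [pxi' [be' py' [-> _]]] := coordinates_inf P' px' => -[eb].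
 subst be'; have e0 : be ^+ 2 + pev j 0 (rev_poly G h) * be = pev j 0 (rev_poly (2 * G) f).
  rewrite !/(pev _ _ _) -!(rmorph0 j) !horner_map /= !horner_coef0 !coef_rev_poly // !subn0.
  exact: (eqP oc).
 exact: (place_at_uniq Mi e0 (minpolyX j) (smooth_inf S)) P P' pxi py pxi' py'.
Qed.

Lemma coordinates_surj a b : on_model j G h f (a, b) -> exists p, is_point j p /\ coordinates p = (a, b).
case: a => [al|] oc.
 have [pi mp] := minpoly_ex (jalg al); have [_ sp _] := mp.
 have [p [P px py]] := place_at_ex M (eqP oc) mp (smooth_fin S sp).
 by exists p; rewrite /coordinates px py.
have e0 : b ^+ 2 + pev j 0 (rev_poly G h) * b = pev j 0 (rev_poly (2 * G) f).
 rewrite !/(pev _ _ _) -!(rmorph0 j) !horner_map /= !horner_coef0 !coef_rev_poly // !subn0.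
 exact: (eqP oc).
have [p [P px py]] := place_at_ex Mi e0 (minpolyX j) (smooth_inf S).
exists p; split=> //; rewrite /coordinates py; case pxx: (p x) => [c|//].
have [_ _ pM _ _] := P; have := pM _ _ _ _ pxx px; rewrite mulfV // (point1 P) mulr0 => -[] /eqP.
by rewrite oner_eq0.
Qed.

Lemma Frob_point (p : K -> option L) : is_point j p -> is_point j (Frob p).
move=> [pC pD pM pV [z pz]]; rewrite /Frob.
have frE a : a ^+ q = frk 1 a by rewrite /frk expn1.
split=> [a|z1 z2 a b|z1 z2 a b|z1|].
- by rewrite pC /= frE fr_j.
- case e1: (p z1) => [a'|] //= [<-]; case e2: (p z2) => [b'|] //= [<-].
 by rewrite (pD _ _ _ _ e1 e2) /= !frE (frD j).
- case e1: (p z1) => [a'|] //= [<-]; case e2: (p z2) => [b'|] //= [<-].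
 by rewrite (pM _ _ _ _ e1 e2) /= !frE frM.
- by case e1: (p z1) => [a'|] //= _; rewrite (pV _ e1) /= frE fr0.
- by exists z; rewrite pz.
Qed.

Lemma coordinates_Frob p : is_point j p -> coordinates (Frob p) = frobC k (coordinates p).
move=> P; rewrite /frobC /fr expn1; case px: (p x) => [al|].
 by have [be py [-> _]] := coordinates_fin P px; rewrite /coordinates /Frob px py /= /fr expn1.
by have [_ [be py [-> _]]] := coordinates_inf P px; rewrite /coordinates /Frob px py.
Qed.

Lemma card_fixed_tuples n (sigma : 'S_n) :
 (fixed_tuples j (K := K) sigma #= `I_(size (cfg (@frobC k L) (curve_pts j G h f) (cycle_type sigma))))%card.
apply: (@card_equivariant _ (@frobC k L) (@frC_inj k L j) (curve_pts j G h f) _ _ _ _ (is_point j (K := K)) (@Frob k L K) coordinates).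
- exact: curve_pts_uniq.
- by move=> d z; rewrite mem_curve_pts => /andP[].
- exact: curve_pts_frC.
- exact: coordinates_inj.
- exact: Frob_point.
- exact: coordinates_Frob.
- by move=> p d P pd; rewrite mem_curve_pts pd coordinates_on_curve.
- by move=> d [a b]; rewrite mem_curve_pts => /andP[_]; apply: coordinates_surj.
Qed.
End ModelPoints.

(* Polynomials with integer coefficients as lists, lowest degree first. *)
Definition zpoly := seq BinNums.Z.

Fixpoint padd (p r : zpoly) : zpoly :=
 match p, r with
 | [::], _ => r
 | _, [::] => p
 | a :: p', b :: r' => BinInt.Z.add a b :: padd p' r'
 end.

Definition pscale (c : BinNums.Z) (p : zpoly) : zpoly := map (BinInt.Z.mul c) p.

Definition psub (p r : zpoly) : zpoly := padd p (pscale (BinInt.Z.opp (BinInt.Z.of_nat 1)) r).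

Fixpoint pmul (p r : zpoly) : zpoly :=
 if p is a :: p' then padd (pscale a r) (BinNums.Z0 :: pmul p' r) else [::].

Definition pconst (n : nat) : zpoly := [:: BinInt.Z.of_nat n].
Definition pX (n : nat) : zpoly := ncons n BinNums.Z0 (pconst 1).
Definition psum (s : seq zpoly) : zpoly := foldr padd [::] s.
Definition pzero (p : zpoly) : bool := all (fun a => BinInt.Z.eqb a BinNums.Z0) p.

Definition zq (a : BinNums.Z) : rat := (int_of_Z a)%:~R.

(** The sums are computed with coefficients in binary integers so that the finite checks can be run
    by [vm_compute]; this map carries the results to rational polynomials. *)
Fixpoint to_poly (p : zpoly) : {poly rat} := if p is a :: p' then (zq a)%:P + 'X * to_poly p' else 0.

Lemma zqD a b : zq (BinInt.Z.add a b) = zq a + zq b.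
Proof. by rewrite /zq -intrD; congr (_%:~R); lia. Qed.

Lemma zqM a b : zq (BinInt.Z.mul a b) = zq a * zq b.
Proof. by rewrite /zq -intrM; congr (_%:~R); lia. Qed.

Lemma zq_nat n : zq (BinInt.Z.of_nat n) = n%:R.
Proof. by rewrite /zq [RHS]pmulrn; congr (_%:~R); lia. Qed.

Lemma zqN a : zq (BinInt.Z.opp a) = - zq a.
Proof. by rewrite /zq -mulrNz; congr (_%:~R); lia. Qed.

Lemma zq_eq0 a : (zq a == 0) = BinInt.Z.eqb a BinNums.Z0.
Proof. by rewrite /zq intr_eq0; apply/eqP/idP => H; lia. Qed.

Lemma to_polyD p r : to_poly (padd p r) = to_poly p + to_poly r.
elim: p r => [|a p IH] [|b r] /=; rewrite ?add0r ?addr0 // IH zqD polyCD; ring.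
Qed.

Lemma to_poly_scale c p : to_poly (pscale c p) = (zq c)%:P * to_poly p.
Proof. by elim: p => [|a p IH] /=; rewrite ?mulr0 // IH zqM polyCM; ring. Qed.

Lemma to_polyB p r : to_poly (psub p r) = to_poly p - to_poly r.
Proof. by rewrite to_polyD to_poly_scale zqN zq_nat polyCN polyC1 mulN1r. Qed.

Lemma to_polyM p r : to_poly (pmul p r) = to_poly p * to_poly r.
elim: p => [|a p IH] /=; first by rewrite mul0r.
by rewrite to_polyD to_poly_scale /= IH /zq /= polyC0; ring.
Qed.

Lemma to_poly_const n : to_poly (pconst n) = n%:R%:P.
Proof. by rewrite /= mulr0 addr0 zq_nat. Qed.

Lemma to_polyX n : to_poly (pX n) = 'X^n.
elim: n => [|n IH]; first by rewrite to_poly_const expr0.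
by rewrite /= -/(pX n) IH /zq /= polyC0 add0r exprS.
Qed.

Lemma to_poly_sum s : to_poly (psum s) = \sum_(p <- s) to_poly p.
Proof. by elim: s => [|p s IH] /=; rewrite ?big_nil // big_cons to_polyD IH. Qed.

Lemma to_poly_eq0 p : (to_poly p == 0) = pzero p.
elim: p => [|a p IH] /=; first by rewrite eqxx.
rewrite -IH -zq_eq0; apply/eqP/andP => [e|[/eqP -> /eqP ->]]; last by rewrite mulr0 addr0.
have a0 : zq a = 0 by have := congr1 (fun r : {poly rat} => r`_0) e; rewrite coefD coefXM coefC coef0 /= addr0.
split; first by rewrite a0.
by move: e; rewrite a0 polyC0 add0r => /eqP; rewrite mulf_eq0 polyX_eq0.
Qed.

Definition pval (x : rat) (p : zpoly) : rat := (to_poly p).[x].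

Lemma pvalD x p r : pval x (padd p r) = pval x p + pval x r. Proof. by rewrite /pval to_polyD hornerD. Qed.
Lemma pvalB x p r : pval x (psub p r) = pval x p - pval x r. Proof. by rewrite /pval to_polyB hornerD hornerN. Qed.
Lemma pvalM x p r : pval x (pmul p r) = pval x p * pval x r. Proof. by rewrite /pval to_polyM hornerM. Qed.
Lemma pval_const x n : pval x (pconst n) = n%:R. Proof. by rewrite /pval to_poly_const hornerC. Qed.
Lemma pvalX x n : pval x (pX n) = x ^+ n. Proof. by rewrite /pval to_polyX hornerXn. Qed.
Lemma pval0 x : pval x [::] = 0. Proof. by rewrite /pval horner0. Qed.
Lemma pval_sum x s : pval x (psum s) = \sum_(p <- s) pval x p.
Proof. by elim: s => [|p s IH] /=; rewrite ?big_nil ?pval0 // big_cons pvalD IH. Qed.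
Definition pvalE := (pvalD, pvalB, pvalM, pvalX, pval_const, pval0).

(** * The sums as explicit polynomials *)

Section CycleLists.
Local Open Scope nat_scope.

Definition cycles_list := seq (nat * nat).

(* The number of points of P^1 of exact degree d. *)
Definition P1_count (d : nat) : zpoly :=
 match d with
 | 1 => padd (pX 1) (pX 0) | 2 => psub (pX 2) (pX 1) | 3 => psub (pX 3) (pX 1) | 4 => psub (pX 4) (pX 2)
 | 5 => psub (pX 5) (pX 1) | 6 => padd (psub (pX 6) (pX 3)) (psub (pX 1) (pX 2)) | 7 => psub (pX 7) (pX 1) | _ => [::]
 end.

Fixpoint cfg_count (ds : seq nat) : zpoly :=
 if ds is d :: ds' then pmul (cfg_count ds') (psub (P1_count d) (pconst (d * count_mem d ds'))) else pconst 1.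

Fixpoint form_poly (ds : seq nat) (d : nat) : zpoly :=
 if ds is e :: ds' then psub (form_poly ds' d) (if (e <= d)%N then form_poly ds' (d - e) else [::])
 else psum [seq pX i | i <- iota 0 d.+1].

Definition odd_part (l : cycles_list) : nat := sumn [seq (if x.2 == 1%N then x.1 else 0%N) | x <- l].

Definition unram_poly (l : cycles_list) : zpoly :=
 pmul (cfg_count (unzip1 l)) (foldr pmul (pconst 1) [seq psub (pX x.1) (pconst 1) | x <- l]).

(** The value of [family_pair_sum] divided by q^(G + 1), with o true for odd q; under this
    normalisation the factor q^d of the sieve disappears. The branches are discriminant 0, constant
    pairs, squares (with the exceptional conics for even q), and first powers in total degree 2 G +
    2. *)
Definition pair_poly_sum (o : bool) (G : nat) (l : cycles_list) : zpoly :=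
 if l is [::] then psub (pX (2 * G).+1) (if o then pX 0 else pX G)
 else if G == 0%N then pmul (psub (pX 1) (pX 0)) (cfg_count (unzip1 l))
 else if all (fun x => x.2 == 2) l then
  if [&& ~~ o, G == 1%N & sumn (unzip1 l) == 3] then
   pmul (cfg_count (unzip1 l)) (pmul (pX 1) (psub (psub (pX 2) (pX 0))
    (pmul (pconst (count (fun x => x.1 == 1%N) l)) (psub (pX 1) (pX 0)))))
  else pmul (unram_poly l) (pX ((2 * G).+1 - sumn (unzip1 l)))
 else if all (fun x => x.2 == 1%N) l && (sumn (unzip1 l) == (2 * G).+2) then
  pmul (cfg_count (unzip1 l)) (psub (pX G.+1) (pX G))
 else [::].

Definition lin_comb := seq (zpoly * cycles_list).

Definition lc_scale (p : zpoly) (F : lin_comb) : lin_comb := [seq (pmul p x.1, x.2) | x <- F].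

Definition lc_mul (d e : nat) (F : lin_comb) : lin_comb :=
 flatten [seq (x.1, (d, e) :: x.2) :: [seq (pmul (pconst d) x.1, l') | l' <- bump d e x.2] | x <- F].

Definition pminus1 : zpoly := psub [::] (pconst 1).

(** On a smooth conic a first power of a trace is traded for squares by [conic_rel]. Each product is
    expanded over distinct orbits, and the coincidences listed by [bump] are subtracted; n bounds
    the recursion. *)
Fixpoint conic_reduce (n : nat) (l : cycles_list) : lin_comb :=
 match n, l with
 | n'.+1, (d, e) :: l0 =>
   (if e == 2 then lc_mul d 2 (conic_reduce n' l0)
    else flatten [seq lc_scale pminus1 (lc_mul x.1 2 (conic_reduce n' l0)) | x <- conic_rel d])
   ++ lc_scale (psub [::] (pconst d)) (flatten [seq conic_reduce n' l' | l' <- bump d e l0])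
 | _, _ => [:: (pconst 1, [::])]
 end.

(** After the reduction all exponents are 2, and each term is the sum over smooth conics given by
    the sieve: level 1 minus the conductors of degree 1 over level 0. *)
Definition conic_sum (o : bool) (l : cycles_list) : zpoly :=
 psum [seq pmul x.1 (psub (pair_poly_sum o 1 x.2) (pmul (form_poly (unzip1 x.2) 1) (pair_poly_sum o 0 x.2)))
    | x <- conic_reduce (size l) l].

(** In weight 6 an exponent 1 forces total degree at least 4, beyond the bound 2 G + 1 = 3 for
    conics, and total degree 2 G + 2 = 4 then has a square as well. So neither [pair_sum_odd] nor
    [pair_sum_top] applies. *)
Definition is_conic_case (G : nat) (l : cycles_list) : bool :=
 [&& G == 1%N, total_weight l == 6 & has (fun x => x.2 == 1%N) l].

(* The list s_n, ..., s_0 of normalised sums over the smooth pairs of levels n, ..., 0. *)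
Fixpoint smooth_table (o : bool) (l : cycles_list) (n : nat) : seq zpoly :=
 if n is m.+1 then
  let t := smooth_table o l m in
  (if is_conic_case n l then conic_sum o l
   else psub (pair_poly_sum o n l)
      (psum [seq pmul (form_poly (unzip1 l) x.1) x.2 | x <- zip (iota 1 n) t])) :: t
 else [:: pair_poly_sum o 0 l].

Definition smooth_poly (o : bool) (G : nat) (l : cycles_list) : zpoly :=
 if odd (total_weight l) then [::] else head [::] (smooth_table o l G).

(** The points of the curve are added one at a time: those of degree c are counted by
    [size_curve_pts], and the conjugates of the points already chosen are removed. *)
Fixpoint expand (cl : seq nat) : lin_comb :=
 if cl is c :: cl' then
  let F := expand cl' in
  lc_scale (psub (P1_count c) (pconst (c * count_mem c cl'))) F ++ lc_mul c 1 F
  ++ (if odd c then [::] else lc_mul c./2 2 F ++ lc_scale pminus1 (lc_mul c./2 1 F))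
 else [:: (pconst 1, [::])].

Definition count_poly (o : bool) (G : nat) (cl : seq nat) : zpoly :=
 psum [seq pmul x.1 (smooth_poly o G x.2) | x <- expand cl].

Fixpoint cycle_lists (n w : nat) : seq cycles_list :=
 if n is n'.+1 then [::] :: flatten [seq [seq (d, e) :: l | l <- cycle_lists n' (w - d * e)]
   | d <- iota 1 w, e <- [seq e <- [:: 1%N; 2] | (d * e <= w)%N]]
 else [:: [::]].

Definition valid_list (l : cycles_list) : bool := all (fun x => (0 < x.1)%N && ((x.2 == 1%N) || (x.2 == 2))) l.

Lemma mem_cycle_lists w l : valid_list l -> (total_weight l <= w)%N -> l \in cycle_lists w w.
suff H n : valid_list l -> (total_weight l <= w)%N -> (w <= n)%N -> l \in cycle_lists n w.
 by move=> v t; apply: H.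
elim: n l w => [|n IH] [|[d e] l] w //=; first by rewrite /total_weight /= => /andP[/andP[d0 /orP[] /eqP ->] _]; move=> H1 H2; lia.
move=> /andP[/andP[d0 e12] v]; rewrite /total_weight /= -/(total_weight l) => tw wn.
have de : (d * e <= w)%N by apply: leq_trans tw; apply: leq_addr.
rewrite inE; apply/orP; right; apply/flattenP; exists [seq (d, e) :: l | l <- cycle_lists n (w - d * e)].
 apply/allpairsPdep; exists d, e; split=> //; first by rewrite mem_iota d0; lia.
 by case/orP: e12 de => /eqP -> /= ->; [|case: ifP => _]; rewrite !inE ?eqxx ?orbT.
by apply: map_f; apply: IH => //; lia.
Qed.

End CycleLists.
Arguments padd : simpl never.
Arguments pmul : simpl never.
Arguments pscale : simpl never.
Arguments psub : simpl never.
Arguments pX : simpl never.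
Arguments pconst : simpl never.
Arguments psum : simpl never.

Lemma bump_props d e l l' : l' \in bump d e l ->
 [/\ size l' = size l, valid_list l -> valid_list l' & valid_list l -> (total_weight l' <= total_weight l + d)%N].
elim: l l' => [//|[d' e'] l IH] l' /=; rewrite mem_cat => /orP[|/mapP[l'' /IH [s v t] ->]]; last first.
 split=> [|/= /andP[-> vl]|/= /andP[_ vl]]; [by rewrite /= s|by rewrite v|].
 by rewrite /total_weight /= -!/(total_weight _) -addnA leq_add2l t.
case: eqP => // ->; rewrite inE => /eqP ->; split=> // /andP[/andP[d0 e12] v]; first by rewrite /= d0 v; case: odd.
rewrite /total_weight /= -!/(total_weight _); case/orP: e12 => /eqP /= ->; case: (odd _) => /=; lia.
Qed.

Lemma valid_pos l : valid_list l -> all (fun x => 0 < x.2)%N l.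
Proof. by apply: sub_all => x /andP[_ /orP[] /eqP ->]. Qed.

Lemma bump_pos d e l l' : l' \in bump d e l -> all (fun x => 0 < x.2)%N l -> all (fun x => 0 < x.2)%N l'.
elim: l l' => [//|[d' e'] l IH] l' /=; rewrite mem_cat => /orP[|/mapP[l'' /IH v ->]] /=.
 by case: eqP => // _; rewrite inE => /eqP -> /= /andP[_ ->]; case: odd.
by move=> /andP[-> /v].
Qed.

Definition lc_pos (F : lin_comb) : bool := all (fun x => all (fun y => 0 < y.2)%N x.2) F.

Lemma lc_scale_pos p F : lc_pos (lc_scale p F) = lc_pos F.
Proof. by rewrite /lc_pos all_map. Qed.

Lemma lc_mul_pos d e F : (0 < e)%N -> lc_pos F -> lc_pos (lc_mul d e F).
move=> e0 /allP P; apply/allP => y /flattenP[_ /mapP[x xF ->]].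
rewrite inE => /orP[/eqP ->|/mapP[l' lb ->]] /=; first by rewrite e0 P.
by apply: bump_pos lb _; apply: P.
Qed.

Lemma lc_cat_pos F F' : lc_pos (F ++ F') = lc_pos F && lc_pos F'.
Proof. exact: all_cat. Qed.

Lemma lc_flatten_pos Fs : lc_pos (flatten Fs) = all lc_pos Fs.
Proof. by elim: Fs => [//|F Fs IH] /=; rewrite lc_cat_pos IH. Qed.

Lemma conic_reduce_pos n l : lc_pos (conic_reduce n l).
elim: n l => [//|n IH] [|[d e] l] //=; rewrite lc_cat_pos lc_scale_pos lc_flatten_pos; apply/andP; split.
 case: eqP => _; first by rewrite lc_mul_pos.
 by rewrite lc_flatten_pos all_map; apply/allP => x _ /=; rewrite lc_scale_pos lc_mul_pos.
by rewrite all_map; apply/allP => x _ /=.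
Qed.

Lemma expand_pos cl : lc_pos (expand cl).
elim: cl => [//|c cl IH] /=; rewrite !lc_cat_pos lc_scale_pos IH lc_mul_pos //=.
by case: ifP => // _; rewrite lc_cat_pos lc_scale_pos !lc_mul_pos.
Qed.

Definition lc_valid w (F : lin_comb) : bool := all (fun x => valid_list x.2 && (total_weight x.2 <= w)%N) F.

Lemma lc_mul_valid w d e F : (0 < d)%N -> (e == 1%N) || (e == 2%N) -> lc_valid w F -> lc_valid (d * e + w) (lc_mul d e F).
move=> d0 e12 /allP P; apply/allP => y /flattenP[_ /mapP[x xF ->]].
have /andP[vx tx] := P x xF; have e0 : (0 < e)%N by case/orP: e12 => /eqP ->.
rewrite inE => /orP[/eqP ->|/mapP[l' lb ->]] /=; first by rewrite d0 e12 vx /total_weight /= leq_add2l.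
have [_ v t] := bump_props lb; rewrite v //=; apply: leq_trans (t vx) _.
by rewrite addnC leq_add // leq_pmulr.
Qed.

Lemma lc_valid_leq w w' F : (w <= w')%N -> lc_valid w F -> lc_valid w' F.
Proof. by move=> le; apply: sub_all => x /andP[-> t]; apply: leq_trans le. Qed.

Lemma lc_scale_valid w p F : lc_valid w (lc_scale p F) = lc_valid w F.
Proof. by rewrite /lc_valid all_map. Qed.

Lemma expand_valid cl : all (fun c => 0 < c)%N cl -> lc_valid (sumn cl) (expand cl).
elim: cl => [//|c cl IH] /= /andP[c0 /IH v]; rewrite /lc_valid !all_cat -!/(lc_valid _ _) lc_scale_valid.
rewrite (lc_valid_leq _ v) ?leq_addl //= -{1}[c]muln1 lc_mul_valid //=; case: ifP => // /negbT ec.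
have c2 : (0 < c./2)%N by case: (c) c0 ec => [|[]].
have e2 : (c./2 * 2 = c)%N by rewrite muln2 even_halfK.
rewrite /lc_valid all_cat -!/(lc_valid _ _) lc_scale_valid -{1}e2 lc_mul_valid //=.
by apply: (@lc_valid_leq (c./2 * 1 + sumn cl)); [lia|apply: lc_mul_valid].
Qed.

Lemma conic_reduce_valid l : valid_list l -> (total_weight l <= 6)%N ->
 all (fun x => [&& valid_list x.2, (total_weight x.2 <= 6)%N & all (fun y => y.2 == 2%N) x.2]) (conic_reduce (size l) l).
move=> v t; have : l \in cycle_lists 6 6 by apply: mem_cycle_lists.
move: l {v t}; apply/allP; by vm_compute.
Qed.

(** * Values of the sums over all pairs *)

Section Values.
Variables (k : finFieldType) (L : closedFieldType) (j : {rmorphism k -> L}).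
Notation q := #|k|.
Notation pts := (P1_pts k L).
Notation cfg := (cfg (@frP k L) pts).
Notation qr := (q%:R : rat).
Notation pv := (pval qr).
Notation o := (odd q).

Lemma P1_countP d : (0 < d <= 7)%N -> (size (pts d))%:R = pv (P1_count d).
have S r : (0 < r)%N -> \sum_(d <- divisors r) (size (pts d))%:R = qr ^+ r + 1.
 by move=> r0; rewrite -natr_sum (sum_P1_pts j r0) -natr1 natrX.
have S1 := S 1%N isT; have S2 := S 2%N isT; have S3 := S 3%N isT; have S4 := S 4%N isT; have S5 := S 5%N isT.
have S6 := S 6%N isT; have S7 := S 7%N isT; rewrite !big_cons !big_nil /= !addr0 expr1 in S1 S2 S3 S4 S5 S6 S7.
have E2 : (size (pts 2%N))%:R = qr ^+ 2 - qr by apply: (addrI (size (pts 1))%:R); rewrite S2 S1; ring.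
have E3 : (size (pts 3%N))%:R = qr ^+ 3 - qr by apply: (addrI (size (pts 1))%:R); rewrite S3 S1; ring.
case: d => [|[|[|[|[|[|[|[|d]]]]]]]] // _; rewrite /= ?pvalE ?expr1 ?expr0 //.
- by apply: (addrI (size (pts 2%N))%:R); apply: (addrI (size (pts 1))%:R); rewrite S4 S1 E2; ring.
- by apply: (addrI (size (pts 1))%:R); rewrite S5 S1; ring.
- apply: (addrI (size (pts 3%N))%:R); apply: (addrI (size (pts 2%N))%:R); apply: (addrI (size (pts 1))%:R).
 by rewrite S6 S1 E2 E3; ring.
- by apply: (addrI (size (pts 1))%:R); rewrite S7 S1; ring.
Qed.

Lemma cfg_countP ds : all (fun d => 0 < d <= 7)%N ds -> (size (cfg ds))%:R = pv (cfg_count ds).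
elim: ds => [|d ds IH] => [_|/= /andP[d7 /IH e]]; first by rewrite pval_const.
by rewrite (size_cfg_consr j) e P1_countP // !pvalE.
Qed.

Lemma form_polyP ds d : form_count k ds d = pv (form_poly ds d).
elim: ds d => [|e ds IH] d /=; last by rewrite pvalB IH; case: ifP; rewrite ?IH ?pval0.
rewrite -(big_mkord predT (fun i => qr ^+ i)) big_nat_recl // -[psum _]/(padd (pX 0) (psum [seq pX i | i <- iota 1 d])).
rewrite pvalD pval_sum big_map pvalX; congr (_ + _).
by rewrite -[iota 1 d]/(iota (1 + 0) d) iotaDl big_map /index_iota subn0; apply: eq_bigr => i _; rewrite pvalX.
Qed.

Lemma weight_le l d : valid_list l -> d \in unzip1 l -> (0 < d <= total_weight l)%N.
elim: l => [//|[d' e'] l IH] /= /andP[/andP[d0 e12] v]; rewrite /total_weight /= -/(total_weight l) inE => /orP[/eqP ->|/(IH v) /andP[-> t]].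
 by rewrite d0; case/orP: e12 => /eqP ->; lia.
by rewrite (leq_trans t) // leq_addl.
Qed.

(** With total degree s, weight t and the part p of s carried by exponents 1, one has t + p = 2 s.
    This decides which lists are within reach of interpolation. *)
Lemma weight_parts l : valid_list l -> (sumn (unzip1 l) <= total_weight l)%N /\
 (all (fun x => x.2 == 2%N) l -> total_weight l = (sumn (unzip1 l)).*2) /\
 (all (fun x => x.2 == 1%N) l -> total_weight l = sumn (unzip1 l)) /\
 (has (fun x => x.2 == 1%N) l -> ((sumn (unzip1 l)).*2 <= total_weight l + odd_part l /\ 0 < odd_part l)%N) /\
 (odd_part l <= sumn (unzip1 l))%N /\ odd (odd_part l) = odd (total_weight l) /\
 (~~ all (fun x => x.2 == 1%N) l -> odd_part l < sumn (unzip1 l))%N /\ (total_weight l + odd_part l = (sumn (unzip1 l)).*2)%N.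
elim: l => [//|[d e] l IH] /= /andP[/andP[d0 e12] v]; have {IH} := IH v; rewrite /total_weight /odd_part /= -!/(total_weight _) -!/(odd_part _).
move: (sumn _) (total_weight _) (odd_part _) => s t p [a [b [c [c' [d' [e' [f g]]]]]]].
case/orP: e12 => /eqP ->; rewrite ?muln1 /=.
- by split; [lia|split=> //; split=> [/c ->|] //; split=> [_|]; [lia|split; [lia|split; [by rewrite !oddD e'|split; [move/f|]; lia]]]].
- split; first by lia.
 split=> [/b ->|]; first by lia.
 by split=> //; split=> [/c'|]; [lia|split; [lia|split; [by rewrite add0n oddD oddM andbF e'|split; lia]]].
Qed.

Lemma pair_poly_sumP G l : valid_list l -> (total_weight l <= 7)%N -> ~~ odd (total_weight l) -> ~~ is_conic_case G l ->
 family_pair_sum j G l = qr ^+ G.+1 * pv (pair_poly_sum o G l).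
move=> v t7 ev nc; have x0 := qr_neq0 k; have al := valid_pos v.
have d7 : all (fun d => 0 < d <= 7)%N (unzip1 l).
 by apply/allP => d /(weight_le v) /andP[-> t]; apply: leq_trans t t7.
have cE := cfg_countP d7.
have [w1 [w2 [w3 [w4 [w5 [w6 [w7 w8]]]]]]] := weight_parts v.
rewrite /pair_poly_sum; case el: l => [|x l'].
 rewrite (family_pair_sum_const (c := pair_sum j G [::] [::])); last by move=> t; rewrite inE => /eqP ->.
 rewrite pair_sum_nil (_ : size (cfg (unzip1 [::])) = 1%N) // mul1r pvalB pvalX; have -> : ((3 * G).+2 = G.+1 + (2 * G).+1)%N by clear; lia.
 case: ifP => _; rewrite pvalX exprD ?expr0; first by ring.
 have e : ((2 * G).+1 = G.+1 + G)%N by clear; lia.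
 by rewrite e !exprD; ring.
rewrite -el; have nl : l != [::] by rewrite el.
case: eqP => [G0|G0].
 subst G; rewrite (family_pair_sum_const (c := qr ^+ 2 - qr)); last first.
  by move=> t tc; rewrite (pair_sum_level0 j tc ev) pair_sum_nil; case: ifP; rewrite muln0 expr1.
 by rewrite !pvalE cE; ring.
have G1 : (0 < G)%N by move: G0; clear; case: G.
case: ifP => [a2|na2].
 have s3 : (sumn (unzip1 l) <= 3)%N by move: (w2 a2) t7; clear; move: (sumn _) (total_weight _) => a b; lia.
 case: ifP => [/and3P[eo /eqP G1' /eqP es]|ns].
  subst G; rewrite (family_pair_sum_const (c := qr ^+ 3 * (qr ^+ 2 - 1 - (count (fun x => x.1 == 1%N) l)%:R * (qr - 1)))).
   by rewrite !pvalE cE; ring.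
  by move=> t tc; apply: pair_sum_even_special.
 have q0 : qr ^+ sumn (unzip1 l) != 0 by rewrite expf_neq0.
 have le : (sumn (unzip1 l) <= (2 * G).+1)%N by move: s3 G1; clear; move: (sumn _) => a; lia.
 have or : o || (sumn (unzip1 l) <= G.+1)%N by move: ns s3 G1; clear; move: (sumn _) => a; case: (odd _) => //= ns s3 G1; case: (G =P 1%N) ns => [-> | Gn]; [case: (a =P 3); lia|lia].
 rewrite (family_pair_sum_const (c := qr ^+ ((3 * G).+2 - sumn (unzip1 l)) * \prod_(x <- l) (qr ^+ x.1 - 1))); last first.
  move=> t tc; apply: (mulfI q0); rewrite (pair_sum_even j tc nl a2 le or) mulrA -exprD subnKC //; move: le G1; clear; move: (sumn _) => a; lia.
 rewrite !pvalE cE.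
 have -> : pv (foldr pmul (pconst 1) [seq psub (pX x0.1) (pconst 1) | x0 <- l]) = \prod_(x <- l) (qr ^+ x.1 - 1).
  by elim: (l) => [|y l0 IH] /=; rewrite ?big_nil ?pval_const // big_cons pvalM IH !pvalE.
 have -> : ((3 * G).+2 - sumn (unzip1 l) = G.+1 + ((2 * G).+1 - sumn (unzip1 l)))%N by move: le; clear; move: (sumn _) => a; lia.
 by rewrite exprD; ring.
have h1 : has (fun x => x.2 == 1%N) l.
 apply: contraFT na2 => /hasPn nh; apply/allP => y yl; have := allP v y yl => /andP[_ /orP[] //].
 by rewrite (negPf (nh y yl)).
case: ifP => [/andP[a1 /eqP es]|ns].
 rewrite (family_pair_sum_const (c := qr ^+ (2 * G).+2 - qr ^+ (2 * G).+1)); last by move=> t tc; apply: pair_sum_top.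
 rewrite !pvalE cE; have -> : ((2 * G).+2 = G.+1 + G.+1)%N by clear; lia.
 have -> : ((2 * G).+1 = G.+1 + G)%N by clear; lia.
 by rewrite !exprD; ring.
rewrite (family_pair_sum_const (c := 0)) ?pval0 ?mulr0 // => t tc; apply: pair_sum_odd => //.
(* A list beyond total degree 2 G + 1 that is neither all squares nor of the top type: the weight
   leaves only conics in weight 6, which [is_conic_case] sets apart. *)
rewrite leqNgt; apply/negP => gt; move: nc ns; rewrite /is_conic_case h1 andbT.
have [w4a w4b] := w4 h1; case a1: (all _ l).
 have e1 := w3 a1; move: gt t7 ev G1; rewrite e1 andTb; clear.
 move: (sumn _) => s gt s7 ev G1 nc; move: gt s7 ev nc; case: (G =P 1%N) => [-> /=|Gn]; first by case: s => [|[|[|[|[|[|[|[|s]]]]]]]].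
 have G2 : (2 <= G)%N by move: G1 Gn; clear; lia.
 have [->|G3] := eqVneq G 2%N; first by case: s => [|[|[|[|[|[|[|[|s]]]]]]]].
 by move=> gt s7 _ _ _; move: G2 G3 gt s7; clear; lia.
have := w7 (negbT a1); move: gt t7 ev w8 w4b w6 G1; clear; move: (sumn _) (total_weight _) (odd_part _) => s t p gt t7 ev w8 p0 po G1 ps nc.
have t6 : (t <= 6)%N by move: t7 ev; case: t {w8 po nc} => [|[|[|[|[|[|[|[|t]]]]]]]].
have G1' : G = 1%N by move: gt t6 w8 p0 G1 ps; clear; lia.
have t5 : (5 <= t)%N by move: gt w8 G1 ps; clear; lia.
move: nc; rewrite G1' /= => /negP nc _; apply: nc.
by move: t5 t6 ev; case: t {t7 w8 po gt} => [|[|[|[|[|[|[|t]]]]]]].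
Qed.
End Values.

(** * Values of the sums over smooth pairs *)

Section SmoothValues.
Variables (k : finFieldType) (L : closedFieldType) (j : {rmorphism k -> L}).
Notation q := #|k|.
Notation pts := (P1_pts k L).
Notation qr := (q%:R : rat).
Notation pv := (pval qr).
Notation o := (odd q).

Definition lc_eval G (u : pair_poly k G) (F : lin_comb) : rat := \sum_(x <- F) pv x.1 * point_sum j u x.2.

Lemma lc_eval_cat G (u : pair_poly k G) F F' : lc_eval u (F ++ F') = lc_eval u F + lc_eval u F'.
Proof. exact: big_cat. Qed.

Lemma lc_eval_flatten G (u : pair_poly k G) Fs : lc_eval u (flatten Fs) = \sum_(F <- Fs) lc_eval u F.
Proof. exact: big_flatten. Qed.

Lemma lc_eval_scale G (u : pair_poly k G) p F : lc_eval u (lc_scale p F) = pv p * lc_eval u F.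
Proof. by rewrite /lc_eval big_map mulr_sumr; apply: eq_bigr => x _; rewrite /= pvalM mulrA. Qed.

Lemma lc_eval_mul G (u : pair_poly k G) d e F : (0 < e)%N -> lc_pos F ->
 lc_eval u (lc_mul d e F) = point_sum j u [:: (d, e)] * lc_eval u F.
move=> e0 /allP P; rewrite lc_eval_flatten big_map mulr_sumr; apply: eq_big_seq => x xF.
rewrite /lc_eval big_cons big_map /= mulrCA point_sum1 // (point_sum_mul j u d e0 (P x xF)) mulrDr; congr (_ + _).
by rewrite mulr_sumr; apply: eq_bigr => l' _; rewrite pvalM pval_const mulrnAr -mulrA mulr_natl.
Qed.

Lemma pval_minus1 : pv pminus1 = -1.
Proof. by rewrite /pminus1 !pvalE sub0r. Qed.

Lemma conic_reduceP (u : pair_poly k 1) n l : smooth_pair u -> valid_list l -> (total_weight l <= 6)%N ->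
 (size l <= n)%N -> point_sum j u l = lc_eval u (conic_reduce n l).
move=> Su; elim: n l => [|n IH] [|[d e] l] //; try by rewrite /lc_eval big_seq1 point_sum_nil pval_const mulr1.
move=> v; have /andP[/andP[/= d0 /= e12] vl0] := v; have {vl0} vl : valid_list l := vl0; rewrite /total_weight /= -/(total_weight l) ltnS => tw sl.
have e0 : (0 < e)%N by case/orP: e12 => /eqP ->.
have de : (d <= d * e)%N by rewrite leq_pmulr.
rewrite lc_eval_cat lc_eval_scale lc_eval_flatten big_map !pvalE sub0r.
have IHl : point_sum j u l = lc_eval u (conic_reduce n l) by apply: IH => //; apply: leq_trans tw; apply: leq_addl.
have main : lc_eval u (if e == 2%N then lc_mul d 2 (conic_reduce n l)
  else flatten [seq lc_scale pminus1 (lc_mul x.1 2 (conic_reduce n l)) | x <- conic_rel d]) =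
  point_sum j u [:: (d, e)] * point_sum j u l.
 case/orP: (e12) => /eqP e1; rewrite e1 /=; last by rewrite lc_eval_mul ?conic_reduce_pos // -IHl.
 have d6 : (0 < d <= 6)%N by rewrite d0; move: tw; rewrite e1; clear; lia.
 rewrite (conic_relP j Su d6) mulr_suml lc_eval_flatten big_map; apply: eq_big_seq => x xr.
 rewrite lc_eval_scale lc_eval_mul ?conic_reduce_pos // -IHl pval_minus1.
 have /allP/(_ x xr)/eqP -> : all (fun y => y.2 == -1 :> int) (conic_rel d) by case: (d) => [|[|[|[|[|[|[|d']]]]]]].
 by rewrite mulrA.
rewrite main point_sum1 // (point_sum_mul j u d e0 (valid_pos vl)) mulNr mulr_sumr.
rewrite -[LHS]addr0 -addrA; congr (_ + _); apply/esym/eqP; rewrite subr_eq0; apply/eqP.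
apply: eq_big_seq => l' lb; have [sz vb tb] := bump_props lb.
by rewrite (IH l') ?vb ?sz // ?mulr_natl //; have := tb vl; move: tw de; clear; lia.
Qed.

Lemma expandP G (u : pair_poly k G) cl : all (fun c => 0 < c <= 7)%N cl ->
 (size (cfg (@frobC k L) (curve_pts j G (hpoly u) (fpoly u)) cl))%:R = lc_eval u (expand cl).
elim: cl => [_|c cl IH /= /andP[c7 /IH {}IH]]; first by rewrite /lc_eval big_seq1 pval_const point_sum_nil mulr1.
have per n x : x \in curve_pts j G (hpoly u) (fpoly u) n -> has_period (@frobC k L) n x by rewrite mem_curve_pts => /andP[].
have := size_cfg_cons (@frC_inj k L j) (curve_pts_uniq j G (hpoly u) (fpoly u)) per (@curve_pts_frC k L j G _ _) c cl.
move/(congr1 (intr : int -> rat)); rewrite rmorphM rmorphB /= -!pmulrn => ->; have /andP[c0 _] := c7.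
have P1 d : \sum_(a <- pts d) tau j G (hpoly u) (fpoly u) d a = point_sum j u [:: (d, 1%N)].
 by rewrite point_sum1 //; apply: eq_bigr => a _; rewrite expr1.
rewrite size_curve_pts // IH !lc_eval_cat lc_eval_scale lc_eval_mul ?expand_pos // !pvalE -(P1_countP j) // P1.
case: ifP => _; first by rewrite /lc_eval big_nil; ring.
rewrite lc_eval_cat lc_eval_scale !lc_eval_mul ?expand_pos // pval_minus1 -point_sum1 // P1; ring.
Qed.

Definition smooth_head o l G := head [::] (smooth_table o l G).

Lemma smooth_tableE o' l n : smooth_table o' l n = [seq smooth_head o' l (n - i) | i <- iota 0 n.+1].
elim: n => [//|n IH]; rewrite -[LHS]/(smooth_head o' l n.+1 :: smooth_table o' l n) IH -[iota 0 n.+2]/(0%N :: iota (1 + 0) n.+1) iotaDl map_cons -map_comp subn0.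
congr (_ :: _); by apply: eq_map => i; rewrite /comp add1n subSS.
Qed.

Lemma smooth_rec o' l G : ~~ is_conic_case G l -> to_poly (smooth_head o' l G) =
 to_poly (pair_poly_sum o' G l) - \sum_(d < G) to_poly (form_poly (unzip1 l) d.+1) * to_poly (smooth_head o' l (G - d.+1)).
case: G => [|n] nc; first by rewrite big_ord0 subr0.
rewrite {1}/smooth_head [smooth_table _ _ _]/= (negPf nc) /= to_polyB to_poly_sum big_map smooth_tableE; congr (_ - _).
rewrite -[1%N :: iota 2 n]/(iota (1 + 0) n.+1) iotaDl zip_map big_map -(big_mkord predT (fun d => to_poly (form_poly (unzip1 l) d.+1) * to_poly (smooth_head o' l (n.+1 - d.+1)))).
by rewrite /index_iota subn0; apply: eq_bigr => i _; rewrite to_polyM /= add1n subSS.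
Qed.

Lemma form_poly0 ds : all (fun d => 0 < d)%N ds -> form_count k ds 0 = 1.
Proof. by elim: ds => [|[|d] ds IH] //= H; rewrite ?big_ord1 ?expr0 // IH // subr0. Qed.

Lemma family_sum_rec G l : valid_list l ->
 family_sum j G l = family_pair_sum j G l - \sum_(d < G) qr ^+ d.+1 * pv (form_poly (unzip1 l) d.+1) * family_sum j (G - d.+1) l.
move=> v; rewrite (family_sieve j G (valid_pos v)) big_ord_recl /= form_poly0; last first.
 by apply/allP => d /(weight_le v) /andP[].
rewrite expr0 !mul1r subn0 -addrA [X in _ = _ + X](_ : _ = 0) ?addr0 //.
by apply/eqP; rewrite subr_eq0; apply/eqP; apply: eq_bigr => d _; rewrite form_polyP.
Qed.

(** Induction on the level along the sieve. In the conic case the value at level 1 comes from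
    [conic_reduceP] instead, and the sieve for higher levels takes it as input. *)
Lemma smooth_polyP G l : valid_list l -> (total_weight l <= 7)%N ->
 family_sum j G l = qr ^+ G.+1 * pv (smooth_poly o G l).
move=> v t7; rewrite /smooth_poly; case: ifPn => [od|ev].
 rewrite pval0 mulr0; elim/ltn_ind: G => G IH; rewrite family_sum_rec // (family_pair_sum_const (c := 0)); last first.
  by move=> t tc; apply: pair_sum_twist.
 rewrite mulr0 sub0r big1 ?oppr0 // => d _; rewrite IH ?mulr0 //.
 by rewrite subnS prednK ?subn_gt0 // leq_subr.
rewrite -/(smooth_head o l G).
have step G' : ~~ is_conic_case G' l -> (forall m, (m < G')%N -> family_sum j m l = qr ^+ m.+1 * pv (smooth_head o l m)) ->
  family_sum j G' l = qr ^+ G'.+1 * pv (smooth_head o l G').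
 move=> nc IH; rewrite family_sum_rec // (pair_poly_sumP j v t7 ev nc) /pval (smooth_rec _ nc) hornerD hornerN mulrBr; congr (_ - _).
 rewrite -/(pv _) (big_morph (fun p : {poly rat} => p.[qr]) (fun p r => hornerD p r qr) (horner0 _)) mulr_sumr.
 apply: eq_bigr => d _; rewrite IH; last by rewrite subnS prednK ?subn_gt0 // leq_subr.
 rewrite hornerM; have -> : (G'.+1 = d.+1 + (G' - d.+1).+1)%N by have := ltn_ord d; lia.
 by rewrite exprD /pval; ring.
elim/ltn_ind: G => G IH; have [nc|nc] := boolP (is_conic_case G l); last by apply: step.
have /and3P[/eqP G1 /eqP t6 h1] := nc; subst G; have t6' : (total_weight l <= 6)%N by rewrite t6.
rewrite /smooth_head /= nc /= /conic_sum pval_sum big_map.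
have cv := conic_reduce_valid v t6'.
transitivity (\sum_(x <- conic_reduce (size l) l) pv x.1 * family_sum j 1 x.2).
 rewrite /family_sum; under [RHS]eq_bigr do rewrite mulr_sumr.
 by rewrite [RHS]exchange_big /=; apply: eq_bigr => u Su; rewrite (conic_reduceP Su v t6' (leqnn _)).
rewrite mulr_sumr; apply: eq_big_seq => x /(allP cv) /and3P[vx tx a2].
have [_ [/(_ a2) tE _]] := weight_parts vx.
have evx : ~~ odd (total_weight x.2) by rewrite tE odd_double.
have ncx m : ~~ is_conic_case m x.2.
 rewrite /is_conic_case !negb_and; apply/orP; right; apply/orP; right; rewrite -all_predC.
 by apply: sub_all a2 => y /= /eqP ->.
have tx7 : (total_weight x.2 <= 7)%N by apply: leq_trans tx _.
rewrite pvalM !family_sum_rec // !pair_poly_sumP // big_ord1 subnn family_sum_rec // pair_poly_sumP // big_ord0 subr0 !pvalE.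
by rewrite expr1 !exprS expr0; ring.
Qed.

Lemma count_polyP G cl : all (fun c => 0 < c)%N cl -> (sumn cl <= 7)%N ->
 \sum_(u : pair_poly k G | smooth_pair u) (size (cfg (@frobC k L) (curve_pts j G (hpoly u) (fpoly u)) cl))%:R =
 qr ^+ G.+1 * pv (count_poly o G cl).
move=> pos s7; have c7 : all (fun c => 0 < c <= 7)%N cl.
 elim: (cl) pos s7 => [//|c cl' IH] /= /andP[c0 pos] s7; rewrite c0 IH // ?andbT.
  by move: s7; clear; lia.
 by move: s7; clear; lia.
rewrite (eq_bigr _ (fun u _ => expandP u c7)) exchange_big /count_poly pval_sum big_map mulr_sumr /=.
apply: eq_big_seq => x xe; have /andP[vx tx] := allP (expand_valid pos) x xe.
by rewrite -mulr_sumr -/(family_sum j G x.2) smooth_polyP ?(leq_trans tx) // pvalM mulrCA.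
Qed.
End SmoothValues.

(** * Divisibility by kappa *)

Definition kappa_list : zpoly :=
 let: z := BinNums.Z0 in let: o := BinInt.Z.of_nat 1 in let: m := BinInt.Z.opp o in [:: z; o; m; m; o].

Definition kappa : {poly rat} := to_poly kappa_list.

Lemma kappaE : kappa = ('X^3 - 'X) * ('X - 1).
Proof. by rewrite /kappa /= /zq /= !polyC0 !polyCN polyC1; ring. Qed.

(* The quotient of [p] by [1 - X - X^2 + X^3] as a power series. *)
Fixpoint kappa_quo (a b c : BinNums.Z) (p : zpoly) : zpoly :=
 if p is x :: p' then
  let r := BinInt.Z.sub (BinInt.Z.add (BinInt.Z.add x a) b) c in r :: kappa_quo r a b p'
 else [::].

(** kappa is X times 1 - X - X^2 + X^3, which explains [behead]. The quotient is checked by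
    multiplying back, so only the soundness of the test has to be proved. *)
Definition kappa_dvd (p : zpoly) : bool :=
 let z := BinNums.Z0 in pzero (psub p (pmul kappa_list (kappa_quo z z z (behead p)))).

Lemma kappa_dvdP p : kappa_dvd p -> kappa %| to_poly p.
rewrite /kappa_dvd -to_poly_eq0 to_polyB to_polyM subr_eq0 => /eqP ->; exact: dvdp_mulr.
Qed.

Lemma kappaX_dvd n : kappa %| ('X^2 - 1) * ('X - 1) * 'X^(n.+1).
Proof. by rewrite kappaE (exprS _ n); apply/dvdpP; exists 'X^n; ring. Qed.

Lemma smooth_conv o l G : ~~ is_conic_case G l -> to_poly (form_poly (unzip1 l) 0) = 1 -> to_poly (pair_poly_sum o G l) =
 \sum_(d < G.+1) to_poly (form_poly (unzip1 l) d) * to_poly (smooth_head o l (G - d)).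
Proof. by move=> nc F0; rewrite big_ord_recl F0 mul1r subn0 smooth_rec // subrK. Qed.

Lemma to_poly_form0 d : to_poly (form_poly [::] d) = \sum_(i < d.+1) 'X^i.
rewrite to_poly_sum big_map -(big_mkord predT (fun i => 'X^i)) /index_iota subn0.
by apply: eq_bigr => i _; rewrite to_polyX.
Qed.

Lemma to_poly_form1 d : to_poly (form_poly [:: 1%N] d) = 'X^d.
rewrite [form_poly _ _]/= to_polyB to_poly_form0; case: d => [|d] /=; first by rewrite big_ord1 subr0.
by rewrite subn1 /= to_poly_form0 big_ord_recr /= addrAC subrr add0r.
Qed.

Lemma to_poly_form11 d : to_poly (form_poly [:: 1%N; 1%N] d.+1) = 'X^(d.+1) - 'X^d.
Proof. by rewrite -[form_poly _ _]/(psub (form_poly [:: 1%N] d.+1) (form_poly [:: 1%N] (d.+1 - 1))) to_polyB !to_poly_form1 subn1. Qed.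

Lemma to_poly_form2 d : to_poly (form_poly [:: 2%N] d.+1) = 'X^(d.+1) + 'X^d.
case: d => [|d].
 by rewrite -[form_poly _ _]/(psub (form_poly [::] 1) [::]) to_polyB to_poly_form0 subr0 big_ord_recr big_ord1 /= addrC.
rewrite -[form_poly _ _]/(psub (form_poly [::] d.+2) (form_poly [::] (d.+2 - 2))) 2!subSS subn0 to_polyB !to_poly_form0.
by rewrite 2!big_ord_recr /=; ring.
Qed.

Arguments form_poly : simpl never.
(** The numbers of conductors have generating series 1 / ((1 - T) (1 - X T)), and undoing both
    factors gives (U_G - U_(G-1)) - X (U_(G-1) - U_(G-2)). This operator kills both 1 and X^G, the
    terms that depend on the parity of q. The quotient by kappa is the number q^(2 g - 1) of
    hyperelliptic curves, weighted by automorphisms. *)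
Lemma smooth_head_nil o G : (2 < G)%N -> to_poly (smooth_head o [::] G) = kappa * 'X^(2 * G - 3).
pose U n := to_poly (pair_poly_sum o n [::]); pose S n := to_poly (smooth_head o [::] n).
pose V n := \sum_(d < n.+1) 'X^d * S (n - d)%N.
have nc n : ~~ is_conic_case n [::] by rewrite /is_conic_case !andbF.
have UE n : U n = \sum_(d < n.+1) to_poly (form_poly [::] d) * S (n - d)%N.
 by apply: smooth_conv => //; rewrite to_poly_form0 big_ord1.
have VE n : V n.+1 = S n.+1 + 'X * V n.
 rewrite /V big_ord_recl mul1r subn0 mulr_sumr; congr (_ + _); apply: eq_bigr => d _.
 by rewrite lift0 subSS exprS -mulrA.
have UV n : U n.+1 = U n + V n.+1.
 rewrite !UE /V !(big_ord_recl n.+1) to_poly_form0 big_ord1 expr0 !mul1r addrCA -big_split /=; congr (_ + _).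
 apply: eq_bigr => d _; rewrite /= /fintype.bump /= add1n subSS -mulrDl; congr (_ * _).
 by rewrite !to_poly_form0 big_ord_recr.
case: G => [|[|[|m]]] // _; rewrite -/(S _).
have -> : S m.+3 = (U m.+3 - U m.+2) - 'X * (U m.+2 - U m.+1).
 by rewrite (UV m.+2) (VE m.+2) (UV m.+1); ring.
have E n : U n = 'X^((2 * n).+1) - (if o then 1 else 'X^n).
 by rewrite /U /= to_polyB to_polyX; case: (o); rewrite ?to_polyX ?expr0.
rewrite !E kappaE; have -> : (2 * m.+3 - 3 = (2 * m).+3)%N by lia.
have -> : ((2 * m.+3).+1 = 7 + 2 * m)%N by lia.
have -> : ((2 * m.+2).+1 = 5 + 2 * m)%N by lia.
have -> : ((2 * m.+1).+1 = 3 + 2 * m)%N by lia.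
rewrite -[(2 * m).+3]/(3 + 2 * m)%N -[m.+3]/(3 + m)%N -[m.+2]/(2 + m)%N -[m.+1]/(1 + m)%N !exprD.
by case: o {U S V nc UE VE UV E}; ring.
Qed.

(** The conductors prime to a rational point have series 1 / (1 - X T), so the sum is U_G - X
    U_(G-1). Each U has only one factor X - 1; the second appears in the difference, which is why
    this list is treated apart. *)
Lemma smooth_head12 o G : (2 < G)%N -> kappa %| to_poly (smooth_head o [:: (1%N, 2%N)] G).
set l := [:: _]; pose U n := to_poly (pair_poly_sum o n l); pose S n := to_poly (smooth_head o l n).
have nc n : ~~ is_conic_case n l by rewrite /is_conic_case /= !andbF.
have UE n : U n = \sum_(d < n.+1) 'X^d * S (n - d)%N.
 rewrite /U smooth_conv // -?to_poly_form1 //; last by rewrite -[unzip1 l]/[:: 1%N] to_poly_form1 expr0.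
 by apply: eq_bigr => d _; rewrite -to_poly_form1.
have US n : S n.+1 = U n.+1 - 'X * U n.
 rewrite !UE big_ord_recl mul1r subn0 mulr_sumr -[LHS]addr0 -addrA; congr (_ + _).
 apply/esym/eqP; rewrite subr_eq0; apply/eqP; apply: eq_bigr => d _.
 by rewrite lift0 subSS exprS -mulrA.
have E n : U n.+2 = ('X^2 - 1) * 'X^(2 * n.+2).
 have -> : U n.+2 = to_poly (pmul (unram_poly l) (pX ((2 * n.+2).+1 - 1))) by rewrite /U /= andbF.
 rewrite subn1 to_polyM to_polyX; congr (_ * _).
 have -> : unram_poly l = psub (pX 2) (pX 0) by vm_compute.
 by rewrite to_polyB !to_polyX.
case: G => [|[|[|m]]] // _; rewrite -/(S _) US !E.
suff -> : ('X^2 - 1) * 'X^(2 * m.+3) - 'X * (('X^2 - 1) * 'X^(2 * m.+2)) = ('X^2 - 1) * ('X - 1) * 'X^((2 * m.+2).+1) :> {poly rat}.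
 exact: kappaX_dvd.
have -> : (2 * m.+3 = (2 * m.+2).+2)%N by lia.
by rewrite (exprS _ (2 * m.+2).+1) !(exprS _ (2 * m.+2)); ring.
Qed.

(* The even lists of positive weight for which every term of the recursion is divisible by kappa. *)
Definition generic_lists : seq cycles_list :=
 [seq l <- cycle_lists 6 6 | [&& l != [::], l != [:: (1%N, 2%N)] & ~~ odd (total_weight l)]].

Lemma generic_unram : all (fun l => all (fun x => x.2 == 2%N) l ==> kappa_dvd (unram_poly l)) generic_lists.
Proof. by vm_compute. Qed.

Lemma generic_low : all (fun l => all (fun G => all (fun o =>
 if is_conic_case G l then kappa_dvd (conic_sum o l) else kappa_dvd (pair_poly_sum o G l)) [:: true; false])
 [:: 1%N; 2%N]) generic_lists.
Proof. by vm_compute. Qed.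

Lemma generic_level0 : all (fun l => [|| unzip1 l == [:: 1%N; 1%N], unzip1 l == [:: 2%N]
 | kappa_dvd (pair_poly_sum true 0 l)]) generic_lists.
Proof. by vm_compute. Qed.

Lemma generic_weight l : l \in generic_lists -> (total_weight l <= 6)%N.
Proof. by apply/allP: l; vm_compute. Qed.

Lemma generic_valid l : l \in generic_lists -> valid_list l.
Proof. by apply/allP: l; vm_compute. Qed.

Lemma generic_nnil l : l \in generic_lists -> l != [::].
Proof. by rewrite mem_filter => /andP[/and3P[]]. Qed.

(** Levels 1 and 2 are computed. From level 3 on the weight excludes total degree 2 G + 2, so only
    squares contribute, and G occurs there merely in a power of X. *)
Lemma generic_pair_poly o G l : l \in generic_lists -> (0 < G)%N -> ~~ is_conic_case G l ->
 kappa %| to_poly (pair_poly_sum o G l).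
move=> gl G0 nc; case: (ltnP 2 G) => [G3|G2]; last first.
 have Gi : G \in [:: 1%N; 2%N] by move: G0 G2; case: (G) => [|[|[|]]].
 have := allP (allP (allP generic_low l gl) G Gi) o; rewrite (negPf nc) => H.
 by apply: kappa_dvdP; apply: H; case: o.
have nl := generic_nnil gl; have t6 := generic_weight gl.
have [_ [_ [w3 _]]] := weight_parts (generic_valid gl).
have -> : pair_poly_sum o G l = if all (fun x => x.2 == 2%N) l then pmul (unram_poly l) (pX ((2 * G).+1 - sumn (unzip1 l))) else
  if all (fun x => x.2 == 1%N) l && (sumn (unzip1 l) == (2 * G).+2) then pmul (cfg_count (unzip1 l)) (psub (pX G.+1) (pX G)) else [::].
 rewrite /pair_poly_sum; case: (l) nl => // x l' _.
 have -> : (G == 0%N) = false by case: (G) G0.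
 have -> : (G == 1%N) = false by case: (G) G3 => [|[|]].
 by rewrite andbF.
case: ifP => [a2|_]; first by rewrite to_polyM dvdp_mulr // kappa_dvdP //; apply: (implyP (allP generic_unram l gl)).
case: ifP => [/andP[a1 /eqP s]|_]; last exact: dvdp0.
by have := w3 a1; rewrite s => e; move: t6 G3; rewrite e; clear; lia.
Qed.

Lemma pair_poly_level0 o o' l : l != [::] -> pair_poly_sum o 0 l = pair_poly_sum o' 0 l.
Proof. by case: l. Qed.

(** The level 0 sums for degrees [:: 1; 1] and [:: 2] lack a factor X - 1 and X + 1 respectively,
    which the number of conductors of positive degree supplies. *)
Lemma generic_form d o l : l \in generic_lists ->
 kappa %| to_poly (form_poly (unzip1 l) d.+1) * to_poly (pair_poly_sum o 0 l).
move=> gl; rewrite (pair_poly_level0 o true (generic_nnil gl)); have E : pair_poly_sum true 0 l = pmul (psub (pX 1) (pX 0)) (cfg_count (unzip1 l)).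
 by have := generic_nnil gl; case: (l).
case/or3P: (allP generic_level0 l gl) => [/eqP e|/eqP e|H].
- rewrite E e to_poly_form11 to_polyM to_polyB !to_polyX.
 have -> : cfg_count [:: 1%N; 1%N] = padd (pX 2) (pX 1) by vm_compute.
 rewrite to_polyD !to_polyX kappaE; apply/dvdpP; exists ('X^d).
 by rewrite exprS expr0; ring.
- rewrite E e to_poly_form2 to_polyM to_polyB !to_polyX.
 have -> : cfg_count [:: 2%N] = psub (pX 2) (pX 1) by vm_compute.
 rewrite to_polyB !to_polyX kappaE; apply/dvdpP; exists ('X^d).
 by rewrite exprS expr0; ring.
- by rewrite dvdp_mull // kappa_dvdP.
Qed.

Lemma generic_smooth o G l : l \in generic_lists -> (0 < G)%N -> kappa %| to_poly (smooth_head o l G).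
move=> gl; elim/ltn_ind: G => G IH G0; have [c|nc] := boolP (is_conic_case G l).
 have /andP[/eqP G1 _] := c; subst G; rewrite /smooth_head /= c /=.
 have := allP (allP (allP generic_low l gl) 1%N isT) o; rewrite c => H.
 by apply: kappa_dvdP; apply: H; case: (o).
rewrite smooth_rec // dvdp_sub ?generic_pair_poly //; apply: (big_ind (fun p => kappa %| p)) => [|p r|d _]; [exact: dvdp0|exact: dvdp_add|].
have [e|n0] := eqVneq (G - d.+1)%N 0%N; first by rewrite e; apply: generic_form.
by rewrite dvdp_mull // IH ?lt0n // subnS prednK ?subn_gt0 // leq_subr.
Qed.

Lemma smooth_poly_dvd o G l : valid_list l -> (total_weight l <= 7)%N -> (2 < G)%N -> kappa %| to_poly (smooth_poly o G l).
move=> v t7 G3; rewrite /smooth_poly; case: ifPn => [_|ev]; first exact: dvdp0.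
rewrite -/(smooth_head o l G); have [->|nl] := eqVneq l [::]; first by rewrite smooth_head_nil // dvdp_mulr.
have [->|n12] := eqVneq l [:: (1%N, 2%N)]; first exact: smooth_head12.
apply: generic_smooth; last by apply: leq_trans G3.
rewrite mem_filter nl n12 ev; apply: mem_cycle_lists => //.
by move: t7 ev; case: (total_weight l) => [|[|[|[|[|[|[|[|t]]]]]]]].
Qed.

Lemma count_poly_dvd o G cl : all (fun c => 0 < c)%N cl -> (sumn cl <= 7)%N -> (2 < G)%N -> kappa %| to_poly (count_poly o G cl).
move=> pos s7 G3; rewrite /count_poly to_poly_sum big_map big_seq_cond.
apply: (big_ind (fun p => kappa %| p)) => [|p r|x /andP[xe _]]; [exact: dvdp0|exact: dvdp_add|].
have /andP[vx tx] := allP (expand_valid pos) x xe.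
by rewrite to_polyM dvdp_mull // smooth_poly_dvd // (leq_trans tx).
Qed.

Arguments pair_poly_sum : simpl never.
(** For a nonempty list the parity matters only for three squares on a conic, of weight 6, which do
    not fit here; the empty list is settled by [smooth_head_nil]. *)
Lemma smooth_poly_parity G l : valid_list l -> (total_weight l <= 5)%N -> (2 < G)%N ->
 to_poly (smooth_poly true G l) = to_poly (smooth_poly false G l).
move=> v t5 G3; rewrite /smooth_poly; case: ifPn => // ev; rewrite -!/(smooth_head _ l G).
have [->|nl] := eqVneq l [::]; first by rewrite !smooth_head_nil.
have nc n : is_conic_case n l = false by rewrite /is_conic_case; case: eqP => // _; move: t5; case: eqP => // ->.
have E n : pair_poly_sum true n l = pair_poly_sum false n l.
 rewrite /pair_poly_sum; case el: l => [|x l']; first by rewrite el in nl.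
 rewrite -el; case: (n == 0%N) => //.
 case: ifP => // a2; case: ifP => //= /andP[_ /eqP s3].
 have [_ [/(_ a2) tE _]] := weight_parts v; move: t5; rewrite tE s3 //.
rewrite /smooth_head; congr (to_poly (head _ _)).
by elim: (G) => [|n IH] /=; rewrite ?E // IH nc.
Qed.

Lemma count_poly_parity G cl : all (fun c => 0 < c)%N cl -> (sumn cl <= 5)%N -> (2 < G)%N ->
 to_poly (count_poly true G cl) = to_poly (count_poly false G cl).
move=> pos s5 G3; rewrite /count_poly !to_poly_sum !big_map; apply: eq_big_seq => x xe.
have /andP[vx tx] := allP (expand_valid pos) x xe.
by rewrite !to_polyM smooth_poly_parity // (leq_trans tx).
Qed.

(** * Cycle types and the case n = 6 *)

Fixpoint compositions (n w : nat) : seq (seq nat) :=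
 if n is n'.+1 then
  if w == 0%N then [:: [::]] else flatten [seq [seq c :: cl | cl <- compositions n' (w - c)] | c <- iota 1 w]
 else [:: [::]].

Lemma mem_compositions n cl : all (fun c => 0 < c)%N cl -> (sumn cl <= n)%N -> cl \in compositions n (sumn cl).
elim: n cl => [|n IH] [|[|c] cl] // pos sn.
have -> : compositions n.+1 (sumn (c.+1 :: cl)) = flatten [seq [seq d :: cl' | cl' <- compositions n (sumn (c.+1 :: cl) - d)] | d <- iota 1 (sumn (c.+1 :: cl))] by [].
apply/flattenP; exists [seq c.+1 :: cl' | cl' <- compositions n (sumn (c.+1 :: cl) - c.+1)].
 by apply/mapP; exists c.+1 => //; rewrite mem_iota /= add1n ltnS leq_addr.
by apply/mapP; exists cl => //; rewrite /= addKn IH //; move: sn => /=; clear; lia.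
Qed.

(** Genus 2 is G = 3. Since [cycle_type] follows the order of the cycle roots, all compositions of 6
    are tested and not just its partitions. *)
Lemma count_poly6_parity : all (fun cl => pzero (psub (count_poly true 3 cl) (count_poly false 3 cl))) (compositions 6 6).
Proof. by vm_compute. Qed.

(** Genus 3 is G = 4, and a single cycle of length 6 is enough to tell the parities apart. *)
Lemma count_poly_6cycle : ~~ pzero (psub (count_poly true 4 [:: 6%N]) (count_poly false 4 [:: 6%N])).
Proof. by vm_compute. Qed.

Section CycleType.
Variables (n : nat) (sigma : 'S_n).

Lemma cycle_type_pos : all (fun c => 0 < c)%N (cycle_type sigma).
Proof. by apply/allP => _ /mapP[r _ ->]; apply: fingraph.order_gt0. Qed.

Lemma sumn_cycle_type : sumn (cycle_type sigma) = n.
have sym := fconnect_sym (@perm_inj _ sigma).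
rewrite sumnE big_map big_enum -[RHS]card_ord -sum1_card /=.
rewrite [RHS](partition_big (froot sigma) (froots sigma)) => [|x _]; last exact: roots_root.
apply: eq_bigr => r /eqP rr; rewrite /fingraph.order -sum1_card; apply: eq_bigl => x.
by rewrite /= -[in RHS]rr; apply/idP/eqP => [c|c]; [apply/esym/fingraph.rootP|apply/fingraph.rootP].
Qed.
End CycleType.

Lemma exists_6cycle : exists sigma : 'S_6, cycle_type sigma = [:: 6%N].
pose f (x : 'I_6) := ordS x; have finj : injective f := can_inj (@ordSK 6).
exists (perm finj); set s := perm finj; have sym := fconnect_sym (@perm_inj _ s).
have c0 i : fconnect s ord0 i.
 suff H m : (m < 6)%N -> iter m s ord0 = m :> nat.
  by have -> : i = iter i s ord0; [apply/val_inj; rewrite /= H|apply: fconnect_iter].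
 by elim: m => [//|m IH] lt; rewrite iterS permE /= IH ?modn_small // ltnW.
have E : cycle_reps s = [:: froot s ord0].
 apply: perm_small_eq => //; apply: uniq_perm => [|//|r]; first exact: enum_uniq.
 rewrite /cycle_reps mem_enum mem_seq1; apply/idP/eqP => [/eqP <-|->]; last exact: roots_root.
 exact/esym/(fingraph.rootP sym).
by have := sumn_cycle_type s; rewrite /cycle_type E /= addn0 => ->.
Qed.

(** * Assembly *)

Section Value.
Variables (k : finFieldType) (L : closedFieldType) (j : {rmorphism k -> L}) (jalg : forall z : L, algebraicOver j z) (g n : nat) (sigma : 'S_n) (g1 : (1 < g)%N) (n7 : (n <= 7)%N).
Notation q := #|k|.

Lemma is_count_poly : is_count j g sigma (to_poly (count_poly (odd q) g.+1 (cycle_type sigma)) %/ kappa).[q%:R].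
have s7 : (sumn (cycle_type sigma) <= 7)%N by rewrite sumn_cycle_type.
have /divpK kE := count_poly_dvd (odd q) (cycle_type_pos sigma) s7 (g1 : (2 < g.+1)%N).
set Q := _ %/ _ in kE *.
pose cnt (u : pair_poly k g.+1) := size (cfg (@frobC k L) (curve_pts j g.+1 (hpoly u) (fpoly u)) (cycle_type sigma)).
have := is_count_pairs (sigma := sigma) jalg (cnt := cnt) (fun K x y u M S => card_fixed_tuples jalg M (asboolW (proj1 (andP S))) sigma) g1 erefl.
rewrite (count_polyP j _ (cycle_type_pos sigma) s7) /pval -kE hornerM.
have q1 : (1 < q)%N := card_finRing_gt1 k.
have q3 : (q <= q ^ 3)%N by rewrite -{1}[q]expn1 leq_pexp2l // ltnW.
have -> : (((q ^ 3 - q) * (q - 1) * q ^ g.+2)%N)%:R = kappa.[q%:R] * q%:R ^+ g.+2 :> rat.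
 by rewrite natrM natrM natrB // (natrB _ (ltnW q1)) !natrX kappaE !hornerE.
suff nz : kappa.[q%:R] * q%:R ^+ g.+2 != 0 :> rat.
 by rewrite [X in X / _]mulrC -[X in X / _]mulrA mulfK.
rewrite mulf_neq0 ?expf_neq0 ?(qr_neq0 k) // kappaE !hornerE mulf_neq0 // subr_eq0.
 by rewrite -natrX eqr_nat -{2}[q]expn1 eqn_exp2l.
by rewrite (eqr_nat _ q 1) gtn_eqF.
Qed.
End Value.

Theorem mainTheorem1 :
  exists Podd Peven : forall g n : nat, 'S_n -> {poly rat},
    [/\ forall (g n : nat) (sigma : 'S_n), (2 <= g)%N -> (n <= 7)%N ->
          forall (k : finFieldType) (kbar : closedFieldType)
                 (iota : {rmorphism k -> kbar}),
            (forall z : kbar, algebraicOver iota z) ->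
            (odd #|k| -> is_count iota g sigma (Podd g n sigma).[#|k|%:R]) /\
            (~~ odd #|k| -> is_count iota g sigma (Peven g n sigma).[#|k|%:R]),
        forall (g n : nat) (sigma : 'S_n), (2 <= g)%N -> (n <= 5)%N ->
          Podd g n sigma = Peven g n sigma,
        forall sigma : 'S_6, Podd 2%N 6%N sigma = Peven 2%N 6%N sigma
      & exists sigma : 'S_6, Podd 3%N 6%N sigma <> Peven 3%N 6%N sigma].
Proof.
pose P o g n (sigma : 'S_n) := to_poly (count_poly o g.+1 (cycle_type sigma)) %/ kappa.
exists (P true), (P false); split.
- move=> g n sigma g1 n7 k L j jalg; split=> [ok|/negPf ok]; rewrite /P -ok; exact: is_count_poly.
- move=> g n sigma g1 n5; rewrite /P count_poly_parity ?cycle_type_pos //.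
  by rewrite sumn_cycle_type.
- move=> sigma; rewrite /P; congr (_ %/ _); apply/eqP; rewrite -subr_eq0 -to_polyB to_poly_eq0.
  apply: (allP count_poly6_parity); rewrite -[6%N in X in _ \in X](sumn_cycle_type sigma).
  by rewrite mem_compositions ?cycle_type_pos // sumn_cycle_type.
have [sigma e] := exists_6cycle; exists sigma; rewrite /P e => H.
(* Both polynomials are multiples of kappa, so equal quotients would make them equal. *)
have dv o : kappa %| to_poly (count_poly o 4 [:: 6%N]) by apply: count_poly_dvd.
have := count_poly_6cycle; rewrite -to_poly_eq0 to_polyB -(divpK (dv true)) -(divpK (dv false)) H.
by rewrite subrr eqxx.
Qed.
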